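(* Assume that $\tilde H$ and $\tilde G$ satisfy (H1), (H2) and (H3) (stated in the context). Let $x\in\mathbb R^d$, let $\bar\gamma\in\mathcal A_{0,x}$ be optimal for $\tilde u_0(x)$ (see the context), and define, for $t\in[0,T]$, the $(\mathcal F_t)_{t\in[0,T]}$-adapted continuous process $\bar p$ by $$\bar p_t=\mathbb E\left[\int_t^TD_x\tilde L_s(\dot{\bar\gamma}_s,\bar\gamma_s)\,ds+D\tilde G(\bar\gamma_T)\ \Big|\ \mathcal F_t\right].$$ Then, for $t\in[0,T]$, $$\dot{\bar\gamma}_t=-D_p\tilde H_t(\bar p_t,\bar\gamma_t),$$ and $\bar p$ solves the backward stochastic differential equation $$d\bar p_t=D_x\tilde H_t(\bar p_t,\bar\gamma_t)\,dt+d\overline m_t\ \text{ in }\ [0,T],\qquad \bar p_T=D\tilde G(\bar\gamma_T),$$ where $(\overline m_t)_{t\in[0,T]}\in\mathcal S^r(\mathbb R^d)$ (for $r\ge 1$) is a continuous martingale.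
   Context: Fix $T>0$. $(\Omega,\mathcal F,(\mathcal F_t)_{t\ge 0},\mathbb P)$ is a complete filtered probability space carrying a $d$-dimensional Wiener process $W=(W_t)_{t\in[0,T]}$, and $(\mathcal F_t)$ is the natural filtration of $W$ augmented by all $\mathbb P$-null sets of $\mathcal F$. For an open set $\mathcal O$, $C^2(\mathcal O)$ is the space of $C^2$ maps with bounded derivatives, with norm $\|u\|_\infty+\|Du\|_\infty+\|D^2u\|_\infty$. For a complete metric space $E$ and $p\ge 1$, $\mathcal S^p(E)$ is the space of continuous, $E$-valued processes $X=(X_t)_{t\in[0,T]}$ that are measurable with respect to the predictable $\sigma$-algebra of $(\mathcal F_t)$ and satisfy $\mathbb E[\sup_{t\in[0,T]}d_E(X_t,x_0)^p]<\infty$ for some (equivalently any) $x_0\in E$. $\mathcal S^r(C^2_{loc}(\mathbb R^d))=\bigcap_{n\ge1}\mathcal S^r(C^2(B_n))$, with $B_n$ the open ball of radius $n$ centered at $0$; $\mathcal S^r(L^1_{loc}(\mathbb R^d))$, $\mathcal S^r(W^{1,1}_{loc}(\mathbb R^d))$ and $\mathcal S^r(C^2_{loc}(\mathbb R^d\times\mathbb R^d))$ are defined similarly. $L^\infty(\Omega,\mathcal F_T,C^2(\mathbb R^d))$ is the space of bounded, $C^2(\mathbb R^d)$-valued, $\mathcal F_T$-measurable maps on $\Omega$. The dependence on $\omega\in\Omega$ is often omitted. Data: random maps $\tilde H=\tilde H_t(p,x)$ ($t\in[0,T]$, $p,x\in\mathbb R^d$) and $\tilde G=\tilde G(x)$.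 (H1) $\tilde G\in L^\infty(\Omega,\mathcal F_T,C^2(\mathbb R^d))$ and $\tilde H\in\mathcal S^r(C^2_{loc}(\mathbb R^d\times\mathbb R^d))$ for all $r\ge1$. (H2) $\mathcal H=\tilde H_t$ satisfies the following, uniformly (i.e. with the same constants) in $t\in[0,T]$ and $\omega\in\Omega$: (i) $\mathcal H(p,x)$ is convex in $p$; (ii) for any $R>0$ there is $C_R>0$ such that, for all $x,p\in\mathbb R^d$ with $|p|\le R$, $|\mathcal H(p,x)|+|D_p\mathcal H(p,x)|+|D^2_{px}\mathcal H(p,x)|+|D^2_{pp}\mathcal H(p,x)|\le C_R$; (iii) there are $\lambda>0$ and $C_0>0$ such that, for any $p,q,x,z\in\mathbb R^d$ with $|z|=1$ and in the sense of distributions, $\lambda(D_p\mathcal H(p,x)\cdot p-\mathcal H(p,x))+D^2_{pp}\mathcal H(p,x)q\cdot q+2D^2_{px}\mathcal H(p,x)z\cdot q+D^2_{xx}\mathcal H(p,x)z\cdot z\ge -C_0$. (H3) For all $R>0$, $\lim_{N\to\infty}\mathbb E[\omega^N_R]=0$, where $\omega^N_R=\sup_{|p|\le R,\,|s-t|\le 1/N,\,y\in\mathbb R^d}|\tilde H_s(p,y)-\tilde H_t(p,y)|$. $\tilde u$ is the (unique) solution, together with a process $\tilde M$, of $d_t\tilde u_t=\tilde H_t(D\tilde u_t,x)dt+d\tilde M_t$ in $\mathbb R^d\times(0,T)$, $\tilde u_T=\tilde G$, in the following sense: (i) $\tilde u\in\mathcal S^r(W^{1,1}_{loc}(\mathbb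 R^d))$ and $\tilde M\in\mathcal S^r(L^1_{loc}(\mathbb R^d))$ for all $r\ge1$; (ii) there is $C>0$ such that, $\mathbb P$-a.s., for a.e. $t\in[0,T]$ and all $|z|\le1$, in the sense of distributions, $\|\tilde u_t\|_\infty+\|D\tilde u_t\|_\infty+\|\tilde M_t\|_\infty+D^2\tilde u_t\,z\cdot z\le C$; (iii) for a.e. $x$, $(\tilde M_t(x))_{t\in[0,T]}$ is a continuous martingale; (iv) for a.e. $(x,t)$ and $\mathbb P$-a.s., $\tilde u_t(x)=\tilde G(x)-\int_t^T\tilde H_s(D\tilde u_s(x),x)ds-\tilde M_T(x)+\tilde M_t(x)$. $\tilde L_t(\alpha,x,\omega)=\sup_{p\in\mathbb R^d}[-p\cdot\alpha-\tilde H_t(p,x,\omega)]$, and $\mathcal A_{t,x}=\{\gamma\in\mathcal S^2(\mathbb R^d):\gamma_t=x\text{ and }\gamma\in H^1([t,T];\mathbb R^d)\text{ a.s.}\}$. One has $\tilde u_0(x)=\inf_{\gamma\in\mathcal A_{0,x}}\mathbb E[\int_0^T\tilde L_s(\dot\gamma_s,\gamma_s)ds+\tilde G(\gamma_T)]$, and $\bar\gamma\in\mathcal A_{0,x}$ is called optimal for $\tilde u_0(x)$ if it attains this infimum. *)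

(* Defs.v *)
From HB Require Import structures.
From mathcomp Require Import all_boot all_order all_algebra.
From mathcomp Require Import all_classical all_reals all_analysis.
Import Order.TTheory GRing.Theory Num.Theory.
Import numFieldNormedType.Exports.

Set Implicit Arguments.
Unset Strict Implicit.
Unset Printing Implicit Defensive.

Local Open Scope classical_set_scope.
Local Open Scope ring_scope.

(* Vectors of R^n are rows 'rV[R]_n.  Time runs over the type R, but only the
   values at times in [0, T] are ever used.  Processes take the time first and
   omega second; a random field such as H is written H t omega p x. *)

(* The library norm on matrices is the sup norm, so the Euclidean (on rows) or
   Frobenius (on matrices) norm is defined here.  Both norms induce the same
   topology and the same derivatives. *)
Definition enorm (R : realType) (m n : nat) (A : 'M[R]_(m, n)) : R :=
  Num.sqrt (\sum_i \sum_j A i j ^+ 2).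

Definition dotp (R : realType) (n : nat) (u v : 'rV[R]_n) : R :=
  \sum_i u 0 i * v 0 i.

(* A u . v, the vectors being seen as columns. *)
Definition bform (R : realType) (m n : nat) (A : 'M[R]_(m, n))
  (u : 'rV[R]_n) (v : 'rV[R]_m) : R := \sum_i \sum_j A i j * u 0 j * v 0 i.

Definition ebase (R : realType) (n : nat) (i : 'I_n) : 'rV[R]_n :=
  delta_mx 0 i.

Definition partial (R : realType) (n : nat) (i : 'I_n) (u : 'rV[R]_n -> R)
  (x : 'rV[R]_n) : R := 'D_(ebase R i) u x.

Definition grad (R : realType) (n : nat) (u : 'rV[R]_n -> R) (x : 'rV[R]_n) :
  'rV[R]_n := \row_i partial i u x.

Definition hess (R : realType) (n : nat) (u : 'rV[R]_n -> R) (x : 'rV[R]_n) :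
  'M[R]_n := \matrix_(i, j) partial j (partial i u) x.

Section TwoVariables.
Context (R : realType) (d : nat) (h : 'rV[R]_d -> 'rV[R]_d -> R).

Definition Dp (p x : 'rV[R]_d) : 'rV[R]_d := grad (fun p' => h p' x) p.
Definition Dx (p x : 'rV[R]_d) : 'rV[R]_d := grad (h p) x.
Definition Dpp (p x : 'rV[R]_d) : 'M[R]_d := hess (fun p' => h p' x) p.
Definition Dpx (p x : 'rV[R]_d) : 'M[R]_d :=
  \matrix_(i, j) partial j (fun x' => Dp p x' 0 i) x.

Definition joint (w : 'rV[R]_(d + d)) : R := h (lsubmx w) (rsubmx w).

End TwoVariables.

(* Carrier and distance.  A function on an open set O is represented by any of
   its extensions, so mdist need only be a pseudo-distance: two representatives
   of the same point are at distance 0.  It is finite on the carrier. *)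
Record mspace (R : realType) := MSpace {
  mpoint : Type;
  mcar : set mpoint;
  mdist : mpoint -> mpoint -> \bar R }.

Arguments mcar [R] m.
Arguments mdist [R m].

Definition mopen (R : realType) (E : mspace R) (U : set (mpoint E)) : Prop :=
  U `<=` mcar E /\
  forall u, U u -> exists2 e : R, 0 < e &
    forall v, mcar E v -> (mdist u v < e%:E)%E -> U v.

Definition euclid (R : realType) (n : nat) : mspace R :=
  @MSpace R 'rV[R]_n setT (fun u v => (enorm (u - v))%:E).

Definition is_C2 (R : realType) (n : nat) (O : set 'rV[R]_n)
  (u : 'rV[R]_n -> R) : Prop :=
  forall x, O x ->
    (forall i, derivable u x (ebase R i) /\ {for x, continuous (partial i u)}) /\
    (forall i j, derivable (partial i u) x (ebase R j) /\
                 {for x, continuous (partial j (partial i u))}).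

Definition C2norm (R : realType) (n : nat) (O : set 'rV[R]_n)
  (u : 'rV[R]_n -> R) : \bar R :=
  (ereal_sup [set `|u x|%:E | x in O] +
   ereal_sup [set (enorm (grad u x))%:E | x in O] +
   ereal_sup [set (enorm (hess u x))%:E | x in O])%E.

Definition C2space (R : realType) (n : nat) (O : set 'rV[R]_n) : mspace R :=
  @MSpace R ('rV[R]_n -> R)
    [set u | is_C2 O u /\ (C2norm O u < +oo)%E]
    (fun u v => C2norm O (fun x => u x - v x)).

Definition eball (R : realType) (n : nat) (r : R) : set 'rV[R]_n :=
  [set x | enorm x < r].

Definition test_function (R : realType) (n : nat) (phi : 'rV[R]_n -> R) :
  Prop :=
  (forall (l : seq 'I_n) x, differentiable (foldr (@partial R n) phi l) x) /\
  (exists r : R, forall x, r < enorm x -> phi x = 0).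

(* Iterated Lebesgue integral over R^n; it is only used on continuous functions
   with compact support. *)
Fixpoint integral_rV (R : realType) (n : nat) : ('rV[R]_n -> R) -> R :=
  match n return ('rV[R]_n -> R) -> R with
  | 0 => fun f => f 0
  | n'.+1 => fun f => \int[@lebesgue_measure R]_(s in setT)
      integral_rV (fun y : 'rV[R]_n' =>
        f (row_mx (const_mx s : 'rV[R]_1) y : 'rV[R]_(1 + n')))
  end.

Section Stochastic.
Context (R : realType) (disp : measure_display) (Omega : measurableType disp).
Context (P : probability Omega R).

(* The last clause gives the joint law of the increments along any subdivision:
   the random variables W^i_{t (k+1)} - W^i_{t k} are independent, with law
   N(0, t (k+1) - t k).  The second argument of normal_prob is the standard
   deviation. *)
Definition wiener (T : R) (d : nat) (W : R -> Omega -> 'rV[R]_d) : Prop :=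
  [/\ forall t i, 0 <= t <= T -> measurable_fun setT (fun w => W t w 0 i),
      {ae P, forall w, W 0 w = 0},
      forall w, {within `[0, T], continuous (fun t => W t w)} &
      forall (n : nat) (t : nat -> R),
        0 <= t 0%N -> t n <= T -> (forall k, (k < n)%N -> t k < t k.+1) ->
        forall B : 'I_n -> 'I_d -> set R, (forall k i, measurable (B k i)) ->
        P [set w | forall k i, B k i (W (t k.+1) w 0 i - W (t k) w 0 i)] =
        (\prod_(k < n) \prod_(i < d)
           normal_prob 0 (Num.sqrt (t k.+1 - t k)) (B k i))%E].

(* Sigma-algebra generated by W_s, s <= t, and the P-null sets. *)
Definition augmented_filtration (d : nat) (W : R -> Omega -> 'rV[R]_d) (t : R) :
  set (set Omega) :=
  <<s [set A | exists s i B, [/\ 0 <= s <= t, measurable (B : set R) &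
                 A = [set w | B (W s w 0 i)]]] `|`
      [set N | measurable N /\ P N = 0%E] >>.

Context (T : R) (F : R -> set (set Omega)).

Definition predictable_sigma : set (set (R * Omega)) :=
  <<s `[0, T]%classic `*` setT,
      [set Y | (exists2 A, F 0 A & Y = [set 0] `*` A) \/
               (exists s t A, [/\ 0 <= s, s < t, t <= T, F s A &
                  Y = `]s, t]%classic `*` A])] >>.

Definition continuous_process (E : mspace R) (X : R -> Omega -> mpoint E) :
  Prop :=
  forall w t, 0 <= t <= T -> forall e : R, 0 < e ->
    exists2 del : R, 0 < del & forall s, 0 <= s <= T -> `|s - t| < del ->
      (mdist (X s w) (X t w) < e%:E)%E.

Definition predictable (E : mspace R) (X : R -> Omega -> mpoint E) : Prop :=
  forall U, mopen U ->
    predictable_sigma [set z | 0 <= z.1 <= T /\ U (X z.1 z.2)].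

Definition Sspace (r : R) (E : mspace R) (X : R -> Omega -> mpoint E) : Prop :=
  [/\ forall w t, 0 <= t <= T -> mcar E (X t w),
      continuous_process X,
      predictable X &
      exists2 x0, mcar E x0 &
        (\int[P]_w ((ereal_sup [set mdist (X t w) x0 | t in `[0%R, T]%classic])
                      `^ r) < +oo)%E].

(* S^r(C^2_loc(R^n)). *)
Definition S_C2loc (r : R) (n : nat) (X : R -> Omega -> 'rV[R]_n -> R) : Prop :=
  forall k : nat, (0 < k)%N -> @Sspace r (C2space (@eball R n k%:R)) X.

Definition Linfty_C2 (n : nat) (g : Omega -> 'rV[R]_n -> R) : Prop :=
  [/\ forall w, is_C2 setT (g w),
      exists C : R, forall w, (C2norm setT (g w) <= C%:E)%E &
      forall U : set (mpoint (C2space (@setT 'rV[R]_n))), mopen U ->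
        F T [set w | U (g w)]].

Definition adapted (n : nat) (X : R -> Omega -> 'rV[R]_n) : Prop :=
  forall t i, 0 <= t <= T -> forall B : set R, measurable B ->
    F t [set w | B (X t w 0 i)].

(* eta is a version of E[xi | G]. *)
Definition cond_expectation (G : set (set Omega)) (n : nat)
  (xi eta : Omega -> 'rV[R]_n) : Prop :=
  forall i,
  [/\ P.-integrable setT (fun w => (xi w 0 i)%:E),
      P.-integrable setT (fun w => (eta w 0 i)%:E),
      forall B : set R, measurable B -> G [set w | B (eta w 0 i)] &
      forall A, G A ->
        (\int[P]_(w in A) (eta w 0 i)%:E = \int[P]_(w in A) (xi w 0 i)%:E)%E].

Definition martingale (n : nat) (m : R -> Omega -> 'rV[R]_n) : Prop :=
  forall s t, 0 <= s -> s <= t -> t <= T ->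
    cond_expectation (F s) (m t) (m s).

Definition vintegral (n : nat) (a b : R) (f : R -> 'rV[R]_n) : 'rV[R]_n :=
  \row_i \int[@lebesgue_measure R]_(s in `[a, b]) f s 0 i.

(* H^1([a, b]; R^n), as the primitives of L^2 maps. *)
Definition H1curve (n : nat) (a b : R) (g : R -> 'rV[R]_n) : Prop :=
  exists v : R -> 'rV[R]_n,
  [/\ forall i, measurable_fun `[a, b] (fun s => v s 0 i),
      (\int[@lebesgue_measure R]_(s in `[a, b]) ((enorm (v s)) ^+ 2)%:E < +oo)%E
    & forall s, a <= s <= b -> g s = g a + vintegral a s v].

(* The classical derivative; when g is in H^1([a, b]) it coincides with the weak
   one at almost every point of [a, b]. *)
Definition dot (n : nat) (g : R -> 'rV[R]_n) (s : R) : 'rV[R]_n :=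
  derive1 g s.

Definition traj (n : nat) (X : R -> Omega -> 'rV[R]_n) (w : Omega) :
  R -> 'rV[R]_n := fun s => X s w.

(* The set A_{t,x}. *)
Definition admissible (d : nat) (t : R) (x : 'rV[R]_d) :
  set (R -> Omega -> 'rV[R]_d) :=
  [set gam | @Sspace 2 (euclid R d) gam /\
     {ae P, forall w, gam t w = x /\ H1curve t T (traj gam w)}].

Context (d : nat) (H : R -> Omega -> 'rV[R]_d -> 'rV[R]_d -> R).
Context (G : Omega -> 'rV[R]_d -> R).

Definition Lagrangian (t : R) (w : Omega) (a x : 'rV[R]_d) : \bar R :=
  ereal_sup [set (- dotp p a - H t w p x)%:E | p in setT].

(* The Lagrangian is +oo outside its effective domain, hence fine. *)
Definition DxL (t : R) (w : Omega) (a x : 'rV[R]_d) : 'rV[R]_d :=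
  grad (fun y => fine (Lagrangian t w a y)) x.

Definition cost (gam : R -> Omega -> 'rV[R]_d) : \bar R :=
  (\int[P]_w
     (\int[@lebesgue_measure R]_(s in `[0%R, T])
        Lagrangian s w (dot (traj gam w) s) (gam s w)
      + (G w (gam T w))%:E))%E.

(* gam attains the infimum which defines the value at time 0 and position x. *)
Definition optimal (x : 'rV[R]_d) (gam : R -> Omega -> 'rV[R]_d) : Prop :=
  admissible 0 x gam /\
  cost gam = ereal_inf [set cost g | g in admissible 0 x].

(* pbar is the continuous adapted process given by the conditional expectations
   E[ int_t^T D_x L_s(dot gam_s, gam_s) ds + DG(gam_T) | F_t ]. *)
Definition adjoint_process (gam pbar : R -> Omega -> 'rV[R]_d) : Prop :=
  [/\ @continuous_process (euclid R d) pbar,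
      adapted pbar &
      forall t, 0 <= t <= T ->
        cond_expectation (F t)
          (fun w => vintegral t T
                      (fun s => DxL s w (dot (traj gam w) s) (gam s w))
                    + grad (G w) (gam T w))
          (pbar t)].

Definition hypH1 : Prop :=
  Linfty_C2 G /\
  (forall r : R, 1 <= r -> S_C2loc r (fun t w => joint (H t w))).

Definition hypH2_convex : Prop :=
  forall t w, 0 <= t <= T -> forall p q x (th : R), 0 <= th <= 1 ->
    H t w (th *: p + (1 - th) *: q) x
    <= th * H t w p x + (1 - th) * H t w q x.

Definition hypH2_bound : Prop :=
  forall r : R, 0 < r -> exists2 C : R, 0 < C &
    forall t w, 0 <= t <= T -> forall p x, enorm p <= r ->
      `|H t w p x| + enorm (Dp (H t w) p x) + enorm (Dpx (H t w) p x)
      + enorm (Dpp (H t w) p x) <= C.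

(* The inequality
     lam (D_p H . p - H) + D^2_pp H q . q + 2 D^2_px H z . q + D^2_xx H z . z
       >= - C0
   in the sense of distributions on R^d x R^d.  By hypH2_bound all the terms but
   the last one are locally bounded functions; D^2_xx H z . z is the
   distributional derivative, carried by the test function. *)
Definition hypH2_lower : Prop :=
  exists lam C0 : R, [/\ 0 < lam, 0 < C0 &
    forall t w, 0 <= t <= T -> forall q z : 'rV[R]_d, enorm z = 1 ->
    forall phi : 'rV[R]_(d + d) -> R, test_function phi ->
      (forall y, 0 <= phi y) ->
      - C0 * integral_rV phi <=
      integral_rV (fun y =>
        let p := lsubmx y in let x := rsubmx y in
        let zz := row_mx 0 z : 'rV[R]_(d + d) in
        (lam * (dotp (Dp (H t w) p x) p - H t w p x)
         + bform (Dpp (H t w) p x) q q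
         + 2 * bform (Dpx (H t w) p x) z q) * phi y
        + H t w p x * 'D_zz ('D_zz phi) y)].

Definition hypH2 : Prop := [/\ hypH2_convex, hypH2_bound & hypH2_lower].

Definition modulus (r : R) (N : nat) (w : Omega) : \bar R :=
  ereal_sup [set e | exists s t p y,
    [/\ 0 <= s <= T, 0 <= t <= T, `|s - t| <= N%:R^-1, enorm p <= r &
        e = `|H s w p y - H t w p y|%:E]].

Definition hypH3 : Prop :=
  forall r : R, 0 < r ->
    (fun N : nat => \int[P]_w modulus r N w)%E @ \oo --> 0%E.

End Stochastic.

(* Main.v *)
(* Write ell = L + const > 0 and let u be the velocity of gam.  Hypothesis (H2)(iii), read pointwise, bounds
   second differences of ell(a, .) by lam * ell, whence exponential growth, semiconcavity and a measurable
   choice xi of supergradients of ell(u, .) along gam.  Switching on an event of F_t to the bounded velocity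
   -D_pH(0, .) shows that the adjoint process p built from xi is bounded.  The first variation in the
   direction -D_pH(p, gam) - u is minus the integral of a Fenchel defect, so u = -D_pH(p, gam); then
   ell(u, .) is differentiable at gam, with gradient xi = -D_xH(p, gam). *)
From HB Require Import structures.
Require Import Defs.
From mathcomp Require Import all_boot all_order all_algebra.
From mathcomp Require Import all_classical all_reals all_analysis.
From mathcomp Require finmap.
From mathcomp Require Import measurable_realfun.
From mathcomp Require Import ring lra.
Import Order.TTheory GRing.Theory Num.Theory.
Import numFieldNormedType.Exports.

Set Implicit Arguments.
Unset Strict Implicit.

Local Open Scope classical_set_scope.
Local Open Scope ring_scope.

(** At the outset [DxL] is not known to exist along gam, and L may take the value +oo, so the
    adjoint process of the statement cannot be the starting point. All estimates use supergradients
    xi; only the feedback formula, at the end, shows that [DxL] exists along gam and equals xi. H is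
    merely convex in p, so L is reached through suprema penalised by del / 2 |p|^2, whose maximiser
    moves continuously with x. The free vector q of (H2)(iii) follows this motion, and the resulting
    bounds do not involve del. Boundedness of p makes -D_pH(p, gam) a bounded velocity, but u is
    only square integrable: the variation is restricted to |u|^2 <= N and all N are combined
    afterwards. The martingale is continuous because the filtration is Brownian: products of
    functions of W at finitely many times have explicit continuous conditional expectations by the
    Markov property, and the maximal inequality closes this class in L^1. The velocity is rebuilt
    from left difference quotients so that it is progressive. *)

(** * Measurability of random fields along random points; integrals and limits *)

Lemma rV_norm_le (R : realType) n (x : 'rV[R]_n) (e : R) :
  0 <= e -> (forall i, `|x 0 i| <= e) -> `|x| <= e.
Proof.
move=> e0 xe; rewrite -[`|x|]/(mx_norm x) mx_normrE.
by apply: bigmax_le => // -[i j] _ /=; rewrite (ord1 i).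
Qed.

Lemma rV_coord_le (R : realType) n (x : 'rV[R]_n) i : `|x 0 i| <= `|x|.
Proof.
rewrite -[`|x|]/(mx_norm x) mx_normrE.
exact: (le_bigmax _ (fun ij : 'I_1 * 'I_n => `|x ij.1 ij.2|) (0, i)).
Qed.

Lemma cvg_rV (R : realType) n (T : Type) (F : set_system T) (FF : Filter F)
  (f : T -> 'rV[R]_n) (l : 'rV[R]_n) :
  (forall i, f x 0 i @[x --> F] --> l 0 i) -> f @ F --> l.
Proof.
move=> fl; apply/cvgrPdist_le => e e0.
have : \forall x \near F, forall i : 'I_n, `|l 0 i - f x 0 i| <= e.
  by apply: filter_forall => i; move/cvgrPdist_le : (fl i); exact.
apply: filterS => x xi; apply: rV_norm_le; first exact: ltW.
by move=> i; have := xi i; rewrite !mxE.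
Qed.

(** Y is rounded down to the grid of mesh 1/(k+1). On each of the countably many cells the field is
    evaluated at a fixed point, hence measurable there, and continuity in y lets k tend to
    infinity. *)
Lemma mcaratheodory (R : realType) disp (Om : measurableType disp) n
    (F : Om -> 'rV[R]_n -> R) (Y : Om -> 'rV[R]_n) :
  (forall y, measurable_fun setT (F^~ y)) ->
  (forall w, continuous (F w)) ->
  (forall i, measurable_fun setT (fun w => Y w 0 i)) ->
  measurable_fun setT (fun w => F w (Y w)).
Proof.
move=> mF cF mY.
pose D (k : nat) w : 'rV[R]_n := \row_i ((Num.floor (k.+1%:R * Y w 0 i))%:~R / k.+1%:R).
apply: (@measurable_realfun.measurable_fun_cvg _ _ _ _ (fun k w => F w (D k w))); last first.
  move=> w _; apply: (@cvg_comp _ _ _ (fun k => D k w) (F w) _ _ _ _ (cF w (Y w))).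
  apply: cvg_rV => i.
  apply/cvgrPdist_le => e e0.
  near=> k.
  rewrite mxE.
  have k0 : 0 < k.+1%:R :> R by rewrite ltr0n.
  have /andP[f1 f2] : (Num.floor (k.+1%:R * Y w 0 i))%:~R <= k.+1%:R * Y w 0 i <
    (Num.floor (k.+1%:R * Y w 0 i) + 1)%:~R by exact: floor_itv.
  rewrite intrD in f2.
  have ke : k.+1%:R^-1 <= e.
    apply: ltW; near: k; exact: (near_infty_natSinv_lt (PosNum e0)).
  rewrite ger0_norm; last by rewrite subr_ge0 ler_pdivrMr// [_ * k.+1%:R]mulrC.
  apply: le_trans ke.
  rewrite -[leRHS]mul1r lerBlDr -mulrDl ler_pdivlMr// mulrC addrC; exact: ltW.
move=> k; move=> _ B mB; rewrite setTI.
have -> : (fun w => F w (D k w)) @^-1` B =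
  \bigcup_(z : 'rV[int]_n)
   ([set w | forall i, Num.floor (k.+1%:R * Y w 0 i) = z 0 i] `&`
    [set w | B (F w (\row_i ((z 0 i)%:~R / k.+1%:R)))]).
  apply/seteqP; split => [w Bw|w [z _ [/= fz Bw]]] /=.
    exists (\row_i Num.floor (k.+1%:R * Y w 0 i)) => //; split => /=.
      by move=> i; rewrite mxE.
    rewrite (_ : \row__ _ = D k w)//.
    by apply/rowP => i; rewrite !mxE.
  rewrite (_ : D k w = (\row_i ((z 0 i)%:~R / k.+1%:R)))//.
  by apply/rowP => i; rewrite !mxE fz.
apply: countable_bigcupT_measurable => [|z]; first exact: countableP.
apply: measurableI; last first.
  by have := mF (\row_i ((z 0 i)%:~R / k.+1%:R)) measurableT B mB; rewrite setTI.
rewrite [X in measurable X](_ : _ = \big[setI/setT]_(i < n)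
  [set w | Num.floor (k.+1%:R * Y w 0 i) = z 0 i]).
  apply: bigsetI_measurable => i _.
  have mk : measurable_fun setT (fun w => k.+1%:R * Y w 0 i).
    by apply: measurable_funM.
  have := mk measurableT `[(z 0 i)%:~R, (z 0 i + 1)%:~R[%classic (measurable_itv _).
  rewrite setTI; congr measurable; apply/seteqP; split => w /=; rewrite in_itv /=.
    by move/floor_def.
  by move=> <-; apply: floor_itv.
apply/seteqP; split => w /=.
  by move=> h; elim/big_ind: _ => // i _; apply: h.
by move=> h i; move: h; rewrite (bigD1 i)//= => -[].
Unshelve. all: by end_near. Qed.

Section Nonmeasurable.
Import HBNNSimple.

(** The integral of a nonnegative function is a supremum over simple functions below it, measurable
    or not. A simple function below f, set to 0 on N, lies below g and keeps its integral. *)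
Lemma nnint_ae_le (R : realType) disp (Om : measurableType disp)
    (mu : {measure set Om -> \bar R}) (f g : Om -> \bar R) (N : set Om) :
  measurable N -> mu N = 0%E -> (forall w, (0 <= g w)%E) ->
  (forall w, ~ N w -> (f w <= g w)%E) -> (forall w, (0 <= f w)%E) ->
  (\int[mu]_w f w <= \int[mu]_w g w)%E.
Proof.
move=> mN N0 g0 fg f0; rewrite !ge0_integralTE//.
apply: ge_ereal_sup => _ [h /= hf <-].
apply: ereal_sup_ubound; exists (proj_nnsfun h (measurableC mN)) => /=.
  move=> w; have := congr1 (@^~ w) (mrestrict h (measurableC mN)) => /= <-.
  rewrite /patch; case: ifPn => //; rewrite inE => Nw.
  exact: le_trans (hf w) (fg w Nw).
rewrite -!integralT_nnsfun; apply: ge0_ae_eq_integral => //.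
- by apply/measurable_EFinP; exact: measurable_funPT.
- by apply/measurable_EFinP; exact: measurable_funPT.
- by move=> w _; rewrite lee_fin.
- by move=> w _; rewrite lee_fin.
exists N; split => // w /= /not_implyP[_]; apply: contra_notP => Nw.
by have := congr1 (@^~ w) (mrestrict h (measurableC mN)) => /= <-; rewrite /patch ifT// inE.
Qed.

(* No measurability is required of the integrands. *)
Lemma integral_ae (R : realType) disp (Om : measurableType disp)
    (mu : {measure set Om -> \bar R}) (D : set Om) (f g : Om -> \bar R) :
  {ae mu, forall w, D w -> f w = g w} ->
  (\int[mu]_(w in D) f w = \int[mu]_(w in D) g w)%E.
Proof.
move=> [N [mN N0 fgN]].
have fg w : ~ N w -> (f \_ D) w = (g \_ D) w.
  move=> Nw; rewrite /patch; case: ifPn => //; rewrite inE => Dw.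
  by apply: contra_notP Nw => h; apply: fgN => /(_ Dw).
rewrite integral_mkcond [RHS]integral_mkcond integralE [RHS]integralE.
congr (_ - _)%E; apply/eqP; rewrite eq_le; apply/andP; split;
  apply: (nnint_ae_le mN N0) => // w Nw; rewrite ?funeposE ?funenegE fg//.
Qed.

End Nonmeasurable.

(** Projection onto [a, b]. Time runs over all of R while processes are only constrained on [0, T];
    composing with this projection turns facts on the interval into facts about functions on R. *)
Definition clamp (R : realType) (a b s : R) : R := Num.max a (Num.min s b).

Lemma clamp_itv (R : realType) (a b s : R) : a <= b -> a <= clamp a b s <= b.
Proof. by move=> ab; rewrite /clamp le_max lexx/= ge_max ab ge_min lexx orbT. Qed.
Lemma clamp_id (R : realType) (a b s : R) : a <= s <= b -> clamp a b s = s.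
Proof. by move=> /andP[? ?]; rewrite /clamp min_l// max_r. Qed.

Lemma clamp_lip (R : realType) (a b s t : R) : `|clamp a b s - clamp a b t| <= `|s - t|.
Proof.
have minl (x y : R) : x <= y -> 0 <= Num.min y b - Num.min x b <= y - x.
  move=> xy; rewrite subr_ge0 le_min !ge_min xy lexx/= orbT/= lerBlDl.
  rewrite -lerBlDr le_min; apply/andP; split; rewrite lerBlDr.
    by rewrite addrC subrK ge_min lexx.
  by rewrite (le_trans (_ : _ <= b)) ?ge_min ?lexx ?orbT// lerDl subr_ge0.
have maxl (x y : R) : x <= y -> 0 <= Num.max a y - Num.max a x <= y - x.
  move=> xy; have yx : 0 <= y - x by rewrite subr_ge0.
  rewrite subr_ge0 ge_max !le_max xy lexx/= orbT/= lerBlDl ge_max.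
  by rewrite -{1}[a]addr0 lerD ?le_max ?lexx//= -lerBlDr subKr le_max lexx orbT.
wlog st : s t / s <= t => [H|].
  by have /orP[/H//|/H] := le_total s t; rewrite distrC (distrC t).
rewrite distrC (distrC s) (ger0_norm (_ : 0 <= t - s)) ?subr_ge0//.
have /andP[h1 h2] := minl _ _ st; rewrite subr_ge0 in h1.
by have /andP[h3 h4] := maxl _ _ h1; rewrite ger0_norm// (le_trans h4).
Qed.

Lemma clamp_continuous (R : realType) (a b : R) : continuous (clamp a b).
Proof.
move=> s; apply/cvgrPdist_le => e e0; near=> t.
apply: le_trans (clamp_lip _ _ _ _) _.
by near: t; apply: cvgr_dist_le.
Unshelve. all: by end_near. Qed.

(** Time is turned into a row of length 1, so that this is a field continuous in the point and
    measurable in omega. *)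
Lemma mprocess (R : realType) disp (Om : measurableType disp)
    (X : R -> Om -> R) :
  (forall w, continuous (X^~ w)) -> (forall t, measurable_fun setT (X t)) ->
  measurable_fun setT (fun z : R * Om => X z.1 z.2).
Proof.
move=> cX mX.
pose F (z : R * Om) (y : 'rV[R]_1) := X (y 0 0) z.2.
pose Y (z : R * Om) : 'rV[R]_1 := const_mx z.1.
have -> : (fun z : R * Om => X z.1 z.2) = (fun z => F z (Y z)).
  by apply/funext => z; rewrite /F/Y mxE.
apply: mcaratheodory.
- move=> y; exact: (measurableT_comp (mX (y 0 0)) measurable_snd).
- move=> z y; apply: (@continuous_comp _ _ _ (fun y : 'rV[R]_1 => y 0 0) (X^~ z.2)).
    exact: coord_continuous.
  exact: cX.
- move=> i; under eq_fun do rewrite mxE; exact: measurable_fst.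
Qed.

Lemma cvg_half0 (R : realType) (c : R) : (fun n => c * 2^-1 ^+ n) @ \oo --> 0.
Proof.
by apply: cvg_geometric; rewrite ger0_norm ?invr_ge0// invf_lt1// ltr1n.
Qed.

Lemma limn_einf_le (R : realType) (u : (\bar R)^nat) (c : \bar R) :
  (\forall n \near \oo, (u n <= c)%E) -> (limn_einf u <= c)%E.
Proof.
move=> uc; rewrite limn_einf_lim; apply: lime_le; first exact: is_cvg_einfs.
apply: filterS uc => n; apply: le_trans.
by apply: ereal_inf_lbound; exists n => /=.
Qed.

Lemma bdd_integrable (R : realType) disp (Om : measurableType disp)
    (mu : {measure set Om -> \bar R}) (D : set Om) (f : Om -> R) (C : R) :
  measurable D -> (mu D < +oo)%E -> measurable_fun D f -> (forall w, D w -> `|f w| <= C) ->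
  mu.-integrable D (EFin \o f).
Proof.
move=> mD muD mf fC; apply: measurable_bounded_integrable => //.
by exists C; split; [exact: num_real|move=> M CM w Dw; exact: le_trans (fC w Dw) (ltW CM)].
Qed.

Lemma bdd_cvg_Rintegral (R : realType) disp (Om : measurableType disp)
    (mu : {measure set Om -> \bar R}) (D : set Om) (f_ : (Om -> R)^nat) (f : Om -> R) (C : R) :
  measurable D -> (mu D < +oo)%E -> (forall n, measurable_fun D (f_ n)) ->
  (forall w, D w -> f_ ^~ w @ \oo --> f w) -> (forall n w, D w -> `|f_ n w| <= C) ->
  \int[mu]_(w in D) f_ n w @[n --> \oo] --> \int[mu]_(w in D) f w.
Proof.
move=> mD muD mf ff fC.
have cf : (\int[mu]_(w in D) (f_ n w)%:E)%E @[n --> \oo] --> (\int[mu]_(w in D) (f w)%:E)%E.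
  apply: (@dominated_cvg _ _ _ _ _ mD _ _ (fun=> `|C|%:E)).
  - by move=> n; apply/measurable_EFinP.
  - by move=> w Dw; apply: cvg_EFin; [exact: nearW|exact: ff].
  - by [].
  - by apply: (bdd_integrable (f := fun=> `|C|) (C := `|C|)) => // w _; rewrite normr_id.
  - by move=> n w Dw; rewrite lee_fin; apply: le_trans (fC n w Dw) (ler_norm _).
have fin : (\int[mu]_(w in D) (f w)%:E)%E \is a fin_num.
  apply: integrable_fin_num => //; apply: (bdd_integrable (C := C)) => //.
  - by apply: (measurable_fun_cvg mf).
  - move=> w Dw; apply: (ler_cvg_to (cvg_norm (ff w Dw)) (cvg_cst C)); near=> n; exact: fC.
by apply: fine_cvg; rewrite fineK.
Unshelve. all: by end_near. Qed.

Lemma Rintegral_bounded_cvg (R : realType) disp (Om : measurableType disp)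
    (mu : {finite_measure set Om -> \bar R}) (D : set Om) (f_ : (Om -> R)^nat) (f : Om -> R) (C : R) :
  measurable D -> (forall n, measurable_fun D (f_ n)) ->
  (forall w, D w -> f_ ^~ w @ \oo --> f w) -> (forall n w, D w -> `|f_ n w| <= C) ->
  \int[mu]_(w in D) f_ n w @[n --> \oo] --> \int[mu]_(w in D) f w.
Proof. by move=> mD; apply: bdd_cvg_Rintegral => //; rewrite ltey_eq fin_num_measure. Qed.

(** Dominated convergence speaks of sequences; this is how it yields continuity of parameter
    integrals. *)
Lemma cvg_seq_nbhs (R : realType) (V : normedModType R) (f : V -> R) (x : V) (l : R) :
  (forall u : nat -> V, u @ \oo --> x -> (f \o u) @ \oo --> l) -> f @ x --> l.
Proof.
move=> H; apply/cvgrPdist_le => e e0; apply: contrapT => nf.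
have /choice[u Hu] : forall n : nat, exists y : V, `|x - y| < n.+1%:R^-1 /\ e < `|l - f y|.
  move=> n; apply: contrapT => /forallNP h; apply: nf.
  have n0 : 0 < n.+1%:R^-1 :> R by rewrite invr_gt0 ltr0n.
  have /cvgrPdist_lt/(_ _ n0) : id y @[y --> x] --> x by exact: cvg_id.
  by apply: filterS => y xy; rewrite leNgt; apply/negP => ey; apply: (h y).
have ux : u @ \oo --> x.
  apply/cvgrPdist_lt => e' e'0; near=> n.
  apply: lt_trans (Hu n).1 _; near: n; exact: (near_infty_natSinv_lt (PosNum e'0)).
have /cvgrPdist_lt/(_ e e0)[n _ /(_ n (leqnn n))/=] := H u ux.
by move=> /(lt_trans (Hu n).2); rewrite ltxx.
Unshelve. all: by end_near. Qed.

Lemma continuous_clamp_within (R : realType) (V : normedModType R) (a b : R) (f : R -> V) :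
  a <= b -> {within `[a, b], continuous f} -> continuous (fun t => f (clamp a b t)).
Proof.
move=> ab /subspace_continuousP cf t.
have cab s : `[a, b]%classic (clamp a b s) by rewrite /= in_itv/=; exact: (clamp_itv s ab).
have /cvgrPdist_le h := cf _ (cab t); apply/cvgrPdist_le => e e0.
have := h e e0; rewrite near_withinE => h'.
have h2 := @clamp_continuous R a b t _ h'.
by apply: (filterS _ (h2 : nbhs t _)) => s hs; exact: (hs (cab s)).
Qed.

Lemma continuous_rVP (R : realType) n (u : 'rV[R]_n -> R) :
  (forall (x : 'rV[R]_n) e, 0 < e -> \forall y \near x, `|u x - u y| <= e) <-> continuous u.
Proof.
split=> [H x|H x e e0].
  apply: (proj2 (@cvgrPdist_le R R 'rV[R]_n (nbhs x) (nbhs_filter x) u (u x))) => e e0.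
  exact: H.
exact: (proj1 (@cvgrPdist_le R R 'rV[R]_n (nbhs x) (nbhs_filter x) u (u x)) (H x) e e0).
Qed.

Lemma nbhs0_leR (R : realType) (e : R) : 0 < e -> \forall x \near (0 : R), `|x| <= e.
Proof.
move=> e0; apply/nbhs_ballP; exists e => // x.
by rewrite -ball_normE /= sub0r normrN => /ltW.
Qed.

(** * Sub-sigma-algebras, conditional averages and the maximal inequality *)

Section SigmaAlgebraClosure.
Context (T : Type) (F : set (set T)) (sF : sigma_algebra setT F).

Lemma sigC A : F A -> F (~` A).
Proof. by case: sF => _ h _ /h; rewrite setTD. Qed.

Lemma sig0 : F set0. Proof. by case: sF. Qed.

Lemma sigT : F setT. Proof. by rewrite -setC0; exact/sigC/sig0. Qed.

Lemma sig_bigcup (A : nat -> set T) : (forall k, F (A k)) -> F (\bigcup_k A k).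
Proof. by case: sF => _ _; apply. Qed.
Lemma sigU A B : F A -> F B -> F (A `|` B).
Proof. by move=> FA FB; rewrite -bigcup2E; apply: sig_bigcup => -[|[|i]]//=; exact: sig0. Qed.
Lemma sigI A B : F A -> F B -> F (A `&` B).
Proof. by move=> FA FB; rewrite -[X in F X]setCK setCI; apply/sigC/sigU; exact: sigC. Qed.
Lemma sigD A B : F A -> F B -> F (A `\` B).
Proof. by move=> FA FB; rewrite setDE; apply: sigI => //; exact: sigC. Qed.

End SigmaAlgebraClosure.

Section SubSigmaAlgebra.
Context (R : realType) (disp : measure_display) (Omega : measurableType disp).
Context (P : probability Omega R).

(** [g_sigma_algebraType F] makes F the sigma-algebra of a measurable type, so that the closure
    properties of measurable functions apply to F. It generates a sigma-algebra from F, which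
    changes nothing when F is one already. *)
Definition fmeas (F : set (set Omega)) (f : Omega -> R) :=
  measurable_fun (T := g_sigma_algebraType F) setT f.

Lemma fmeasP F f : sigma_algebra setT F ->
  fmeas F f <-> forall B, measurable B -> F (f @^-1` B).
Proof.
move=> sF; split => [mf B mB|mf _ B mB]; last by rewrite setTI; apply: sub_sigma_algebra; apply: mf.
have := mf measurableT B mB; rewrite setTI.
by rewrite -[X in X -> _]/(<<s F >> _) sigma_algebra_id.
Qed.

Lemma fmeasS F F' f : F `<=` F' -> fmeas F f -> fmeas F' f.
Proof.
by move=> FF' mf _ B mB; have := mf measurableT B mB; exact: (sub_sigma_algebra2 FF').
Qed.

Lemma fmeasW F f : F `<=` measurable -> fmeas F f -> measurable_fun setT f.
Proof.
move=> FF' mf _ B mB; have := mf measurableT B mB.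
suff : <<s F >> `<=` measurable by move=> h /h.
apply: smallest_sub => //; exact: sigma_algebra_measurable.
Qed.

Definition is_sub_sigma (F : set (set Omega)) := sigma_algebra setT F /\ F `<=` measurable.

Lemma fmeas_set F (f : Omega -> R) B : is_sub_sigma F -> fmeas F f -> measurable B ->
  F (f @^-1` B).
Proof. by move=> [sF _] /(fmeasP _ sF); apply. Qed.

Definition Pint (f : Omega -> R) := P.-integrable setT (EFin \o f).

Lemma Pint_bdd (f : Omega -> R) (C : R) : measurable_fun setT f ->
  (forall w, `|f w| <= C) -> Pint f.
Proof.
move=> mf fC; apply: measurable_bounded_integrable => //.
  by rewrite [X in (X < _)%E]probability_setT ltry.
by exists C; split; [exact: num_real|move=> M CM w _; exact: le_trans (fC w) (ltW CM)].
Qed.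

Lemma PintS (f : Omega -> R) A : measurable A -> Pint f -> P.-integrable A (EFin \o f).
Proof. by move=> mA; apply: integrableS. Qed.
Lemma PintD f g : Pint f -> Pint g -> Pint (fun w => f w + g w).
Proof. by move=> fi gi; rewrite /Pint/= /comp; under eq_fun do rewrite EFinD; exact: integrableD. Qed.
Lemma PintB f g : Pint f -> Pint g -> Pint (fun w => f w - g w).
Proof. by move=> fi gi; rewrite /Pint/= /comp; under eq_fun do rewrite EFinB; exact: integrableB. Qed.
Lemma PintZ c f : Pint f -> Pint (fun w => c * f w).
Proof. by move=> fi; rewrite /Pint/= /comp; under eq_fun do rewrite EFinM; exact: integrableZl. Qed.
Lemma Pint_abs f : Pint f -> Pint (fun w => `|f w|).
Proof. exact: integrable_norm. Qed.
Lemma Pint_measurable f : Pint f -> measurable_fun setT f.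
Proof. by move=> /measurable_int/measurable_EFinP. Qed.

Lemma Rint_split (f : Omega -> R) A B : measurable A -> measurable B -> Pint f ->
  \int[P]_(w in A) f w = \int[P]_(w in A `&` B) f w + \int[P]_(w in A `\` B) f w.
Proof.
move=> mA mB fi; rewrite -{1}(setDUK (@subIsetl _ A B)) Rintegral_setU//.
- by rewrite setDIr setDv set0U.
- exact: measurableI.
- by rewrite setDIr setDv set0U; exact: measurableD.
- by rewrite setDUK//; exact: PintS.
- by rewrite /disj_set setDIr setDv set0U setDE setIACA setICr !setI0; apply/eqP.
Qed.

(** Conditional expectation contracts the L^1 norm: the event N >= 0 and its complement lie in F,
    and on each of them |N| is N up to sign. *)
Lemma condexp_le F (N eta : Omega -> R) : is_sub_sigma F ->
  fmeas F N -> Pint N -> Pint eta ->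
  (forall A, F A -> \int[P]_(w in A) N w = \int[P]_(w in A) eta w) ->
  \int[P]_w `|N w| <= \int[P]_w `|eta w|.
Proof.
move=> sF mN iN ie H; have [sF1 sF2] := sF.
pose B := N @^-1` `[0, +oo[%classic.
have FB : F B by apply: fmeas_set.
have FB' : F (setT `\` B) by rewrite setTD; exact: sigC.
have mB := sF2 _ FB; have mB' := sF2 _ FB'.
rewrite (Rint_split measurableT mB (Pint_abs iN)) (Rint_split measurableT mB (Pint_abs ie)) setTI.
apply: lerD.
  rewrite (@eq_Rintegral _ _ _ P _ N); last first.
    by move=> w; rewrite inE /B/= in_itv/= andbT => /ger0_norm.
  rewrite H//; apply: le_trans (ler_norm _) _.
  by apply: le_normr_Rintegral => //; exact: PintS.
rewrite (@eq_Rintegral _ _ _ P _ (fun w => - N w)); last first.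
  by move=> w; rewrite inE /B/= in_itv/= andbT => -[_ /negP]; rewrite -ltNge => /ltr0_norm.
rewrite (@eq_Rintegral _ _ _ P _ (fun w => (-1) * N w)); last by move=> w _; rewrite mulN1r.
rewrite RintegralZl//; last exact: PintS.
rewrite H// mulN1r; apply: le_trans (ler_norm _) _; rewrite normrN.
by apply: le_normr_Rintegral => //; exact: PintS.
Qed.

(** Doob's maximal inequality, by the first index at which c is exceeded: what the index n+1 adds to
    B is an event of F (n+1), disjoint from B, on which N (n+1) > c and has the averages of eta. *)
Lemma doob (F : nat -> set (set Omega)) (N : nat -> Omega -> R) (eta : Omega -> R) (c : R) n :
  (forall k, is_sub_sigma (F k)) -> (forall k, F k `<=` F k.+1) ->
  (forall k, fmeas (F k) (N k)) -> (forall k, Pint (N k)) -> Pint eta ->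
  (forall k A, F k A -> \int[P]_(w in A) N k w = \int[P]_(w in A) eta w) ->
  let B := [set w | exists2 k, (k <= n)%N & c < N k w] in
  F n B /\ c * fine (P B) <= \int[P]_(w in B) `|eta w|.
Proof.
move=> sF sub mN iN ie H.
have FN k : F k [set w | c < N k w].
  have := fmeas_set (sF k) (mN k) (measurable_itv `]c, +oo[).
  by congr (F k); apply/seteqP; split => w /=; rewrite in_itv/= andbT.
have key k A : F k A -> A `<=` [set w | c < N k w] -> c * fine (P A) <= \int[P]_(w in A) `|eta w|.
  move=> FA AN; have mA := (sF k).2 _ FA.
  rewrite -Rintegral_cst//.
  apply: le_trans (_ : _ <= \int[P]_(w in A) N k w) _.
    apply: le_Rintegral => //.
    - by apply: PintS => //; apply: (@Pint_bdd _ `|c|).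
    - exact: PintS.
    - by move=> w /AN /ltW.
  rewrite H//; apply: le_trans (ler_norm _) _.
  by apply: le_normr_Rintegral => //; exact: PintS.
elim: n => [|n [FB IH]] /=.
  have -> : [set w | exists2 k, (k <= 0)%N & c < N k w] = [set w | c < N 0%N w].
    by apply/seteqP; split => [w [k]|w ?]; [rewrite leqn0 => /eqP ->|exists 0%N].
  by split; [exact: FN|exact: (key 0%N)].
set B := [set w | exists2 k, (k <= n)%N & c < N k w] in FB IH *.
set B' := [set w | _].
pose A := [set w | c < N n.+1 w] `\` B.
have FA : F n.+1 A by apply: (sigD (sF n.+1).1); [exact: FN|exact: sub].
have B'E : B' = B `|` A.
  apply/seteqP; split => w /=.
    move=> [k]; rewrite leq_eqVlt => /orP[/eqP ->|kn] ck.
      by have [Bw|nBw] := pselect (B w); [left|right].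
    by left; exists k.
  by move=> [[k kn ck]|[ck _]]; [exists k => //; exact: leqW|exists n.+1].
have FB' : F n.+1 B' by rewrite B'E; apply: (sigU (sF n.+1).1) => //; exact: sub.
have mB := (sF n).2 _ FB; have mA := (sF n.+1).2 _ FA; have mB' := (sF n.+1).2 _ FB'.
split => //.
have dBA : [disjoint B & A].
  by rewrite /disj_set; apply/eqP; rewrite /A setDE setIC -setIA setICl setI0.
rewrite B'E Rintegral_setU//; last by rewrite -B'E; apply: PintS => //; exact: Pint_abs.
rewrite measureU//; last exact/eqP.
rewrite fineD ?fin_num_measure// mulrDr; apply: lerD => //.
by apply: (key n.+1) => // w [].
Qed.

End SubSigmaAlgebra.

(** * Martingales with continuous paths and their L^1 limits *)

Section ContinuousVersions.
Context (R : realType) (disp : measure_display) (Omega : measurableType disp).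
Context (P : probability Omega R) (T : R) (F : R -> set (set Omega)).
Hypothesis T0 : 0 < T.
Hypothesis sF : forall t, 0 <= t <= T -> is_sub_sigma (F t).
Hypothesis monoF : forall s t, 0 <= s -> s <= t -> t <= T -> F s `<=` F t.
Hypothesis nullF : forall t N, 0 <= t <= T -> measurable N -> P N = 0%E -> F t N.

Let clT s : 0 <= clamp 0 T s <= T. Proof. exact: clamp_itv (ltW T0). Qed.

(** M is a version of E[xi | F_t] all of whose paths are continuous on [0, T]. Equality of averages
    over events replaces conditional expectations. *)
Definition cmart (xi : Omega -> R) (M : R -> Omega -> R) : Prop :=
  [/\ Pint P xi,
      forall w, continuous (fun t => M (clamp 0 T t) w),
      forall t, 0 <= t <= T -> fmeas (F t) (M t),
      forall t, 0 <= t <= T -> Pint P (M t) &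
      forall t, 0 <= t <= T -> forall A, F t A ->
        \int[P]_(w in A) M t w = \int[P]_(w in A) xi w].

Lemma cmartB xi M xi' M' : cmart xi M -> cmart xi' M' ->
  cmart (fun w => xi w - xi' w) (fun t w => M t w - M' t w).
Proof.
move=> [a1 a2 a3 a4 a5] [b1 b2 b3 b4 b5]; split.
- exact: PintB.
- by move=> w t; apply: cvgB; [exact: a2|exact: b2].
- by move=> t tT; apply: measurable_funB; [exact: a3|exact: b3].
- by move=> t tT; apply: PintB; [exact: a4|exact: b4].
- move=> t tT A FA; have mA := (sF tT).2 _ FA.
  by rewrite !RintegralB ?a5 ?b5//; apply: PintS => //; [exact: a4|exact: b4].
Qed.

Lemma cmart0 : cmart (fun=> 0) (fun _ _ => 0).
Proof.
have i0 : Pint P (fun=> 0).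
  by apply: (@Pint_bdd _ _ _ _ _ 0) => [|w]; [exact: measurable_cst|rewrite normr0].
split => //.
- by move=> w t; exact: cvg_cst.
- by move=> t tT; exact: measurable_cst.
Qed.

Lemma cmartN xi M : cmart xi M -> cmart (fun w => - xi w) (fun t w => - M t w).
Proof.
move=> h; have -> : (fun w => - xi w) = (fun w => 0 - xi w) by apply/funext => w; rewrite sub0r.
have -> : (fun t w => - M t w) = (fun t w => 0 - M t w).
  by apply/funext => t; apply/funext => w; rewrite sub0r.
exact: cmartB cmart0 h.
Qed.

Let grid (m k : nat) : R := clamp 0 T (k%:R * T / 2 ^+ m).

Let gridS m k : grid m.+1 k.*2 = grid m k.
Proof.
rewrite /grid -mul2n natrM exprS -[in RHS](mul1r (2 ^+ m)) invfM.
congr (clamp _ _ _); rewrite -!mulrA; field.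
by apply/lt0r_neq0; rewrite exprn_gt0.
Qed.

Let grid_dense (f : R -> R) c : continuous (fun t => f (clamp 0 T t)) ->
  (forall m k, (k <= 2 ^ m)%N -> f (grid m k) <= c) ->
  forall t, 0 <= t <= T -> f t <= c.
Proof.
move=> cf fc t tT.
(* [a m] is the last dyadic multiple of T before t; it is at distance at most T / 2^m from t. *)
pose k m := Num.truncn (t / T * 2 ^+ m).
pose a m := (k m)%:R * T / 2 ^+ m.
have e0 m : 0 < 2 ^+ m :> R by rewrite exprn_gt0.
have t0 : 0 <= t / T by case/andP: tT => ? ?; rewrite divr_ge0// ltW.
have ax m : t - T / 2 ^+ m <= a m <= t.
  have /andP[h1 h2] : (k m)%:R <= t / T * 2 ^+ m < (k m).+1%:R.
    by apply: truncn_itv; rewrite mulr_ge0// ltW.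
  apply/andP; split.
    rewrite lerBlDr -mulrDl ler_pdivlMr// -[X in _ + X]mul1r -mulrDl -ler_pdivrMr//.
    by rewrite mulrAC (le_trans (ltW h2))// -natr1.
  by rewrite ler_pdivrMr// -ler_pdivlMr// mulrAC.
have acvg : a @ \oo --> t.
  apply: (@squeeze_cvgr _ _ _ _ (fun m => t - T / 2 ^+ m) (fun=> t)).
  - by near=> m; exact: ax.
  - rewrite -[X in _ --> X]subr0; apply: cvgB; first exact: cvg_cst.
    under eq_fun do rewrite -exprVn.
    exact: cvg_half0.
  - exact: cvg_cst.
have fa := cvg_comp _ _ acvg (cf t).
rewrite -(clamp_id tT).
apply: (ler_cvg_to fa (cvg_cst c)); near=> m.
apply: fc.
rewrite -(ler_nat R) natrX; have /andP[h1 _] : (k m)%:R <= t / T * 2 ^+ m < (k m).+1%:R.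
  by apply: truncn_itv; rewrite mulr_ge0// ltW.
apply: le_trans h1 _; rewrite -[leRHS]mul1r ler_pM2r// ler_pdivrMr// mul1r.
by case/andP: tT.
Unshelve. all: by end_near. Qed.

(** The discrete inequality is applied on each dyadic grid. The grids are nested, so the exceptional
    events increase and their probability passes to the limit; continuity extends the bound from
    dyadic times to all times. *)
Lemma cmart_sup1 xi M (c : R) : cmart xi M -> 0 < c -> exists B, [/\ measurable B,
  (P B <= (c^-1 * \int[P]_w `|xi w|)%:E)%E &
  forall w, ~ B w -> forall t, 0 <= t <= T -> M t w <= c].
Proof.
move=> [a1 a2 a3 a4 a5] c0.
pose B m := [set w | exists2 k, (k <= 2 ^ m)%N & c < M (grid m k) w].
have D m : F (grid m (2 ^ m)) (B m) /\ c * fine (P (B m)) <= \int[P]_(w in B m) `|xi w|.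
  apply: (@doob _ _ _ P (fun k => F (grid m k)) (fun k => M (grid m k))) => //.
  - by move=> k; apply: sF; exact: clT.
  - move=> k; apply: monoF.
    + by case/andP: (clT (k%:R * T / 2 ^+ m)).
    + rewrite /grid /clamp le_max2// le_min2// ler_pM2r ?invr_gt0 ?exprn_gt0// ler_pM2r// ler_nat.
      exact: leqnSn.
    + by case/andP: (clT (k.+1%:R * T / 2 ^+ m)).
  - by move=> k; apply: a3; exact: clT.
  - by move=> k; apply: a4; exact: clT.
  - by move=> k A; apply: a5; exact: clT.
have mB m : measurable (B m) by apply: (sF (clT _)).2; exact: (D m).1.
exists (\bigcup_m B m); split; first exact: bigcupT_measurable.
- have ndB : nondecreasing_seq B.
    apply/nondecreasing_seqP => m; apply/subsetPset => w [k km ck].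
    by exists k.*2; rewrite ?gridS// expnS mul2n leq_double.
  have := nondecreasing_cvg_mu (mu := P) mB (bigcupT_measurable _ mB) ndB.
  move=> Bc; rewrite -(cvg_lim _ Bc)//; apply: lime_le; first by apply/cvg_ex; eexists; exact: Bc.
  near=> m => /=.
  rewrite -(fineK (fin_num_measure P _ (mB m))) lee_fin ler_pdivlMl//.
  apply: le_trans (D m).2 _.
  rewrite (Rint_split measurableT (mB m) (Pint_abs a1)) setTI lerDl.
  by apply: Rintegral_ge0.
- move=> w nB; apply: grid_dense (a2 w) _ => m k km.
  by rewrite leNgt; apply/negP => ck; apply: nB; exists m => //; exists k.
Unshelve. all: by end_near. Qed.

Lemma cmart_sup xi M (c : R) : cmart xi M -> 0 < c -> exists B, [/\ measurable B,
  (P B <= (2 * c^-1 * \int[P]_w `|xi w|)%:E)%E &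
  forall w, ~ B w -> forall t, 0 <= t <= T -> `|M t w| <= c].
Proof.
move=> h c0; have [B1 [m1 p1 q1]] := cmart_sup1 h c0.
have [B2 [m2 p2 q2]] := cmart_sup1 (cmartN h) c0.
exists (B1 `|` B2); split; first exact: measurableU.
  apply: (le_trans (measureU2 _ m1 m2)).
  have -> : 2 * c^-1 * \int[P]_w `|xi w| = c^-1 * \int[P]_w `|xi w| + c^-1 * \int[P]_w `|xi w| by ring.
  rewrite EFinD leeD//.
  by apply: le_trans p2 _; under eq_Rintegral do rewrite normrN.
move=> w /not_orP[n1 n2] t tT; rewrite ler_norml q1// andbT.
by rewrite lerNl; exact: q2.
Qed.

Lemma geom_cvg (u : nat -> R) n0 :
  (forall n, (n0 <= n)%N -> `|u n.+1 - u n| <= 2^-1 ^+ n) ->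
  cvgn u /\ forall n, (n0 <= n)%N -> `|limn u - u n| <= 2 * 2^-1 ^+ n.
Proof.
move=> H.
have tail n k : (n0 <= n)%N -> `|u (n + k)%N - u n| <= 2 * 2^-1 ^+ n - 2 * 2^-1 ^+ (n + k).
  move=> n0n; elim: k => [|k IH]; first by rewrite addn0 !subrr normr0.
  rewrite addnS; have := H (n + k)%N (leq_trans n0n (leq_addr _ _)) => h.
  rewrite (le_trans (ler_distD (u (n + k)%N) _ _))//.
  apply: le_trans (lerD h IH) _; rewrite exprS.
  by rewrite le_eqVlt; apply/orP; left; apply/eqP; field.
have half0 : (fun n => 2 * 2^-1 ^+ n : R) @ \oo --> 0.
  exact: cvg_half0.
have cu : cvgn u.
  apply: cauchy_cvg; apply/cauchy_exP => e e0.
  have /cvgrPdist_lt/(_ e e0)[m _ hm] := half0.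
  pose n := maxn m n0.
  exists (u n); exists n => // k /= nk.
  rewrite /ball/= distrC -(subnKC nk).
  apply: le_lt_trans (tail _ _ (leq_maxr _ _)) _.
  have := hm n (leq_maxl _ _); rewrite /= sub0r normrN.
  apply: le_lt_trans; apply: le_trans (ler_norm _).
  by rewrite gerBl mulr_ge0// exprn_ge0// invr_ge0.
split => // n nn0.
have h : (fun k => `|u (k + n)%N - u n|) @ \oo --> `|limn u - u n|.
  apply: cvg_norm; apply: cvgB; last exact: cvg_cst.
  by rewrite (cvg_shiftn n (fun k => u k)).
apply: (ler_cvg_to h (cvg_cst _)); near=> k.
rewrite addnC; apply: le_trans (tail _ _ nn0) _.
by rewrite gerBl mulr_ge0// exprn_ge0// invr_ge0.
Unshelve. all: by end_near. Qed.

Definition hasM (xi : Omega -> R) := exists M, cmart xi M.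

(** Take approximants at L^1 distance 4^-n. Consecutive martingales then differ by more than 2^-n
    somewhere on [0, T] only with probability at most 8 / 2^(n+1), which is summable, so by
    Borel-Cantelli they converge uniformly in time off a null set. *)
Lemma hasM_L1 (xi : Omega -> R) : Pint P xi ->
  (forall e, 0 < e -> exists2 xi', hasM xi' & \int[P]_w `|xi w - xi' w| <= e) ->
  hasM xi.
Proof.
move=> ixi H.
have e0 n : 0 < 4^-1 ^+ n :> R by rewrite exprn_gt0// invr_gt0.
have /choice[z Hz] : forall n, exists z : (Omega -> R) * (R -> Omega -> R),
    cmart z.1 z.2 /\ \int[P]_w `|xi w - z.1 w| <= 4^-1 ^+ n.
  by move=> n; have [xi' [M hM] hxi] := H _ (e0 n); exists (xi', M).
pose X n := (z n).1; pose M n := (z n).2.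
have cM n : cmart (X n) (M n) := (Hz n).1.
have iX n : Pint P (X n) by have [] := cM n.
have dX n m : \int[P]_w `|X n w - X m w| <= 4^-1 ^+ n + 4^-1 ^+ m.
  apply: le_trans (lerD (Hz n).2 (Hz m).2).
  have i1 k : Pint P (fun w => `|xi w - X k w|) by apply: Pint_abs; exact: PintB.
  rewrite -RintegralD//; [|exact: i1..].
  apply: le_Rintegral => //; [apply: Pint_abs; exact: PintB|exact: (PintD (i1 n) (i1 m))|].
  by move=> w _; rewrite (distrC (xi w)); exact: ler_distD.
have /choice[B HB] : forall n, exists B : set Omega, [/\ measurable B,
    (P B <= (8 / (2 ^ n.+1)%:R)%:E)%E &
    forall w, ~ B w -> forall t, 0 <= t <= T -> `|M n.+1 t w - M n t w| <= 2^-1 ^+ n].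
  move=> n.
  have h0 : 0 < 2^-1 ^+ n :> R by rewrite exprn_gt0// invr_gt0.
  have [B [mB PB MB]] := cmart_sup (cmartB (cM n.+1) (cM n)) h0.
  exists B; split => //; apply: le_trans PB _; rewrite lee_fin.
  rewrite exprVn invrK natrX.
  have : \int[P]_w `|X n.+1 w - X n w| <= 2 * 4^-1 ^+ n.
    apply: le_trans (dX _ _) _; rewrite mulr2n mulrDl mul1r lerD2r.
    by rewrite exprS ler_piMl ?(ltW (e0 n))// invf_le1// ler1n.
  move=> /(ler_wpM2l (_ : 0 <= 2 * 2 ^+ n)) => /(_ _); rewrite mulr_ge0 ?exprn_ge0// => /(_ isT).
  move=> /le_trans; apply.
  rewrite (_ : 4 = 2 * 2)// ?exprVn ?exprMn ?exprS; last by rewrite -natrM.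
  have h2 : 2 ^+ n != 0 :> R by apply/lt0r_neq0; rewrite exprn_gt0.
  rewrite le_eqVlt; apply/orP; left; apply/eqP; field; exact: h2.
pose N := lim_sup_set B.
have mN : measurable N.
  by apply: bigcapT_measurable => n; apply: bigcup_measurable => k _; have [] := HB k.
have PN : P N = 0%E.
  apply: lim_sup_set_cvg0 => [n|]; first by have [] := HB n.
  apply: le_lt_trans (ltry 8); apply: le_trans (epsilon_trick0 xpredT (ler0n _ 8)).
  apply: lee_nneseries => [n *|n *]; first exact: measure_ge0.
  by have [] := HB n.
have Nw w : ~ N w -> exists n0, forall n, (n0 <= n)%N -> forall t, 0 <= t <= T ->
    `|M n.+1 t w - M n t w| <= 2^-1 ^+ n.
  move=> nNw.
  have [n0 hn0] : exists n0, forall n, (n0 <= n)%N -> ~ B n w.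
    apply: contrapT => hn; apply: nNw => n _ /=.
    have /existsNP[k] : ~ (forall k, (n <= k)%N -> ~ B k w) by move=> h; apply: hn; exists n.
    by move=> /not_implyP[nk /contrapT Bk]; exists k.
  by exists n0 => n /hn0 nB t tT; have [_ _] := HB n; exact.
(* On the null set N the limit and the approximants are put equal to 0. N belongs to every F t, so
   adaptedness survives. *)
pose L t w := if `[< N w >] then 0 else limn (fun n => M n t w).
pose M' n t w := if `[< N w >] then 0 else M n t w.
have M'L t w : 0 <= t <= T -> (fun n => M' n t w) @ \oo --> L t w.
  move=> tT; rewrite /M' /L; case: asboolP => [_|/Nw[n0 h]]; first exact: cvg_cst.
  by have [] := @geom_cvg (fun n => M n t w) n0 (fun n hn => h n hn t tT).
have mM' n t : 0 <= t <= T -> fmeas (F t) (M' n t).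
  move=> tT; have [_ _ a3 _ _] := cM n.
  have FN : F t N by exact: nullF.
  rewrite (_ : M' n t = fun w => M n t w * \1_(~` N) w).
    apply: measurable_funM; first exact: a3.
    apply: (@measurable_indic _ (g_sigma_algebraType (F t))).
    by apply: sub_sigma_algebra; apply: (sigC (sF tT).1).
  apply/funext => w; rewrite /M' indicE; case: asboolP => nw.
    by rewrite memNset ?mulr0//= => /(_ nw).
  by rewrite mem_set// mulr1.
have mL t : 0 <= t <= T -> fmeas (F t) (L t).
  move=> tT; apply: (@measurable_fun_cvg _ (g_sigma_algebraType (F t)) R setT (fun n => M' n t) (L t)).
    by move=> n; exact: mM'.
  by move=> w _; exact: M'L.
have M'E n t : {ae P, forall w, M' n t w = M n t w}.
  by exists N; split => // w /=; rewrite /M'; case: asboolP.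
have mMM n t : 0 <= t <= T -> measurable_fun setT (M n t).
  by move=> tT; have [_ _ _ a4 _] := cM n; exact: Pint_measurable (a4 t tT).
have mM'm n t : 0 <= t <= T -> measurable_fun setT (M' n t).
  by move=> tT; exact: fmeasW (sF tT).2 (mM' n t tT).
have mLm t : 0 <= t <= T -> measurable_fun setT (L t).
  by move=> tT; exact: fmeasW (sF tT).2 (mL t tT).
(* Fatou's lemma in m, the differences of approximants being controlled by the L^1 contraction. *)
have LM n t : 0 <= t <= T -> (\int[P]_w `|L t w - M n t w|%:E <= (2 * 4^-1 ^+ n)%:E)%E.
  move=> tT.
  have -> : (\int[P]_w `|L t w - M n t w|%:E =
            \int[P]_w limn_einf (fun m => `|M' m t w - M' n t w|%:E))%E.
    apply: integral_ae; exists N; split => // w /=; apply: contra_notP => nNw _.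
    have -> : L t w - M n t w = L t w - M' n t w by rewrite /M'; case: asboolP.
    apply/esym; apply: (cvg_limn_einf_sup _).1.
    apply: cvg_EFin; first exact: nearW.
    by apply: cvg_norm; apply: cvgB; [exact: M'L|exact: cvg_cst].
  apply: le_trans (fatou _ _ _ _) _ => //.
    by move=> m; apply/measurable_EFinP; apply: measurableT_comp => //; apply: measurable_funB; exact: mM'm.
  apply: limn_einf_le; exists n => // m /= nm.
  have -> : (\int[P]_w `|M' m t w - M' n t w|%:E = \int[P]_w `|M m t w - M n t w|%:E)%E.
    by apply: integral_ae; exists N; split => // w /=; rewrite /M'; case: asboolP.
  have [b1 b2 b3 b4 b5] := cmartB (cM n) (cM m).
  under eq_integral do rewrite distrC.
  rewrite -[leLHS]fineK; last by apply: integrable_fin_num => //; exact: Pint_abs (b4 t tT).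
  rewrite lee_fin; apply: (@le_trans _ _ (4^-1 ^+ n + 4^-1 ^+ m)); last first.
    by rewrite mulrDl mul1r lerD2l -(subnKC nm) exprD ler_piMr ?(ltW (e0 _))// exprn_ile1 ?invr_ge0// invf_le1 ?ler1n.
  apply: le_trans (dX n m).
  by apply: (condexp_le (sF tT)) => //; [exact: b3|exact: b4|move=> A FA; exact: b5].
have iLM n t : 0 <= t <= T -> Pint P (fun w => L t w - M n t w).
  move=> tT; apply/integrableP; split.
    by apply/measurable_EFinP; apply: measurable_funB; [exact: mLm|exact: mMM].
  by apply: le_lt_trans (ltry (2 * 4^-1 ^+ n)); exact: LM.
have iL t : 0 <= t <= T -> Pint P (L t).
  move=> tT; rewrite (_ : L t = fun w => (L t w - M 0%N t w) + M 0%N t w).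
    by apply: PintD; [exact: iLM|have [_ _ _ a4 _] := cM 0%N; exact: a4].
  by apply/funext => w; rewrite subrK.
exists L; split => //.
- move=> w; rewrite /L; case: asboolP => [_|/Nw[n0 h]] t; first exact: cvg_cst.
  have G s := @geom_cvg (fun n => M n (clamp 0 T s) w) n0 (fun n hn => h n hn _ (clT s)).
  apply/cvgrPdist_le => e ee0.
  have /cvgrPdist_lt/(_ (e / 3) (divr_gt0 ee0 (ltr0n _ 3)))[m _ hm] := @cvg_half0 R 2.
  pose n := maxn m n0.
  have hn : 2 * 2^-1 ^+ n <= e / 3.
    have := hm n (leq_maxl _ _); rewrite /= sub0r normrN => /ltW; apply: le_trans.
    exact: ler_norm.
  have [_ a2 _ _ _] := cM n.
  have /cvgrPdist_le /(_ _ (divr_gt0 ee0 (ltr0n _ 3))) := a2 w t.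
  apply: filterS => s hs.
  have g1 := le_trans ((G t).2 n (leq_maxr _ _)) hn.
  have g2 := le_trans ((G s).2 n (leq_maxr _ _)) hn.
  rewrite (le_trans (ler_distD (M n (clamp 0 T t) w) _ _))//.
  have := ler_distD (M n (clamp 0 T s) w) (M n (clamp 0 T t) w) (limn (fun n => M n (clamp 0 T s) w)).
  rewrite (distrC (M n (clamp 0 T s) w) (limn _)).
  by move=> ?; lra.
- move=> t tT A FA; have mA := (sF tT).2 _ FA.
  apply/eqP; rewrite -subr_eq0 -normr_eq0 eq_le normr_ge0 andbT.
  apply/ler_addgt0Pr => e ee0; rewrite add0r.
  have q1 : `|4^-1| < 1 :> R by rewrite ger0_norm ?invr_ge0// invf_lt1// ltr1n.
  have /cvgrPdist_lt/(_ e ee0)[m _ hm] := @cvg_geometric R 3 4^-1 q1.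
  have := hm m (leqnn _); rewrite /= sub0r normrN => /ltW /(le_trans (ler_norm _)); apply: le_trans.
  have [a1 a2 a3 a4 a5] := cM m.
  have ib : forall f, Pint P f -> `|\int[P]_(w in A) f w| <= \int[P]_w `|f w|.
    move=> f fi; apply: le_trans (le_normr_Rintegral mA (PintS mA fi)) _.
    rewrite (Rint_split measurableT mA (Pint_abs fi)) setTI lerDl.
    exact: Rintegral_ge0.
  have -> : \int[P]_(w in A) L t w - \int[P]_(w in A) xi w =
    \int[P]_(w in A) (L t w - M m t w) - \int[P]_(w in A) (xi w - X m w).
    rewrite (RintegralB mA (PintS mA (iL _ tT)) (PintS mA (a4 _ tT))).
    by rewrite (RintegralB mA (PintS mA ixi) (PintS mA (iX m))) a5//; ring.
  apply: le_trans (ler_normB _ _) _.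
  have -> : 3 * 4^-1 ^+ m = 2 * 4^-1 ^+ m + 4^-1 ^+ m :> R by ring.
  apply: lerD.
    apply: le_trans (ib _ (iLM m t tT)) _.
    rewrite -lee_fin fineK; first exact: LM.
    by apply: integrable_fin_num => //; exact: Pint_abs (iLM m t tT).
  by apply: le_trans (ib _ (PintB ixi (iX m))) _; exact: (Hz m).2.
Qed.

End ContinuousVersions.

(** * Brownian increments are independent of the augmented past *)

Section ProbabilityAe.
Context (R : realType) (disp : measure_display) (Omega : measurableType disp).
Context (P : probability Omega R).

Lemma measure_ae_eq (A B : set Omega) : measurable A -> measurable B ->
  {ae P, forall w, A w <-> B w} -> P A = P B.
Proof.
move=> mA mB AB; rewrite -[A]setIT -[B]setIT -!integral_indic//.
apply: integral_ae; apply: filterS AB => w AB _.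
by rewrite !indicE; congr (_%:R%:E); congr nat_of_bool; apply/idP/idP; rewrite !inE => /AB.
Qed.

Lemma indep_lambda Y : measurable Y ->
  lambda_system setT [set A | measurable A /\ P (A `&` Y) = (P A * P Y)%E].
Proof.
move=> mY; split => //.
- by split => //; rewrite setTI probability_setT mul1e.
- move=> A B BA [mA hA] [mB hB]; split; first exact: measurableD.
  have fP C : measurable C -> P C \is a fin_num by move=> ?; exact: fin_num_measure.
  have lP C : measurable C -> (P C < +oo)%E by move=> ?; rewrite ltey_eq fP.
  have mAY : measurable (A `&` Y) by exact: measurableI.
  have mBY : measurable (B `&` Y) by exact: measurableI.
  rewrite (_ : (A `\` B) `&` Y = (A `&` Y) `\` (B `&` Y)); last first.
    apply/seteqP; split => w /=; first by move=> [[? nB] ?]; split => // -[].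
    by move=> [[? ?] nB]; split => //; split => // ?; apply: nB.
  rewrite (measureD mAY mBY (lP _ mAY)) (measureD mA mB (lP _ mA)).
  have BYA : B `&` Y `<=` A `&` Y by move=> w [/BA Aw Yw]; split.
  rewrite (setIidr BYA) (setIidr BA).
  change (P (A `&` Y) - P (B `&` Y) = (P A - P B) * P Y)%E.
  rewrite hA hB muleBl ?fP//.
  by rewrite fin_num_adde_defr// fP.
- move=> A ndA hA; have mA n : measurable (A n) := (hA n).1.
  have mU : measurable (\bigcup_n A n) by exact: bigcupT_measurable.
  split => //; rewrite setI_bigcupl.
  have c1 : (P \o (fun n => A n `&` Y)) @ \oo --> P (\bigcup_n (A n `&` Y)).
    apply: nondecreasing_cvg_mu.
    - by move=> n; exact: measurableI.
    - by apply: bigcupT_measurable => n; exact: measurableI.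
    - by move=> m n mn; apply/subsetPset; apply: setSI; apply/subsetPset; exact: ndA.
  have c2 : (P \o (fun n => A n `&` Y)) @ \oo --> (P (\bigcup_n A n) * P Y)%E.
    rewrite (_ : _ \o _ = fun n => P (A n) * P Y)%E; last by apply/funext => n; exact: (hA n).2.
    apply: cvgeZr; first exact: fin_num_measure.
    exact: nondecreasing_cvg_mu.
  exact: (cvg_unique _ c1 c2).
Qed.

(** Measurability of the events is carried along in the conclusion because G generates a
    sigma-algebra that is not assumed to be contained in the ambient one. *)
Lemma indep_generated (G : set (set Omega)) Y : measurable Y -> setI_closed G ->
  (forall A, G A -> measurable A /\ P (A `&` Y) = (P A * P Y)%E) ->
  forall A, <<s G >> A -> measurable A /\ P (A `&` Y) = (P A * P Y)%E.
Proof.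
by move=> mY GI GH; apply: (lambda_system_subset GI (indep_lambda mY)) => // A GA.
Qed.

End ProbabilityAe.

Section BrownianFiltration.
Context (R : realType) (disp : measure_display) (Omega : measurableType disp).
Context (P : probability Omega R) (T : R) (d : nat) (W : R -> Omega -> 'rV[R]_d).
Hypothesis Wien : wiener P T W.
Local Notation F := (augmented_filtration P W).

Lemma aug_sigma t : sigma_algebra setT (F t).
Proof. exact: smallest_sigma_algebra. Qed.

Let mW t i : 0 <= t <= T -> measurable_fun setT (fun w => W t w 0 i).
Proof. by case: Wien => mW _ _ _; exact: mW. Qed.

Lemma aug_sub t : t <= T -> F t `<=` measurable.
Proof.
move=> tT; apply: smallest_sub; first exact: sigma_algebra_measurable.
move=> A [[s [i [B [/andP[s0 st] mB ->]]]]|[]//].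
have := @mW s i; rewrite s0 (le_trans st tT) => /(_ isT) m.
by have := m measurableT B mB; rewrite setTI.
Qed.

Lemma aug_sub_sigma t : t <= T -> is_sub_sigma (F t).
Proof. by move=> tT; split; [exact: aug_sigma|exact: aug_sub]. Qed.

Lemma aug_mono s t : s <= t -> F s `<=` F t.
Proof.
move=> st; apply: sub_sigma_algebra2 => A [[r [i [B [/andP[r0 rs] mB ->]]]]|hA]; [left|by right].
by exists r, i, B; split => //; rewrite r0 (le_trans rs st).
Qed.

Lemma aug_null t N : measurable N -> P N = 0%E -> F t N.
Proof. by move=> mN PN; apply: sub_sigma_algebra; right. Qed.

Lemma aug_W s t i : 0 <= s <= t -> fmeas (F t) (fun w => W s w 0 i).
Proof.
move=> st; apply/(fmeasP _ (aug_sigma t)) => B mB; apply: sub_sigma_algebra; left.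
by exists s, i, B.
Qed.

(* Up to null sets, the finite intersections of the events {W^i_r < a}, r <= t. *)
Definition cylinder (t : R) : set (set Omega) := [set A | measurable A /\
  exists l : seq (R * 'I_d * R), (forall x, x \in l -> 0 <= x.1.1 <= t) /\
   {ae P, forall w, A w <-> forall x, x \in l -> W x.1.1 w 0 x.1.2 < x.2}].

Lemma cylinderI t : setI_closed (cylinder t).
Proof.
move=> A B [mA [l [hl Al]]] [mB [k [hk Bk]]]; split; first exact: measurableI.
exists (l ++ k); split.
  by move=> x; rewrite mem_cat => /orP[/hl|/hk].
apply: filterS2 Al Bk => w [Aw1 Aw2] [Bw1 Bw2].
split => [[Aw Bw] x|h].
  by rewrite mem_cat => /orP[xl|xk]; [exact: Aw1|exact: Bw1].
by split; [apply: Aw2 => x xl|apply: Bw2 => x xk]; apply: h; rewrite mem_cat ?xl ?xk ?orbT.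
Qed.

(** A generator W^i_s in B is reached from half-lines. A null set is the complement of an almost
    sure event, and such an event is a cylinder with the empty list of constraints. *)
Lemma aug_cylinder t : t <= T -> F t `<=` <<s cylinder t >>.
Proof.
move=> tT; apply: smallest_sub; first exact: smallest_sigma_algebra.
move=> A [[s [i [B [st mB ->]]]]|[mA PA]].
- have sT : 0 <= s <= T by case/andP: st => -> /le_trans ->.
  have : measurable_fun (T := g_sigma_algebraType (cylinder t)) setT (fun w => W s w 0 i).
    apply: (measurability _ (RGenInftyO.measurableE R)) => _ [_ [a ->] <-].
    rewrite setTI; apply: sub_sigma_algebra; split.
      by have := mW i sT measurableT (measurable_itv `]-oo, a[); rewrite setTI.
    exists [:: (s, i, a)]; split; first by move=> x; rewrite inE => /eqP ->.
    apply: aeW => w /=; rewrite in_itv/=; split => [h x|].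
      by rewrite inE => /eqP ->.
    by move=> /(_ (s, i, a)); apply; rewrite inE.
  by move=> /(_ measurableT B mB); rewrite setTI.
- rewrite -(setCK A); apply: (sigC (smallest_sigma_algebra _ _)).
  apply: sub_sigma_algebra; split; first exact: measurableC.
  exists [::]; split => //.
  by exists A; split => // w /=; apply: contra_notP => nA; split.
Qed.

Section Increments.
Variables (s t : R).
Hypotheses (s0 : 0 <= s) (st : s < t) (tT : t <= T).

Definition increments : set (set Omega) := [set E | exists2 B : 'I_d -> set R,
  (forall i, measurable (B i)) &
  E = [set w | forall i, B i (W t w 0 i - W s w 0 i)]].

Let m_increment (r q : R) (B : 'I_d -> set R) : 0 <= r <= T -> 0 <= q <= T ->
  (forall i, measurable (B i)) -> measurable [set w | forall i, B i (W q w 0 i - W r w 0 i)].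
Proof.
move=> rT qT mB.
have -> : [set w | forall i, B i (W q w 0 i - W r w 0 i)] =
    \bigcap_(i in [set: 'I_d]) [set w | B i (W q w 0 i - W r w 0 i)].
  by apply/seteqP; split => w /= h i; [move=> _|]; exact: h.
apply: fin_bigcap_measurable => // i _.
have := @measurable_funB _ _ _ _ _ _ (mW i qT) (mW i rT) measurableT _ (mB i).
by rewrite setTI.
Qed.

Let sT : 0 <= s <= T. Proof. by rewrite s0 (le_trans (ltW st)). Qed.

Let t0T : 0 <= t <= T. Proof. by rewrite tT (le_trans s0 (ltW st)). Qed.

Lemma increment_eventsI : setI_closed increments.
Proof.
move=> _ _ [B mB ->] [C mC ->]; exists (fun i => B i `&` C i).
  by move=> i; exact: measurableI.
apply/seteqP; split => [w [h1 h2] i|w h]; first by split; [exact: h1|exact: h2].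
by split => i; have [] := h i.
Qed.

(** Only the product form of the joint law matters below, so the normal laws are hidden behind an
    abstract [np]. *)
Let law_increments : exists np : R -> R -> ('I_d -> set R) -> \bar R,
  forall (n : nat) (r : nat -> R),
    0 <= r 0%N -> r n <= T -> (forall k, (k < n)%N -> r k < r k.+1) ->
    forall B : 'I_n -> 'I_d -> set R, (forall k i, measurable (B k i)) ->
    P [set w | forall k i, B k i (W (r k.+1) w 0 i - W (r k) w 0 i)] =
    (\prod_(k < n) np (r k) (r k.+1) (B k))%E.
Proof.
exists (fun a b B => \prod_(i < d) normal_prob 0 (Num.sqrt (b - a)) (B i))%E.
by case: Wien.
Qed.

(** The times of the cylinder are completed into a subdivision of [0, s]. Rectangles of increments
    along it are independent of the increment from s to t by the product law on the subdivision
    extended by t, and the cylinder is generated by such rectangles. *)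
Let indep_cylinder A (B : 'I_d -> set R) : cylinder s A -> (forall i, measurable (B i)) ->
  let E := [set w | forall i, B i (W t w 0 i - W s w 0 i)] in
  P (A `&` E) = (P A * P E)%E.
Proof.
have [np law] := law_increments.
have law_single (B' : 'I_d -> set R) : (forall i, measurable (B' i)) ->
  P [set w | forall i, B' i (W t w 0 i - W s w 0 i)] = np s t B'.
  move=> mB.
have := law 1%N (fun k => if k is 0%N then s else t) s0 tT.
have h0 : forall k, (k < 1)%N -> (if k is 0%N then s else t) < t by case.
move=> /(_ h0 (fun _ => B')) /(_ (fun _ => mB)).
rewrite big_ord_recl big_ord0 mule1 /= => <-.
congr (P _); apply/seteqP; split => w /=; first by move=> h k i; rewrite (ord1 k).
by move=> h i; exact: (h ord0).
move=> [mA [l [hl Al]]] mB E.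
(* The times 0 and s are added to those of the cylinder, so that the subdivision starts at 0 and
   ends at s. *)
pose tau := sort <=%O (undup (0 :: s :: map (fun x => x.1.1) l)).
pose m := (size tau).-1.
have taum : size tau = m.+1.
  rewrite /m prednK// size_sort.
  by have : 0 \in undup (0 :: s :: map (fun x => x.1.1) l); [rewrite mem_undup mem_head|case: undup].
have tau_mem r : (r \in tau) = (r \in (0 :: s :: map (fun x => x.1.1) l)).
  by rewrite mem_sort mem_undup.
have tau_bd r : r \in tau -> 0 <= r <= s.
  rewrite tau_mem !inE => /or3P[/eqP ->|/eqP ->|]; rewrite ?lexx ?s0//.
  by move=> /mapP[x /hl + ->].
have tau_sorted : sorted <%O tau by rewrite sort_lt_sorted undup_uniq.
have tau_lt i j : (i < size tau)%N -> (j < size tau)%N -> (nth 0 tau i < nth 0 tau j) = (i < j)%N.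
  by move=> hi hj; rewrite (lt_sorted_ltn_nth 0 tau_sorted).
have nth0tau : nth 0 tau 0 = 0.
  have h0 : 0 \in tau by rewrite tau_mem mem_head.
  apply/eqP; rewrite eq_le; apply/andP; split; last first.
    by have /tau_bd/andP[] : nth 0 tau 0 \in tau by apply: mem_nth; rewrite taum.
  rewrite -{2}(nth_index 0 h0) leNgt tau_lt ?taum ?index_mem// -?taum ?index_mem//.
have nthmtau : nth 0 tau m = s.
  have hs : s \in tau by rewrite tau_mem !inE eqxx orbT.
  apply/eqP; rewrite eq_le; apply/andP; split.
    by have /tau_bd/andP[] : nth 0 tau m \in tau by apply: mem_nth; rewrite taum.
  rewrite -{1}(nth_index 0 hs) leNgt tau_lt ?taum ?index_mem// -?taum ?index_mem//.
  by rewrite -ltnNge index_mem.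
(* [tt m] is s, and the default value makes [tt m.+1] equal to t: the same sequence serves for the
   subdivisions with m and with m+1 steps. *)
pose tt k := if (k < size tau)%N then nth 0 tau k else t.
have tt_tau k : (k <= m)%N -> tt k = nth 0 tau k by move=> km; rewrite /tt taum ltnS km.
have ttS k : (k <= m)%N -> tt k < tt k.+1.
  move=> km; rewrite tt_tau//; rewrite /tt taum ltnS.
  case: ltnP => hk; first by rewrite tau_lt ?taum// ltnS.
  by apply: le_lt_trans st; have /tau_bd/andP[] : nth 0 tau k \in tau by apply: mem_nth; rewrite taum.
have tt_bd k : (k <= m)%N -> 0 <= tt k <= s.
  by move=> km; rewrite tt_tau//; apply: tau_bd; apply: mem_nth; rewrite taum.
have ttT k : (k <= m)%N -> 0 <= tt k <= T.
  by move=> /tt_bd/andP[-> /le_trans h]; apply: h; case/andP: sT.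
pose rect (C : nat -> 'I_d -> set R) :=
  [set w | forall k, (k < m)%N -> forall i, C k i (W (tt k.+1) w 0 i - W (tt k) w 0 i)].
pose G := [set A | exists2 C : nat -> 'I_d -> set R, (forall k i, measurable (C k i)) & A = rect C].
have law_rect C : (forall k i, measurable (C k i)) ->
   P (rect C) = (\prod_(k < m) np (tt k) (tt k.+1) (C k))%E.
  move=> mC.
  have := law m tt; rewrite !tt_tau// nth0tau nthmtau lexx => /(_ isT).
  move=> /(_ (le_trans (ltW st) tT)) /(_ (fun k km => ttS k (ltnW km))).
  move=> /(_ (fun k => C k)) /(_ (fun k => mC k)) <-.
  congr (P _); apply/seteqP; split => w /=; first by move=> h k i; exact: h.
  by move=> h k km i; exact: (h (Ordinal km)).
have law_rectE C : (forall k i, measurable (C k i)) -> P (rect C `&` E) = (P (rect C) * P E)%E.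
  move=> mC; rewrite law_rect// /E law_single//.
  (* The constraint B on the increment from s to t becomes the last factor of the product law. *)
  pose C' k := if (k < m)%N then C k else B.
  have mC' k i : measurable (C' k i) by rewrite /C'; case: ifP.
  have ttm1 : tt m.+1 = t by rewrite /tt taum ltnn.
  have := law m.+1 tt; rewrite tt_tau// nth0tau ttm1 lexx => /(_ isT tT (fun k => ttS k)).
  move=> /(_ (fun k => C' k)) /(_ (fun k => mC' k)).
  rewrite big_ord_recr/= ttm1 (tt_tau m)// nthmtau.
  have -> : C' m = B by rewrite /C' ltnn.
  have C'k (k : 'I_m) : C' k = C k by rewrite /C' ltn_ord.
  under eq_bigr do rewrite C'k.
  move=> <-; congr (P _); apply/seteqP; split => w /=.
    move=> [h1 h2] k i; rewrite /C'; case: ifP => km; first exact: h1.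
    have -> : nat_of_ord k = m by apply/eqP; rewrite eqn_leq -ltnS ltn_ord leqNgt km.
    by rewrite ttm1 tt_tau// nthmtau.
  move=> h; split => [k km i|i].
    by have := h (widen_ord (leqnSn m) (Ordinal km)) i; rewrite /C'/= km.
  by have := h ord_max i; rewrite /C'/= ltnn ttm1 tt_tau// nthmtau.
have mrect C : (forall k i, measurable (C k i)) -> measurable (rect C).
  move=> mC.
  have -> : rect C = \bigcap_(k in `I_m) [set w | forall i, C k i (W (tt k.+1) w 0 i - W (tt k) w 0 i)].
    by apply/seteqP; split => w.
  apply: bigcap_measurableType => k /= km; apply: m_increment => //; apply: ttT => //.
  exact: ltnW.
have mE : measurable E by exact: m_increment.
have GI : setI_closed G.
  move=> _ _ [C mC ->] [D mD ->]; exists (fun k i => C k i `&` D k i).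
    by move=> k i; exact: measurableI.
  apply/seteqP; split => [w [h1 h2] k km i|w h]; first by split; [exact: h1|exact: h2].
  by split => k km i; have [] := h k km i.
have indG := @indep_generated _ _ _ P G E mE GI.
have {}indG A' : <<s G >> A' -> measurable A' /\ P (A' `&` E) = (P A' * P E)%E.
  by apply: indG => _ [C mC ->]; split; [exact: mrect|exact: law_rectE].
have mincr k i : (k < m)%N -> fmeas <<s G >> (fun w => W (tt k.+1) w 0 i - W (tt k) w 0 i).
  move=> km; apply/(fmeasP _ (smallest_sigma_algebra _ _)) => D mD.
  apply: sub_sigma_algebra; exists (fun k' i' => if (k' == k) && (i' == i) then D else setT).
    by move=> k' i'; case: ifP.
  apply/seteqP; split => w /=.
    by move=> h k' _ i'; case: ifP => // /andP[/eqP -> /eqP ->].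
  by move=> /(_ k km i); rewrite !eqxx.
have mW0 j i : (j <= m)%N -> fmeas <<s G >> (fun w => W (tt j) w 0 i - W (tt 0%N) w 0 i).
  elim: j => [|j IH] jm.
    under eq_fun do rewrite subrr; exact: measurable_cst.
  rewrite (_ : (fun w => _) = fun w => (W (tt j.+1) w 0 i - W (tt j) w 0 i) + (W (tt j) w 0 i - W (tt 0%N) w 0 i)).
    by apply: measurable_funD; [exact: mincr|exact: IH (ltnW jm)].
  by apply/funext => w; rewrite addrA subrK.
(* The law only concerns increments, so W_r is replaced by W_r - W_0, which is almost surely the
   same. *)
pose A' (l' : seq (R * 'I_d * R)) := [set w | forall x, x \in l' -> W x.1.1 w 0 x.1.2 - W 0 w 0 x.1.2 < x.2].
have sA' l' : (forall x, x \in l' -> x \in l) -> <<s G >> (A' l').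
  elim: l' => [|x l' IH] hl'.
    rewrite (_ : A' [::] = setT); first exact: (sigT (smallest_sigma_algebra _ _)).
    by apply/seteqP; split.
  have -> : A' (x :: l') = [set w | W x.1.1 w 0 x.1.2 - W 0 w 0 x.1.2 < x.2] `&` A' l'.
    apply/seteqP; split => [w h|w [h1 h2] y].
      by split => [|y yl]; apply: h; rewrite inE ?eqxx ?yl ?orbT.
    by rewrite inE => /orP[/eqP -> //|]; exact: h2.
  apply: (sigI (smallest_sigma_algebra _ _)); last by apply: IH => y yl; apply: hl'; rewrite inE yl orbT.
  have xtau : x.1.1 \in tau.
    by rewrite tau_mem !inE; apply/orP; right; apply/orP; right; apply: map_f; apply: hl'; rewrite mem_head.
  have im : (index x.1.1 tau <= m)%N by rewrite -ltnS -taum index_mem.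
  have -> : [set w | W x.1.1 w 0 x.1.2 - W 0 w 0 x.1.2 < x.2] =
      (fun w => W (tt (index x.1.1 tau)) w 0 x.1.2 - W (tt 0%N) w 0 x.1.2) @^-1` `]-oo, x.2[.
    by rewrite !tt_tau// nth_index// nth0tau; apply/seteqP; split => w /=; rewrite in_itv.
  by apply: (fmeasP _ (smallest_sigma_algebra _ _)).1; [exact: mW0|exact: measurable_itv].
have [mA' PA'E] := indG _ (sA' l (fun _ h => h)).
have AA' : {ae P, forall w, A w <-> A' l w}.
  case: Wien => _ W0 _ _; apply: filterS2 Al W0 => w Alw W0w.
  rewrite Alw /A'/= W0w; split => h x xl; have := h x xl; rewrite mxE subr0//.
rewrite (measure_ae_eq mA mA' AA') -PA'E; apply: measure_ae_eq.
- exact: measurableI.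
- exact: measurableI.
- by apply: filterS AA' => w [h1 h2]; split => -[? ?]; split => //; [exact: h1|exact: h2].
Qed.

(** Two extensions from a class stable under intersection: first in E with A fixed, then in A with E
    a generator. *)
Lemma indep_increment A E : F s A -> <<s increments >> E ->
  measurable E /\ P (A `&` E) = (P A * P E)%E.
Proof.
move=> FA; have mA : measurable A by apply: aug_sub FA; case/andP: sT.
rewrite setIC muleC; apply: (indep_generated mA increment_eventsI) => _ [B mB ->].
have mE : measurable [set w | forall i, B i (W t w 0 i - W s w 0 i)] by exact: m_increment.
split => //; rewrite setIC muleC.
have := @indep_generated _ _ _ P (cylinder s) _ mE (@cylinderI s).
move=> /(_ _ A)[] //; first by move=> C cC; split; [case: cC|exact: indep_cylinder].
by apply: aug_cylinder FA; case/andP: sT.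
Qed.

Lemma fmeas_increment i : fmeas <<s increments >> (fun w => W t w 0 i - W s w 0 i).
Proof.
apply/(fmeasP _ (smallest_sigma_algebra _ _)) => D mD; apply: sub_sigma_algebra.
exists (fun j => if j == i then D else setT); first by move=> j; case: ifP.
apply/seteqP; split => w /=; first by move=> h j; case: ifP => // /eqP ->.
by move=> /(_ i); rewrite eqxx.
Qed.

End Increments.

End BrownianFiltration.

(** * Every martingale of the Brownian filtration has a continuous version *)

Section Markov.
Context (R : realType) (disp : measure_display) (Omega : measurableType disp).
Context (P : probability Omega R) (T : R) (d : nat) (W : R -> Omega -> 'rV[R]_d).
Hypothesis Wien : wiener P T W.
Hypothesis T0 : 0 < T.
Local Notation F := (augmented_filtration P W).

Lemma mfun_ex d1 d2 (T1 : measurableType d1) (T2 : measurableType d2) (f : T1 -> T2) :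
  measurable_fun setT f -> exists X : {mfun T1 >-> T2}, X = f :> (T1 -> T2).
Proof. by move=> mf; exists (mfun_Sub (mem_set mf)). Qed.

Definition bcont (f : 'rV[R]_d -> R) :=
  continuous f /\ exists C, forall y, `|f y| <= C.

(** The Brownian transition operator: the mean of f (W_t) knowing that W_s = y. *)
Definition shift_mean (f : 'rV[R]_d -> R) (t s : R) (y : 'rV[R]_d) : R :=
  \int[P]_w f (y + (W t w - W s w)).

Let mW t i : 0 <= t <= T -> measurable_fun setT (fun w => W t w 0 i).
Proof. by case: Wien => mW _ _ _; exact: mW. Qed.

Lemma wiener_continuous w : continuous (fun t => W (clamp 0 T t) w).
Proof.
case: Wien => _ _ cW _.
exact: (@continuous_clamp_within R 'rV[R]_d 0 T (fun t => W t w) (ltW T0) (cW w)).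
Qed.

Lemma measurable_comp_rV d' (O : measurableType d') (f : 'rV[R]_d -> R) (Y : O -> 'rV[R]_d) :
  continuous f -> (forall i, measurable_fun setT (fun w => Y w 0 i)) ->
  measurable_fun setT (fun w => f (Y w)).
Proof.
by move=> cf mY; apply: (@mcaratheodory _ _ _ _ (fun _ => f)).
Qed.

Lemma shift_mean_measurable (f : 'rV[R]_d -> R) s t y : continuous f -> 0 <= s <= T -> 0 <= t <= T ->
  measurable_fun setT (fun w => f (y + (W t w - W s w))).
Proof.
move=> cf sT tT; apply: measurable_comp_rV => // i; under eq_fun do rewrite !mxE.
by apply: measurable_funD => //; apply: measurable_funB; exact: mW.
Qed.

Lemma shift_mean_cvg f t (u : nat -> R) (y : nat -> 'rV[R]_d) s z :
  bcont f -> 0 <= t <= T -> (forall n, 0 <= u n <= T) -> 0 <= s <= T ->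
  u @ \oo --> s -> y @ \oo --> z ->
  (fun n => shift_mean f t (u n) (y n)) @ \oo --> shift_mean f t s z.
Proof.
move=> [cf [C fC]] tT uT sT us yz.
apply: (@Rintegral_bounded_cvg _ _ _ P setT (fun n w => f (y n + (W t w - W (u n) w)))
  (fun w => f (z + (W t w - W s w))) C) => // [n|w _].
  exact: shift_mean_measurable.
apply: (@cvg_comp _ _ _ (fun n => y n + (W t w - W (u n) w)) f _ _ _ _ (cf _)).
apply: cvgD => //; apply: cvgB; first exact: cvg_cst.
have := cvg_comp _ _ us (@wiener_continuous w s).
rewrite (clamp_id sT) (_ : _ \o u = fun n => W (u n) w)//.
by apply/funext => n /=; rewrite clamp_id.
Qed.

Lemma shift_mean_bc f s t : bcont f -> 0 <= s <= T -> 0 <= t <= T ->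
  bcont (shift_mean f t s).
Proof.
move=> bf sT tT; split.
  move=> y; apply: cvg_seq_nbhs => u uy.
  by apply: (@shift_mean_cvg f t (fun=> s) u s y) => //; exact: cvg_cst.
case: bf => cf [C fC]; exists C => y.
have mf := shift_mean_measurable y cf sT tT.
apply: le_trans (le_normr_Rintegral _ (Pint_bdd P mf (fun w => fC _))) _ => //.
apply: (@le_trans _ _ (\int[P]_(w in setT) C)).
  apply: le_Rintegral => //.
  - by apply: Pint_abs; exact: (Pint_bdd P mf (fun w => fC _)).
  - exact: (@Pint_bdd _ _ _ _ _ `|C|).
by rewrite Rintegral_cst// [X in fine X](_ : _ = 1%E) ?mulr1//; exact: probability_setT.
Qed.

Lemma shift_mean_id f t y : shift_mean f t t y = f y.
Proof.
rewrite /shift_mean; under eq_Rintegral do rewrite subrr addr0.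
by rewrite Rintegral_cst// [X in fine X](_ : _ = 1%E) ?mulr1//; exact: probability_setT.
Qed.

(** By independence, the pair formed by the past up to s and the increments after s has a product
    law. Fubini's theorem then integrates the increment first, with the past frozen. *)
Lemma markov Z f s t : 0 <= s -> s <= t -> t <= T -> fmeas (F s) Z ->
  (exists C, forall w, `|Z w| <= C) -> bcont f ->
  \int[P]_w (Z w * f (W t w)) = \int[P]_w (Z w * shift_mean f t s (W s w)).
Proof.
move=> s0; rewrite le_eqVlt => /orP[/eqP <- _ _ _ _|st tT mZ [C ZC] bf].
  by apply: eq_Rintegral => w _; rewrite shift_mean_id.
have [cf [Cf fCf]] := bf.
have sT : 0 <= s <= T by rewrite s0 (le_trans (ltW st)).
have tT' : 0 <= t <= T by rewrite tT (le_trans s0 (ltW st)).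
have sT2 := proj2 (andP sT).
(* Omega is equipped with two coarser sigma-algebras, and the identity is read as a random variable
   into each of them; the diagonal map is their joint variable. *)
pose O1 := g_sigma_algebraType (F s).
pose O2 := g_sigma_algebraType (increments W s t).
have m1 : measurable_fun setT (id : Omega -> O1).
  move=> _ B; rewrite setTI => mB; have : <<s F s >> `<=` measurable.
    by apply: smallest_sub; [exact: sigma_algebra_measurable|exact: (aug_sub Wien sT2)].
  exact.
have m2 : measurable_fun setT (id : Omega -> O2).
  move=> _ B; rewrite setTI => mB.
  by have [] := indep_increment Wien s0 st tT (sigT (aug_sigma P W s)) mB.
have m12 : measurable_fun setT ((fun w => (w, w)) : Omega -> O1 * O2).
  exact: measurable_fun_pair.
have [X1 X1E] := mfun_ex m1; have [X2 X2E] := mfun_ex m2; have [X12 X12E] := mfun_ex m12.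
pose P1 := distribution P X1; pose P2 := distribution P X2.
pose h (z : O1 * O2) := Z z.1 * f (W s z.1 + (W t z.2 - W s z.2)).
have mZ1 : measurable_fun setT (Z : O1 -> R) by exact: mZ.
have mWs i : measurable_fun setT ((fun w => W s w 0 i) : O1 -> R).
  by apply: aug_W; rewrite s0 lexx.
have mInc i : measurable_fun setT ((fun w => W t w 0 i - W s w 0 i) : O2 -> R).
  have hm : fmeas <<s increments W s t >> (fun w => W t w 0 i - W s w 0 i).
    exact: fmeas_increment.
  move=> _ B mB.
  have := hm measurableT B mB; rewrite -[X in X -> _]/(<<s <<s _ >> >> _).
  by rewrite sigma_algebra_id//; exact: smallest_sigma_algebra.
have mh : measurable_fun setT h.
  apply: measurable_funM; first exact: (measurableT_comp mZ1 measurable_fst).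
  apply: measurable_comp_rV => // i; under eq_fun do rewrite !mxE.
  apply: measurable_funD; first exact: (measurableT_comp (mWs i) measurable_fst).
  exact: (measurableT_comp (mInc i) measurable_snd).
have C0 : 0 <= C by apply: le_trans (normr_ge0 _) (ZC point).
have hC z : `|h z| <= C * Cf by rewrite normrM; apply: ler_pM.
have ih : (P1 \x P2)%E.-integrable setT (EFin \o h).
  apply: measurable_bounded_integrable => //.
    change ((P1 \x P2)%E setT < +oo)%E; rewrite -setXTT product_measure1E//.
    apply: (@le_lt_trans _ _ (1 * 1)%E); last by rewrite mule1 ltry.
    by apply: lee_pmul => //; exact: probability_le1.
  by exists (C * Cf); split; [exact: num_real|move=> M CM w _; exact: le_trans (hC w) (ltW CM)].
have mhP : measurable_fun setT (h \o X12).
  exact: measurableT_comp.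
have e1 : (\int[P]_w (Z w * f (W t w))%:E = \int[P]_w ((EFin \o h) \o X12) w)%E.
  by apply: eq_integral => w _; rewrite /= X12E /h/= addrC subrK.
have e2 : (\int[P]_w ((EFin \o h) \o X12) w = \int[distribution P X12]_z (EFin \o h) z)%E.
  rewrite integral_distribution//; first exact/measurable_EFinP.
  by apply: (@Pint_bdd _ _ _ P (h \o X12) (C * Cf)) => // w; exact: hC.
have e3 : (\int[distribution P X12]_z (EFin \o h) z = \int[P1 \x P2]_z (EFin \o h) z)%E.
  apply: eq_measure_integral => A mA _; apply/esym.
  apply: (@product_measure_unique _ _ _ _ _ P1 P2 (distribution P X12)) => // B D mB mD.
  have d1 A' : P1 A' = P A' by rewrite /P1 /distribution /pushforward X1E.
  have d2 A' : P2 A' = P A' by rewrite /P2 /distribution /pushforward X2E.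
  have d12 A' : distribution P X12 A' = P [set w | A' (w, w)].
    by rewrite /distribution /pushforward X12E.
  have FB : F s B by move: mB; rewrite -[X in X -> _]/(<<s F s >> B) sigma_algebra_id//; exact: aug_sigma.
  transitivity (P (B `&` D)); first exact: (d12 (B `*` D)).
  rewrite (indep_increment Wien s0 st tT FB mD).2.
  by congr (_ * _)%E; apply/esym; [exact: (d1 B)|exact: (d2 D)].
have e4 : (\int[P1 \x P2]_z (EFin \o h) z = \int[P1]_x (Z x * shift_mean f t s (W s x))%:E)%E.
  rewrite -fubini1//; apply: eq_integral => x _; rewrite /fubini_F/= /h/=.
  have ms := shift_mean_measurable (W s x) cf sT tT'.
  have isf := Pint_bdd P ms (fun w => fCf _).
  rewrite /P2 (_ : (\int[distribution P X2]_y (Z x * f (W s x + (W t y - W s y)))%:E)%E =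
     (\int[P]_w (Z x * f (W s x + (W t w - W s w)))%:E)%E).
    under eq_integral do rewrite EFinM.
    rewrite integralZl// EFinM /shift_mean fineK//.
    exact: integrable_fin_num.
  rewrite (integral_distribution (X := X2) (f := fun y => (Z x * f (W s x + (W t y - W s y)))%:E)).
  - by rewrite /comp X2E.
  - by apply/measurable_EFinP; exact: (measurable_fun_pair2 (f := h) x mh).
  - by rewrite /comp X2E; exact: (PintZ (Z x) isf).
have [cg [Cg gCg]] := shift_mean_bc bf sT tT'.
have mg : measurable_fun setT ((fun x => Z x * shift_mean f t s (W s x)) : O1 -> R).
  by apply: measurable_funM => //; exact: measurable_comp_rV.
have e5 : (\int[P1]_x (Z x * shift_mean f t s (W s x))%:E = \int[P]_w (Z w * shift_mean f t s (W s w))%:E)%E.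
  rewrite /P1 (integral_distribution (X := X1) (f := fun x => (Z x * shift_mean f t s (W s x))%:E)).
  - by rewrite /comp X1E.
  - exact/measurable_EFinP.
  - rewrite /comp X1E; apply: (@Pint_bdd _ _ _ P (fun w => Z w * shift_mean f t s (W s w)) (C * Cg)).
      exact: (fmeasW (aug_sub Wien sT2) mg).
    by move=> w; rewrite normrM; exact: ler_pM.
by rewrite /Rintegral e1 e2 e3 e4 e5.
Qed.

Local Notation cmart := (cmart P T F).
Local Notation hasM := (hasM P T F).

Let sF t : 0 <= t <= T -> is_sub_sigma (F t).
Proof. by move=> /andP[_]; exact: (aug_sub_sigma Wien). Qed.

Lemma hasM_F0 Z : fmeas (F 0) Z -> (exists C, forall w, `|Z w| <= C) -> hasM Z.
Proof.
move=> mZ [C ZC]; exists (fun _ => Z).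
have iZ : Pint P Z.
  apply: Pint_bdd ZC; apply: fmeasW mZ.
  by apply: (aug_sub Wien); exact: ltW.
split => //.
- by move=> w t; exact: cvg_cst.
- by move=> t /andP[t0 _]; apply: fmeasS mZ; exact: aug_mono.
Qed.

(** Between r and t the martingale is Z times the transition operator applied at W_s. It is
    continuous in s because [shift_mean] is jointly continuous in (s, y). *)
Lemma hasM_step Z f r t : 0 <= r -> r <= t -> t <= T -> fmeas (F r) Z ->
  (exists C, forall w, `|Z w| <= C) -> bcont f ->
  hasM (fun w => Z w * shift_mean f t r (W r w)) -> hasM (fun w => Z w * f (W t w)).
Proof.
move=> r0 rt tT mZ ZC bf [M' [a1 a2 a3 a4 a5]].
have rT : r <= T := le_trans rt tT.
have tT' : 0 <= t <= T by rewrite tT (le_trans r0 rt).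
pose S s w := Z w * shift_mean f t s (W s w).
have cl s : r <= clamp r t s <= t by exact: clamp_itv.
have clT s : 0 <= clamp r t s <= T.
  by have /andP[h1 h2] := cl s; rewrite (le_trans r0 h1) (le_trans h2 tT).
have mS s : r <= s <= t -> fmeas (F s) (S s).
  move=> /andP[rs st]; apply: measurable_funM; first exact: fmeasS (aug_mono rs) mZ.
  have sT : 0 <= s <= T by rewrite (le_trans r0 rs) (le_trans st tT).
  apply: (@measurable_comp_rV _ (g_sigma_algebraType (F s)) (shift_mean f t s) (W s)).
    exact: (shift_mean_bc bf sT tT').1.
  by move=> i; apply: aug_W; rewrite (le_trans r0 rs) lexx.
have [C Zb] := ZC; have C0 : 0 <= C by apply: le_trans (normr_ge0 _) (Zb point).
have iS s : r <= s <= t -> Pint P (S s).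
  move=> rst; have /andP[rs st] := rst.
  have sT : 0 <= s <= T by rewrite (le_trans r0 rs) (le_trans st tT).
  have [_ [Cg gCg]] := shift_mean_bc bf sT tT'.
  apply: (@Pint_bdd _ _ _ _ _ (C * Cg)).
    exact: fmeasW (sF sT).2 (mS s rst).
  by move=> w; rewrite normrM; exact: ler_pM.
have intS s A : r <= s <= t -> F s A -> \int[P]_(w in A) S s w = \int[P]_(w in A) (Z w * f (W t w)).
  move=> /andP[rs st] FA; rewrite Rintegral_mkcond [RHS]Rintegral_mkcond.
  have r0s := le_trans r0 rs.
  have mZA : fmeas (F s) (fun w => \1_A w * Z w).
    apply: measurable_funM; last exact: fmeasS (aug_mono rs) mZ.
    by apply: (@measurable_indic _ (g_sigma_algebraType (F s))); apply: sub_sigma_algebra.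
  have bZA : exists C, forall w, `|\1_A w * Z w| <= C.
    exists C => w; rewrite normrM -[leRHS]mul1r; apply: ler_pM => //.
    by rewrite indicE; case: (w \in A); rewrite ?normr1 ?normr0.
  have := markov r0s st tT mZA bZA bf.
  have patchE (g : Omega -> R) : g \_ A = (fun w => \1_A w * g w).
    apply/funext => w; rewrite patchE indicE.
    by case: (w \in A); rewrite ?mul1r ?mul0r.
  rewrite !patchE => h; under eq_Rintegral do rewrite /S mulrA.
  by rewrite -h; apply: eq_Rintegral => w _; rewrite mulrA.
have rrt : r <= r <= t by rewrite lexx rt.
have iff0 : Pint P (fun w => Z w * f (W t w)).
  have := iS t; rewrite rt lexx => /(_ isT); rewrite /S /Pint/= /comp.
  by under eq_fun do rewrite shift_mean_id.
(* M' up to r, then the explicit martingale S, then constant from t on. After r, M' s and S r have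
   the same averages over F s, so adding M' and subtracting S r glues the pieces. *)
exists (fun s w => M' s w + (S (clamp r t s) w - S r w)); split => //.
- move=> w s; apply: cvgD; first exact: a2.
  apply: cvgB; last exact: cvg_cst.
  apply: cvgM; first exact: cvg_cst.
  have cc : continuous (fun x => clamp r t (clamp 0 T x)).
    by move=> x; apply: continuous_comp; exact: clamp_continuous.
  apply: (@cvg_seq_nbhs _ R) => u us.
  have cu := cvg_comp _ _ us (cc s).
  apply: (shift_mean_cvg (u := (fun x => clamp r t (clamp 0 T x)) \o u)) => //.
    by move=> n; exact: clT.
  have := cvg_comp _ _ cu (@wiener_continuous w (clamp r t (clamp 0 T s))).
  rewrite (clamp_id (clT _)) (_ : _ \o _ = fun n => W (clamp r t (clamp 0 T (u n))) w)//.
  by apply/funext => n /=; rewrite (clamp_id (clT _)).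
- move=> s sT; have [sr|rs] := ltP s r.
    have -> : (fun w => M' s w + (S (clamp r t s) w - S r w)) = M' s.
      apply/funext => w; rewrite (_ : clamp r t s = r) ?subrr ?addr0//.
      by rewrite /clamp min_l ?max_l ?(ltW sr)// (le_trans (ltW sr) rt).
    exact: a3.
  apply: measurable_funD; first exact: a3.
  apply: measurable_funB; last by apply: fmeasS (mS r rrt); exact: aug_mono.
  apply: fmeasS (mS _ (cl s)); apply: aug_mono.
  by rewrite /clamp ge_max rs/= ge_min lexx.
- move=> s sT; apply: PintD; first exact: a4.
  by apply: PintB; exact: iS.
- move=> s sT A FA; have mA := (sF sT).2 _ FA.
  rewrite RintegralD//; [|exact: (PintS mA (a4 _ sT))|exact: (PintS mA (PintB (iS _ (cl s)) (iS _ rrt)))].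
  rewrite RintegralB//; [|exact: (PintS mA (iS _ (cl s)))|exact: (PintS mA (iS _ rrt))].
  have -> : \int[P]_(w in A) M' s w = \int[P]_(w in A) S r w := a5 s sT A FA.
  rewrite addrC subrK.
  have [sr|rs] := ltP s r.
    have -> : clamp r t s = r by rewrite /clamp min_l ?max_l ?(ltW sr)// (le_trans (ltW sr) rt).
    by apply: intS => //; apply: aug_mono FA; exact: ltW.
  have [st|ts] := leP s t.
    by rewrite clamp_id ?rs//; apply: intS => //; rewrite rs.
  have -> : clamp r t s = t by rewrite /clamp min_r ?max_r// ltW.
  by apply: eq_Rintegral => w _; rewrite /S shift_mean_id.
Qed.

Definition wprod (l : seq (R * ('rV[R]_d -> R))) (w : Omega) : R :=
  \prod_(x <- l) x.2 (W x.1 w).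

Lemma bounded_continuousM f g : bcont f -> bcont g ->
  bcont (fun y => f y * g y).
Proof.
move=> [cf [C fC]] [cg [D gD]]; split; first by move=> y; exact: (continuousM (cf y) (cg y)).
by exists (C * D) => y; rewrite normrM; apply: ler_pM.
Qed.

Lemma wiener_prod_fmeas l r : r <= T ->
  (forall x, List.In x l -> 0 <= x.1 <= r /\ bcont x.2) ->
  fmeas (F r) (wprod l) /\ exists C, forall w, `|wprod l w| <= C.
Proof.
move=> rT; elim: l => [|x l IH] h.
  split; last by exists 1 => w; rewrite /wprod big_nil normr1.
  rewrite (_ : wprod _ = fun=> 1); first exact: measurable_cst.
  by apply/funext => w; rewrite /wprod big_nil.
have [m [C lC]] := IH (fun y yl => h y (or_intror yl)).
have [xr [cx [D xD]]] := h x (or_introl erefl).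
have E : wprod (x :: l) = fun w => x.2 (W x.1 w) * wprod l w.
  by apply/funext => w; rewrite /wprod big_cons.
rewrite E; split; last by exists (D * C) => w; rewrite normrM; apply: ler_pM.
apply: measurable_funM => //.
apply: (@measurable_comp_rV _ (g_sigma_algebraType (F r)) x.2 (W x.1)) => // i.
exact: aug_W.
Qed.

(** Induction on the number of times, listed from the latest to the earliest. *)
Lemma wiener_prod_hasM n l : size l = n ->
  (forall x, List.In x l -> 0 <= x.1 <= T /\ bcont x.2) ->
  sorted (fun x y => y <= x) (map fst l) -> hasM (wprod l).
Proof.
have TT : T <= T by [].
elim: n l => [[|//] _ _ _|n IH [//|[t f] l] [sl] hl].
  apply: hasM_F0; last by exists 1 => w; rewrite /wprod big_nil normr1.
  rewrite (_ : wprod _ = fun=> 1); first exact: measurable_cst.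
  by apply/funext => w; rewrite /wprod big_nil.
have [/= /andP[t0 tT] bf] := hl _ (or_introl erefl).
have tT' : 0 <= t <= T by rewrite t0.
have hl' y : List.In y l -> 0 <= y.1 <= T /\ bcont y.2 by move=> yl; exact: hl (or_intror yl).
have -> : wprod ((t, f) :: l) = fun w => wprod l w * f (W t w).
  by apply/funext => w; rewrite /wprod big_cons mulrC.
case: l sl hl hl' => [|[r f'] l] sl hl hl' /=.
  move=> _; apply: (@hasM_step _ _ 0) => //.
  - rewrite (_ : wprod _ = fun=> 1); first exact: measurable_cst.
    by apply/funext => w; rewrite /wprod big_nil.
  - by exists 1 => w; rewrite /wprod big_nil normr1.
  - have T00 : (0 : R) <= 0 <= T by rewrite lexx ltW.
    have [cg gb] := shift_mean_bc bf T00 tT'.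
    rewrite (_ : (fun w => _) = fun w => shift_mean f t 0 (W 0 w)).
      apply: hasM_F0; last by case: gb => C gC; exists C.
      apply: (@measurable_comp_rV _ (g_sigma_algebraType (F 0)) _ (W 0)) => // i.
      by apply: aug_W; rewrite lexx.
    by apply/funext => w; rewrite /wprod big_nil mul1r.
move=> /andP[rt srt].
have [/= /andP[r0 rT] bf'] := hl' _ (or_introl erefl).
have sorted_le : forall x, List.In x ((r, f') :: l) -> x.1 <= r.
  move=> x [<- //|xl]; have := srt; rewrite (path_sortedE (fun _ _ _ h1 h2 => le_trans h2 h1)).
  move=> /andP[/allP h _]; apply: h.
  elim: l xl {sl hl hl' srt} => // y l IHl [->|xl]; first by rewrite mem_head.
  by rewrite inE IHl ?orbT.
have [mZ bZ] := @wiener_prod_fmeas ((r, f') :: l) r rT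
  (fun x xl => conj (introT andP (conj (elimTF andP (hl' x xl).1).1 (sorted_le x xl))) (hl' x xl).2).
have rT' : 0 <= r <= T by rewrite r0.
apply: (hasM_step r0 rt tT mZ bZ bf).
(* The latest time has been averaged out, and the result is a function of W_r that joins the factor
   already present at time r: the list is one shorter. *)
have -> : (fun w => wprod ((r, f') :: l) w * shift_mean f t r (W r w)) =
    wprod ((r, fun y => f' y * shift_mean f t r y) :: l).
  by apply/funext => w; rewrite /wprod !big_cons/= mulrAC.
apply: IH => //.
- move=> x [<-/=|xl]; last by apply: hl'; right.
  by split => //; apply: bounded_continuousM => //; exact: shift_mean_bc.
Qed.

Let cl_itv t : 0 <= clamp 0 T t <= T. Proof. exact: clamp_itv (ltW T0). Qed.

Let hasM_closed := @hasM_L1 R disp Omega P T F T0 sF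
  (fun s t _ st _ => @aug_mono R disp Omega P d W s t st) (fun t N _ => @aug_null R disp Omega P d W t N).

Lemma hasM_ae xi xi' : measurable_fun setT xi' -> {ae P, forall w, xi w = xi' w} ->
  hasM xi -> hasM xi'.
Proof.
move=> mx E [M [a1 a2 a3 a4 a5]]; exists M; split => //.
- have /integrableP[mxi ixi] := a1; apply/integrableP; split; first exact/measurable_EFinP.
  apply: le_lt_trans ixi; rewrite le_eqVlt; apply/orP; left; apply/eqP.
  by apply: integral_ae; apply: filterS E => w /= -> .
- move=> t tT A FA; rewrite a5//; congr fine; apply: integral_ae.
  by apply: filterS E => w ->.
Qed.

Lemma hasM_lin (a b : R) xi xi' : hasM xi -> hasM xi' -> hasM (fun w => a * xi w + b * xi' w).
Proof.
move=> [M [a1 a2 a3 a4 a5]] [N [b1 b2 b3 b4 b5]].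
exists (fun t w => a * M t w + b * N t w); split => //.
- by apply: PintD; exact: PintZ.
- move=> w t; apply: cvgD; (apply: cvgM; first exact: cvg_cst).
    exact: a2.
  exact: b2.
- move=> t tT; apply: measurable_funD; apply: measurable_funM; try exact: measurable_cst.
    exact: a3.
  exact: b3.
- by move=> t tT; apply: PintD; apply: PintZ; [exact: a4|exact: b4].
- move=> t tT A FA; have mA := (sF tT).2 _ FA.
  rewrite !RintegralD//; last first.
  + by apply: (PintS mA); apply: PintZ; exact: b4.
  + by apply: (PintS mA); apply: PintZ; exact: a4.
  + by apply: (PintS mA); exact: PintZ.
  + by apply: (PintS mA); exact: PintZ.
  rewrite !RintegralZl//; [by rewrite a5// b5//|..].
  + exact: (PintS mA b1).
  + exact: (PintS mA a1).
  + exact: (PintS mA (b4 t tT)).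
  + exact: (PintS mA (a4 t tT)).
Qed.

Lemma hasM_bounded_cvg (X : nat -> Omega -> R) (xi : Omega -> R) (C : R) :
  (forall n, hasM (X n)) -> measurable_fun setT xi ->
  (forall w, X^~ w @ \oo --> xi w) -> (forall n w, `|X n w| <= C) -> hasM xi.
Proof.
move=> hX mxi Xxi XC.
have xiC w : `|xi w| <= C.
  apply: (ler_cvg_to (cvg_norm (Xxi w)) (cvg_cst C)); near=> n; exact: XC.
have mX n : measurable_fun setT (X n) by have [M [/Pint_measurable]] := hX n.
apply: hasM_closed => [|e e0]; first exact: Pint_bdd xiC.
have : (fun n => \int[P]_w `|xi w - X n w|) @ \oo --> \int[P]_w (0 : R).
  apply: (@Rintegral_bounded_cvg _ _ _ P setT _ _ (C + C)) => //.
  - by move=> n; apply: measurableT_comp => //; exact: measurable_funB.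
  - move=> w _; rewrite -(normr0 R) -(subrr (xi w)); apply: cvg_norm.
    by apply: cvgB => //; exact: cvg_cst.
  - by move=> n w _; rewrite normr_id (le_trans (ler_normB _ _))// lerD.
rewrite Rintegral_cst// mul0r => /cvgrPdist_le/(_ e e0)[n _ /(_ n (leqnn n))].
rewrite sub0r normrN /= => h; exists (X n) => //.
exact: le_trans (ler_norm _) h.
Unshelve. all: by end_near. Qed.

(** Continuous functions with values in [0, 1] that converge to the indicator of the half-line below
    a. *)
Definition below (a : R) (n : nat) (x : R) : R := Num.min 1 (Num.max 0 (n%:R * (a - x))).

Lemma below_cvg a x : below a ^~ x @ \oo --> (\1_[set z : R | z < a] x : R).
Proof.
rewrite indicE; have [xa|ax] := ltP x a.
  rewrite mem_set//.
  apply: cvg_near_cst; near=> n; rewrite /below.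
  have h : 1 <= n%:R * (a - x).
    rewrite -ler_pdivrMr ?subr_gt0// mul1r.
    apply: ltW; apply: lt_le_trans (truncnS_gt _) _; rewrite ler_nat.
    near: n; exact: nbhs_infty_ge.
  by rewrite max_r ?min_l// (le_trans ler01).
rewrite memNset/=; last by apply/negP; rewrite -leNgt.
apply: cvg_near_cst; near=> n; rewrite /below max_l ?min_r//.
by rewrite mulr_ge0_le0// subr_le0.
Unshelve. all: by end_near. Qed.

Lemma below_bd a n x : `|below a n x| <= 1.
Proof.
rewrite ger0_norm; first by rewrite /below ge_min lexx.
by rewrite /below le_min ler01 le_max lexx.
Qed.

Lemma below_bc i a n : bcont (fun y => below a n (y 0 i)).
Proof.
split; last by exists 1 => y; exact: below_bd.
move=> y; apply: (@continuous_min _ _ (fun=> 1) _ y); first exact: cst_continuous.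
apply: (@continuous_max _ _ (fun=> 0) _ y); first exact: cst_continuous.
have c0 := @coord_continuous R 1 d 0 i y.
have c1 := @continuousB _ R^o _ (fun=> a) _ y (@cst_continuous _ _ a y) c0.
exact: (@continuousM _ _ (fun=> n%:R) _ y (@cst_continuous _ _ _ y) c1).
Qed.

Lemma In_mem (I : eqType) (x : I) (s : seq I) : List.In x s -> x \in s.
Proof.
elim: s => // y s IH /= [->|/IH]; first by rewrite mem_head.
by rewrite inE => ->; rewrite orbT.
Qed.

Lemma hasM_cylinder A : cylinder P W T A -> hasM \1_A.
Proof.
move=> [mA [l [hl Al]]].
pose g n w : R := \prod_(x <- l) below x.2 n (W x.1.1 w 0 x.1.2).
pose B : set Omega := [set w | forall x, x \in l -> W x.1.1 w 0 x.1.2 < x.2].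
have gB w : g^~ w @ \oo --> (\1_B w : R).
  have -> : (\1_B w : R) = \prod_(x <- l) \1_[set z : R | z < x.2] (W x.1.1 w 0 x.1.2).
    rewrite {}/g {}/B {hl Al}; elim: l => [|x l IH].
      by rewrite big_nil indicE mem_set.
    rewrite big_cons -IH !indicE -natrM mulnb; congr (_%:R); congr nat_of_bool.
    apply/idP/andP => [/set_mem/= h|[/set_mem/= h1 /set_mem/= h2]].
      by split; apply/mem_set => /=; [apply: h; rewrite mem_head|move=> y yl; apply: h; rewrite inE yl orbT].
    by apply/mem_set => y /=; rewrite inE => /orP[/eqP ->|/h2].
  rewrite /g; elim: l {hl Al g B} => [|x l IH].
    by rewrite big_nil; under eq_fun do rewrite big_nil; exact: cvg_cst.
  rewrite big_cons; under eq_fun do rewrite big_cons.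
  by apply: cvgM => //; exact: below_cvg.
have gC n w : `|g n w| <= 1.
  rewrite /g normr_prod; elim: l {hl Al g B gB} => [|x l IH]; first by rewrite big_nil.
  rewrite big_cons -[leRHS]mul1r; apply: ler_pM => //; last exact: below_bd.
  exact: prodr_ge0.
have hg n : hasM (g n).
  pose l' := [seq (x.1.1, fun y : 'rV[R]_d => below x.2 n (y 0 x.1.2)) | x <- sort (fun x y => y.1.1 <= x.1.1) l].
  have -> : g n = wprod l'.
    apply/funext => w; rewrite /wprod big_map /g; apply: perm_big.
    by rewrite perm_sym perm_sort.
  apply: wiener_prod_hasM erefl _ _.
    move=> x /List.in_map_iff[y [<- /In_mem]] /=.
    by rewrite mem_sort => /hl; split => //; exact: below_bc.
  rewrite -map_comp sorted_map; apply: (sub_sorted (e := fun x y => y.1.1 <= x.1.1)) => //.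
  by apply: sort_sorted => x y; exact: le_total.
have mB : measurable_fun setT (\1_B : Omega -> R).
  by apply: (measurable_fun_cvg (h := g)) => [n|w _]; [have [M [/Pint_measurable]] := hg n|exact: gB].
apply: (hasM_ae (xi := \1_B)).
- exact: measurable_indic.
- apply: filterS Al => w Aw; rewrite !indicE; congr (_%:R); congr nat_of_bool.
  by apply/idP/idP => /set_mem/Aw ?; exact/mem_set.
- exact: (hasM_bounded_cvg hg mB gB gC).
Qed.

Let TT : 0 <= T <= T. Proof. by rewrite lexx ltW. Qed.

(** Cylinders are stable under intersection, and the events whose indicator has a continuous
    martingale are stable under proper differences and increasing unions. *)
Lemma hasM_indic A : F T A -> hasM \1_A.
Proof.
have TT1 : T <= T by [].
move=> /(aug_cylinder Wien TT1).
suff : <<s cylinder P W T >> `<=` [set A | measurable A /\ hasM \1_A] by move=> h /h[].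
have i1 (B : set Omega) w : `|\1_B w : R| <= 1.
  by rewrite indicE; case: (_ \in _); rewrite ?normr1 ?normr0.

apply: lambda_system_subset => //.
- exact: cylinderI.
- split => //.
  + split => //; rewrite indicT; apply: hasM_F0; first exact: measurable_cst.
    by exists 1 => w; rewrite normr1.
  + move=> B C CB [mB hB] [mC hC]; split; first exact: measurableD.
    have -> : \1_(B `\` C) = (fun w => 1 * \1_B w + (-1) * \1_C w) :> (Omega -> R).
      apply/funext => w; rewrite !indicE mul1r mulN1r.
      have [Cw|nCw] := pselect (C w).
        by rewrite (mem_set Cw) (mem_set (CB _ Cw)) subrr memNset// => -[].
      rewrite [w \in C]memNset// subr0; have [Bw|nBw] := pselect (B w).
        by rewrite (mem_set Bw) mem_set.
      by rewrite [w \in B]memNset// memNset// => -[].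
    exact: hasM_lin.
  + move=> B ndB hB; have mB n : measurable (B n) := (hB n).1.
    have mU : measurable (\bigcup_n B n) by exact: bigcupT_measurable.
    split => //; apply: (@hasM_bounded_cvg (fun n => \1_(B n)) _ 1) => //.
    * by move=> n; exact: (hB n).2.
    * move=> w; rewrite indicE; have [[n _ Bn]|nBw] := pselect ((\bigcup_n B n) w).
        rewrite mem_set; last by exists n.
        apply: cvg_near_cst; near=> m; rewrite indicE mem_set//.
        have nm : (n <= m)%N by near: m; exact: nbhs_infty_ge.
        by have /subsetPset := ndB _ _ nm; exact.
      rewrite memNset//; apply: cvg_near_cst; near=> m; rewrite indicE memNset//.
      by move=> Bm; apply: nBw; exists m.
- by move=> C cC; split; [case: cC|exact: hasM_cylinder].
Unshelve. all: by end_near. Qed.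

Lemma hasM_finite_sum (I : Type) (s : seq I) (X : I -> Omega -> R) :
  (forall i, hasM (X i)) -> hasM (fun w => \sum_(i <- s) X i w).
Proof.
move=> hX; elim: s => [|i s IH].
  under eq_fun do rewrite big_nil; apply: hasM_F0; first exact: measurable_cst.
  by exists 0 => w; rewrite normr0.
under eq_fun do rewrite big_cons -[X i _]mul1r -[\sum_(_ <- _) _]mul1r.
exact: hasM_lin.
Qed.

Import finmap HBSimple HBNNSimple.

Lemma hasM_ge0 xi : fmeas (F T) xi -> Pint P xi -> (forall w, 0 <= xi w) -> hasM xi.
Proof.
move=> mxi ixi xi0.
pose O := g_sigma_algebraType (F T).
have mE : measurable_fun setT (EFin \o (xi : O -> R)) by exact/measurable_EFinP.
have mO : measurable (setT : set O) by exact: measurableT.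
pose X n := nnsfun_approx mO mE n.
have X0 n w : 0 <= X n w by [].
have Xle n w : X n w <= xi w.
  rewrite -lee_fin /X nnsfun_approxE.
  by apply: (@le_approx _ _ R setT (EFin \o xi)) => // z _; rewrite /= lee_fin.
have Xcvg w : X^~ w @ \oo --> xi w.
  have h := @cvg_nnsfun_approx _ _ _ _ mO _ mE (fun z _ => xi0 z : (0 <= (EFin \o xi) z)%E) w I.
  exact: (fine_cvg h).
have hX n : hasM (X n).
  have -> : (X n : Omega -> R) = fun w => \sum_(y <- fset_set (range (X n))) y * \1_(X n @^-1` [set y]) w.
    apply/funext => w; rewrite [LHS](fimfunE (X n)) fsbig_finite//=.
  apply: hasM_finite_sum => y.
  have hi : hasM \1_(X n @^-1` [set y]).
    apply: hasM_indic; have : measurable (X n @^-1` [set y]) by exact: measurable_funPTI.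
    by rewrite -[X in X -> _]/(<<s F T >> _) sigma_algebra_id//; exact: aug_sigma.
  by have := hasM_lin y 0 hi hi; under eq_fun do rewrite mul0r addr0.
have mxi' : measurable_fun setT xi := Pint_measurable ixi.
have mX n : measurable_fun setT (X n : Omega -> R) by have [M [/Pint_measurable]] := hX n.
apply: hasM_closed => // e e0.
have : (fun n => \int[P]_w `|xi w - X n w|%:E)%E @ \oo --> (\int[P]_w 0)%E.
  apply: (@dominated_cvg _ _ _ P setT _ _ _ (EFin \o xi)) => //.
  - by move=> n; apply/measurable_EFinP; apply: measurableT_comp => //; exact: measurable_funB.
  - move=> w _; apply: cvg_EFin; first exact: nearW.
    rewrite -(normr0 R) -(subrr (xi w)); apply: cvg_norm.
    by apply: cvgB => //; exact: cvg_cst.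
  - by move=> n w _; rewrite /= lee_fin normr_id ger0_norm ?subr_ge0// gerBl.
rewrite integral0 => /fine_cvgP[_ /cvgrPdist_le/(_ e e0)[n _ /(_ n (leqnn n))]].
rewrite sub0r normrN /= => h; exists (X n) => //.
exact: le_trans (ler_norm _) h.
Qed.

(** The positive and negative parts are written as halves of |xi| + xi and |xi| - xi, both of which
    are nonnegative. *)
Lemma hasM_integrable xi : fmeas (F T) xi -> Pint P xi -> hasM xi.
Proof.
move=> mxi ixi.
have mn : fmeas (F T) (fun w => `|xi w|).
  by apply: (@measurableT_comp _ _ _ (g_sigma_algebraType (F T)) _ _ (fun x : R => `|x|)).
have ia : Pint P (fun w => `|xi w|) by exact: Pint_abs.
have E : xi = fun w => 2^-1 * (`|xi w| + xi w) + (- 2^-1) * (`|xi w| - xi w).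
  by apply/funext => w; field.
rewrite E; apply: hasM_lin; apply: hasM_ge0.
- exact: measurable_funD.
- exact: PintD.
- by move=> w; rewrite -lerBlDr sub0r -normrN ler_norm.
- exact: measurable_funB.
- exact: PintB.
- by move=> w; rewrite subr_ge0 ler_norm.
Qed.

End Markov.

(** * Differential calculus on rows from continuous partial derivatives *)

Lemma is_derive_lim (R : realType) (f : R -> R) (x l : R) :
  (forall e, 0 < e -> \forall h \near 0, `|f (x + h) - f x - h * l| <= e * `|h|) ->
  is_derive x (1 : R) f l.
Proof.
move=> H.
have cv : (fun h => h^-1 *: ((f \o shift x) (h *: (1 : R)) - f x)) @ 0^' --> l.
  apply/cvgrPdist_le => e e0; rewrite near_withinE.
  apply: filterS (H e e0) => h hh h0.
  rewrite /= -[_ *: 1]/(h * 1) mulr1 addrC -[_ *: _]/(h^-1 * _) -(ler_pM2r (_ : 0 < `|h|)) ?normr_gt0//.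
  rewrite -normrM mulrDl mulNr mulrAC mulVf// mul1r [l * h]mulrC addrC distrC (addrC h x).
  exact: hh.
apply: DeriveDef; first by apply/cvg_ex; exists l.
exact: cvg_lim.
Qed.


Lemma is_derive_scale (R : realType) (f : R -> R) (c x l : R) :
  is_derive x (1 : R) f l -> is_derive x (1 : R) (fun s => c * f s) (c * l).
Proof. by move=> h; have := is_deriveZ c h. Qed.

Lemma is_derive_square (R : realType) (K x : R) :
  is_derive x (1 : R) (fun s => K * s ^+ 2) (2 * K * x).
Proof.
apply: is_derive_lim => e e0; near=> h.
rewrite (_ : _ - _ = (K * h) * h); last by ring.
rewrite normrM ler_wpM2r// normrM.
have : `|h| <= e / (`|K| + 1) by near: h; apply: nbhs0_leR; rewrite divr_gt0// ltr_wpDl.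
rewrite ler_pdivlMr ?ltr_wpDl//; apply: le_trans.
by rewrite mulrC ler_wpM2l// lerDl.
Unshelve. all: by end_near. Qed.

Lemma mvt (R : realType) (g dg : R -> R) (a b : R) :
  (forall x, is_derive x (1 : R) g (dg x)) ->
  exists2 c, Num.min a b <= c <= Num.max a b & g b - g a = dg c * (b - a).
Proof.
move=> dgE; have cg : continuous g.
  by move=> x; apply: differentiable_continuous; apply/derivable1_diffP; have [] := dgE x.
wlog ab : a b / a <= b => [H|].
  have /orP[ab|ba] := le_total a b; first exact: H.
  have [c cab E] := H b a ba; exists c; first by rewrite minC maxC.
  by rewrite -opprB E -mulrN opprB.
have [c + E] := @MVT_segment R g dg a b ab (fun x _ => dgE x) (continuous_subspaceT cg).
by rewrite in_itv/= => cab; exists c => //; rewrite min_l// max_r.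
Qed.

Lemma mvt0 (R : realType) (g dg : R -> R) (b : R) :
  (forall x, is_derive x (1 : R) g (dg x)) ->
  exists2 c, `|c| <= `|b| & g b - g 0 = dg c * b.
Proof.
move=> /(@mvt _ _ _ 0 b)[c /andP[c1 c2] E]; exists c; last by rewrite E subr0.
rewrite ler_norml; apply/andP; split.
  apply: le_trans c1; rewrite le_min oppr_le0 normr_ge0/=.
  by rewrite lerNl -normrN ler_norm.
by apply: le_trans c2 _; rewrite ge_max normr_ge0 ler_norm.
Qed.

Lemma close_eq (R : realType) (A A0 B B0 e : R) :
  `|A - A0| <= e / 2 -> `|B - B0| <= e / 2 -> A = B -> `|A0 - B0| <= e.
Proof.
move=> h1 h2 AB; rewrite AB in h1.
rewrite -(subrKA B) (le_trans (ler_normD _ _))// distrC.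
by apply: le_trans (lerD h1 h2) _; rewrite -splitr.
Qed.

Lemma ebaseE (R : realType) n (i j : 'I_n) : ebase R i 0 j = (j == i)%:R.
Proof. by rewrite mxE eqxx. Qed.

Section Calculus.
Context (R : realType) (n : nat).
Implicit Types (u : 'rV[R]_n -> R) (x v : 'rV[R]_n).

Lemma derivable_line u x v : (forall s : R, derivable u (x + s *: v) v) ->
  forall s, is_derive s (1 : R) (fun s => u (x + s *: v)) ('D_v u (x + s *: v)).
Proof.
move=> du s.
have E : (fun h : R => h^-1 *: (((fun s => u (x + s *: v)) \o shift s) (h *: (1 : R)) - u (x + s *: v)))
    = (fun h => h^-1 *: ((u \o shift (x + s *: v)) (h *: v) - u (x + s *: v))).
  apply/funext => h; congr (_ *: (u _ - _)) => /=.
  by rewrite -[h *: 1]/(h * 1) mulr1 scalerDl addrCA.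
apply: DeriveDef; rewrite /derivable /derive E//; exact: du.
Qed.

Definition C1 u := (forall x i, derivable u x (ebase R i)) /\ (forall i, continuous (partial i u)).

Definition dirD u x v : R := \sum_i v 0 i * partial i u x.

(** The staircase from x to x + v that changes one coordinate at a time, so that each step involves
    a single partial derivative. *)
Let stair x v (k : nat) : 'rV[R]_n := \row_j (x 0 j + (if (j < k)%N then v 0 j else 0)).

Lemma C1_increment u x : C1 u -> forall e, 0 < e -> exists2 del, 0 < del &
  forall v, `|v| <= del -> `|u (x + v) - u x - dirD u x v| <= e * `|v|.
Proof.
move=> [du cu] e e0.
have e1 : 0 < e / n.+1%:R by rewrite divr_gt0.
have : \forall y \near x, forall i, `|partial i u x - partial i u y| <= e / n.+1%:R.
  apply: (@filter_forall _ _ _ _ (nbhs_filter x)) => i.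
  exact: (continuous_rVP _).2 (cu i) x _ e1.
move=> /nbhs_ballP[del del0 H].
exists (del / 2); first by rewrite divr_gt0.
move=> v vd.
have step (k : 'I_n) : `|u (stair x v k.+1) - u (stair x v k) - v 0 k * partial k u x| <= e / n.+1%:R * `|v|.
  have sE : stair x v k.+1 = stair x v k + v 0 k *: ebase R k.
    apply/rowP => j; rewrite !mxE eqxx/=; have [->|jk] := eqVneq j k.
      by rewrite ltnS leqnn ltnn addr0 mulr1.
    by rewrite ltnS leq_eqVlt (negPf (_ : nat_of_ord j != k))//= mulr0 addr0.
  have [c cv E] := mvt0 (v 0 k) (derivable_line (fun s => du (stair x v k + s *: ebase R k) k)).
  rewrite scale0r addr0 in E; rewrite sE E mulrC -mulrBr normrM mulrC.
  apply: ler_pM => //; last exact: rV_coord_le.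
  rewrite distrC; apply: H; rewrite -ball_normE /=.
  apply: (@le_lt_trans _ _ (del / 2)); last by rewrite ltr_pdivrMr// ltr_pMr// ltr1n.
  apply: le_trans vd; apply: rV_norm_le => // j; rewrite !mxE eqxx/= opprD addrA opprD addrA subrr sub0r.
  have [->|jk] := eqVneq j k.
    by rewrite ltnn oppr0 mulr1 sub0r normrN (le_trans cv)// rV_coord_le.
  by rewrite mulr0 subr0 normrN; case: ifP => _; rewrite ?normr0// rV_coord_le.
have E : u (x + v) - u x - dirD u x v =
    \sum_(k < n) (u (stair x v k.+1) - u (stair x v k) - v 0 k * partial k u x).
  rewrite sumrB; congr (_ - _).
  rewrite -(big_mkord xpredT (fun k => u (stair x v k.+1) - u (stair x v k))) telescope_sumr//.
  by congr (u _ - u _); apply/rowP => j; rewrite !mxE ?ltn_ord// ltn0 addr0.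
rewrite E (le_trans (ler_norm_sum _ _ _))//.
apply: le_trans (ler_sum _ (fun k _ => step k)) _.
rewrite sumr_const card_ord -[leLHS]mulr_natl mulrA ler_wpM2r// mulrCA ler_piMr ?(ltW e0)//.
by rewrite ler_pdivrMr// mul1r ler_nat leqnSn.
Qed.

Lemma line_derive u x v : C1 u -> forall s,
  is_derive s (1 : R) (fun s => u (x + s *: v)) (dirD u (x + s *: v) v).
Proof.
move=> cu s; apply: is_derive_lim => e e0.
have v1 : 0 < `|v| + 1 by rewrite ltr_wpDl.
have [del del0 H] := C1_increment (x + s *: v) cu (divr_gt0 e0 v1).
have h0 : 0 < del / (`|v| + 1) by rewrite divr_gt0.
near=> h.
have hd : `|h| <= del / (`|v| + 1) by near: h; exact: nbhs0_leR.
have hv : `|h *: v| <= del.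
  rewrite normrZ (le_trans (ler_wpM2r (normr_ge0 v) hd))// -mulrA ler_piMr ?(ltW del0)//.
  by rewrite mulrC ler_pdivrMr// mul1r lerDl.
have := H _ hv; rewrite -[x + _ + _]addrA -scalerDl normrZ.
have -> : dirD u (x + s *: v) (h *: v) = h * dirD u (x + s *: v) v.
  by rewrite /dirD mulr_sumr; apply: eq_bigr => i _; rewrite mxE mulrA.
move=> /le_trans; apply; rewrite mulrCA mulrC ler_wpM2r//.
by rewrite -mulrA ler_piMr ?(ltW e0)// mulrC ler_pdivrMr// mul1r lerDl.
Unshelve. all: by end_near. Qed.

Lemma C1_continuous u : C1 u -> continuous u.
Proof.
move=> cu; apply/continuous_rVP => x e e0.
have [del del0 H] := C1_increment x cu ltr01.
pose K := 1 + \sum_i `|partial i u x|.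
have K0 : 0 < K by rewrite ltr_wpDr// sumr_ge0.
near=> y; rewrite distrC.
have yd : `|y - x| <= del by rewrite distrC; near: y; apply: cvgr_dist_le.
have ye : `|y - x| <= e / K.
  by rewrite distrC; near: y; apply: cvgr_dist_le => //; rewrite divr_gt0.
have := H _ yd; rewrite (addrC x) subrK mul1r => h.
have : `|dirD u x (y - x)| <= (\sum_i `|partial i u x|) * `|y - x|.
  rewrite mulr_suml (le_trans (ler_norm_sum _ _ _))//; apply: ler_sum => i _.
  by rewrite normrM mulrC ler_wpM2l// rV_coord_le.
move=> h2; have := ler_normD (u y - u x - dirD u x (y - x)) (dirD u x (y - x)).
rewrite subrK => /le_trans; apply; apply: le_trans (lerD h h2) _.
rewrite -{1}[`|y - x|]mul1r -mulrDl -/K mulrC -ler_pdivlMr//.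
Unshelve. all: by end_near. Qed.

Definition C2 u := C1 u /\ forall i, C1 (partial i u).

Lemma is_C2_C2 u : (forall k : nat, (0 < k)%N -> is_C2 (@eball R n k%:R) u) -> C2 u.
Proof.
move=> H.
have K x : exists2 k : nat, (0 < k)%N & @eball R n k%:R x.
  exists (Num.truncn (enorm x)).+1 => //=; exact: truncnS_gt.
split; first split.
- by move=> x i; have [k k0 kx] := K x; have [/(_ i)[]] := H k k0 x kx.
- by move=> i x; have [k k0 kx] := K x; have [/(_ i)[]] := H k k0 x kx.
- move=> i; split.
    by move=> x j; have [k k0 kx] := K x; have [_ /(_ i j)[]] := H k k0 x kx.
  by move=> j x; have [k k0 kx] := K x; have [_ /(_ i j)[]] := H k k0 x kx.
Qed.

Definition hessq u x v : R := \sum_i \sum_j v 0 i * v 0 j * partial j (partial i u) x.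

Lemma line_derive2 u x v : C2 u -> forall s,
  is_derive s (1 : R) (fun s => dirD u (x + s *: v) v) (hessq u (x + s *: v) v).
Proof.
move=> [_ c2] s; rewrite /dirD /hessq.
have := @is_derive_sum R R R n (fun i => (fun s => v 0 i * partial i u (x + s *: v))) s 1
  (fun i => v 0 i * dirD (partial i u) (x + s *: v) v).
have -> : \sum_(i < n) (fun s0 : R => v 0 i * partial i u (x + s0 *: v)) =
   (fun s => \sum_i v 0 i * partial i u (x + s *: v)).
  by apply/funext => z; rewrite fct_sumE.
have -> : \sum_(i < n) v 0 i * dirD (partial i u) (x + s *: v) v =
   \sum_i \sum_j v 0 i * v 0 j * partial j (partial i u) (x + s *: v).
  by apply: eq_bigr => i _; rewrite mulr_sumr; apply: eq_bigr => j _; rewrite mulrA.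
apply=> i.
have := line_derive x v (c2 i) s => h.
exact: is_derive_scale.
Qed.

Lemma second_difference u x v (h : R) : C2 u -> 0 < h -> exists2 th, `|th| <= h &
  u (x + h *: v) + u (x - h *: v) - 2 * u x = h ^+ 2 * hessq u (x + th *: v) v.
Proof.
move=> c2 h0.
pose phi s := u (x + s *: v); pose dphi s := dirD u (x + s *: v) v.
have dphiE s : is_derive s (1 : R) phi (dphi s) by exact: (line_derive x v c2.1 s).
have d2phiE s : is_derive s (1 : R) dphi (hessq u (x + s *: v) v) by exact: line_derive2.
(* K is chosen so that [chi] vanishes at 0 and at h. Rolle's theorem gives dphi c - dphi (- c) = 2 K
   c, and the mean value theorem on [-c, c] identifies K as a second derivative. *)
pose K := (phi h + phi (- h) - 2 * phi 0) / h ^+ 2.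
pose chi s := phi s + phi (- s) - 2 * phi 0 - K * s ^+ 2.
have dchi s : is_derive s (1 : R) chi (dphi s - dphi (- s) - 2 * K * s).
  have dN : is_derive s (1 : R) (fun s => phi (- s)) (dphi (- s) * -1).
    have : is_derive s (1 : R) (-%R : R -> R) (-1).
      by have := is_deriveN (@is_derive_id R R s 1); rewrite (_ : - id = -%R).
    exact: (is_derive1_comp (f := phi) (g := -%R)).
  have := is_deriveB (is_deriveB (is_deriveD (dphiE s) dN) (is_derive_cst (2 * phi 0) s 1))
     (is_derive_square K s).
  move=> D; have D' : is_derive s (1 : R) chi _ := D; apply: (is_derive_eq D').
  by rewrite mulrN1 subr0.
have chi0 : chi 0 = 0 by rewrite /chi oppr0; ring.
have chih : chi h = 0.
  by rewrite /chi /K divfK ?subrr// expf_neq0// gt_eqF.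
have [c] := @Rolle R chi 0 h h0 (fun s _ => ltac:(by have [] := dchi s))
  (continuous_subspaceT (fun s => differentiable_continuous ((derivable1_diffP _ _).1 (@ex_derive _ _ _ _ _ _ _ (dchi s)))))
  (etrans chi0 (esym chih)).
rewrite in_itv/= => /andP[c0 ch] dc.
have E0 : dphi c - dphi (- c) - 2 * K * c = 0.
  by rewrite -(@derive_val _ _ _ _ _ _ _ (dchi c)) (@derive_val _ _ _ _ _ _ _ dc).
have [th thc E] := mvt (- c) c d2phiE.
have KE : K = hessq u (x + th *: v) v.
  move/eqP: E0; rewrite subr_eq0 E => /eqP E0.
  have c2n : 2 * c != 0 by rewrite mulf_neq0 ?gt_eqF.
  apply: (mulIf c2n); rewrite mulrCA mulrA -E0; ring.
exists th.
  have c01 : - c <= c by rewrite ge0_cp// ltW.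
  move: thc; rewrite min_l// max_r// => /andP[t1 t2]; rewrite ler_norml.
  by rewrite (le_trans t2 (ltW ch)) andbT; apply: le_trans t1; rewrite lerN2 ltW.
rewrite -KE /K [RHS]mulrC divfK ?expf_neq0 ?gt_eqF//.
by rewrite /phi scale0r addr0 scaleNr.
Qed.

(** The double difference over a square of side h is symmetric in i and j. Two mean value theorems,
    taken in either order, express it as h^2 times one or the other mixed derivative near x. *)
Lemma partialC u x i j : C2 u -> partial j (partial i u) x = partial i (partial j u) x.
Proof.
move=> [c1 c2].
pose D (h : R) := u (x + h *: ebase R i + h *: ebase R j) - u (x + h *: ebase R i)
   - u (x + h *: ebase R j) + u x.
have key k l (h : R) : exists a b : R, [/\ `|a| <= `|h|, `|b| <= `|h| &
    u (x + h *: ebase R k + h *: ebase R l) - u (x + h *: ebase R k)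
   - u (x + h *: ebase R l) + u x = h ^+ 2 * partial l (partial k u) (x + a *: ebase R k + b *: ebase R l)].
  pose g s := u ((x + h *: ebase R l) + s *: ebase R k) - u (x + s *: ebase R k).
  have dg s : is_derive s (1 : R) g (partial k u ((x + h *: ebase R l) + s *: ebase R k) - partial k u (x + s *: ebase R k)).
    apply: is_deriveB; exact: (derivable_line (fun s => c1.1 _ k)).
  have [a ah E] := mvt0 h dg.
  have [b bh E2] := mvt0 h (derivable_line (fun s => (c2 k).1 ((x + a *: ebase R k) + s *: ebase R l) l)).
  exists a, b; split => //.
  have -> : u (x + h *: ebase R k + h *: ebase R l) - u (x + h *: ebase R k)
   - u (x + h *: ebase R l) + u x = g h - g 0.
    by rewrite /g !scale0r !addr0 (addrAC x); ring.
  rewrite E (addrAC x) -/(partial _ _ _).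
  rewrite [in LHS](_ : partial k u (x + a *: ebase R k + h *: ebase R l) - partial k u (x + a *: ebase R k) =
    partial l (partial k u) (x + a *: ebase R k + b *: ebase R l) * h); first by ring.
  by rewrite -E2 scale0r addr0.
have near_eq k l e : 0 < e -> exists2 del, 0 < del & forall a b : R, `|a| <= del -> `|b| <= del ->
    `|partial l (partial k u) (x + a *: ebase R k + b *: ebase R l) - partial l (partial k u) x| <= e.
  move=> e0; have /continuous_rVP/(_ x e e0)/nbhs_ballP[del del0 H] := (c2 k).2 l.
  exists (del / 3) => [|a b ad bd]; first by rewrite divr_gt0.
  rewrite distrC; apply: H; rewrite -ball_normE /=.
  rewrite -addrA opprD addrA subrr sub0r normrN.
  apply: (@le_lt_trans _ _ (del / 3 + del / 3)); last by move: del0 => /=; lra.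
  apply: le_trans (ler_normD _ _) _; rewrite !normrZ.
  have eb m : `|ebase R m : 'rV[R]_n| <= 1.
    by apply: rV_norm_le => // p; rewrite ebaseE; case: (_ == _); rewrite ?normr1 ?normr0.
  by apply: lerD; rewrite -[leRHS]mulr1; exact: ler_pM.
apply/eqP; rewrite -subr_eq0 -normr_eq0 eq_le normr_ge0 andbT; apply/ler_addgt0Pr => e e0; rewrite add0r.
have e2 : 0 < e / 2 by rewrite divr_gt0.
have [d1 d10 H1] := near_eq i j _ e2; have [d2 d20 H2] := near_eq j i _ e2.
pose h := Num.min d1 d2; have h0 : 0 < h by rewrite lt_min d10.
have hn : `|h| = h by rewrite ger0_norm// ltW.
have hd1 : h <= d1 by rewrite ge_min lexx.
have hd2 : h <= d2 by rewrite ge_min lexx orbT.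
have [a [b [ah bh E1]]] := key i j h; have [a' [b' [ah' bh' E2]]] := key j i h.
rewrite hn in ah bh ah' bh'.
apply: (@close_eq _ (partial j (partial i u) (x + a *: ebase R i + b *: ebase R j)) _
  (partial i (partial j u) (x + a' *: ebase R j + b' *: ebase R i))).
- by apply: H1; [exact: le_trans ah hd1|exact: le_trans bh hd1].
- by apply: H2; [exact: le_trans ah' hd2|exact: le_trans bh' hd2].
apply: (mulfI (_ : h ^+ 2 != 0)); first by rewrite expf_neq0// gt_eqF.
refine (etrans (esym E1) (etrans _ E2)).
have -> : x + h *: ebase R j + h *: ebase R i = x + h *: ebase R i + h *: ebase R j.
  by rewrite -!addrA [h *: ebase R j + _]addrC.
move: (u _) (u (x + h *: _)) (u (x + h *: _)) => A B C'.
by rewrite [A - B - _]addrAC.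
Qed.

End Calculus.

(** * Integrals of compactly supported functions and construction of test functions *)

Section CompactIntegral1.
Context (R : realType).
Notation mu := (@lebesgue_measure R).
Implicit Types (f g : R -> R).

Definition csupp1 (r : R) f := continuous f /\ forall s, r < `|s| -> f s = 0.

Lemma csupp1_int r f : csupp1 r f ->
  \int[mu]_(s in setT) f s = \int[mu]_(s in `[- r, r]) f s.
Proof.
move=> [_ f0]; rewrite [RHS]Rintegral_mkcond; congr (fine _); apply: eq_integral => s _.
rewrite /patch; case: ifPn => //; rewrite notin_setE /= in_itv/= => h; rewrite f0// ltNge.
by apply/negP; rewrite ler_norml.
Qed.

Lemma mu_itv_fin (a b : R) : (mu `[a, b]%classic < +oo)%E.
Proof. by rewrite lebesgue_measure_itv/=; case: ifP => _; rewrite ?ltry// -EFinB ltry. Qed.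
Lemma continuous_measurable_itv f a b : continuous f -> measurable_fun (`[a, b] : set R) f.
Proof. by move=> cf; apply: measurable_funTS; exact: continuous_measurable_fun. Qed.

Lemma itv_integrable f a b : continuous f ->
  mu.-integrable `[a, b] (EFin \o f).
Proof.
move=> cf; apply: continuous_compact_integrable; first exact: segment_compact.
exact: continuous_subspaceT.
Qed.

Lemma int1_bound r f M : 0 <= r -> csupp1 r f -> (forall s, `|f s| <= M) ->
  `|\int[mu]_(s in setT) f s| <= M * (2 * r).
Proof.
move=> r0 cf fM; rewrite (csupp1_int cf).
have mr : mu `[- r, r]%classic = (2 * r)%:E.
  rewrite lebesgue_measure_itv/= lte_fin; case: ltP => h.
    by rewrite -EFinB opprK -mulr2n mulr_natl.
  have -> : r = 0 by lra.
  by rewrite mulr0.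
apply: le_trans (le_normr_Rintegral _ (itv_integrable _ _ cf.1)) _ => //.
apply: le_trans (le_Rintegral (f2 := fun=> M) _ _ _ _) _ => //.
- apply: itv_integrable => x; apply: cvg_norm; exact: cf.1.
- exact: itv_integrable (fun x => cvg_cst _).
by rewrite Rintegral_cst//= mr.
Qed.

Lemma int1_lin r f g c : csupp1 r f -> csupp1 r g ->
  \int[mu]_(s in setT) (f s + c * g s) = \int[mu]_(s in setT) f s + c * \int[mu]_(s in setT) g s.
Proof.
move=> cf cg.
have ch : csupp1 r (fun s => f s + c * g s).
  split=> [x|s rs]; last by rewrite cf.2// cg.2// mulr0 addr0.
  by apply: cvgD; [exact: cf.1|apply: cvgM; [exact: cvg_cst|exact: cg.1]].
rewrite (csupp1_int ch) (csupp1_int cf) (csupp1_int cg) RintegralD//.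
- by rewrite RintegralZl//; exact: itv_integrable cg.1.
- exact: itv_integrable cf.1.
- apply: itv_integrable => x; apply: cvgM; [exact: cvg_cst|exact: cg.1].
Qed.

Lemma int1_pos r f s0 : csupp1 r f -> (forall s, 0 <= f s) -> 0 < f s0 ->
  0 < \int[mu]_(s in setT) f s.
Proof.
move=> cf f0 fs; pose e := f s0 / 2.
have e0 : 0 < e by rewrite divr_gt0.
have /cvgrPdist_lt/(_ e e0)/nbhs_ballP[del /= del0 H] := cf.1 s0.
pose a := s0 - del / 2; pose b := s0 + del / 2.
have d2 : 0 < del / 2 by rewrite divr_gt0.
have fe s : a <= s <= b -> e <= f s.
  move=> /andP[as_ sb]; have : `|f s0 - f s| < e.
    by apply: H; rewrite -ball_normE /= ltr_norml; rewrite /a /b in as_ sb; apply/andP; split; lra.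
  rewrite /e ltr_norml => /andP[]; lra.
pose rr := Num.max r (`|s0| + del).
have cf' : csupp1 rr f by split; [exact: cf.1|move=> s; rewrite gt_max => /andP[/cf.2]].
rewrite (csupp1_int cf').
have sub : `[a, b] `<=` `[- rr, rr].
  move=> s; rewrite /= !in_itv/= => /andP[as_ sb].
  rewrite -ler_norml le_max; apply/orP; right.
  have -> : s = s0 + (s - s0) by rewrite addrC subrK.
  apply: le_trans (ler_normD _ _) _; rewrite lerD2l ler_norml; rewrite /a /b in as_ sb.
  by apply/andP; split; lra.
have intf := itv_integrable (- rr) rr cf.1.
have : \int[mu]_(s in `[a, b]) f s <= \int[mu]_(s in `[- rr, rr]) f s.
  rewrite -lee_fin /Rintegral !fineK ?integrable_fin_num//.
    apply: ge0_subset_integral => //.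
      by apply/measurable_EFinP; apply: continuous_measurable_itv; exact: cf.1.
    by move=> *; rewrite lee_fin.
  exact: itv_integrable cf.1.
apply: lt_le_trans.
apply: (@lt_le_trans _ _ (\int[mu]_(s in `[a, b]) e)).
  rewrite Rintegral_cst//= lebesgue_measure_itv/= lte_fin.
  rewrite ifT; last by rewrite /a /b; lra.
  by rewrite -EFinB/= mulr_gt0// /a /b; lra.
apply: le_Rintegral => //.
- exact: itv_integrable (fun x => cvg_cst _).
- exact: itv_integrable cf.1.
Qed.

(** Translation invariance, from the fact that Lebesgue measure is determined by its values on
    half-open intervals. *)
Lemma int1_shift f c : measurable_fun setT f ->
  \int[mu]_(s in setT) f (s + c) = \int[mu]_(s in setT) f s.
Proof.
move=> mf; congr fine.
pose phi : measurableTypeR R -> measurableTypeR R := fun s => s + c.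
have mphi : measurable_fun setT phi by apply: measurable_funD.
have muE A : measurable A -> mu A = pushforward mu phi A.
  move=> mA; apply: lebesgue_measure_unique => //= _ [[a b]] _ <-.
  have E : phi @^-1` `]a, b] = `]a - c, b - c]%classic.
    by apply/seteqP; split=> s; rewrite /= !in_itv/= ltrBlDr lerBrDr.
  rewrite /pushforward E !lebesgue_measure_itv/= !lte_fin ltrD2r.
  by case: ifP => // _; rewrite -!EFinB; congr EFin; ring.
have pE h : measurable_fun setT h -> (forall s, (0 <= h s)%E) ->
    (\int[mu]_s h s = \int[mu]_s h (phi s))%E.
  move=> mh h0; rewrite -[RHS](@ge0_integral_pushforward _ _ _ _ _ _ mphi mu setT h)//.
  by apply: eq_measure_integral => A mA _; exact: muE.
rewrite integralE [RHS]integralE; congr (_ - _)%E; apply/esym.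
  rewrite pE//; first by apply: eq_integral => s _; rewrite !funeposE.
  exact/measurable_funepos/measurable_EFinP.
rewrite pE//; first by apply: eq_integral => s _; rewrite !funenegE.
exact/measurable_funeneg/measurable_EFinP.
Qed.

End CompactIntegral1.

Lemma box_max (R : realType) n (u : 'rV[R]_n -> R) r : 0 <= r -> continuous u ->
  exists2 c, `|c| <= r & forall y, `|y| <= r -> u y <= u c.
Proof.
move=> r0 cu.
pose A := [set v : 'rV[R]_n | forall i, `[- r, r]%classic (v ord0 i)].
have AE v : v \in A <-> `|v| <= r.
  rewrite inE; split=> [Av|vr i]; last by rewrite /= in_itv/= -ler_norml (le_trans (rV_coord_le _ _)).
  by apply: rV_norm_le => // i; have := Av i; rewrite /= in_itv/= -ler_norml.
have [||c cA H] := @EVT_max_rV R n u A _ (@rV_compact R n (fun=> `[- r, r]%classic) (fun=> @segment_compact R _ _)).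
- by exists 0 => i; rewrite mxE /= in_itv/= oppr_le0 r0.
- exact: continuous_subspaceT.
by exists c => [|y yr]; [exact/AE|apply/H/AE].
Qed.

Lemma contD (R : realType) (T : topologicalType) (f g : T -> R) :
  continuous f -> continuous g -> continuous (fun y => f y + g y).
Proof. by move=> cf cg y; apply: cvgD; [exact: cf|exact: cg]. Qed.
Lemma continuous_fctM (R : realType) (T : topologicalType) (f g : T -> R) :
  continuous f -> continuous g -> continuous (fun y => f y * g y).
Proof. by move=> cf cg y; apply: cvgM; [exact: cf|exact: cg]. Qed.
Lemma continuous_fct_cst (R : realType) (T : topologicalType) (c : R) : continuous (fun _ : T => c).
Proof. by move=> y; exact: cvg_cst. Qed.
Lemma contZ (R : realType) (T : topologicalType) (c : R) (f : T -> R) : continuous f ->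
  continuous (fun y => c * f y).
Proof. by move=> cf; apply: continuous_fctM => //; exact: continuous_fct_cst. Qed.

Lemma continuous_fct_sum (R : realType) (T : topologicalType) (I : Type) (s : seq I) (f : I -> T -> R) :
  (forall i, continuous (f i)) -> continuous (fun y => \sum_(i <- s) f i y).
Proof.
move=> cf; elim: s => [|i s IH].
  rewrite (_ : (fun _ => _) = fun=> 0); first exact: continuous_fct_cst.
  by apply/funext => y; rewrite big_nil.
under eq_fun do rewrite big_cons.
exact: contD.
Qed.

Lemma continuous_shift (R : realType) (V : normedModType R) (f : V -> R) (v : V) :
  continuous f -> continuous (fun y => f (y + v)).
Proof.
by move=> cf x; apply: continuous_comp; [apply: cvgD; [exact: cvg_id|exact: cvg_cst]|exact: cf].
Qed.
Arguments continuous_shift [R V f] v _.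

Section CompactIntegral.
Context (R : realType).

Definition csupp n (r : R) (f : 'rV[R]_n -> R) := continuous f /\ forall y, r < `|y| -> f y = 0.

Lemma csupp_bounded n r (f : 'rV[R]_n -> R) : 0 <= r -> csupp r f ->
  exists2 M, 0 <= M & forall y, `|f y| <= M.
Proof.
move=> r0 [cf f0].
have [c cr H] := box_max r0 (fun x => cvg_norm (cf x) : _ --> _).
by exists `|f c| => // y; have [/H//|/f0->] := leP `|y| r; rewrite normr0.
Qed.

Lemma csuppW n r r' (f : 'rV[R]_n -> R) : r <= r' -> csupp r f -> csupp r' f.
Proof. by move=> rr [cf f0]; split=> // y /(le_lt_trans rr)/f0. Qed.

Lemma csuppMl n r (f g : 'rV[R]_n -> R) : continuous f -> csupp r g -> csupp r (fun y => f y * g y).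
Proof.
by move=> cf [cg g0]; split=> [|y /g0->]; [exact: continuous_fctM|rewrite mulr0].
Qed.

Lemma csuppD n r (f g : 'rV[R]_n -> R) : csupp r f -> csupp r g -> csupp r (fun y => f y + g y).
Proof.
move=> [cf f0] [cg g0]; split=> [|y yr]; last by rewrite f0// g0// addr0.
exact: contD.
Qed.

Lemma csupp_shift n r (f : 'rV[R]_n -> R) v : csupp r f -> csupp (r + `|v|) (fun y : 'rV[R]_n => f (y + v)).
Proof.
move=> [cf f0]; split=> [|y h]; first exact: continuous_shift.
rewrite f0//; have := ler_normB (y + v) v; rewrite addrK => /(lt_le_trans h).
by rewrite ltrD2r.
Qed.

(** Has the shape of the argument built by [integral_rV], so that slices unfold by conversion. *)
Definition rc n (s : R) (y : 'rV[R]_n) : 'rV[R]_n.+1 := row_mx (const_mx s : 'rV[R]_1) y.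

Lemma rc0 n s (y : 'rV[R]_n) : rc s y 0 ord0 = s.
Proof.
have -> : (ord0 : 'I_n.+1) = lshift n (ord0 : 'I_1) by exact: val_inj.
by rewrite -[LHS]/(row_mx (const_mx s : 'rV_1) y 0 (lshift n ord0)) row_mxEl mxE.
Qed.

Lemma rcS n s (y : 'rV[R]_n) (i : 'I_n) : rc s y 0 (lift ord0 i) = y 0 i.
Proof. have -> : lift ord0 i = rshift 1 i by exact: val_inj.
by rewrite -[LHS]/(row_mx (const_mx s : 'rV_1) y 0 (rshift 1 i)) row_mxEr. Qed.

Lemma rc_norm1 n s (y : 'rV[R]_n) : `|s| <= `|rc s y|.
Proof. by have := rV_coord_le (rc s y) ord0; rewrite rc0. Qed.

Lemma rc_norm2 n s (y : 'rV[R]_n) : `|y| <= `|rc s y|.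
Proof.
by apply: rV_norm_le => // i; have := rV_coord_le (rc s y) (lift ord0 i); rewrite rcS.
Qed.

Lemma rcD n s t (y z : 'rV[R]_n) : rc s y + rc t z = rc (s + t) (y + z).
Proof. by apply/rowP => i; rewrite mxE; case: (unliftP ord0 i) => [j|] ->; rewrite ?rc0// !rcS mxE. Qed.
Lemma rc_surj n (y : 'rV[R]_n.+1) : y = rc (y 0 ord0) (\row_i y 0 (lift ord0 i)).
Proof. by apply/rowP => i; case: (unliftP ord0 i) => [j|] ->; rewrite ?rc0// rcS mxE. Qed.

Lemma csupp_slice n r (f : 'rV[R]_n.+1 -> R) s : csupp r f -> csupp r (fun y => f (rc s y)).
Proof.
move=> [cf f0]; split=> [|y yr]; last by rewrite f0// (lt_le_trans yr) ?rc_norm2.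
move=> y; apply: (@continuous_comp _ _ _ (rc s) f); last exact: cf.
apply: (@cvg_rV _ _ _ (nbhs y) (nbhs_filter y)) => i; case: (unliftP ord0 i) => [j|] ->.
  rewrite rcS; under eq_fun do rewrite rcS; exact: coord_continuous.
by rewrite rc0; under eq_fun do rewrite rc0; exact: cvg_cst.
Qed.

Lemma integral_rVS n (f : 'rV[R]_n.+1 -> R) :
  integral_rV f = \int[@lebesgue_measure R]_(s in setT) integral_rV (fun y => f (rc s y)).
Proof. by []. Qed.

(** Bound and convergence go through one induction: the outer integral needs a slice integral that
    is continuous, which follows from convergence in dimension n, and compactly supported, which
    follows from the bound with M = 0. *)
Lemma integral_rV_cvg n (r : R) : 0 <= r ->
  (forall f M, @csupp n r f -> (forall y, `|f y| <= M) -> `|integral_rV f| <= M * (2 * r) ^+ n) /\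
  (forall f_ f M, (forall k : nat, @csupp n r (f_ k)) -> csupp r f ->
     (forall k y, `|f_ k y| <= M) -> (forall y, f_ k y @[k --> \oo] --> f y) ->
     integral_rV (f_ k) @[k --> \oo] --> integral_rV f).
Proof.
move=> r0; elim: n => [|n [IH1 IH2]].
  by split=> [f M _ fM|f_ f M _ _ _ fc]; [rewrite expr0 mulr1; exact: fM|exact: fc].
have slice1 f : csupp r f -> csupp1 r (fun s => integral_rV (fun y => f (@rc n s y))).
  move=> cf; have [M M0 fM] := csupp_bounded r0 cf.
  split=> [s|s sr].
    apply: cvg_seq_nbhs => u us.
    apply: (IH2 (fun k y => f (rc (u k) y)) _ M) => //.
    - by move=> k; exact: csupp_slice.
    - exact: csupp_slice.
    - move=> y; apply: (@cvg_comp _ _ _ (fun k => rc (u k) y) f _ (nbhs (rc s y))); last exact: cf.1.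
      apply: cvg_rV => i; case: (unliftP ord0 i) => [j|] ->.
        by rewrite rcS; under eq_fun do rewrite rcS; exact: cvg_cst.
      by rewrite rc0; under eq_fun do rewrite rc0.
  have := IH1 (fun y => f (rc s y)) 0 (csupp_slice s cf).
  rewrite mul0r => H; apply/eqP; rewrite -normr_eq0 eq_le normr_ge0 andbT; apply: H => y.
  by rewrite cf.2 ?normr0// (lt_le_trans sr)// rc_norm1.
split=> [f M cf fM|f_ f M cf_ cf fM fc].
  have -> : M * (2 * r) ^+ n.+1 = M * (2 * r) ^+ n * (2 * r) by rewrite exprSr !mulrA.
  rewrite integral_rVS; apply: (int1_bound r0 (slice1 _ cf)).
  by move=> s; apply: IH1 => [|y]; [exact: csupp_slice|exact: fM].
rewrite integral_rVS (csupp1_int (slice1 _ cf)).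
under eq_fun do rewrite integral_rVS (csupp1_int (slice1 _ (cf_ _))).
apply: (bdd_cvg_Rintegral (C := M * (2 * r) ^+ n)) => //.
- exact: mu_itv_fin.
- by move=> k; apply: continuous_measurable_itv; exact: (slice1 _ (cf_ k)).1.
- by move=> s _; apply: (IH2 _ _ M) => // [k|]; exact: csupp_slice.
- by move=> k s _; apply: IH1 => [|y]; [exact: csupp_slice|exact: fM].
Qed.

Lemma csupp1_slice n r (f : 'rV[R]_n.+1 -> R) : 0 <= r -> csupp r f ->
  csupp1 r (fun s => integral_rV (fun y => f (rc s y))).
Proof.
move=> r0 cf; have [M M0 fM] := csupp_bounded r0 cf.
have [IH1 IH2] := @integral_rV_cvg n r r0.
split=> [s|s sr].
  apply: cvg_seq_nbhs => u us.
  apply: (IH2 (fun k y => f (rc (u k) y)) _ M) => //.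
  - by move=> k; exact: csupp_slice.
  - exact: csupp_slice.
  - move=> y; apply: (@cvg_comp _ _ _ (fun k => rc (u k) y) f _ (nbhs (rc s y))); last exact: cf.1.
    apply: cvg_rV => i; case: (unliftP ord0 i) => [j|] ->.
      by rewrite rcS; under eq_fun do rewrite rcS; exact: cvg_cst.
    by rewrite rc0; under eq_fun do rewrite rc0.
have := IH1 (fun y => f (rc s y)) 0 (csupp_slice s cf).
rewrite mul0r => H; apply/eqP; rewrite -normr_eq0 eq_le normr_ge0 andbT; apply: H => y.
by rewrite cf.2 ?normr0// (lt_le_trans sr)// rc_norm1.
Qed.

Lemma integral_rV_lin n r (f g : 'rV[R]_n -> R) c : 0 <= r -> csupp r f -> csupp r g ->
  integral_rV (fun y => f y + c * g y) = integral_rV f + c * integral_rV g.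
Proof.
move=> r0; elim: n f g => [//|n IH] f g cf cg.
rewrite !integral_rVS -(int1_lin c (csupp1_slice r0 cf) (csupp1_slice r0 cg)).
by congr (fine _); apply: eq_integral => s _; rewrite IH//; exact: csupp_slice.
Qed.

Lemma integral_rV_ge0 n (f : 'rV[R]_n -> R) : (forall y, 0 <= f y) -> 0 <= integral_rV f.
Proof.
elim: n f => [|n IH] f f0; first exact: f0.
by rewrite integral_rVS; apply: Rintegral_ge0 => s _; exact: IH.
Qed.

Lemma integral_rV_pos n r (f : 'rV[R]_n -> R) y : 0 <= r -> csupp r f -> (forall y, 0 <= f y) ->
  0 < f y -> 0 < integral_rV f.
Proof.
move=> r0; elim: n f y => [|n IH] f y cf f0 fy.
  by rewrite /= (_ : 0 = y)//; apply/rowP => -[].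
rewrite integral_rVS; apply: (int1_pos (s0 := y 0 ord0) (csupp1_slice r0 cf)).
  by move=> s; apply: integral_rV_ge0.
apply: (IH _ (\row_i y 0 (lift ord0 i))) => //; first exact: csupp_slice.
by rewrite -rc_surj.
Qed.

Lemma integral_rV_shift n r (f : 'rV[R]_n -> R) v : 0 <= r -> csupp r f ->
  integral_rV (fun y : 'rV[R]_n => f (y + v)) = integral_rV f.
Proof.
move=> r0; elim: n f v => [|n IH] f v cf.
  by rewrite /=; congr f; apply/rowP => -[].
rewrite integral_rVS [RHS]integral_rVS.
rewrite -(int1_shift (v 0 ord0) (continuous_measurable_fun (csupp1_slice r0 cf).1)).
congr (fine _); apply: eq_integral => s _; congr EFin.
rewrite -(IH _ (\row_i v 0 (lift ord0 i)) (csupp_slice _ cf)).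
by congr integral_rV; apply/funext => y; rewrite {1}(rc_surj v) rcD.
Qed.

End CompactIntegral.

Section Bump.
Context (R : realType).

(** The classical flat function exp (- 1 / s) times powers of 1 / s. The powers make the family
    closed under differentiation, up to linear combinations. *)
Definition bexp (k : nat) (s : R) : R := if 0 < s then s^-1 ^+ k * expR (- s^-1) else 0.

(** From exp x >= x^(k+2) / (k+2)! at x = 1 / s. The quadratic bound gives the zero derivative at
    the origin. *)
Lemma bexp_bound k s : `|bexp k s| <= k.+2`!%:R * s ^+ 2.
Proof.
rewrite /bexp; case: ltP => s0; last by rewrite normr0 mulr_ge0 ?sqr_ge0.
have x0 : 0 < s^-1 by rewrite invr_gt0.
rewrite ger0_norm ?mulr_ge0 ?exprn_ge0 ?expR_ge0// ?(ltW x0)//.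
rewrite expRN ler_pdivrMr ?expR_gt0//.
have := expR_ge1Dxn k.+1 (ltW x0) => h.
have {}h : s^-1 ^+ k.+2 / k.+2`!%:R <= expR s^-1 by apply: le_trans h; rewrite lerDr.
have c0 : 0 < k.+2`!%:R * s ^+ 2 :> R by rewrite mulr_gt0 ?ltr0n ?fact_gt0// exprn_gt0.
apply: le_trans (ler_wpM2l (ltW c0) h).
suff -> : k.+2`!%:R * s ^+ 2 * (s^-1 ^+ k.+2 / k.+2`!%:R) = s^-1 ^+ k by [].
have f0 : k.+2`!%:R != 0 :> R by rewrite pnatr_eq0 -lt0n fact_gt0.
rewrite -[k.+2 in X in _ * (X / _)]addn2 exprD.
move: (k.+2`!%:R) f0 (s^-1 ^+ k) => F F0 X; field.
by rewrite F0 gt_eqF.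
Qed.

Lemma bexp_ge0 k s : 0 <= bexp k s.
Proof. by rewrite /bexp; case: ltP => // s0; rewrite mulr_ge0 ?exprn_ge0 ?expR_ge0// invr_ge0 ltW. Qed.
Lemma is_derive_near (f g : R -> R) (x l : R) : (\forall y \near x, f y = g y) ->
  is_derive x (1 : R) f l -> is_derive x (1 : R) g l.
Proof. by move=> fg D; exact: (near_eq_is_derive fg D). Qed.

Lemma bexp_derive k s : is_derive s (1 : R) (bexp k) (bexp k.+2 s - k%:R * bexp k.+1 s).
Proof.
have [s0|s0|s0] := ltgtP s 0.
- rewrite /bexp !ltNge (ltW s0)/= mulr0 subr0.
  apply: (is_derive_near (f := fun=> 0)).
  have : \forall y \near s, y < 0 by exact: lt_nbhsl.
  by apply: filterS => y y0; rewrite ltNge (ltW y0).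
- have D1 : is_derive s (1 : R) (fun y : R => y^-1) (- s ^- 2).
    have := is_deriveV (f := id) (lt0r_neq0 s0) (is_derive_id s (1 : R)).
    by rewrite -[_ *: _]/(_ * _) mulr1.
  have D2 := is_deriveX k D1.
  have D3 : is_derive s (1 : R) (fun y : R => expR (- y^-1)) _ :=
    is_derive1_comp (is_derive_expR _) (is_deriveN D1).
  have := is_deriveM D2 D3.
  set l := (X in is_derive _ _ _ X) => D.
  apply: (is_derive_near (f := ((fun y : R => y^-1) ^+ k) * (fun y : R => expR (- y^-1)))).
    have : \forall y \near s, 0 < y by exact: lt_nbhsr.
    apply: filterS => y y0; rewrite /bexp y0.
    by rewrite -[LHS]/(_ * _) exprfctE.
  rewrite (_ : _ - _ = l)// /l /bexp s0 -![_ *: _]/(_ * _) exprfctE /=.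
  case: k {D2 l D} => [|k]; first by rewrite !expr0 !exprS expr0; field; rewrite gt_eqF.
  by rewrite !exprS -pred_Sn; field; rewrite gt_eqF.
- subst s; rewrite /bexp ltxx mulr0 subr0; apply: is_derive_lim => e e0; near=> h.
  rewrite add0r mulr0 subr0 ltxx subr0 -/(bexp k h).
  apply: le_trans (bexp_bound k h) _.
  rewrite -[h ^+ 2]real_normK ?num_real// expr2 mulrA ler_wpM2r//.
  have kf : 0 < k.+2`!%:R :> R by rewrite ltr0n fact_gt0.
  by rewrite mulrC -ler_pdivlMr//; near: h; apply: nbhs0_leR; rewrite divr_gt0.
Unshelve. all: by end_near. Qed.

Lemma derive_line0 n (u : 'rV[R]_n -> R) x v l :
  is_derive (0 : R) (1 : R) (fun s => u (x + s *: v)) l -> is_derive x v u l.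
Proof.
have E : (fun h : R => h^-1 *: (((fun s => u (x + s *: v)) \o shift 0) (h *: (1 : R)) - u (x + 0 *: v)))
    = (fun h => h^-1 *: ((u \o shift x) (h *: v) - u x)).
  apply/funext => h; rewrite scale0r addr0; congr (_ *: (u _ - _)) => /=.
  by rewrite -[h *: 1]/(h * 1) mulr1 addr0 addrC.
by case=> d dl; apply: DeriveDef; [move: d; rewrite /derivable E|rewrite -dl /derive E].
Qed.

(** A syntactic class containing the bumps and closed under partial derivatives, which settles all
    the iterated derivatives of a test function by one induction. *)
Inductive smooth n : ('rV[R]_n -> R) -> Prop :=
| smooth_cst c : smooth (fun=> c)
| smooth_bexp k a i c : smooth (fun y => bexp k (a * y 0 i + c))
| smooth_add f g : smooth f -> smooth g -> smooth (fun y => f y + g y)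
| smooth_mul f g : smooth f -> smooth g -> smooth (fun y => f y * g y).

Lemma smooth_diff n (f : 'rV[R]_n -> R) : smooth f -> forall x, differentiable f x.
Proof.
elim=> [c|k a i c|{}f g _ IHf _ IHg|{}f g _ IHf _ IHg] x.
- exact: differentiable_cst.
- apply: (@differentiable_comp _ _ _ _ (fun y : 'rV[R]_n => a * y 0 i + c) (bexp k)).
    apply: differentiableD; last exact: differentiable_cst.
    by apply: differentiableM; [exact: differentiable_cst|exact: differentiable_coord].
  by apply/derivable1_diffP; exact: (@ex_derive _ _ _ _ _ _ _ (bexp_derive _ _)).
- exact: differentiableD.
- exact: differentiableM.
Qed.

Lemma smooth_partial n (f : 'rV[R]_n -> R) j : smooth f -> smooth (partial j f).
Proof.
elim=> [c|k a i c|{}f g sf IHf sg IHg|{}f g sf IHf sg IHg].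
- rewrite (_ : partial _ _ = fun=> 0); first exact: smooth_cst.
  by apply/funext => x; exact: derive_cst.
- rewrite (_ : partial _ _ = fun x => a * (i == j)%:R * (bexp k.+2 (a * x 0 i + c) + - k%:R * bexp k.+1 (a * x 0 i + c))).
    apply: smooth_mul; first exact: smooth_cst.
    by apply: smooth_add; [|apply: smooth_mul; first exact: smooth_cst]; exact: smooth_bexp.
  apply/funext => x.
  have D : is_derive (0 : R) (1 : R) (fun s : R => bexp k (a * (x + s *: ebase R j) 0 i + c))
     (a * (i == j)%:R * (bexp k.+2 (a * x 0 i + c) + - k%:R * bexp k.+1 (a * x 0 i + c))).
    have E s : a * (x + s *: ebase R j) 0 i + c = a * (i == j)%:R * s + (a * x 0 i + c).
      by rewrite !mxE eqxx/=; ring.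
    under [X in is_derive _ _ X]eq_fun do rewrite E.
    have D1 : is_derive (0 : R) (1 : R) (fun s => a * (i == j)%:R * s + (a * x 0 i + c)) (a * (i == j)%:R).
      have := is_deriveD (is_derive_scale (a * (i == j)%:R) (is_derive_id (0 : R) (1 : R))) (is_derive_cst (a * x 0 i + c) (0 : R) (1 : R)).
      by rewrite mulr1 addr0.
    have D2 := bexp_derive k (a * (i == j)%:R * 0 + (a * x 0 i + c)).
    have := @is_derive1_comp _ (bexp k) (fun s => a * (i == j)%:R * s + (a * x 0 i + c)) 0 _ _ D2 D1.
    by rewrite mulr0 add0r [X in is_derive _ _ _ X]mulrC mulNr.
  have DD := @derive_line0 n (fun y => bexp k (a * y 0 i + c)) x (ebase R j) _ D.
  exact: (@derive_val _ _ _ _ _ _ _ DD).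
- rewrite (_ : partial _ _ = fun x => partial j f x + partial j g x); first exact: smooth_add.
  by apply/funext => x; rewrite /partial deriveD//; apply: diff_derivable; exact: smooth_diff.
- rewrite (_ : partial _ _ = fun x => f x * partial j g x + g x * partial j f x).
    by apply: smooth_add; exact: smooth_mul.
  by apply/funext => x; rewrite /partial deriveM//; apply: diff_derivable; exact: smooth_diff.
Qed.

Lemma smooth_C1 n (f : 'rV[R]_n -> R) : smooth f -> C1 f.
Proof.
move=> sf; split=> [x i|i x]; first by apply: diff_derivable; exact: smooth_diff.
by apply: differentiable_continuous; apply/smooth_diff/smooth_partial.
Qed.

Lemma smooth_C2 n (f : 'rV[R]_n -> R) : smooth f -> C2 f.
Proof. by move=> sf; split=> [|i]; apply: smooth_C1 => //; exact: smooth_partial. Qed.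

Lemma smooth_test n (f : 'rV[R]_n -> R) r : smooth f -> csupp r f -> 0 <= r -> test_function f.
Proof.
move=> sf [_ f0] r0; split.
  by move=> l; apply: smooth_diff; elim: l => //= i l; exact: smooth_partial.
(* Test functions vanish outside a Euclidean ball while [csupp] uses the sup norm: this is the
   Euclidean length of the corner (r, ..., r). *)
exists (Num.sqrt (\sum_(i < 1) \sum_(j < n) r ^+ 2)) => x rx; apply: f0.
rewrite ltNge; apply/negP => xr; move: rx; rewrite ltNge => /negP; apply.
rewrite /enorm ler_sqrt; last by rewrite sumr_ge0// => i _; rewrite sumr_ge0// => j _; exact: sqr_ge0.
apply: ler_sum => i _; apply: ler_sum => j _; rewrite (ord1 i) -[leLHS]real_normK ?num_real//.
by apply: lerXn2r; rewrite ?nnegrE ?(le_trans (rV_coord_le _ _)).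
Qed.

Definition bump n (c : 'rV[R]_n) r (y : 'rV[R]_n) : R :=
  \prod_i (bexp 0 (1 * y 0 i + (r - c 0 i)) * bexp 0 (-1 * y 0 i + (r + c 0 i))).

Lemma smooth_bump n (c : 'rV[R]_n) r : smooth (bump c r).
Proof.
rewrite /bump; elim: (index_enum _) => [|i l IH].
  rewrite (_ : (fun _ => _) = fun=> 1); first exact: smooth_cst.
  by apply/funext => y; rewrite big_nil.
under eq_fun do rewrite big_cons.
by apply: smooth_mul => //; apply: smooth_mul; exact: smooth_bexp.
Qed.

Lemma bump_ge0 n (c : 'rV[R]_n) r y : 0 <= bump c r y.
Proof. by apply: prodr_ge0 => i _; rewrite mulr_ge0 ?bexp_ge0. Qed.

Lemma bump_gt0 n (c : 'rV[R]_n) r : 0 < r -> 0 < bump c r c.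
Proof.
move=> r0; apply: prodr_gt0 => i _; rewrite mul1r mulN1r addrCA subrr addr0 addrCA addNr addr0.
by rewrite /bexp r0 expr0 mul1r mulr_gt0 ?expR_gt0.
Qed.

Lemma bump_supp n (c : 'rV[R]_n) r y : 0 <= r -> bump c r y != 0 -> `|y - c| <= r.
Proof.
move=> r0 /prodf_neq0 h; apply: rV_norm_le => // i; have := h i isT.
rewrite mulf_eq0 negb_or /bexp mul1r mulN1r !mxE => /andP[].
case: ltP => [h1 _|]; last by rewrite eqxx.
case: ltP => [h2 _|]; last by rewrite eqxx.
by rewrite ler_norml; apply/andP; split; lra.
Qed.

Lemma bump_csupp n (c : 'rV[R]_n) r : 0 <= r -> csupp (r + `|c|) (bump c r).
Proof.
move=> r0; split; first exact: C1_continuous (smooth_C1 (smooth_bump c r)).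
move=> y h; apply/eqP; apply: contraTT h => /(bump_supp r0) h; rewrite -leNgt.
by rewrite -[y](subrK c) (le_trans (ler_normD _ _))// lerD2r.
Qed.

End Bump.

(** * From the distributional inequality to a pointwise one *)

Section Distributional.
Context (R : realType) (n : nat).
Implicit Types (u a phi : 'rV[R]_n -> R) (v y : 'rV[R]_n).

Lemma derive_dirD u y v : C1 u -> 'D_v u y = dirD u y v.
Proof.
move=> cu; have := line_derive y v cu 0; rewrite scale0r addr0 => D.
exact: (@derive_val _ _ _ _ _ _ _ (derive_line0 D)).
Qed.

Lemma derive_hessq u y v : C2 u -> 'D_v ('D_v u) y = hessq u y v.
Proof.
move=> cu; have -> : 'D_v u = fun y => dirD u y v by apply/funext => z; rewrite derive_dirD//; exact: cu.1.
have := line_derive2 y v cu 0; rewrite scale0r addr0 => D.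
exact: (@derive_val _ _ _ _ _ _ _ (@derive_line0 R n (fun y => dirD u y v) _ _ _ D)).
Qed.

Lemma hessq_continuous u v : C2 u -> continuous (fun y => hessq u y v).
Proof.
move=> [_ cu]; apply: continuous_fct_sum => i; apply: continuous_fct_sum => j.
by apply: contZ; exact: (cu i).2.
Qed.

Definition diff2 u v y := u (y + v) + u (y - v) - 2 * u y.

Lemma diff2_hessq u y v k : C2 u -> exists2 th : R, `|th| <= k.+1%:R^-1 &
  k.+1%:R ^+ 2 * diff2 u (k.+1%:R^-1 *: v) y = hessq u (y + th *: v) v.
Proof.
move=> cu; have k0 : 0 < k.+1%:R^-1 :> R by rewrite invr_gt0.
have [th thk E] := second_difference y v cu k0.
by exists th => //; rewrite /diff2 E mulrA -exprMn mulfV ?expr1n ?mul1r.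
Qed.

Lemma diff2_cvg u : C2 u -> forall y v,
  k.+1%:R ^+ 2 * diff2 u (k.+1%:R^-1 *: v) y @[k --> \oo] --> hessq u y v.
Proof.
move=> cu y v.
have /choice[th H] : forall k, exists th : R, `|th| <= k.+1%:R^-1 /\
    k.+1%:R ^+ 2 * diff2 u (k.+1%:R^-1 *: v) y = hessq u (y + th *: v) v.
  by move=> k; have [th h1 h2] := diff2_hessq y v k cu; exists th.
under eq_fun do rewrite (H _).2.
have th0 : th k @[k --> \oo] --> (0 : R).
  apply/cvgr0Pnorm_le => e e0; near=> k; apply: le_trans (H k).1 _.
  by near: k; apply: filterS (near_infty_natSinv_lt (PosNum e0)) => k /ltW.
apply: (@cvg_comp _ _ _ (fun k => y + th k *: v) (fun z => hessq u z v) _ (nbhs y)); last exact: hessq_continuous.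
apply: (@cvg_rV _ _ _ \oo _) => i.
rewrite [X in _ --> X](_ : _ = y 0 i + 0 * v 0 i); last by rewrite mul0r addr0.
under eq_fun do rewrite !mxE.
by apply: cvgD; [exact: cvg_cst|apply: cvgM; [exact: th0|exact: cvg_cst]].
Unshelve. all: by end_near. Qed.

(** Discrete integration by parts, by translating the variable; it moves second differences from the
    test function to u. *)
Lemma integral_diff2 r u phi v : 0 <= r -> csupp r phi -> continuous u ->
  integral_rV (fun y => u y * diff2 phi v y) = integral_rV (fun y => diff2 u v y * phi y).
Proof.
move=> r0 cp cu.
pose r' := r + `|v|; have r'0 : 0 <= r' by rewrite addr_ge0.
have rr' : r <= r' by rewrite lerDl.
have c0 : csupp r' phi := csuppW rr' cp.
have c1 : csupp r' (fun y => phi (y + v)) := csupp_shift v cp.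
have c2 : csupp r' (fun y => phi (y - v)) by have := csupp_shift (- v) cp; rewrite normrN.
have cu1 := continuous_shift v cu; have cu2 := continuous_shift (- v) cu.
have S w : integral_rV (fun y => u y * phi (y + w)) = integral_rV (fun y => u (y - w) * phi y).
  rewrite -[RHS](@integral_rV_shift _ _ _ _ w r0 (csuppMl (continuous_shift (- w) cu) cp)).
  by congr integral_rV; apply/funext => y; rewrite addrK.
have L f1 f2 f3 : csupp r' f1 -> csupp r' f2 -> csupp r' f3 ->
    integral_rV (fun y => f1 y + f2 y + (-2) * f3 y) =
    integral_rV f1 + integral_rV f2 + (-2) * integral_rV f3.
  move=> h1 h2 h3; rewrite (integral_rV_lin (-2) r'0 (csuppD h1 h2) h3).
  have := integral_rV_lin 1 r'0 h1 h2; rewrite mul1r => <-; congr (integral_rV _ + _).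
  by apply/funext => y; rewrite mul1r.
have -> : (fun y => u y * diff2 phi v y) =
    (fun y => u y * phi (y + v) + u y * phi (y - v) + (-2) * (u y * phi y)).
  by apply/funext => y; rewrite /diff2; ring.
rewrite (L _ _ _ (csuppMl cu c1) (csuppMl cu c2) (csuppMl cu c0)) !S opprK.
rewrite -(L _ _ _ (csuppMl cu2 c0) (csuppMl cu1 c0) (csuppMl cu c0)).
by congr integral_rV; apply/funext => y; rewrite /diff2; ring.
Qed.

(** If the inequality failed at y0 it would fail with a margin on a small ball, and a bump carried
    by that ball would contradict the weak form. The second derivative of the bump is approximated
    by second differences, which are then moved to u. *)
Lemma distrib_pointwise u a v (C0 : R) : C2 u -> continuous a ->
  (forall phi, test_function phi -> (forall y, 0 <= phi y) ->
     - C0 * integral_rV phi <= integral_rV (fun y => a y * phi y + u y * 'D_v ('D_v phi) y)) ->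
  forall y, - C0 <= a y + hessq u y v.
Proof.
move=> cu ca H y0; rewrite leNgt; apply/negP => neg.
pose b y := a y + C0.
have cb : continuous b by apply: contD => //; exact: continuous_fct_cst.
(* The defect at y0 is 3 e: b and the Hessian may each vary by e, and e is left. *)
pose e := - (b y0 + hessq u y0 v) / 3.
have e0 : 0 < e by rewrite /e /b; move: neg; lra.
have uc := C1_continuous cu.1.
have /nbhs_ballP[r1 /= r10 Hb] := (continuous_rVP _).2 cb y0 e e0.
have /nbhs_ballP[r2 /= r20 Hh] := (continuous_rVP _).2 (@hessq_continuous u v cu) y0 e e0.
(* Twice r must fit in both balls: once for the support of the bump, once for the intermediate point
   of the second difference. *)
pose r := Num.min r1 r2 / 3.
have r0 : 0 < r by rewrite divr_gt0// lt_min r10.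
have rr1 : 2 * r < r1 by have : Num.min r1 r2 <= r1 by [rewrite ge_min lexx]; move: r0; rewrite /r; lra.
have rr2 : 2 * r < r2 by have : Num.min r1 r2 <= r2 by [rewrite ge_min lexx orbT]; move: r0; rewrite /r; lra.
have rlt : r < r1 by apply: le_lt_trans rr1; rewrite mulr2n mulrDl mul1r lerDl ltW.
pose phi := bump y0 r.
have sphi : smooth phi := smooth_bump y0 r.
have c2phi := smooth_C2 sphi.
have phi0 y : 0 <= phi y := bump_ge0 y0 r y.
pose rho := r + `|y0|; have rho0 : 0 <= rho by rewrite addr_ge0// ltW.
have cphi : csupp rho phi by apply: bump_csupp; exact: ltW.
have Ipos : 0 < integral_rV phi := integral_rV_pos rho0 cphi phi0 (bump_gt0 y0 r0).
pose rho' := rho + `|v|; have rho'0 : 0 <= rho' by rewrite addr_ge0.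
have cphi' : csupp rho' phi by apply: csuppW cphi; rewrite lerDl.
pose w k := k.+1%:R^-1 *: v : 'rV[R]_n.
have wn k : `|w k| = k.+1%:R^-1 * `|v| by rewrite normrZ ger0_norm ?invr_ge0.
have wv k : `|w k| <= `|v| by rewrite wn ler_piMl// invf_le1// ler1n.
have cdiff k : csupp rho' (fun y => k.+1%:R ^+ 2 * diff2 phi (w k) y).
  have c1 : csupp rho' (fun y => phi (y + w k)).
    by apply: csuppW (csupp_shift (w k) cphi); rewrite lerD2l.
  have c2 : csupp rho' (fun y => phi (y - w k)).
    by apply: csuppW (csupp_shift (- w k) cphi); rewrite lerD2l normrN.
  apply: csuppMl; first exact: continuous_fct_cst.
  rewrite (_ : diff2 phi (w k) = fun y => (phi (y + w k) + phi (y - w k)) + (-2) * phi y).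
    by apply: csuppD; [exact: csuppD|apply: csuppMl => //; exact: continuous_fct_cst].
  by apply/funext => y; rewrite /diff2 mulNr.
have chess : csupp rho' (fun y => hessq phi y v).
  split; first exact: hessq_continuous.
  move=> y h; have := @diff2_cvg phi c2phi y v.
  under eq_fun do rewrite (cdiff _).2//.
  by move=> /(cvg_lim (@Rhausdorff R)) <-; rewrite lim_cst//; exact: Rhausdorff.
have cF : csupp rho' (fun y => b y * phi y + u y * hessq phi y v).
  by apply: csuppD; exact: csuppMl.
have cFk k : csupp rho' (fun y => b y * phi y + u y * (k.+1%:R ^+ 2 * diff2 phi (w k) y)).
  by apply: csuppD; exact: csuppMl.
have Hphi : 0 <= integral_rV (fun y => b y * phi y + u y * hessq phi y v).
  have := H phi (smooth_test sphi cphi rho0) phi0.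
  have -> : (fun y => a y * phi y + u y * 'D_v ('D_v phi) y) = (fun y => a y * phi y + u y * hessq phi y v).
    by apply/funext => y; rewrite derive_hessq.
  have cG : csupp rho' (fun y => a y * phi y + u y * hessq phi y v).
    by apply: csuppD; exact: csuppMl.
  move=> h; have := integral_rV_lin C0 rho'0 cG cphi'.
  have -> : (fun y => a y * phi y + u y * hessq phi y v + C0 * phi y) =
     (fun y => b y * phi y + u y * hessq phi y v) by apply/funext => y; rewrite /b; ring.
  by move=> ->; move: h; rewrite mulNr; lra.
have [B B0 hB] := csupp_bounded rho'0 chess.
have [M M0 hM] := csupp_bounded rho'0 (csuppMl cb cphi').
have lim : integral_rV (fun y => b y * phi y + u y * (k.+1%:R ^+ 2 * diff2 phi (w k) y)) @[k --> \oo]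
    --> integral_rV (fun y => b y * phi y + u y * hessq phi y v).
  have [c cr hc] := box_max rho'0 (fun x => cvg_norm (uc x) : _ --> _).
  apply: ((@integral_rV_cvg R n rho' rho'0).2 _ _ (M + `|u c| * B) cFk cF).
    move=> k y; have [yr|yr] := leP `|y| rho'.
      apply: le_trans (ler_normD _ _) _; apply: lerD => //.
      have [th _ E] := diff2_hessq y v k c2phi.
      by rewrite E normrM; apply: ler_pM => //; exact: hc.
    by rewrite (cFk k).2// normr0 addr_ge0// mulr_ge0.
  move=> y; apply: cvgD; first exact: cvg_cst.
  by apply: cvgM; [exact: cvg_cst|exact: diff2_cvg].
suff : integral_rV (fun y => b y * phi y + u y * hessq phi y v) <= - e * integral_rV phi.
  by move=> h; have := le_trans Hphi h; rewrite mulNr oppr_ge0 leNgt mulr_gt0.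
have v1 : 0 < `|v| + 1 by rewrite ltr_wpDl.
have rv : 0 < r / (`|v| + 1) by rewrite divr_gt0.
apply: (ler_cvg_to lim (cvg_cst _)); near=> k.
have kv : `|w k| <= r.
  rewrite normrZ ger0_norm ?invr_ge0//.
  have : k.+1%:R^-1 <= r / (`|v| + 1).
    by near: k; apply: filterS (near_infty_natSinv_lt (PosNum rv)) => k /ltW.
  rewrite ler_pdivlMr//; apply: le_trans; rewrite ler_wpM2l ?invr_ge0// lerDl//.
have csu : continuous (fun y => k.+1%:R ^+ 2 * u y) by exact: contZ.
have -> : integral_rV (fun y => b y * phi y + u y * (k.+1%:R ^+ 2 * diff2 phi (w k) y)) =
   integral_rV (fun y => (b y + k.+1%:R ^+ 2 * diff2 u (w k) y) * phi y).
  have c1 := csuppMl cb cphi'.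
  have c2 : csupp rho' (fun y => diff2 (fun y => k.+1%:R ^+ 2 * u y) (w k) y * phi y).
    apply: csuppMl => //; rewrite /diff2.
    have s1 := continuous_shift (w k) csu; have s2 := continuous_shift (- w k) csu.
    have s3 := contZ (c := -2) csu.
    have := contD (contD s1 s2) s3.
    by under [X in continuous X -> _]eq_fun do rewrite mulNr.
  transitivity (integral_rV (fun y => b y * phi y) + 1 * integral_rV (fun y => (k.+1%:R ^+ 2 * u y) * diff2 phi (w k) y)).
    have c3 : csupp rho' (fun y => k.+1%:R ^+ 2 * u y * diff2 phi (w k) y).
      rewrite (_ : (fun y => _) = fun y => u y * (k.+1%:R ^+ 2 * diff2 phi (w k) y)).
        by apply: csuppMl => //; exact: cdiff.
      by apply/funext => y; ring.
    rewrite -(integral_rV_lin 1 rho'0 c1 c3); congr integral_rV; apply/funext => y; ring.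
  rewrite (integral_diff2 (w k) rho'0 cphi' csu) -(integral_rV_lin 1 rho'0 c1 c2).
  by congr integral_rV; apply/funext => y; rewrite /diff2; ring.
have cdu : continuous (fun y => b y + k.+1%:R ^+ 2 * diff2 u (w k) y).
  have s1 := continuous_shift (w k) csu; have s2 := continuous_shift (- w k) csu.
  have s3 := contZ (c := -2) csu.
  have -> : (fun y => b y + k.+1%:R ^+ 2 * diff2 u (w k) y) = (fun y => b y + (k.+1%:R ^+ 2 * u (y + w k) +
      k.+1%:R ^+ 2 * u (y - w k) + (-2) * (k.+1%:R ^+ 2 * u y))).
    by apply/funext => y; rewrite /diff2; ring.
  exact: (contD cb (contD (contD s1 s2) s3)).
rewrite -subr_ge0.
have c1 := csuppMl cdu cphi'.
have -> : - e * integral_rV phi - integral_rV (fun y => (b y + k.+1%:R ^+ 2 * diff2 u (w k) y) * phi y) =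
  integral_rV (fun y => (- e) * phi y + (-1) * ((b y + k.+1%:R ^+ 2 * diff2 u (w k) y) * phi y)).
  have cm : csupp rho' (fun y => - e * phi y) by apply: csuppMl => //; exact: continuous_fct_cst.
  rewrite (integral_rV_lin (-1) rho'0 cm c1) mulN1r; congr (_ - _).
  have := integral_rV_lin (- e - 1) rho'0 cphi' cphi'.
  rewrite (_ : (fun y => _) = (fun y => - e * phi y)); last by apply/funext => y; ring.
  by move=> ->; ring.
apply: integral_rV_ge0 => y.
rewrite mulN1r -mulrBl; have [->|py] := eqVneq (phi y) 0; first by rewrite mulr0.
rewrite mulr_ge0//.
have yr : `|y - y0| <= r by apply: bump_supp => //; exact: ltW.
have [th thk E] := diff2_hessq y v k cu; rewrite E.
have h1 : `|b y0 - b y| <= e.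
  apply: Hb; rewrite -ball_normE /= distrC; exact: le_lt_trans yr rlt.
have h2 : `|hessq u y0 v - hessq u (y + th *: v) v| <= e.
  apply: Hh; rewrite -ball_normE /= distrC addrAC; apply: le_lt_trans (ler_normD _ _) _.
  apply: le_lt_trans rr2; rewrite mulr2n mulrDl mul1r; apply: lerD => //.
  rewrite normrZ; apply: le_trans kv; rewrite wn; exact: ler_wpM2r.
move: h1 h2; rewrite !ler_norml => /andP[h1 _] /andP[h2 _].
have ee : b y0 + hessq u y0 v = - 3 * e by rewrite /e; field.
move: h1 h2 ee; move: (b y0) (b y) (hessq u y0 v) (hessq u (y + th *: v) v) => A B' C' D'.
by clear; lra.
Unshelve. all: by end_near. Qed.

End Distributional.

(** * Euclidean norm, and derivatives of H in the pair (p, x) *)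

Section Euclid.
Context (R : realType) (n : nat).
Implicit Types (u v w : 'rV[R]_n).

Lemma dotpC u v : dotp u v = dotp v u.
Proof. by apply: eq_bigr => i _; rewrite mulrC. Qed.
Lemma dotpDl u v w : dotp (u + v) w = dotp u w + dotp v w.
Proof. by rewrite -big_split; apply: eq_bigr => i _; rewrite mxE mulrDl. Qed.
Lemma dotpZl c u v : dotp (c *: u) v = c * dotp u v.
Proof. by rewrite mulr_sumr; apply: eq_bigr => i _; rewrite mxE mulrA. Qed.
Lemma dotpNl u v : dotp (- u) v = - dotp u v.
Proof. by rewrite -scaleN1r dotpZl mulN1r. Qed.
Lemma dotpBl u v w : dotp (u - v) w = dotp u w - dotp v w.
Proof. by rewrite dotpDl dotpNl. Qed.
Lemma dotpDr u v w : dotp w (u + v) = dotp w u + dotp w v.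
Proof. by rewrite !(dotpC w) dotpDl. Qed.
Lemma dotpZr c u v : dotp v (c *: u) = c * dotp v u.
Proof. by rewrite !(dotpC v) dotpZl. Qed.
Lemma dotpNr u v : dotp v (- u) = - dotp v u.
Proof. by rewrite !(dotpC v) dotpNl. Qed.
Lemma dotpBr u v w : dotp w (u - v) = dotp w u - dotp w v.
Proof. by rewrite !(dotpC w) dotpBl. Qed.
Lemma dotp0l u : dotp 0 u = 0.
Proof. by rewrite /dotp big1// => i _; rewrite mxE mul0r. Qed.
Lemma dotp_ge0 u : 0 <= dotp u u.
Proof. by apply: sumr_ge0 => i _; rewrite -expr2 sqr_ge0. Qed.
Lemma enormE u : enorm u = Num.sqrt (dotp u u).
Proof. by rewrite /enorm big_ord1; congr Num.sqrt; apply: eq_bigr => i _; rewrite expr2. Qed.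
Lemma enorm_sqr u : enorm u ^+ 2 = dotp u u.
Proof. by rewrite enormE sqr_sqrtr// dotp_ge0. Qed.

Lemma enorm_ge0 u : 0 <= enorm u. Proof. by rewrite enormE sqrtr_ge0. Qed.

Lemma enorm_coord u i : `|u 0 i| <= enorm u.
Proof.
rewrite -(@ler_pXn2r _ 2)// ?nnegrE ?enorm_ge0// enorm_sqr real_normK ?num_real//.
by rewrite /dotp (bigD1 i)//= expr2 lerDl sumr_ge0// => j _; rewrite -expr2 sqr_ge0.
Qed.

Lemma norm_enorm u : `|u| <= enorm u.
Proof. by apply: rV_norm_le => [|i]; [exact: enorm_ge0|exact: enorm_coord]. Qed.

Lemma enorm_norm u : enorm u <= n%:R * `|u|.
Proof.
have nn (m : nat) : (m <= m * m)%N by case: m => // m; exact: leq_pmulr.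
rewrite -(@ler_pXn2r _ 2)// ?nnegrE ?enorm_ge0 ?mulr_ge0// enorm_sqr exprMn.
apply: (@le_trans _ _ (\sum_(i < n) `|u| ^+ 2)).
  apply: ler_sum => i _; rewrite -expr2 -[leLHS]real_normK ?num_real//.
  by apply: lerXn2r; rewrite ?nnegrE ?rV_coord_le.
rewrite sumr_const card_ord -[leLHS]mulr_natl ler_wpM2r ?sqr_ge0//.
by rewrite -natrX ler_nat; exact: nn.
Qed.

Lemma cauchy_schwarz u v : `|dotp u v| <= enorm u * enorm v.
Proof.
rewrite -(@ler_pXn2r _ 2)// ?nnegrE ?mulr_ge0 ?enorm_ge0// real_normK ?num_real//.
rewrite exprMn !enorm_sqr.
have [v0|v0] := eqVneq (dotp v v) 0.
  have vz : v = 0.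
    apply/rowP => i; apply/eqP; rewrite mxE -normr_eq0 eq_le normr_ge0 andbT.
    by apply: le_trans (enorm_coord v i) _; rewrite enormE v0 sqrtr0.
  by rewrite v0 mulr0 vz dotpC dotp0l expr0n.
have vp : 0 < dotp v v by rewrite lt_neqAle eq_sym v0 dotp_ge0.
have := dotp_ge0 (dotp v v *: u - dotp u v *: v).
rewrite dotpBl !dotpBr !dotpZl !dotpZr (dotpC v u) => h.
rewrite -subr_ge0 -(pmulr_rge0 _ vp); move: h; set a := dotp v v; set b := dotp u v; set c := dotp u u.
by congr (_ <= _); ring.
Qed.

Lemma enormZ c u : enorm (c *: u) = `|c| * enorm u.
Proof. by rewrite !enormE dotpZl dotpZr mulrA -expr2 sqrtrM ?sqr_ge0// sqrtr_sqr. Qed.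
Lemma enormN u : enorm (- u) = enorm u.
Proof. by rewrite -scaleN1r enormZ normrN1 mul1r. Qed.

Lemma enormD u v : enorm (u + v) <= enorm u + enorm v.
Proof.
rewrite -(@ler_pXn2r _ 2)// ?nnegrE ?addr_ge0 ?enorm_ge0//.
rewrite sqrrD !enorm_sqr dotpDl !dotpDr (dotpC v u).
have := le_trans (ler_norm _) (cauchy_schwarz u v).
by move: (dotp u v) (enorm u * enorm v) => a b; lra.
Qed.

Lemma enorm0 : enorm (0 : 'rV[R]_n) = 0.
Proof. by rewrite enormE dotp0l sqrtr0. Qed.

Lemma enorm_eq0 u : enorm u = 0 -> u = 0.
Proof.
move=> u0; apply/rowP => i; apply/eqP; rewrite mxE -normr_eq0 eq_le normr_ge0 andbT.
by rewrite -u0 enorm_coord.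
Qed.

Lemma dirDE (f : 'rV[R]_n -> R) u v : dirD f u v = dotp v (grad f u).
Proof. by apply: eq_bigr => i _; rewrite mxE. Qed.

End Euclid.

Section Joint.
Context (R : realType) (d : nat).
Implicit Types (h : 'rV[R]_d -> 'rV[R]_d -> R) (p x q z : 'rV[R]_d).

Lemma joint_row h p x : joint h (row_mx p x) = h p x.
Proof. by rewrite /joint row_mxKl row_mxKr. Qed.

Lemma ebase_lshift (i : 'I_d) : ebase R (lshift d i) = row_mx (ebase R i) 0.
Proof.
apply/rowP => j; rewrite -[j]splitK; case: (fintype.split j) => k /=.
  by rewrite row_mxEl !mxE eqxx/= (inj_eq (@lshift_inj _ _)).
by rewrite row_mxEr !mxE eqxx/= eq_rlshift.
Qed.

Lemma ebase_rshift (i : 'I_d) : ebase R (rshift d i) = row_mx 0 (ebase R i).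
Proof.
apply/rowP => j; rewrite -[j]splitK; case: (fintype.split j) => k /=.
  by rewrite row_mxEl !mxE eqxx/= eq_lrshift.
by rewrite row_mxEr !mxE eqxx/= (inj_eq (@rshift_inj _ _)).
Qed.

Lemma row_mxD p x q z : row_mx p x + row_mx q z = row_mx (p + q) (x + z).
Proof. by rewrite add_row_mx. Qed.
Lemma row_mxZ c p x : c *: row_mx p x = row_mx (c *: p) (c *: x).
Proof. by rewrite scale_row_mx. Qed.

Lemma derive_joint h p x q z : 'D_(row_mx q z) (joint h) (row_mx p x) =
  lim ((fun s : R => s^-1 *: (h (s *: q + p) (s *: z + x) - h p x)) @ 0^').
Proof.
rewrite /derive; apply: (congr1 (fun f : R -> R => lim (f @ 0^'))); apply/funext => s.
by rewrite /= row_mxZ row_mxD !joint_row.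
Qed.

Lemma partial_lshift h p x i : partial (lshift d i) (joint h) (row_mx p x) = partial i (h^~ x) p.
Proof.
rewrite /partial ebase_lshift derive_joint /derive; apply: (congr1 (fun f : R -> R => lim (f @ 0^'))); apply/funext => s /=.
by rewrite scaler0 add0r.
Qed.

Lemma partial_rshift h p x i : partial (rshift d i) (joint h) (row_mx p x) = partial i (h p) x.
Proof.
rewrite /partial ebase_rshift derive_joint /derive; apply: (congr1 (fun f : R -> R => lim (f @ 0^'))); apply/funext => s /=.
by rewrite scaler0 add0r.
Qed.

Lemma partial_l_joint h (i : 'I_d) :
  partial (lshift d i) (joint h) = joint (fun p x => partial i (h^~ x) p).
Proof. by apply/funext => y; rewrite -[y]hsubmxK joint_row partial_lshift. Qed.

Lemma dirD_joint h p x q z :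
  dirD (joint h) (row_mx p x) (row_mx q z) = dotp q (Dp h p x) + dotp z (Dx h p x).
Proof.
rewrite /dirD big_split_ord /=; congr (_ + _); apply: eq_bigr => i _.
  by rewrite row_mxEl partial_lshift mxE.
by rewrite row_mxEr partial_rshift mxE.
Qed.

Lemma quad_block (A : 'I_(d + d) -> 'I_(d + d) -> R) q z :
  (forall i j, A (lshift d i) (rshift d j) = A (rshift d j) (lshift d i)) ->
  \sum_i \sum_j row_mx q z 0 i * row_mx q z 0 j * A i j =
  \sum_i \sum_j q 0 i * q 0 j * A (lshift d i) (lshift d j)
  + 2 * \sum_i \sum_j q 0 i * z 0 j * A (lshift d i) (rshift d j)
  + \sum_i \sum_j z 0 i * z 0 j * A (rshift d i) (rshift d j).
Proof.
move=> AC; rewrite big_split_ord /=.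
have -> : \sum_(i < d) \sum_(j < d + d) row_mx q z 0 (lshift d i) * row_mx q z 0 j * A (lshift d i) j =
   \sum_i \sum_j q 0 i * q 0 j * A (lshift d i) (lshift d j) +
   \sum_i \sum_j q 0 i * z 0 j * A (lshift d i) (rshift d j).
  rewrite -big_split /=; apply: eq_bigr => i _; rewrite big_split_ord /=.
  by congr (_ + _); apply: eq_bigr => j _; rewrite ?row_mxEl ?row_mxEr.
have -> : \sum_(i < d) \sum_(j < d + d) row_mx q z 0 (rshift d i) * row_mx q z 0 j * A (rshift d i) j =
   \sum_i \sum_j q 0 i * z 0 j * A (lshift d i) (rshift d j) +
   \sum_i \sum_j z 0 i * z 0 j * A (rshift d i) (rshift d j).
  rewrite [X in _ = X + _]exchange_big -big_split /=; apply: eq_bigr => i _; rewrite big_split_ord /=.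
  congr (_ + _); apply: eq_bigr => j _; rewrite ?row_mxEl ?row_mxEr// AC.
  by rewrite [z 0 i * _]mulrC.
by rewrite mulr2n mulrDl !mul1r !addrA.
Qed.

(** Singles out the block in z alone, the only term that (H2)(iii) takes as a distributional
    derivative. *)
Lemma quad_split (A : 'I_(d + d) -> 'I_(d + d) -> R) q z :
  (forall i j, A (lshift d i) (rshift d j) = A (rshift d j) (lshift d i)) ->
  \sum_i \sum_j row_mx q z 0 i * row_mx q z 0 j * A i j =
  \sum_i \sum_j q 0 i * q 0 j * A (lshift d i) (lshift d j)
  + 2 * \sum_i \sum_j q 0 i * z 0 j * A (lshift d i) (rshift d j)
  + \sum_i \sum_j row_mx 0 z 0 i * row_mx 0 z 0 j * A i j.
Proof.
move=> AC; rewrite !quad_block//; congr (_ + _).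
rewrite [X in X + 2 * _]big1 => [|i _]; last by rewrite big1// => j _; rewrite mxE !mul0r.
rewrite [X in _ + 2 * X + _]big1 => [|i _]; last by rewrite big1// => j _; rewrite mxE !mul0r.
by rewrite mulr0 !add0r.
Qed.

Lemma hessq_joint h p x q z : C2 (joint h) ->
  hessq (joint h) (row_mx p x) (row_mx q z) =
  bform (Dpp h p x) q q + 2 * bform (Dpx h p x) z q
  + hessq (joint h) (row_mx p x) (row_mx 0 z).
Proof.
move=> c2.
have ll i j : partial (lshift d j) (partial (lshift d i) (joint h)) (row_mx p x) = Dpp h p x i j.
  by rewrite partial_l_joint partial_lshift mxE.
have lr i j : partial (rshift d j) (partial (lshift d i) (joint h)) (row_mx p x) = Dpx h p x i j.
  rewrite partial_l_joint partial_rshift mxE; congr (partial j _ x).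
  by apply/funext => x'; rewrite mxE.
have rl i j : partial (rshift d i) (partial (lshift d j) (joint h)) (row_mx p x) =
    partial (lshift d j) (partial (rshift d i) (joint h)) (row_mx p x).
  by rewrite partialC.
rewrite /hessq (quad_split _ _ (fun i j => rl j i)); congr (_ + _ * _ + _);
  apply: eq_bigr => i _; apply: eq_bigr => j _.
  by rewrite ll mulrC [q 0 i * _]mulrC mulrA.
by rewrite lr mulrC [q 0 i * _]mulrC mulrA.
Qed.

End Joint.

(** * One-dimensional comparison from bounds on second differences *)

Section Comparison.
Context (R : realType).
Implicit Types (g w : R -> R).

(** A negative minimum would be interior, and second differences with small steps are nonnegative at
    a minimum. *)
Lemma minimum_principle w (a b : R) : a <= b -> continuous w -> 0 <= w a -> 0 <= w b ->
  (forall s, a < s < b -> w s < 0 -> forall k0, 0 < k0 ->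
     exists2 k, 0 < k <= k0 & w (s + k) + w (s - k) - 2 * w s < 0) ->
  forall s, a <= s <= b -> 0 <= w s.
Proof.
move=> ab cw wa wb H s sab.
have [c cab Hc] := EVT_min ab (continuous_subspaceT cw).
rewrite in_itv/= in cab; have /andP[ac cb] := cab.
have cs : w c <= w s by apply: Hc; rewrite in_itv.
apply: le_trans cs; rewrite leNgt; apply/negP => wc.
have ac' : a < c by rewrite lt_neqAle ac andbT; apply/eqP => E; move: wc; rewrite -E ltNge wa.
have cb' : c < b by rewrite lt_neqAle cb andbT; apply/eqP => E; move: wc; rewrite E ltNge wb.
have k00 : 0 < Num.min (c - a) (b - c) by rewrite lt_min !subr_gt0 ac'.
have [|k /andP[k0 kk]] := H c _ wc _ k00; first by rewrite ac'.
move: kk; rewrite le_min => /andP[k1 k2].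
have h1 : w c <= w (c + k) by apply: Hc; rewrite in_itv/=; apply/andP; split; lra.
have h2 : w c <= w (c - k) by apply: Hc; rewrite in_itv/=; apply/andP; split; lra.
lra.
Qed.

(** Makes the exponential barrier satisfy its differential inequality for second differences of
    every step, not only in the limit. *)
Lemma expR_second (x : R) : x ^+ 2 <= expR x + expR (- x) - 2.
Proof.
wlog x0 : x / 0 <= x => [H|].
  have [/H//|x0] := leP 0 x.
  have := H (- x); rewrite oppr_ge0 sqrrN opprK (addrC (expR (- x))); apply; exact: ltW.
pose f (x : R) := expR x + expR (- x) - 2 - x ^+ 2.
have dN (s : R) : is_derive s (1 : R) (fun s => expR (- s)) (- expR (- s)).
  have : is_derive s (1 : R) (-%R : R -> R) (-1).
    by have := is_deriveN (@is_derive_id R R s 1); rewrite (_ : - id = -%R).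
  move=> D; have := is_derive1_comp (is_derive_expR (- s)) D.
  by rewrite mulrN1.
have dsq (s : R) : is_derive s (1 : R) (fun s : R => s ^+ 2) (2 * s).
  have := is_derive_square 1 s; rewrite mulr1.
  by under [X in is_derive _ _ X]eq_fun do rewrite mul1r.
have df s : is_derive s (1 : R) f (expR s - expR (- s) - 2 * s).
  have D := is_deriveB (is_deriveB (is_deriveD (is_derive_expR s) (dN s)) (is_derive_cst (2 : R) s (1 : R))) (dsq s).
  have D' : is_derive s (1 : R) f _ := D; apply: (is_derive_eq D').
  by rewrite subr0.
pose f1 (s : R) := expR s - expR (- s) - 2 * s.
have df1 s : is_derive s (1 : R) f1 (expR s + expR (- s) - 2).
  have D := is_deriveB (is_deriveB (is_derive_expR s) (dN s)) (is_derive_scale 2 (is_derive_id s (1 : R))).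
  have D' : is_derive s (1 : R) f1 _ := D; apply: (is_derive_eq D').
  by rewrite opprK mulr1.
have pos (s : R) : 0 <= expR s + expR (- s) - 2.
  have h : expR s * expR (- s) = 1 by rewrite -expRD subrr expR0.
  have e0 := expR_gt0 s; move: h e0 (expR_gt0 (- s)); set A := expR s; set B := expR (- s) => h A0 B0.
  rewrite -(pmulr_rge0 _ A0) (_ : A * _ = (A - 1) ^+ 2 + (A * B - 1)); last by ring.
  by rewrite h subrr addr0 sqr_ge0.
have f1pos s : 0 <= s -> 0 <= f1 s.
  move=> s0; have [c _ E] := mvt0 s df1.
  have f10 : f1 0 = 0 by rewrite /f1 oppr0 expR0; ring.
  by move: E; rewrite f10 subr0 => ->; rewrite mulr_ge0.
have [c + E] := mvt 0 x df.
rewrite min_l// => /andP[c0 _].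
have f0 : f 0 = 0 by rewrite /f oppr0 expR0; ring.
move: E; rewrite f0 !subr0 => E; rewrite -subr_ge0 -/(f x) E mulr_ge0//; exact: f1pos.
Qed.

Variables (g : R -> R) (L : R).
Hypotheses (L0 : 0 < L) (cg : continuous g).
Hypothesis g2 : forall s e, 0 < e -> exists2 k0, 0 < k0 & forall k, 0 < k -> k <= k0 ->
  g (s + k) + g (s - k) - 2 * g s <= k ^+ 2 * (L * g s + e).

(** The second differences only say that g'' <= L g, which leaves g' at 0 free. It is the sign of g
    on the whole line that excludes faster growth: a solution of phi'' = mu^2 phi passing just below
    g at s becomes negative far to the left, so it stays below g in between, in particular at 0. *)
Lemma exp_growth mu s : (forall s, 0 <= g s) -> 0 <= mu -> L <= mu ^+ 2 ->
  0 <= s -> g s <= g 0 * expR (mu * s).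
Proof.
move=> g0 mu0 Lmu s0; pose A := g s * expR (- (mu * s)).
have mup : 0 < mu.
  by rewrite lt_neqAle mu0 andbT; apply/eqP => E; move: Lmu; rewrite -E expr0n/= leNgt L0.
have A0 : 0 <= A by rewrite mulr_ge0 ?expR_ge0.
suff : A <= g 0.
  by rewrite /A expRN ler_pdivrMr ?expR_gt0.
apply/ler_addgt0Pr => eta eta0.
have [An|An] := eqVneq A 0; first by rewrite An addr_ge0// ltW.
have Ap : 0 < A by rewrite lt_neqAle eq_sym An.
pose ep := Num.min 1 (eta / A); have ep0 : 0 < ep by rewrite lt_min ltr01 divr_gt0.
have ep1 : ep <= 1 by rewrite ge_min lexx.
(* A solution of phi'' = mu^2 phi. The small coefficient ep makes it negative far to the left and
   costs only A ep <= eta at 0. *)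
pose phi r := A * (expR (mu * r) - ep * expR (- (mu * r))).
(* With this S, phi (- S) <= 0 reduces to exp (- 1 / ep) <= 1 <= ep exp (1 / ep). *)
pose S := ep^-1 / mu; have S0 : 0 < S by rewrite divr_gt0// invr_gt0.
have h0 : 0 <= g 0 - phi 0; last first.
  have : A * ep <= eta by rewrite mulrC -ler_pdivlMr// ge_min lexx orbT.
  by move: h0; rewrite /phi mulr0 oppr0 expR0; lra.
have cphi : continuous phi.
  have ce : continuous (fun r : R => expR (mu * r)).
    move=> r; apply: (@continuous_comp _ _ _ (fun r => mu * r) expR); last exact: continuous_expR.
    by apply: cvgM; [exact: cvg_cst|exact: cvg_id].
  have ce2 : continuous (fun r : R => - ep * expR (- (mu * r))).
    apply: contZ => r; apply: (@continuous_comp _ _ _ (fun r => - (mu * r)) expR); last exact: continuous_expR.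
    by apply: cvgN; apply: cvgM; [exact: cvg_cst|exact: cvg_id].
  have := contZ (c := A) (contD ce ce2).
  by under [X in continuous X -> _]eq_fun do rewrite mulNr.
have cw : continuous (fun r => g r - phi r).
  have := contD cg (contZ (c := -1) cphi).
  by under [X in continuous X -> _]eq_fun do rewrite mulN1r.
apply: (@minimum_principle (fun r => g r - phi r) (- S) s) => //.
- by apply: le_trans s0; rewrite oppr_le0 ltW.
- have : phi (- S) <= 0; last by move: (g0 (- S)); lra.
  rewrite /phi pmulr_rle0// subr_le0 mulrN opprK /S (mulrC mu) divfK ?gt_eqF//.
  have e1 : expR (- ep^-1) <= 1 by rewrite -[leRHS]expR0 ler_expR oppr_le0 invr_ge0 ltW.
  apply: le_trans e1 _; rewrite mulrC -ler_pdivrMr// mul1r.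
  by apply: le_trans (expR_ge1Dx _); rewrite lerDr.
- rewrite subr_ge0 /phi mulrBr /A -mulrA -expRD addNr expR0 mulr1 lerBlDr lerDl.
  by rewrite !mulr_ge0 ?expR_ge0// ltW.
- move=> r _ wr k0 k00.
  (* Half of the gap L (phi - g): the second difference of g stays strictly below that of phi
     wherever g < phi. *)
  pose e := L * (phi r - g r) / 2.
  have e0 : 0 < e by rewrite divr_gt0// mulr_gt0//; move: wr; lra.
  have [k1 k10 Hk] := g2 r e0.
  pose k := Num.min k0 k1; have kp : 0 < k by rewrite lt_min k00.
  exists k; first by rewrite kp ge_min lexx.
  have {}Hk := Hk k kp (ltac:(by rewrite ge_min lexx orbT)).
  have phr : 0 < phi r by move: (g0 r) wr; lra.
  have phi2 : phi (r + k) + phi (r - k) - 2 * phi r = phi r * (expR (mu * k) + expR (- (mu * k)) - 2).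
    have E1 : expR (mu * (r + k)) = expR (mu * r) * expR (mu * k) by rewrite mulrDr expRD.
    have E2 : expR (- (mu * (r + k))) = expR (- (mu * r)) * expR (- (mu * k)) by rewrite mulrDr opprD expRD.
    have E3 : expR (mu * (r - k)) = expR (mu * r) * expR (- (mu * k)) by rewrite mulrBr expRD.
    have E4 : expR (- (mu * (r - k))) = expR (- (mu * r)) * expR (mu * k) by rewrite mulrBr opprB addrC expRD.
    rewrite /phi E1 E2 E3 E4; ring.
  have h2 : phi r * (L * k ^+ 2) <= phi (r + k) + phi (r - k) - 2 * phi r.
    rewrite phi2 ler_pM2l//; apply: le_trans (expR_second _).
    by rewrite exprMn ler_wpM2r ?sqr_ge0.
  have k2 : 0 < k ^+ 2 by rewrite exprn_gt0.
  have : k ^+ 2 * (L * g r + e) - phi r * (L * k ^+ 2) < 0.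
    have eE : L * (phi r - g r) = e + e by rewrite /e -splitr.
    suff -> : k ^+ 2 * (L * g r + e) - phi r * (L * k ^+ 2) = k ^+ 2 * (e - L * (phi r - g r)).
      by rewrite eE opprD addrA subrr sub0r mulrN oppr_lt0 mulr_gt0.
    by ring.
  by move: Hk h2; lra.
- by rewrite oppr_le0 ltW.
Qed.

(** On the segment g'' <= L M, so g minus its chord plus a parabola of larger curvature satisfies
    the minimum principle. *)
Lemma semiconcave_segment M x0 x1 (th : R) : x0 <= x1 -> 0 <= th <= 1 ->
  (forall r, x0 <= r <= x1 -> g r <= M) ->
  th * g x1 + (1 - th) * g x0 <= g (th * x1 + (1 - th) * x0) + L * M / 2 * (th * (1 - th)) * (x1 - x0) ^+ 2.
Proof.
move=> x01 /andP[th0 th1] gM.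
have [E|x01n] := eqVneq x0 x1.
  rewrite E subrr expr0n/= mulr0 addr0 (_ : th * x1 + _ = x1); last by ring.
  by rewrite (_ : th * g x1 + _ = g x1)//; ring.
have x01p : 0 < x1 - x0 by rewrite subr_gt0 lt_neqAle x01n.
apply/ler_addgt0Pr => eta eta0.
(* 2 K exceeds L M strictly, as the minimum principle requires; the normalisation keeps the extra
   error below eta. *)
pose K := (L * M + eta / (1 + (x1 - x0) ^+ 2)) / 2.
pose chord r := g x0 + (r - x0) * ((g x1 - g x0) / (x1 - x0)).
have := @minimum_principle (fun r => g r - chord r + K * ((r - x0) * (x1 - r))) x0 x1 x01.
have cw : continuous (fun r => g r - chord r + K * ((r - x0) * (x1 - r))).
  move=> r; apply: cvgD; first apply: cvgB.
  - exact: cg.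
  - apply: cvgD; first exact: cvg_cst.
    by apply: cvgM; [apply: cvgB; [exact: cvg_id|exact: cvg_cst]|exact: cvg_cst].
  - apply: cvgM; first exact: cvg_cst.
    by apply: cvgM; apply: cvgB; [exact: cvg_id|exact: cvg_cst|exact: cvg_cst|exact: cvg_id].
have xn : x1 - x0 != 0 by rewrite gt_eqF.
pose sl := (g x1 - g x0) / (x1 - x0).
have slE : (x1 - x0) * sl = g x1 - g x0 by rewrite /sl mulrCA mulfV// mulr1.
move=> /(_ cw); rewrite /chord -/sl slE !subrr mul0r !mulr0 !addr0 subrr.
rewrite ?mul0r ?mulr0 ?addr0 (_ : g x1 - (g x0 + (g x1 - g x0)) = 0); last by ring.
move=> /(_ (lexx _) (lexx _)) H.
have D0 : 0 < 1 + (x1 - x0) ^+ 2 by rewrite ltr_wpDr ?sqr_ge0.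
pose r0 := th * x1 + (1 - th) * x0.
have rin : x0 <= r0 <= x1.
  have h1 : 0 <= th * (x1 - x0) by rewrite mulr_ge0// ltW.
  have h2 : 0 <= (1 - th) * (x1 - x0) by rewrite mulr_ge0 ?subr_ge0// ltW.
  by rewrite /r0; apply/andP; split; lra.
have {}H : 0 <= g r0 - (g x0 + (r0 - x0) * sl) + K * ((r0 - x0) * (x1 - r0)).
  apply: H rin => r rr _ k0 k00.
  pose e := eta / (1 + (x1 - x0) ^+ 2) / 2.
  have e0 : 0 < e by rewrite !divr_gt0.
  have [k1 k10 Hk] := g2 r e0.
  pose k := Num.min k0 k1; have kp : 0 < k by rewrite lt_min k00.
  exists k; first by rewrite kp ge_min lexx.
  have {}Hk := Hk k kp (ltac:(by rewrite ge_min lexx orbT)).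
  have gr : L * g r <= L * M.
    by rewrite ler_wpM2l// ?(ltW L0)//; apply: gM; move: rr => /andP[/ltW-> /ltW->].
  have k2 : 0 < k ^+ 2 by rewrite exprn_gt0.
  have : k ^+ 2 * (L * g r + e) < k ^+ 2 * (2 * K).
    rewrite ltr_pM2l// /K [2 * _]mulrC divfK// (splitr (eta / _)) -/e.
    by move: gr e0; lra.
  move: Hk.
  rewrite -subr_lt0 => h1 h2.
  apply: (@le_lt_trans _ _ ((g (r + k) + g (r - k) - 2 * g r) - k ^+ 2 * (2 * K))).
    by rewrite le_eqVlt; apply/orP; left; apply/eqP; ring.
  by move: h1 h2; lra.
have dx : r0 - x0 = th * (x1 - x0) by rewrite /r0; ring.
have dx1 : x1 - r0 = (1 - th) * (x1 - x0) by rewrite /r0; ring.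
rewrite dx dx1 in H.
have E1 : th * (x1 - x0) * sl = th * (g x1 - g x0) by rewrite -mulrA slE.
rewrite E1 in H; rewrite -/r0.
have : K * (th * (x1 - x0) * ((1 - th) * (x1 - x0))) <= L * M / 2 * (th * (1 - th)) * (x1 - x0) ^+ 2 + eta.
  rewrite (_ : K * _ = L * M / 2 * (th * (1 - th)) * (x1 - x0) ^+ 2 +
     (th * (1 - th) / 2) * (eta * ((x1 - x0) ^+ 2 / (1 + (x1 - x0) ^+ 2)))); last first.
    by rewrite /K; field; rewrite gt_eqF.
  rewrite lerD2l.
  have t1 : th * (1 - th) / 2 <= 1.
    by rewrite ler_pdivrMr// mul1r; have : 0 <= th ^+ 2 := sqr_ge0 _; rewrite expr2; lra.
  have t0 : 0 <= th * (1 - th) / 2 by rewrite divr_ge0// mulr_ge0// subr_ge0.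
  have q1 : (x1 - x0) ^+ 2 / (1 + (x1 - x0) ^+ 2) <= 1 by rewrite ler_pdivrMr// mul1r lerDr.
  have q0 : 0 <= (x1 - x0) ^+ 2 / (1 + (x1 - x0) ^+ 2) by rewrite divr_ge0 ?sqr_ge0// ltW.
  rewrite -[leRHS]mul1r; apply: ler_pM => //; first exact: (mulr_ge0 (ltW eta0) q0).
  by rewrite -[leRHS]mulr1 ler_wpM2l// ltW.
by move: H; lra.
Qed.

End Comparison.

Lemma is_derive_eps (R : realType) (f : R -> R) (x l : R) : is_derive x (1 : R) f l ->
  forall e, 0 < e -> exists2 del, 0 < del &
    forall h, `|h| <= del -> `|f (x + h) - f x - h * l| <= e * `|h|.
Proof.
move=> [df lE] e e0.
have cv : (fun h => h^-1 *: ((f \o shift x) (h *: (1 : R)) - f x)) @ 0^' --> l.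
  by rewrite -lE; exact: df.
have /cvgrPdist_le/(_ e e0) := cv; rewrite near_withinE => /nbhs_ballP[del /= del0 H].
exists (del / 2) => [|h hd]; first by rewrite divr_gt0.
have [->|h0] := eqVneq h 0; first by rewrite addr0 subrr mul0r subr0 normr0 mulr0.
have := H h; rewrite -ball_normE /= sub0r normrN => /(_ _ h0) {}H.
have hp : 0 < `|h| by rewrite normr_gt0.
have {}H : `|l - h^-1 * (f (h + x) - f x)| <= e.
  have := H (le_lt_trans hd _); rewrite ltr_pdivrMr// ltr_pMr// ltr1n => /(_ isT).
  by rewrite -[h *: 1]/(h * 1) mulr1.
rewrite -(@ler_pM2r _ `|h|) ?normr_gt0// -normrM mulrBl mulrAC mulVf// mul1r in H.
by rewrite distrC [h * l]mulrC (addrC x).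
Qed.

(** * The Lagrangian by penalisation: growth and semiconcavity in x *)

Section Hamiltonian.
Context (R : realType) (d : nat) (lam C0 : R) (Cb : R -> R).
Hypotheses (lam0 : 0 < lam) (C00 : 0 < C0).
Implicit Types (h : 'rV[R]_d -> 'rV[R]_d -> R) (a p x y q z : 'rV[R]_d).

(** What is used of H at one time and one omega. The constants are parameters of the section, hence
    common to all times and omega. [ham_star] is (H2)(iii) pointwise and for z of any length, which
    makes it homogeneous in (q, z). *)
Record ham h : Prop := Ham {
  ham_convex : forall p q x (th : R), 0 <= th <= 1 ->
    h (th *: p + (1 - th) *: q) x <= th * h p x + (1 - th) * h q x;
  ham_C2 : C2 (joint h);
  ham_bound : forall r, 0 < r -> forall p x, enorm p <= r ->
    `|h p x| + enorm (Dp h p x) + enorm (Dpx h p x) + enorm (Dpp h p x) <= Cb r;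
  ham_star : forall p x q z,
    - (enorm z ^+ 2 * (lam * (dotp (Dp h p x) p - h p x) + C0)) <=
    hessq (joint h) (row_mx p x) (row_mx q z) }.

Lemma joint_line h p x q z (s : R) :
  joint h (row_mx p x + s *: row_mx q z) = h (p + s *: q) (x + s *: z).
Proof. by rewrite row_mxZ row_mxD joint_row. Qed.

Lemma hessqZ n (u : 'rV[R]_n -> R) (y v : 'rV[R]_n) c : hessq u y (c *: v) = c ^+ 2 * hessq u y v.
Proof.
rewrite mulr_sumr; apply: eq_bigr => i _; rewrite mulr_sumr; apply: eq_bigr => j _.
by rewrite !mxE expr2 -!mulrA; congr (_ * _); rewrite mulrCA.
Qed.

Section Fixed.
Context (h : 'rV[R]_d -> 'rV[R]_d -> R) (Hh : ham h).

Lemma ham_line p x q z (s : R) :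
  is_derive s (1 : R) (fun s => h (p + s *: q) (x + s *: z))
   (dotp q (Dp h (p + s *: q) (x + s *: z)) + dotp z (Dx h (p + s *: q) (x + s *: z))).
Proof.
have := line_derive (row_mx p x) (row_mx q z) (ham_C2 Hh).1 s.
under [X in is_derive _ _ X]eq_fun do rewrite joint_line.
by rewrite row_mxZ row_mxD dirD_joint.
Qed.

Lemma joint_continuous : continuous (joint h).
Proof. exact: C1_continuous (ham_C2 Hh).1. Qed.

Lemma continuous_row_mx (T : topologicalType) n1 n2 (f : T -> 'rV[R]_n1) (g : T -> 'rV[R]_n2) :
  continuous f -> continuous g -> continuous (fun t => row_mx (f t) (g t)).
Proof.
move=> cf cg t; apply: (@cvg_rV _ _ _ (nbhs t) (nbhs_filter t)) => i; rewrite -[i]splitK.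
case: (fintype.split i) => k /=.
  rewrite row_mxEl; under eq_fun do rewrite row_mxEl.
  by apply: (cvg_comp f (fun y : 'rV[R]_n1 => y 0 k) (cf t)); exact: coord_continuous.
rewrite row_mxEr; under eq_fun do rewrite row_mxEr.
by apply: (cvg_comp g (fun y : 'rV[R]_n2 => y 0 k) (cg t)); exact: coord_continuous.
Qed.

Lemma ham_continuous (T : topologicalType) (f g : T -> 'rV[R]_d) :
  continuous f -> continuous g -> continuous (fun t => h (f t) (g t)).
Proof.
move=> cf cg t; rewrite (_ : (fun t => h (f t) (g t)) = joint h \o (fun t => row_mx (f t) (g t))).
  by apply: continuous_comp; [exact: continuous_row_mx|exact: joint_continuous].
by apply/funext => s /=; rewrite joint_row.
Qed.

Lemma ham_gradient p q x : h p x + dotp (q - p) (Dp h p x) <= h q x.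
Proof.
have := ham_line p x (q - p) 0 0; rewrite !scale0r !addr0 dotp0l addr0.
under [X in is_derive _ _ X]eq_fun do rewrite scaler0 addr0.
move=> /is_derive_eps H; apply/ler_addgt0Pr => e e0.
have [del del0 {}H] := H e e0.
pose s := Num.min 1 del; have s0 : 0 < s by rewrite lt_min ltr01.
have s1 : s <= 1 by rewrite ge_min lexx.
have := H s; rewrite ger0_norm ?(ltW s0)// ge_min lexx orbT => /(_ isT).
rewrite add0r scale0r addr0 ler_norml => /andP[h1 _].
have := @ham_convex _ Hh q p x s; rewrite s1 (ltW s0) => /(_ isT).
rewrite (_ : s *: q + (1 - s) *: p = p + s *: (q - p)); last first.
  by rewrite scalerBl scale1r scalerBr addrCA.
move=> h2; rewrite -subr_ge0 -(pmulr_rge0 _ s0).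
by move: h1 h2; lra.
Qed.

(** Uniformity over bounded p is what the stability of maximisers requires. *)
Lemma local_lip rho x e : 0 <= rho -> 0 < e -> exists2 eta, 0 < eta &
  forall p y, `|p| <= rho -> `|y - x| <= eta -> `|h p y - h p x| <= e.
Proof.
move=> rho0 e0.
pose S (y : 'rV[R]_(d + d)) := \sum_(i < d) `|partial (rshift d i) (joint h) y|.
have cS : continuous S.
  apply: continuous_fct_sum => i y.
  apply: (@continuous_comp _ _ _ (partial (rshift d i) (joint h)) Num.norm); first exact: (ham_C2 Hh).1.2.
  exact: norm_continuous.
pose r := Num.max rho (`|x| + 1).
have r0 : 0 <= r by rewrite le_max rho0.
have [c cr Hc] := box_max r0 cS.
have S0 (y : 'rV[R]_(d + d)) : 0 <= S y by apply: sumr_ge0.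
exists (Num.min 1 (e / (S c + 1))); first by rewrite lt_min ltr01 divr_gt0// ltr_wpDl.
move=> p y pr; rewrite le_min => /andP[y1 y2].
have [t t1 E] := mvt0 1 (fun s => ham_line p x 0 (y - x) s).
move: E; rewrite mulr1 !scale1r !scale0r !scaler0 !addr0 (addrC x (y - x)) subrK => ->.
rewrite dotp0l add0r; set z := x + _.
have zr : `|row_mx p z| <= r.
  apply: rV_norm_le => // i; rewrite -[i]splitK; case: (fintype.split i) => k /=.
    by rewrite row_mxEl (le_trans (rV_coord_le _ _))// (le_trans pr)// le_max lexx.
  rewrite row_mxEr (le_trans (rV_coord_le _ _))// le_max; apply/orP; right.
  rewrite /z (le_trans (ler_normD _ _))// lerD2l normrZ -[leRHS]mul1r; apply: ler_pM => //.
  by move: t1; rewrite normr1.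
have : `|dotp (y - x) (Dx h p z)| <= `|y - x| * S (row_mx p z).
  rewrite /S mulr_sumr (le_trans (ler_norm_sum _ _ _))//; apply: ler_sum => i _.
  by rewrite normrM partial_rshift /Dx [grad _ _ 0 i]mxE ler_wpM2r// rV_coord_le.
move=> /le_trans; apply.
apply: (@le_trans _ _ (`|y - x| * (S c + 1))).
  by apply: ler_wpM2l => //; apply: le_trans (Hc _ zr) _; rewrite lerDl.
by rewrite -ler_pdivlMr// ltr_wpDl.
Qed.

(** The Legendre integrand minus a quadratic penalty. The penalty provides a maximiser over p and,
    by strong concavity, its continuity in x. With del = 0 it is the integrand of L itself. *)
Definition phi (a : 'rV[R]_d) (del : R) p x := - dotp p a - h p x - del / 2 * dotp p p.

Lemma phi_foc a del p0 x q : (forall p, phi a del p x <= phi a del p0 x) ->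
  dotp q a + dotp q (Dp h p0 x) + del * dotp q p0 = 0.
Proof.
move=> M.
move: q; suff H q : 0 <= dotp q a + dotp q (Dp h p0 x) + del * dotp q p0.
  move=> q; apply/eqP; rewrite eq_le H andbT; have := H (- q); rewrite !dotpNl.
  by move: (dotp q a) (dotp q _) (dotp q p0) => A B C; lra.
have := ham_line p0 x q 0 0; rewrite !scale0r !addr0 dotp0l addr0.
under [X in is_derive _ _ X]eq_fun do rewrite scaler0 addr0.
move=> /is_derive_eps H; apply/ler_addgt0Pr => e e0.
have [k k0 {}H] := H (e / 2) (divr_gt0 e0 (ltr0Sn _ _)).
pose A := `|del| * dotp q q + 1.
have A0 : 0 < A by rewrite ltr_wpDl// mulr_ge0// dotp_ge0.
pose s := Num.min k (e / A); have s0 : 0 < s by rewrite lt_min k0 divr_gt0.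
have := H s; rewrite ger0_norm ?(ltW s0)// ge_min lexx => /(_ isT).
rewrite add0r scale0r addr0 ler_norml => /andP[_ h1].
have := M (p0 + s *: q); rewrite /phi !dotpDl !dotpDr !dotpZl !dotpZr (dotpC p0 q) => h2.
rewrite -(pmulr_rge0 _ s0).
have h3 : del * s * dotp q q <= e.
  have : s * A <= e by rewrite -ler_pdivlMr// ge_min lexx orbT.
  apply: le_trans; rewrite /A mulrDr mulr1 -[leLHS]addr0; apply: lerD; last exact: ltW.
  by rewrite [del * s]mulrC -mulrA ler_wpM2l ?(ltW s0)// ler_wpM2r ?dotp_ge0// ler_norm.
have h4 : s * (del * s * dotp q q) <= s * e by rewrite ler_wpM2l// ltW.
move: h1 h2 h4; move: (dotp q a) (dotp q _) (dotp q p0) (dotp q q) (h _ _) (h _ _) (dotp p0 a) (dotp p0 p0).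
by move=> B1 B2 B3 B4 B5 B6 B7 B8; lra.
Qed.

Lemma ham_bound1 r p x : 0 < r -> enorm p <= r ->
  `|h p x| <= Cb r /\ enorm (Dp h p x) <= Cb r.
Proof.
move=> r0 pr; have := ham_bound Hh r0 x pr.
have n1 : 0 <= enorm (Dpx h p x) by rewrite sqrtr_ge0.
have n2 : 0 <= enorm (Dpp h p x) by rewrite sqrtr_ge0.
have := enorm_ge0 (Dp h p x); have := normr_ge0 (h p x).
by move=> *; split; lra.
Qed.

Lemma ham_lower p x : - Cb 1 - Cb 1 * enorm p <= h p x.
Proof.
have [h0 d0] : `|h 0 x| <= Cb 1 /\ enorm (Dp h 0 x) <= Cb 1.
  by apply: ham_bound1 => //; rewrite enorm0.
have := ham_gradient 0 p x; rewrite subr0; apply: le_trans.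
apply: lerD; first by move: h0; rewrite ler_norml => /andP[].
have := cauchy_schwarz p (Dp h 0 x); rewrite ler_norml => /andP[+ _]; apply: le_trans.
by rewrite lerN2 mulrC ler_wpM2r// enorm_ge0.
Qed.

Lemma Cb1_ge0 : 0 <= Cb 1.
Proof. by have [+ _] := @ham_bound1 1 0 0 ltr01 ltac:(by rewrite enorm0); apply: le_trans. Qed.

Lemma phi_max a del : 0 < del -> exists (rho : R) (P : 'rV[R]_d -> 'rV[R]_d), [/\ 0 <= rho,
  forall x, `|P x| <= rho & forall x p, phi a del p x <= phi a del (P x) x].
Proof.
move=> d0; have C1 := Cb1_ge0; have ea := enorm_ge0 a.
(* Beyond this radius the penalty outweighs |p| |a| and the linear lower bound of H, whatever x is,
   so maximisers stay in one ball. *)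
pose rho := 1 + 2 / del * (3 * Cb 1 + enorm a).
have rho1 : 1 <= rho by rewrite lerDl mulr_ge0 ?divr_ge0 ?addr_ge0 ?mulr_ge0// ltW.
have rho0 : 0 <= rho := le_trans ler01 rho1.
have /choice[P HP] : forall x, exists p0, `|p0| <= rho /\ forall p, phi a del p x <= phi a del p0 x.
  move=> x.
  have cphi : continuous (fun p => phi a del p x).
    have c1 : continuous (fun p : 'rV[R]_d => - dotp p a).
      have := @continuous_fct_sum R 'rV[R]_d _ (index_enum 'I_d) (fun i p => (- a 0 i) * p 0 i).
      move=> /(_ (fun i => contZ (fun p => @coord_continuous _ _ _ _ _ p))).
      under [X in continuous X -> _]eq_fun do under eq_bigr do rewrite mulNr mulrC.
      by under [X in continuous X -> _]eq_fun do rewrite sumrN.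
    have c2 : continuous (fun p => (-1) * h p x).
      apply: contZ.
      have cid : continuous (id : 'rV[R]_d -> 'rV[R]_d) by move=> y; exact: cvg_id.
      have ccst : continuous (fun _ : 'rV[R]_d => x) by exact: cst_continuous.
      exact: (ham_continuous cid ccst).
    have c3 : continuous (fun p : 'rV[R]_d => (- (del / 2)) * dotp p p).
      apply: contZ; apply: continuous_fct_sum => i.
      by apply: continuous_fctM => p; exact: coord_continuous.
    have := contD (contD c1 c2) c3.
    by under [X in continuous X -> _]eq_fun do rewrite mulN1r mulNr.
  have [p0 p0r H] := box_max rho0 cphi.
  exists p0; split => // p; have [/H//|pr] := leP `|p| rho.
  have := H 0; rewrite normr0 => /(_ rho0); apply: le_trans.
  have := ham_lower p x; have [/ler_normlP[_ h0] _] := @ham_bound1 1 0 x ltr01 ltac:(by rewrite enorm0).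
  rewrite /phi !dotp0l mulr0 oppr0 addr0 sub0r -enorm_sqr.
  have pe : rho < enorm p := lt_le_trans pr (norm_enorm p).
  have := cauchy_schwarz p a; rewrite ler_norml => /andP[+ _].
  have : (Cb 1 + enorm a) * enorm p + 2 * Cb 1 <= del / 2 * enorm p ^+ 2.
    have e1 : 1 <= enorm p := le_trans rho1 (ltW pe).
    apply: (@le_trans _ _ ((3 * Cb 1 + enorm a) * enorm p)).
      have : Cb 1 <= Cb 1 * enorm p by rewrite ler_peMr.
      by lra.
    rewrite expr2 mulrA ler_wpM2r ?enorm_ge0//.
    have : 2 / del * (3 * Cb 1 + enorm a) <= enorm p by apply: le_trans (ltW pe); rewrite lerDr.
    have d2 : 0 < del / 2 by rewrite divr_gt0.
    rewrite -(ler_pM2l d2); apply: le_trans; rewrite le_eqVlt; apply/orP; left; apply/eqP; field.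
    by rewrite gt_eqF.
  by move: (dotp p a) (enorm p) => A B; lra.
by exists rho, P; split => // x; have [] := HP x.
Qed.

Section Regularized.
Context (a : 'rV[R]_d) (del : R) (d0 : 0 < del).
Context (rho : R) (P : 'rV[R]_d -> 'rV[R]_d) (rho0 : 0 <= rho) (Prho : forall x, `|P x| <= rho).
Hypothesis PM : forall x p, phi a del p x <= phi a del (P x) x.

Definition freg x := phi a del (P x) x.

(** Maximality is tested at the midpoint of p and P x, where convexity of H costs nothing and the
    penalty gains a square. *)
Lemma phi_strong p x : phi a del p x <= freg x - del / 4 * dotp (p - P x) (p - P x).
Proof.
have := PM x (2^-1 *: p + (1 - 2^-1) *: P x); rewrite -/(freg x).
have := ham_convex Hh p (P x) x (th := 2^-1); rewrite invr_ge0 ler0n invf_le1// ler1n => /(_ isT).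
rewrite /freg /phi !(dotpDl, dotpDr, dotpZl, dotpZr, dotpNl, dotpNr) (dotpC (P x) p).
move: (h _ _) (h _ _) (h _ _) (dotp p a) (dotp (P x) a) (dotp p p) (dotp p (P x)) (dotp (P x) (P x)).
move=> h1 h2 h3 A B C D E.
by rewrite (_ : 1 - 2^-1 = 2^-1 :> R); last lra; move=> H1 H2; lra.
Qed.

(** P y nearly maximises at x when y is close to x, and strong concavity turns near maximality into
    proximity. *)
Lemma P_continuous x e : 0 < e -> exists2 eta, 0 < eta & forall y, `|y - x| <= eta -> `|P y - P x| <= e.
Proof.
move=> e0; have e1 : 0 < del / 8 * e ^+ 2 by rewrite !mulr_gt0// exprn_gt0.
have [eta eta0 H] := local_lip x rho0 e1; exists eta => // y yx.
have := phi_strong (P y) x; have := PM y (P x); rewrite /freg.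
have := H _ _ (Prho x) yx; have := H _ _ (Prho y) yx.
rewrite !ler_norml => /andP[h1 h2] /andP[h3 h4] M S.
have : dotp (P y - P x) (P y - P x) <= e ^+ 2.
  have d4 : 0 < del / 4 by rewrite divr_gt0.
  rewrite -(ler_pM2l d4); move: M S; rewrite /phi.
  move: (dotp (P y) a) (dotp (P x) a) (dotp (P y) (P y)) (dotp (P x) (P x)) (dotp (_ - _) _) => A B C D E.
  by move: h1 h2 h3 h4; lra.
move=> h5; apply: le_trans (norm_enorm _) _.
by rewrite -(@ler_pXn2r _ 2)// ?nnegrE ?enorm_ge0 ?(ltW e0)// enorm_sqr.
Qed.

Lemma freg_ge0 x : - Cb 1 <= freg x.
Proof.
apply: le_trans (PM x 0); rewrite /phi !dotp0l mulr0 oppr0 addr0 sub0r lerN2.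
by have [/ler_normlP[]] := @ham_bound1 1 0 x ltr01 ltac:(by rewrite enorm0).
Qed.

Lemma freg_continuous : continuous freg.
Proof.
have cP : continuous P.
  move=> x; apply/(@cvgrPdist_le _ _ _ (nbhs x) (nbhs_filter x)) => e e0.
  have [eta eta0 H] := P_continuous x e0.
  apply/nbhs_ballP; exists eta => // y; rewrite -ball_normE /= distrC => /ltW yx.
  by rewrite distrC; exact: H.
have c1 : continuous (fun x => - dotp (P x) a).
  have := @continuous_fct_sum R 'rV[R]_d _ (index_enum 'I_d) (fun i x => (- a 0 i) * P x 0 i).
  move=> H; have := H (fun i => contZ (fun x => cvg_comp P (fun p : 'rV[R]_d => p 0 i) (cP x) (@coord_continuous _ _ _ 0 i (P x)))).
  under [X in continuous X -> _]eq_fun do under eq_bigr do rewrite mulNr mulrC.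
  by under [X in continuous X -> _]eq_fun do rewrite sumrN.
have c2 : continuous (fun x => (-1) * h (P x) x).
  by apply: contZ; apply: ham_continuous => // x; exact: cvg_id.
have c3 : continuous (fun x => (- (del / 2)) * dotp (P x) (P x)).
  apply: contZ; apply: continuous_fct_sum => i.
  by apply: continuous_fctM => x; exact: (cvg_comp P (fun p : 'rV[R]_d => p 0 i) (cP x) (@coord_continuous _ _ _ 0 i (P x))).
have := contD (contD c1 c2) c3.
by under [X in continuous X -> _]eq_fun do rewrite mulN1r mulNr.
Qed.

(** Let p1, p2 be the maximisers at x + k z and x - k z. The midpoint competes at x, and the second
    difference of [freg] is then at most minus that of h along the line through (p1, x + k z) and
    (p2, x - k z). Its direction (q, z) has an uncontrolled q, which (H2)(iii) allows. *)
Lemma freg_diff2 x z e : 0 < e -> exists2 k0, 0 < k0 & forall k, 0 < k -> k <= k0 ->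
  freg (x + k *: z) + freg (x - k *: z) - 2 * freg x <=
  k ^+ 2 * (enorm z ^+ 2 * (lam * freg x + C0) + e).
Proof.
move=> e0.
pose A (Y : 'rV[R]_(d + d)) := enorm z ^+ 2 * (lam * (\sum_(i < d)
   partial (lshift d i) (joint h) Y * Y 0 (lshift d i) + (-1) * joint h Y) + C0).
have AE p y : A (row_mx p y) = enorm z ^+ 2 * (lam * (dotp (Dp h p y) p - h p y) + C0).
  rewrite /A joint_row mulN1r; congr (_ * (_ * (_ - _) + _)); apply: eq_bigr => i _.
  by rewrite partial_lshift row_mxEl mxE.
have cA : continuous A.
  apply: contZ; apply: contD; last exact: cst_continuous.
  apply: contZ; apply: contD; last exact/contZ/joint_continuous.
  apply: continuous_fct_sum => i; apply: continuous_fctM; first exact: (ham_C2 Hh).1.2.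
  by move=> Y; exact: coord_continuous.
have /nbhs_ballP[r /= r0 HA] := (continuous_rVP _).2 cA (row_mx (P x) x) e e0.
(* The first order condition at P x turns D_pH . p - H into the value of the regularised Lagrangian,
   and the penalty contributes with the right sign. *)
have A0 : A (row_mx (P x) x) <= enorm z ^+ 2 * (lam * freg x + C0).
  rewrite AE ler_wpM2l ?sqr_ge0// lerD2r ler_wpM2l ?(ltW lam0)//.
  have := phi_foc (P x) (PM x); rewrite -(enorm_sqr (P x)) (dotpC (P x) (Dp _ _ _)) /freg /phi -enorm_sqr.
  have : 0 <= del * enorm (P x) ^+ 2 by rewrite mulr_ge0 ?sqr_ge0// ltW.
  by move: (dotp _ _) (dotp (P x) a) => B C; lra.
have r2 : 0 < r / 2 by rewrite divr_gt0.
have [eta eta0 HP] := P_continuous x r2.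
have z1 : 0 < `|z| + 1 by rewrite ltr_wpDl.
pose m := Num.min eta (r / 2); have m0 : 0 < m by rewrite lt_min eta0.
exists (m / (`|z| + 1)) => [|k k0 kk]; first by rewrite divr_gt0.
have kz : `|k *: z| <= m.
  rewrite normrZ gtr0_norm//; move: kk; rewrite ler_pdivlMr//; apply: le_trans.
  by rewrite ler_wpM2l ?(ltW k0)// lerDl.
have kz1 : `|k *: z| <= eta by apply: le_trans kz _; rewrite ge_min lexx.
have kz2 : `|k *: z| <= r / 2 by apply: le_trans kz _; rewrite ge_min lexx orbT.
pose p1 := P (x + k *: z); pose p2 := P (x - k *: z).
have hp1 : `|p1 - P x| <= r / 2 by apply: HP; rewrite addrAC subrr add0r.
have hp2 : `|p2 - P x| <= r / 2 by apply: HP; rewrite addrAC subrr add0r normrN.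
(* Chosen so that p + k q = p1 and p - k q = p2. *)
pose p := 2^-1 *: (p1 + p2); pose q := (2 * k)^-1 *: (p1 - p2).
have kn : k != 0 by rewrite gt_eqF.
have half : 2^-1 *: p1 + 2^-1 *: p1 = p1 by rewrite -scalerDl (_ : 2^-1 + 2^-1 = 1 :> R) ?scale1r//; field.
have kq : k *: q = 2^-1 *: (p1 - p2).
  by rewrite /q scalerA; congr (_ *: _); field.
have E1 : p + k *: q = p1.
  by rewrite kq /p -scalerDr addrACA subrr addr0 scalerDr.
have E2 : p - k *: q = p2.
  by rewrite kq /p; apply/rowP => i; rewrite !mxE; field.
have [th thk SD] := second_difference (row_mx p x) (row_mx q z) (ham_C2 Hh) k0.
rewrite !joint_line joint_row -scaleNr !joint_line !scaleNr E1 E2 in SD.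
have := PM x p; rewrite -/(freg x) => fx.
have pn : `|p + th *: q - P x| <= r / 2.
  have tk : `|th / k| <= 1 by rewrite normrM normfV (gtr0_norm k0) ler_pdivrMr// mul1r.
  (* Since |th| <= k, the point p + th q is a convex combination of p1 and p2, hence as close to P x
     as they are. *)
  have [s1 [s2 [s10 s20 s12 s1E s2E]]] : exists s1 s2 : R, [/\ 0 <= s1, 0 <= s2, s1 + s2 = 1,
      s1 = (1 + th / k) / 2 & s2 = (1 - th / k) / 2].
    exists ((1 + th / k) / 2), ((1 - th / k) / 2).
    move: tk; rewrite ler_norml => /andP[h1 h2]; split=> //; try by field.
    - by rewrite divr_ge0//; lra.
    - by rewrite divr_ge0//; lra.
  have -> : p + th *: q - P x = s1 *: (p1 - P x) + s2 *: (p2 - P x).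
    apply/rowP => i; rewrite s1E s2E /p /q !mxE; field.
    by rewrite kn.
  rewrite (le_trans (ler_normD _ _))// !normrZ (ger0_norm s10) (ger0_norm s20).
  have h1 := ler_wpM2l s10 hp1; have h2 := ler_wpM2l s20 hp2.
  by apply: le_trans (lerD h1 h2) _; rewrite -mulrDl s12 mul1r.
have xn : `|th *: z| <= r / 2.
  apply: le_trans kz2; rewrite !normrZ (gtr0_norm k0); exact: ler_wpM2r.
have AY : A (row_mx (p + th *: q) (x + th *: z)) <= enorm z ^+ 2 * (lam * freg x + C0) + e.
  have := HA (row_mx (p + th *: q) (x + th *: z)).
  rewrite /= ler_norml => H; have /H/andP[h1 _] : ball (row_mx (P x) x) r (row_mx (p + th *: q) (x + th *: z)).
    rewrite -ball_normE /= distrC opp_row_mx add_row_mx.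
    apply: (@le_lt_trans _ _ (r / 2)); last by rewrite ltr_pdivrMr// ltr_pMr// ltr1n.
    apply: rV_norm_le => [|i]; first exact: ltW.
    rewrite -[i]splitK; case: (fintype.split i) => j /=.
      by rewrite row_mxEl (le_trans (rV_coord_le _ _)).
    by rewrite row_mxEr (le_trans (rV_coord_le _ _))// addrAC subrr add0r.
  by move: h1 A0; lra.
have := ham_star Hh (p + th *: q) (x + th *: z) q z; rewrite -AE => st.
rewrite row_mxZ row_mxD in SD.
have k2 : 0 < k ^+ 2 by rewrite exprn_gt0.
have h1 := ler_wpM2l (ltW k2) AY; have h2 := ler_wpM2l (ltW k2) st.
rewrite -SD in h2; move: h1 h2 fx.
rewrite /freg -/p1 -/p2 /phi -/(phi a del (P x) x).
have PE : 2 * dotp p a = dotp p1 a + dotp p2 a.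
  by rewrite -E1 -E2 dotpDl dotpBl; ring.
have P2 : 2 * dotp p p <= dotp p1 p1 + dotp p2 p2.
  have := dotp_ge0 (p1 - p2); rewrite /p !(dotpDl, dotpDr, dotpZl, dotpZr, dotpNl, dotpNr) (dotpC p2 p1).
  by move: (dotp _ _) (dotp _ _) (dotp _ _) => B1 B2 B3; lra.
have P3 : del / 2 * (2 * dotp p p) <= del / 2 * (dotp p1 p1 + dotp p2 p2).
  by rewrite ler_wpM2l// divr_ge0// ltW.
rewrite mulrN; move: PE P3; move: (A _) => X5.
move: (phi a del (P x) x) => X6.
move: (k ^+ 2 * X5) (k ^+ 2 * (_ + e)) (h _ _) (h _ _) (h _ _) => X7 X8 X9 X10 X11.
move: (dotp p1 a) (dotp p2 a) (dotp p a) (dotp p1 p1) (dotp p2 p2) (dotp p p).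
by move=> *; lra.
Qed.

End Regularized.

(** All that is kept of the penalised Lagrangian: it lies between [phi] and L, and the constants of
    its differential inequality are free of del. *)
Lemma regularization a del : 0 < del -> exists f : 'rV[R]_d -> R,
  [/\ continuous f, forall x, - Cb 1 <= f x,
      forall x z e, 0 < e -> exists2 k0, 0 < k0 & forall k, 0 < k -> k <= k0 ->
        f (x + k *: z) + f (x - k *: z) - 2 * f x <= k ^+ 2 * (enorm z ^+ 2 * (lam * f x + C0) + e),
      forall x p, phi a del p x <= f x &
      forall x, exists p, f x <= - dotp p a - h p x].
Proof.
move=> d0; have [rho [P [rho0 Prho PM]]] := phi_max a d0.
exists (freg a del P); split.
- exact: (freg_continuous d0 rho0 Prho PM).
- exact: (freg_ge0 PM).
- by move=> x z e; exact: (freg_diff2 d0 rho0 Prho PM).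
- exact: PM.
- by move=> x; exists (P x); rewrite /freg /phi gerBl mulr_ge0 ?dotp_ge0// divr_ge0// ltW.
Qed.

Definition Lag a x : \bar R := ereal_sup [set (- dotp p a - h p x)%:E | p in setT].
(** C0 / lam absorbs the constant of (H2)(iii) into lam times ell; Cb 1 compensates the lower bound
    L >= - H(0, x). *)
Definition C1ell := C0 / lam + Cb 1.
(** Where L is +oo, [fine] gives 0 and ell equals C1ell; statements about ell therefore come with
    finiteness of L. *)
Definition ell a x := fine (Lag a x) + C1ell.

Lemma ellE a x : ell a x = fine (Lag a x) + C1ell. Proof. by []. Qed.

Lemma Lag_ge p a x : ((- dotp p a - h p x)%:E <= Lag a x)%E.
Proof. by apply: ereal_sup_ubound; exists p. Qed.

Lemma Lag_lower a x : ((- Cb 1)%:E <= Lag a x)%E.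
Proof.
apply: le_trans (Lag_ge 0 a x); rewrite lee_fin dotp0l oppr0 sub0r lerN2.
by have [/ler_normlP[]] := @ham_bound1 1 0 x ltr01 ltac:(by rewrite enorm0).
Qed.

Lemma Lag_finP a x : reflect (exists M : R, forall p, - dotp p a - h p x <= M) (Lag a x \is a fin_num).
Proof.
apply: (iffP idP) => [f|[M HM]].
  by exists (fine (Lag a x)) => p; rewrite -lee_fin fineK//; exact: Lag_ge.
rewrite fin_numElt (lt_le_trans _ (Lag_lower a x)) ?ltNyr//=.
apply: (@le_lt_trans _ _ M%:E); last exact: ltry.
by apply: ge_ereal_sup => _ [p _ <-]; rewrite lee_fin.
Qed.

Lemma Lag_fine_ge p a x : Lag a x \is a fin_num -> - dotp p a - h p x <= fine (Lag a x).
Proof. by move=> f; rewrite -lee_fin fineK//; exact: Lag_ge. Qed.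

Lemma Lag_fine_le M a x : (forall p, - dotp p a - h p x <= M) -> fine (Lag a x) <= M.
Proof.
move=> HM; have f : Lag a x \is a fin_num by apply/Lag_finP; exists M.
by rewrite -lee_fin fineK//; apply: ge_ereal_sup => _ [p _ <-]; rewrite lee_fin.
Qed.

Lemma ell_gt0 a x : Lag a x \is a fin_num -> 0 < ell a x.
Proof.
move=> f; have : - Cb 1 <= fine (Lag a x) by rewrite -lee_fin fineK//; exact: Lag_lower.
have : 0 < C0 / lam by rewrite divr_gt0.
by rewrite /ell /C1ell; lra.
Qed.

Section Segment.
Context (f : 'rV[R]_d -> R) (x0 z : 'rV[R]_d).
Hypotheses (cf : continuous f) (f2 : forall x z e, 0 < e -> exists2 k0, 0 < k0 & forall k, 0 < k -> k <= k0 ->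
        f (x + k *: z) + f (x - k *: z) - 2 * f x <= k ^+ 2 * (enorm z ^+ 2 * (lam * f x + C0) + e)).

Let g (s : R) := f (x0 + s *: z) + C1ell.

Lemma segment_continuous : continuous g.
Proof.
apply: contD; last exact: cst_continuous.
move=> s; apply: (@continuous_comp _ _ _ (fun s : R => x0 + s *: z) f); last exact: cf.
apply: (@cvg_rV _ _ _ (nbhs s) (nbhs_filter s)) => i.
rewrite !mxE; under eq_fun do rewrite !mxE.
by apply: cvgD; [exact: cvg_cst|apply: cvgM; [exact: cvg_id|exact: cvg_cst]].
Qed.

Lemma segment_diff2 s e : 0 < e -> exists2 k0, 0 < k0 & forall k, 0 < k -> k <= k0 ->
  g (s + k) + g (s - k) - 2 * g s <= k ^+ 2 * (lam * enorm z ^+ 2 * g s + e).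
Proof.
move=> e0; have [k0 k00 H] := f2 (x0 + s *: z) z e0; exists k0 => // k kp kk.
have := H k kp kk.
have -> : x0 + s *: z + k *: z = x0 + (s + k) *: z by rewrite scalerDl addrA.
have -> : x0 + s *: z - k *: z = x0 + (s - k) *: z by rewrite scalerBl addrA.
move=> h1; rewrite (_ : _ - 2 * g s = f (x0 + (s + k) *: z) + f (x0 + (s - k) *: z) - 2 * f (x0 + s *: z)); last first.
  by rewrite /g; ring.
apply: (le_trans h1); apply: ler_wpM2l; first exact: sqr_ge0.
rewrite lerD2r (_ : lam * enorm z ^+ 2 * g s = enorm z ^+ 2 * (lam * g s)); last by ring.
apply: ler_wpM2l; first exact: sqr_ge0.
have : 0 <= lam * Cb 1 by rewrite mulr_ge0 ?Cb1_ge0// ltW.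
have : lam * (C0 / lam) = C0 by rewrite mulrCA mulfV ?gt_eqF// mulr1.
by rewrite /g /C1ell; lra.
Qed.

End Segment.

Lemma phi_to0 a p x (M : R) : (forall del, 0 < del -> phi a del p x <= M) -> - dotp p a - h p x <= M.
Proof.
move=> H; apply/ler_addgt0Pr => e e0.
have D0 : 0 < 1 + dotp p p by rewrite ltr_wpDr ?dotp_ge0.
have := H (e / (1 + dotp p p)) (divr_gt0 e0 D0); rewrite /phi.
have tE : e / (1 + dotp p p) * (1 + dotp p p) = e by rewrite divfK// gt_eqF.
have t0 : 0 <= e / (1 + dotp p p) * dotp p p by rewrite mulr_ge0 ?dotp_ge0// divr_ge0// ltW.
by move: tE t0 (divr_gt0 e0 D0); move: (e / _) => t; lra.
Qed.

(** Finiteness propagates in x: each value of the Legendre integrand at x1 is below the regularised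
    Lagrangian up to the penalty, the latter grows exponentially along the segment from x0, and del
    tends to 0 with p fixed. *)
Lemma ell_growth a x0 x1 : Lag a x0 \is a fin_num ->
  Lag a x1 \is a fin_num /\ ell a x1 <= expR (Num.sqrt lam * enorm (x1 - x0)) * ell a x0.
Proof.
move=> fin0; pose z := x1 - x0; pose K := expR (Num.sqrt lam * enorm z) * ell a x0.
have [zE|zn] := eqVneq z 0.
  have -> : x1 = x0 by apply/eqP; rewrite -subr_eq0 -/z zE.
  by rewrite subrr enorm0 mulr0 expR0 mul1r.
have L0 : 0 < lam * enorm z ^+ 2.
  rewrite mulr_gt0// exprn_gt0// lt_neqAle enorm_ge0 andbT eq_sym.
  by apply: contra_neq zn => /enorm_eq0.
have key p : - dotp p a - h p x1 <= K - C1ell.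
  apply: phi_to0 => del d0.
  have [f [cf flow f2 fphi fLag]] := regularization a d0.
  have := @exp_growth R _ _ L0 (@segment_continuous f x0 z cf) (segment_diff2 x0 z f2)
    (Num.sqrt lam * enorm z) 1 _ _ _ ler01.
  have x1E : x0 + z = x1 by rewrite /z addrC subrK.
  rewrite scale1r scale0r addr0 mulr1 x1E => H.
  have {}H : f x1 + C1ell <= (f x0 + C1ell) * expR (Num.sqrt lam * enorm z).
    apply: H.
    - move=> s; have := flow (x0 + s *: z); have : 0 < C0 / lam by rewrite divr_gt0.
      by rewrite /C1ell; lra.
    - by rewrite mulr_ge0 ?sqrtr_ge0 ?enorm_ge0.
    - by rewrite exprMn (sqr_sqrtr (ltW lam0)).
  rewrite lerBrDr; apply: le_trans (_ : f x1 + C1ell <= _); first by rewrite lerD2r.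
  apply: le_trans H _; rewrite /K mulrC ler_wpM2l ?expR_ge0// /ell lerD2r.
  by have [p' /le_trans] := fLag x0; apply; exact: Lag_fine_ge.
split; first by apply/Lag_finP; exists (K - C1ell).
by rewrite -/z -/K /ell -lerBrDr; exact: Lag_fine_le.
Qed.

(** Semiconcavity holds for the regularised functions. It is transferred with the dual variables p
    and p' of both endpoints fixed, and suprema are taken only afterwards. *)
Lemma ell_semiconcave a x0 x1 (th M : R) : Lag a x0 \is a fin_num -> 0 <= th <= 1 ->
  (forall s, 0 <= s <= 1 -> ell a (x0 + s *: (x1 - x0)) <= M) ->
  th * ell a x1 + (1 - th) * ell a x0 <= ell a (x0 + th *: (x1 - x0))
    + lam * M / 2 * (th * (1 - th)) * enorm (x1 - x0) ^+ 2.
Proof.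
move=> fin0 /andP[th0 th1] HM; pose z := x1 - x0.
have finx y : Lag a y \is a fin_num := (ell_growth y fin0).1.
have [zE|zn] := eqVneq z 0.
  rewrite -/z zE enorm0 expr0n mulr0 scaler0 !addr0.
  have -> : x1 = x0 by apply/eqP; rewrite -subr_eq0 -/z zE.
  by rewrite -mulrDl addrC subrK mul1r.
have L0 : 0 < lam * enorm z ^+ 2.
  rewrite mulr_gt0// exprn_gt0// lt_neqAle enorm_ge0 andbT eq_sym.
  by apply: contra_neq zn => /enorm_eq0.
set B := (X in _ <= X).
have key p p' : th * (- dotp p a - h p x1 + C1ell) + (1 - th) * (- dotp p' a - h p' x0 + C1ell) <= B.
  apply/ler_addgt0Pr => e e0.
  have D0 : 0 < 1 + dotp p p + dotp p' p' by rewrite ltr_wpDr ?dotp_ge0// ltr_wpDr ?dotp_ge0.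
  (* del depends on p and p', so that both penalties together stay below e. *)
  pose del := e / (1 + dotp p p + dotp p' p'); have d0 : 0 < del by rewrite divr_gt0.
  have [f [cf flow f2 fphi fLag]] := regularization a d0.
  have fell y : f y + C1ell <= ell a y.
    by rewrite lerD2r; have [q /le_trans] := fLag y; apply; exact: Lag_fine_ge.
  have := @semiconcave_segment R _ _ L0 (@segment_continuous f x0 z cf) (segment_diff2 x0 z f2) M 0 1 th ler01.
  rewrite th0 th1 => /(_ isT) H.
  have {}H := H (fun s s01 => le_trans (fell _) (HM s s01)).
  rewrite mulr1 mulr0 addr0 subr0 expr1n mulr1 scale1r scale0r addr0 in H.
  have h1 : - dotp p a - h p x1 <= f x1 + del / 2 * dotp p p by have := fphi x1 p; rewrite /phi lerBlDr.
  have h2 : - dotp p' a - h p' x0 <= f x0 + del / 2 * dotp p' p' by have := fphi x0 p'; rewrite /phi lerBlDr.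
  have x1E : x0 + z = x1 by rewrite /z addrC subrK.
  rewrite x1E in H.
  have hf := fell (x0 + th *: z).
  have hd : th * (del / 2 * dotp p p) + (1 - th) * (del / 2 * dotp p' p') <= e.
    have dd : del * (1 + dotp p p + dotp p' p') = e by rewrite /del divfK// gt_eqF.
    have a1 : 0 <= del / 2 * dotp p p by rewrite mulr_ge0 ?dotp_ge0// divr_ge0// ltW.
    have a2 : 0 <= del / 2 * dotp p' p' by rewrite mulr_ge0 ?dotp_ge0// divr_ge0// ltW.
    have b1 : th * (del / 2 * dotp p p) <= del / 2 * dotp p p by rewrite ler_piMl.
    have b2 : (1 - th) * (del / 2 * dotp p' p') <= del / 2 * dotp p' p' by rewrite ler_piMl// gerBl.
    move: b1 b2 a1 a2 dd d0; move: (dotp p p) (dotp p' p') => X3 X4.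
    by lra.
  have t1 : 0 <= 1 - th by rewrite subr_ge0.
  have g1 := ler_wpM2l th0 h1; have g2 := ler_wpM2l t1 h2.
  rewrite /B -/z; move: H g1 g2 hf hd.
  move: (ell a _) (f _) (f x1) (f x0) (- dotp p a - _) (- dotp p' a - _) (del / 2 * dotp p p) (del / 2 * dotp p' p').
  by move=> *; lra.
(* Supremum in p', then in p below. Each requires dividing by its weight, hence the separate cases 1
   - th = 0 and th = 0. *)
have step p : th * (- dotp p a - h p x1 + C1ell) + (1 - th) * ell a x0 <= B.
  have [E|tn] := eqVneq (1 - th) 0; first by have := key p 0; rewrite E !mul0r.
  have tp : 0 < 1 - th by rewrite lt_neqAle eq_sym tn subr_ge0.
  have : fine (Lag a x0) <= (B - th * (- dotp p a - h p x1 + C1ell)) / (1 - th) - C1ell.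
    apply: Lag_fine_le => p'; rewrite lerBrDr ler_pdivlMr// lerBrDl mulrC [in X in _ + X]mulrC.
    by have := key p p'; rewrite [_ * th]mulrC.
  rewrite lerBrDr ler_pdivlMr// -/(ell a x0) => h1; move: h1; rewrite lerBrDl mulrC.
  by rewrite mulrC [ell a x0 * _]mulrC.
have [E|tn] := eqVneq th 0; first by have := step 0; rewrite E !mul0r.
have tp : 0 < th by rewrite lt_neqAle eq_sym tn.
have : fine (Lag a x1) <= (B - (1 - th) * ell a x0) / th - C1ell.
  apply: Lag_fine_le => p; rewrite lerBrDr ler_pdivlMr// lerBrDr mulrC.
  exact: step.
by rewrite lerBrDr ler_pdivlMr// -/(ell a x1) lerBrDr mulrC.
Qed.

End Fixed.
End Hamiltonian.

(** * Pointwise form of the hypotheses on H *)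

Section FromHypotheses.
Context (R : realType) (disp : measure_display) (Omega : measurableType disp).
Context (P : probability Omega R) (T : R) (F : R -> set (set Omega)) (d : nat).
Context (H : R -> Omega -> 'rV[R]_d -> 'rV[R]_d -> R) (G : Omega -> 'rV[R]_d -> R).
Hypotheses (H1 : hypH1 P T F H G) (H2 : hypH2 T H).

Lemma hyp_C2 t w : 0 <= t <= T -> C2 (joint (H t w)).
Proof.
move=> tT; apply: is_C2_C2 => k k0.
by have [h _ _ _] := H1.2 1 (lexx _) k k0; have [] := h w t tT.
Qed.

(** For |z| = 1 the distributional inequality is made pointwise along (0, z); other z follow by
    scaling (q, z) together. *)
Lemma hyp_ham : exists lam C0 Cb, [/\ 0 < lam, 0 < C0 &
  forall t w, 0 <= t <= T -> ham lam C0 Cb (H t w)].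
Proof.
have [cvx bd [lam [C0 [lam0 C00 low]]]] := H2.
have /choice[Cb HCb] : forall r : R, exists C, 0 < r -> forall t w, 0 <= t <= T -> forall p x, enorm p <= r ->
      `|H t w p x| + enorm (Dp (H t w) p x) + enorm (Dpx (H t w) p x) + enorm (Dpp (H t w) p x) <= C.
  move=> r; have [r0|r0] := ltP 0 r; last by exists 0.
  by have [C _ HC] := bd r r0; exists C.
exists lam, C0, Cb; split=> // t w tT.
have c2 := hyp_C2 w tT.
split=> //; first exact: cvx.
  by move=> r r0 p x; exact: HCb.
have star1 p x q z : enorm z = 1 ->
    - (lam * (dotp (Dp (H t w) p x) p - H t w p x) + C0) <= hessq (joint (H t w)) (row_mx p x) (row_mx q z).
  move=> z1.
  (* The terms of (H2)(iii) that are functions. Their continuity is read off the identity [aE],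
     where the blocks in q appear as a difference of two Hessian forms. *)
  pose a (Y : 'rV[R]_(d + d)) := lam * (dotp (Dp (H t w) (lsubmx Y) (rsubmx Y)) (lsubmx Y) - joint (H t w) Y)
     + bform (Dpp (H t w) (lsubmx Y) (rsubmx Y)) q q
     + 2 * bform (Dpx (H t w) (lsubmx Y) (rsubmx Y)) z q.
  have aE Y : a Y = lam * (\sum_(i < d) partial (lshift d i) (joint (H t w)) Y * Y 0 (lshift d i)
      + (-1) * joint (H t w) Y) + (hessq (joint (H t w)) Y (row_mx q z) + (-1) * hessq (joint (H t w)) Y (row_mx 0 z)).
    rewrite -{2 3 4 5 6}[Y]hsubmxK (hessq_joint _ _ q z c2) /a -addrA; congr (lam * _ + _).
      rewrite mulN1r; congr (_ - _); last by rewrite hsubmxK.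
      apply: eq_bigr => i _; rewrite partial_lshift hsubmxK -[in Y 0 _](hsubmxK Y) row_mxEl.
      by rewrite /Dp [grad _ _ 0 i]mxE.
    by move: (hessq _ _ _) => Z; ring.
  have ca : continuous a.
    rewrite (funext aE); apply: contD; apply: (@contZ _ _ lam) || idtac.
      apply: contD; last exact/contZ/C1_continuous/c2.1.
      apply: continuous_fct_sum => i; apply: continuous_fctM; first exact: c2.1.2.
      by move=> Y; exact: coord_continuous.
    apply: contD; first exact: hessq_continuous.
    by apply: contZ; exact: hessq_continuous.
  have := distrib_pointwise (v := row_mx 0 z) (C0 := C0) c2 ca _ (row_mx p x).
  have -> : a (row_mx p x) + hessq (joint (H t w)) (row_mx p x) (row_mx 0 z) =
     lam * (dotp (Dp (H t w) p x) p - H t w p x) + hessq (joint (H t w)) (row_mx p x) (row_mx q z).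
    rewrite (hessq_joint _ _ q z c2) /a row_mxKl row_mxKr joint_row.
    by move: (hessq _ _ _) => Z; ring.
  have ph phi : test_function phi -> (forall y, 0 <= phi y) -> - C0 * integral_rV phi <=
      integral_rV (fun y => a y * phi y + joint (H t w) y * 'D_(row_mx 0 z) ('D_(row_mx 0 z) phi) y).
    exact: low.
  by move=> /(_ ph); lra.
(* For z = 0 scaling is impossible; the claim is then nonnegativity of the second derivative in p,
   which is convexity. *)
move=> p x q z; have [z0|zn] := eqVneq (enorm z) 0.
  rewrite z0 expr0n/= mul0r oppr0 (enorm_eq0 z0).
  have D := @diff2_cvg R _ _ c2 (row_mx p x) (row_mx q 0).
  apply: (ler_cvg_to (cvg_cst 0) D).
  apply: nearW => k; rewrite mulr_ge0 ?sqr_ge0// /diff2.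
  have := cvx t w tT (p + k.+1%:R^-1 *: q) (p - k.+1%:R^-1 *: q) x 2^-1.
  rewrite invr_ge0 ler0n invf_le1// ler1n => /(_ isT).
  have -> : 2^-1 *: (p + k.+1%:R^-1 *: q) + (1 - 2^-1) *: (p - k.+1%:R^-1 *: q) = p.
    by apply/rowP => i; rewrite !mxE; field.
  have -> : row_mx p x - k.+1%:R^-1 *: row_mx q 0 = row_mx p x + (- k.+1%:R^-1) *: row_mx q 0.
    by rewrite scaleNr.
  rewrite !joint_line joint_row !scaler0 !addr0 scaleNr.
  by move: (H t w p x) (H t w (p + _) x) (H t w (p - _) x) => A B C; lra.
have zp : 0 < enorm z by rewrite lt_neqAle eq_sym zn enorm_ge0.
have z1 : enorm ((enorm z)^-1 *: z) = 1.
  by rewrite enormZ ger0_norm ?invr_ge0 ?enorm_ge0// mulVf.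
have := star1 p x ((enorm z)^-1 *: q) _ z1; rewrite -row_mxZ hessqZ => h.
have e2 : 0 < enorm z ^+ 2 by rewrite exprn_gt0.
have := ler_wpM2l (ltW e2) h; rewrite mulrN mulrA exprVn mulfV ?mul1r//.
by rewrite gt_eqF.
Qed.

End FromHypotheses.

(** * Fenchel duality between H and L *)

Section Fenchel.
Context (R : realType) (d : nat) (lam C0 : R) (Cb : R -> R).
Hypotheses (lam0 : 0 < lam) (C00 : 0 < C0).
Context (h : 'rV[R]_d -> 'rV[R]_d -> R) (Hh : ham lam C0 Cb h).
Implicit Types (a p x y q z v : 'rV[R]_d).
Local Notation ell := (ell lam C0 Cb h).
Local Notation C1ell := (C1ell lam C0 Cb).

Lemma Lag_gradient p x : Lag h (- Dp h p x) x \is a fin_num /\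
  fine (Lag h (- Dp h p x) x) = dotp p (Dp h p x) - h p x.
Proof.
have key q : - dotp q (- Dp h p x) - h q x <= dotp p (Dp h p x) - h p x.
  rewrite dotpNr opprK; have := ham_gradient Hh p q x; rewrite dotpBl; lra.
have f : Lag h (- Dp h p x) x \is a fin_num by apply/(Lag_finP Hh); eexists; exact: key.
split=> //; apply/eqP; rewrite eq_le (Lag_fine_le Hh key)/=.
by have := Lag_fine_ge p f; rewrite dotpNr opprK.
Qed.

(** Equality means that p maximises the Legendre integrand, and the first order condition at p, with
    del = 0, is the claim. *)
Lemma Fenchel_eq a p x : Lag h a x \is a fin_num -> fine (Lag h a x) = - dotp p a - h p x ->
  a = - Dp h p x.
Proof.
move=> f E; apply/eqP; rewrite -subr_eq0 opprK; apply/eqP/enorm_eq0/eqP.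
rewrite -sqrf_eq0 enorm_sqr; apply/eqP.
have M q : phi h a 0 q x <= phi h a 0 p x.
  by rewrite /phi !mul0r !subr0 -E; exact: Lag_fine_ge.
have := phi_foc Hh (a + Dp h p x) M; rewrite mul0r addr0 -dotpDr.
by move=> ->.
Qed.

Lemma Lag_convex a b x (th : R) : 0 <= th <= 1 -> Lag h a x \is a fin_num -> Lag h b x \is a fin_num ->
  Lag h (th *: a + (1 - th) *: b) x \is a fin_num /\
  ell (th *: a + (1 - th) *: b) x <= th * ell a x + (1 - th) * ell b x.
Proof.
move=> /andP[th0 th1] fa fb.
have key p : - dotp p (th *: a + (1 - th) *: b) - h p x <= th * fine (Lag h a x) + (1 - th) * fine (Lag h b x).
  have t1 : 0 <= 1 - th by rewrite subr_ge0.
  have := ler_wpM2l th0 (Lag_fine_ge p fa); have := ler_wpM2l t1 (Lag_fine_ge p fb).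
  by rewrite dotpDr !dotpZr; lra.
split; first by apply/(Lag_finP Hh); eexists; exact: key.
have := Lag_fine_le Hh key; rewrite !ellE; lra.
Qed.

Definition cgrow : R := Num.sqrt lam * expR 1.

Lemma cgrow_ge0 : 0 <= cgrow. Proof. by rewrite mulr_ge0 ?sqrtr_ge0 ?expR_ge0. Qed.

Lemma expR_linear (y : R) : 0 <= y -> y <= 1 -> expR y <= 1 + expR 1 * y.
Proof.
move=> y0 y1; have : 1 - y <= expR (- y) by exact: expR_ge1Dx.
move=> h1; have := ler_wpM2l (expR_ge0 y) h1; rewrite -expRD subrr expR0 mulrBr mulr1.
have : expR y * y <= expR 1 * y by rewrite ler_wpM2r// ler_expR.
by move: (expR y * y) (expR y) => A B; lra.
Qed.

(* The Lagrangian is locally Lipschitz in x with a rate proportional to its own size. *)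
Lemma ell_near a x v : Lag h a x \is a fin_num -> Num.sqrt lam * enorm v <= 1 ->
  ell a (x + v) <= ell a x + cgrow * enorm v * ell a x /\
  ell a x - cgrow * expR 1 * enorm v * ell a x <= ell a (x + v).
Proof.
move=> f vn; have [f' h1] := ell_growth lam0 C00 Hh (x + v) f.
have [_ h2] := ell_growth lam0 C00 Hh x f'.
rewrite addrAC subrr add0r in h1; rewrite opprD addrA subrr sub0r enormN in h2.
have sv : 0 <= Num.sqrt lam * enorm v by rewrite mulr_ge0 ?sqrtr_ge0 ?enorm_ge0.
have e1 := expR_linear sv vn.
have l0 := ltW (ell_gt0 lam0 C00 Hh f); have l1 := ltW (ell_gt0 lam0 C00 Hh f').
have g1 := ler_wpM2r l0 e1; have g2 := ler_wpM2r l1 e1.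
have E : expR 1 * (Num.sqrt lam * enorm v) = cgrow * enorm v by rewrite /cgrow; ring.
rewrite E in g1 g2; split; first by move: h1 g1; lra.
have g3 : ell a (x + v) <= expR 1 * ell a x.
  apply: (le_trans h1); apply: ler_wpM2r => //; by rewrite ler_expR.
have c0 : 0 <= cgrow * enorm v by rewrite mulr_ge0 ?cgrow_ge0 ?enorm_ge0.
have := ler_wpM2l c0 g3; move: h2 g2; rewrite (_ : cgrow * expR 1 * enorm v * ell a x = cgrow * enorm v * (expR 1 * ell a x)); last by ring.
by lra.
Qed.

(** With a = - D_pH(p, x), the function p . D_pH(p, x) - H(p, .) lies below L(a, .) and touches it
    at x, so - D_xH in any direction is at most the growth rate of ell. *)
Lemma Dx_bound p x : enorm (Dx h p x) <= cgrow * ell (- Dp h p x) x.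
Proof.
pose a := - Dp h p x; have [f fE] := Lag_gradient p x.
have l0 := ltW (ell_gt0 lam0 C00 Hh f).
have key z : - dotp z (Dx h p x) <= cgrow * enorm z * ell a x.
  have := ham_line Hh p x 0 z 0; rewrite !scale0r !addr0 dotp0l add0r.
  under [X in is_derive _ _ X]eq_fun do rewrite scaler0 addr0.
  move=> /is_derive_eps D; apply/ler_addgt0Pr => e e0.
  have [del del0 {}D] := D e e0.
  have Z1 : 0 < Num.sqrt lam * enorm z + 1 by rewrite ltr_wpDl// mulr_ge0 ?sqrtr_ge0 ?enorm_ge0.
  pose s := Num.min del (Num.sqrt lam * enorm z + 1)^-1.
  have s0 : 0 < s by rewrite lt_min del0 invr_gt0.
  have := D s; rewrite ger0_norm ?(ltW s0)// ge_min lexx => /(_ isT).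
  rewrite add0r scale0r addr0 ler_norml => /andP[_ d1].
  have [|n1 _] := @ell_near a x (s *: z) f.
    rewrite enormZ ger0_norm ?(ltW s0)// mulrCA.
    have : s * (Num.sqrt lam * enorm z + 1) <= 1 by rewrite -ler_pdivlMr// mul1r ge_min lexx orbT.
    by rewrite mulrDr mulr1; move: s0; lra.
  have f' := (ell_growth lam0 C00 Hh (x + s *: z) f).1.
  have := Lag_fine_ge p f'; rewrite {1}/a dotpNr opprK => n2.
  have n3 : dotp p (Dp h p x) - h p (x + s *: z) - (dotp p (Dp h p x) - h p x) <= s * (cgrow * enorm z * ell a x).
    rewrite -fE -/a; move: n1; rewrite enormZ ger0_norm ?(ltW s0)// !ellE.
    rewrite (_ : cgrow * (s * enorm z) = s * (cgrow * enorm z)); last by ring.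
    by move: n2; rewrite -mulrA; lra.
  by rewrite -(ler_pM2l s0); move: d1 n3; lra.
have := key (- Dx h p x); rewrite dotpNl opprK enormN -enorm_sqr => h1.
have [->|n0] := eqVneq (enorm (Dx h p x)) 0; first by rewrite mulr_ge0 ?cgrow_ge0.
have np : 0 < enorm (Dx h p x) by rewrite lt_neqAle eq_sym n0 enorm_ge0.
by rewrite -(ler_pM2l np) -expr2; apply: (le_trans h1); rewrite le_eqVlt; apply/orP; left; apply/eqP; ring.
Qed.

Lemma ell_bound p x r : 0 < r -> enorm p <= r ->
  ell (- Dp h p x) x <= r * Cb r + Cb r + C1ell.
Proof.
move=> r0 pr; have [_ fE] := Lag_gradient p x.
rewrite !ellE fE lerD2r.
have [h1 h2] := ham_bound1 Hh x r0 pr.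
have := cauchy_schwarz p (Dp h p x); rewrite ler_norml => /andP[_ h3].
have := ler_pM (enorm_ge0 _) (enorm_ge0 _) pr h2.
by move: h1; rewrite ler_norml => /andP[]; lra.
Qed.

(** L(a, .) is squeezed at x between the differentiable function p . D_pH(p, x) - H(p, .) from below
    and a paraboloid of slope xi from above: all three have the same gradient. *)
Lemma Lag_differentiable p x (xi : 'rV[R]_d) (K : R) : let a := - Dp h p x in 0 <= K ->
  (forall v, enorm v <= 1 -> ell a (x + v) <= ell a x + dotp xi v + K * enorm v ^+ 2) ->
  xi = - Dx h p x /\ grad (fun y => fine (Lag h a y)) x = xi.
Proof.
move=> a K0 up; have [f fE] := Lag_gradient p x.
have low z (s : R) : fine (Lag h a x) - (h p (x + s *: z) - h p x) <= fine (Lag h a (x + s *: z)).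
  have f' := (ell_growth lam0 C00 Hh (x + s *: z) f).1.
  by have := Lag_fine_ge p f'; rewrite {1}/a dotpNr opprK fE; lra.
have nE i : enorm (ebase R i) = 1.
  rewrite enormE /dotp (bigD1 i)//= big1 ?addr0 => [|j ji].
    by rewrite ebaseE eqxx mulr1 sqrtr1.
  by rewrite ebaseE (negPf ji) mul0r.
have dE v i : dotp v (ebase R i) = v 0 i.
  rewrite /dotp (bigD1 i)//= big1 ?addr0 => [|j ji]; first by rewrite ebaseE eqxx mulr1.
  by rewrite ebaseE (negPf ji) mulr0.
have upi i (s : R) : `|s| <= 1 -> fine (Lag h a (x + s *: ebase R i)) <= fine (Lag h a x) + s * xi 0 i + K * s ^+ 2.
  move=> s1; have := up (s *: ebase R i); rewrite enormZ nE mulr1 => /(_ s1).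
  by rewrite dotpZr dE real_normK ?num_real// !ellE; lra.
have Di i e : 0 < e -> exists2 del, 0 < del & forall s, `|s| <= del ->
    `|h p (x + s *: ebase R i) - h p x - s * Dx h p x 0 i| <= e * `|s|.
  have := ham_line Hh p x 0 (ebase R i) 0; rewrite !scale0r !addr0 dotp0l add0r.
  under [X in is_derive _ _ X]eq_fun do rewrite scaler0 addr0.
  move=> /is_derive_eps D e0; have [del del0 {}D] := D e e0.
  by exists del => // s sd; have := D s sd; rewrite add0r scale0r addr0 dotpC dE.
have xiE i : xi 0 i = - Dx h p x 0 i.
  suff H (sg : R) : `|sg| = 1 -> 0 <= sg * (xi 0 i + Dx h p x 0 i).
    have := H 1; have := H (-1); rewrite normrN normr1 => /(_ erefl) h1 /(_ erefl) h2.
    by move: h1 h2; rewrite mulN1r mul1r; lra.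
  move=> sg1; apply/ler_addgt0Pr => e e0.
  have e2 : 0 < e / 2 by rewrite divr_gt0.
  have [del del0 D] := Di i _ e2.
  pose t := Num.min 1 (Num.min del (e / 2 / (K + 1))).
  have K1 : 0 < K + 1 by rewrite ltr_wpDl.
  have t0 : 0 < t by rewrite !lt_min ltr01 del0 divr_gt0.
  have tn : `|t * sg| = t by rewrite normrM sg1 mulr1 ger0_norm// ltW.
  have t1 : t <= 1 by rewrite ge_min lexx.
  have td : t <= del by rewrite !ge_min lexx orbT.
  have tK : K * t <= e / 2.
    have : t * (K + 1) <= e / 2 by rewrite -ler_pdivlMr// !ge_min lexx !orbT.
    by move: t0; lra.
  have h1 := upi i (t * sg); rewrite tn in h1; have {}h1 := h1 t1.
  have h2 := low (ebase R i) (t * sg).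
  have h3 := D (t * sg); rewrite tn in h3; have := h3 td; rewrite ler_norml => /andP[_ {}h3].
  have sg2 : (t * sg) ^+ 2 = t ^+ 2 by rewrite -[LHS]real_normK ?num_real// tn.
  rewrite sg2 in h1; rewrite -(pmulr_rge0 _ t0).
  have tK2 := ler_wpM2l (ltW t0) tK.
  by move: h1 h2 h3 tK2; rewrite expr2; lra.
split; first by apply/rowP => i; rewrite mxE.
apply/rowP => i; rewrite mxE.
have D : is_derive (0 : R) (1 : R) (fun s => fine (Lag h a (x + s *: ebase R i))) (xi 0 i).
  apply: is_derive_lim => e e0.
  have [del del0 D] := Di i e e0.
  have K1 : 0 < K + 1 by rewrite ltr_wpDl.
  have t0 : 0 < Num.min 1 (Num.min del (e / (K + 1))) by rewrite !lt_min ltr01 del0 divr_gt0.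
  near=> s; have st : `|s| <= Num.min 1 (Num.min del (e / (K + 1))) by near: s; exact: nbhs0_leR.
  move: st; rewrite !le_min => /and3P[s1 s2 s3].
  rewrite add0r scale0r addr0.
  have h1 := upi i s s1; have h2 := low (ebase R i) s.
  have := D s s2; rewrite -[Dx h p x 0 i]opprK -xiE ler_norml => /andP[_ h3].
  have h4 : K * s ^+ 2 <= e * `|s|.
    rewrite -[s ^+ 2]real_normK ?num_real// expr2 mulrA ler_wpM2r//.
    move: s3; rewrite ler_pdivlMr//; apply: le_trans; rewrite mulrDr mulr1 mulrC lerDl//.
  by rewrite ler_norml; apply/andP; split; lra.
exact: (@derive_val _ _ _ _ _ _ _ (@derive_line0 R d (fun y => fine (Lag h a y)) x (ebase R i) _ D)).
Unshelve. all: by end_near. Qed.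

End Fenchel.

(** * Supergradients chosen by limits of sequences *)

Section Superlinear.
Context (R : realType) (d : nat).
Implicit Types (sg : 'rV[R]_d -> R) (e v w : 'rV[R]_d).

Definition superlinear sg := (forall v w, sg v + sg w <= sg (v + w)) /\
  (forall (c : R) v, 0 < c -> sg (c *: v) = c * sg v).

Lemma superlinear0 sg : superlinear sg -> sg 0 = 0.
Proof. by move=> [_ /(_ 2 0 (ltr0Sn _ _))]; rewrite scaler0; lra. Qed.

(* The one-sided derivative of sg at e: it lies above sg and is linear along e. *)
Definition refine_at e sg v : R := limn (fun n : nat => sg (n%:R *: e + v) - n%:R * sg e).

Section Refine.
Context (sg : 'rV[R]_d -> R) (Hs : superlinear sg) (e : 'rV[R]_d).

Lemma refine_mono v (s t : R) : s <= t -> sg (s *: e + v) - s * sg e <= sg (t *: e + v) - t * sg e.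
Proof.
rewrite le_eqVlt => /orP[/eqP->//|st].
have := Hs.1 (s *: e + v) ((t - s) *: e).
rewrite Hs.2 ?subr_gt0// addrAC -scalerDl [s + _]addrC subrK; lra.
Qed.

Lemma refine_is_cvg v : (fun n : nat => sg (n%:R *: e + v) - n%:R * sg e) @ \oo --> refine_at e sg v.
Proof.
apply: nondecreasing_is_cvgn.
  by move=> m n mn; apply: refine_mono; rewrite ler_nat.
exists (- sg (- v)) => _ [n _ <-].
have := Hs.1 (n%:R *: e + v) (- v); rewrite addrK.
have [->|n0] := posnP n; first by rewrite scale0r add0r mul0r superlinear0//; lra.
by rewrite Hs.2 ?ltr0n//; lra.
Qed.

Lemma refine_ge_real v (t : R) : sg (t *: e + v) - t * sg e <= refine_at e sg v.
Proof.
have [n tn] : exists n : nat, t <= n%:R.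
  by exists (Num.truncn t).+1; apply: ltW; exact: truncnS_gt.
apply: le_trans (refine_mono v tn) _.
have mono : nondecreasing_seq (fun n : nat => sg (n%:R *: e + v) - n%:R * sg e).
  by move=> m k mk; apply: refine_mono; rewrite ler_nat.
exact: (nondecreasing_cvgn_le mono (cvgP _ (@refine_is_cvg v)) n).
Qed.

Lemma refine_ge v : sg v <= refine_at e sg v.
Proof. by have := refine_ge_real v 0; rewrite scale0r add0r mul0r subr0. Qed.
Lemma refine_le v (M : R) : (forall n : nat, sg (n%:R *: e + v) - n%:R * sg e <= M) ->
  refine_at e sg v <= M.
Proof. by move=> H; apply: (ler_cvg_to (@refine_is_cvg v) (cvg_cst M)); exact: nearW. Qed.

Lemma refine_superlinear : superlinear (refine_at e sg).
Proof.
split=> [v w|].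
  rewrite -lerBrDr; apply: refine_le => n; rewrite lerBrDr addrC -lerBrDr; apply: refine_le => m.
  rewrite lerBrDr; apply: le_trans (refine_ge_real (v + w) (n%:R + m%:R)).
  have := Hs.1 (n%:R *: e + v) (m%:R *: e + w); rewrite addrACA -scalerDl mulrDl; lra.
have half (c : R) v : 0 < c -> c * refine_at e sg v <= refine_at e sg (c *: v).
  move=> c0; rewrite mulrC -ler_pdivlMr//; apply: refine_le => n; rewrite ler_pdivlMr//.
  apply: le_trans (refine_ge_real (c *: v) (c * n%:R)).
  by rewrite -scalerA -scalerDr Hs.2// mulrC mulrBr mulrA.
move=> c v c0; apply/eqP; rewrite eq_le half// andbT.
have ci : 0 < c^-1 by rewrite invr_gt0.
have := half c^-1 (c *: v) ci; rewrite scalerA mulVf ?gt_eqF// scale1r.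
by rewrite mulrC ler_pdivrMr// [_ * c]mulrC.
Qed.

Lemma refine_linear_at : refine_at e sg e + refine_at e sg (- e) = 0.
Proof.
apply/eqP; rewrite eq_le; apply/andP; split.
  by apply: le_trans (refine_superlinear.1 _ _) _; rewrite subrr superlinear0//; exact: refine_superlinear.
have := refine_ge e; have := refine_ge_real (- e) 1.
by rewrite scale1r subrr superlinear0// mul1r; lra.
Qed.

End Refine.

(** A linear form above sg is a supergradient. Making sg linear along each basis vector in turn
    involves only limits of sequences, so the choice is measurable in parameters. *)
Definition select sg : 'rV[R]_d -> R := foldr (fun i s => refine_at (ebase R i) s) sg (enum 'I_d).

Lemma selectP sg : superlinear sg -> [/\ superlinear (select sg), forall v, sg v <= select sg v &
  forall i, select sg (ebase R i) + select sg (- ebase R i) = 0].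
Proof.
move=> s0; suff H l : let s := foldr (fun i s => refine_at (ebase R i) s) sg l in
    [/\ superlinear s, forall v, sg v <= s v & forall i, i \in l -> s (ebase R i) + s (- ebase R i) = 0].
  by have [h1 h2 h3] := H (enum 'I_d); split=> // i; apply: h3; rewrite mem_enum.
elim: l => [|i l [IH1 IH2 IH3]] /=; first by split.
split=> [|v|j]; first exact: refine_superlinear.
  by apply: le_trans (IH2 v) _; exact: refine_ge.
rewrite inE => /orP[/eqP->|/IH3 jl]; first exact: refine_linear_at.
have rs := refine_superlinear IH1 (ebase R i).
apply/eqP; rewrite eq_le; apply/andP; split.
  by apply: le_trans (rs.1 _ _) _; rewrite subrr superlinear0.
by rewrite -jl; apply: lerD; exact: refine_ge.
Qed.

(** Superadditivity bounds s from below by the linear form of its values on the basis. Used at - v,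
    together with s v + s (- v) <= 0, it gives the bound from above. *)
Lemma select_dominates sg : superlinear sg -> forall v,
  sg v <= \sum_i v 0 i * select sg (ebase R i).
Proof.
move=> s0 v; have [ss sge sl] := selectP s0; set s := select sg in ss sge sl *.
have lin (c : R) i : c * s (ebase R i) <= s (c *: ebase R i).
  have [c0|c0|->] := ltgtP c 0; last by rewrite scale0r mul0r superlinear0.
    have := ss.2 (- c) (- ebase R i); rewrite oppr_gt0 => /(_ c0).
    rewrite scaleNr scalerN opprK => ->; have := sl i; move=> h.
    by rewrite (_ : s (- _) = - s (ebase R i)) ?mulrNN//; lra.
  by rewrite ss.2.
have sumle (I : Type) (l : seq I) (f : I -> 'rV[R]_d) : \sum_(i <- l) s (f i) <= s (\sum_(i <- l) f i).
  elim: l => [|i l IH]; first by rewrite !big_nil superlinear0.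
  by rewrite !big_cons; apply: le_trans (ss.1 _ _); rewrite lerD2l.
have h1 : \sum_i (- v 0 i) * s (ebase R i) <= s (- v).
  apply: le_trans (_ : \sum_i s ((- v 0 i) *: ebase R i) <= _); first by apply: ler_sum => i _; exact: lin.
  apply: le_trans (sumle _ _ _) _; rewrite le_eqVlt; apply/orP; left; apply/eqP; congr s.
  apply/rowP => j; rewrite summxE !mxE (bigD1 j)//= big1 ?addr0 => [|i ij].
    by rewrite !mxE !eqxx mulr1.
  by rewrite !mxE eqxx/= eq_sym (negPf ij) mulr0.
have h2 := ss.1 v (- v); rewrite subrr superlinear0// in h2.
apply: le_trans (sge v) _; rewrite -lerN2 -sumrN.
by under eq_bigr do rewrite -mulNr; move: h1 h2; lra.
Qed.

End Superlinear.

Lemma numeric_bound (R : realType) (C a b s t : R) :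
  - C <= a -> - C <= b -> s + t = 0 -> b <= t -> a <= s -> `|s| <= C.
Proof. by move=> *; rewrite ler_norml; apply/andP; split; lra. Qed.

(** * One-sided directional derivatives of ell(a, .) *)

Section DirectionalDerivative.
Context (R : realType) (d : nat) (lam C0 : R) (Cb : R -> R).
Hypotheses (lam0 : 0 < lam) (C00 : 0 < C0).
Context (h : 'rV[R]_d -> 'rV[R]_d -> R) (Hh : ham lam C0 Cb h) (a x : 'rV[R]_d).
Hypothesis fin : Lag h a x \is a fin_num.
Implicit Types (v w : 'rV[R]_d).
Let f w := ell lam C0 Cb h a (x + w).

(** Semiconcavity constant on the unit ball around x: half of lam times the bound exp (sqrt lam) l
    of ell there. *)
Definition kappa (l : R) : R := lam * (expR (Num.sqrt lam) * l) / 2.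
Let k := kappa (f 0).

Let f0E : f 0 = ell lam C0 Cb h a x. Proof. by rewrite /f addr0. Qed.

Let f00 : 0 < f 0.
Proof. by rewrite f0E; exact: (ell_gt0 lam0 C00 Hh fin). Qed.
Let k0 : 0 <= k.
Proof. by rewrite /k /kappa divr_ge0// !mulr_ge0 ?expR_ge0 ?(ltW lam0)// ltW. Qed.

Let f_le w : enorm w <= 1 -> f w <= expR (Num.sqrt lam) * f 0.
Proof.
move=> w1; have [_] := ell_growth lam0 C00 Hh (x + w) fin.
rewrite addrAC subrr add0r -f0E => /le_trans; apply; rewrite ler_wpM2r ?(ltW f00)// ler_expR.
by rewrite -[leRHS]mulr1 ler_wpM2l ?sqrtr_ge0.
Qed.

Let f_conc w0 w1 (th : R) : enorm w0 <= 1 -> enorm w1 <= 1 -> 0 <= th <= 1 ->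
  th * f w1 + (1 - th) * f w0 <= f (w0 + th *: (w1 - w0)) + k * (th * (1 - th)) * enorm (w1 - w0) ^+ 2.
Proof.
move=> h0 h1 th01; have fin0 := (ell_growth lam0 C00 Hh (x + w0) fin).1.
have := @ell_semiconcave _ _ _ _ _ lam0 C00 _ Hh a (x + w0) (x + w1) th (expR (Num.sqrt lam) * f 0) fin0 th01.
have -> : x + w1 - (x + w0) = w1 - w0 by rewrite opprD addrACA subrr add0r.
rewrite /f [x + (w0 + _)]addrA; apply=> s /andP[s0 s1]; rewrite -[x + w0 + _]addrA; apply: f_le.
have -> : w0 + s *: (w1 - w0) = (1 - s) *: w0 + s *: w1.
  by apply/rowP => i; rewrite !mxE; ring.
apply: le_trans (enormD _ _) _; rewrite !enormZ !ger0_norm ?subr_ge0//.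
have s1' : 0 <= 1 - s by rewrite subr_ge0.
by have := ler_wpM2l s0 h1; have := ler_wpM2l s1' h0; lra.
Qed.

Definition isdd v (S : R) := forall e, 0 < e -> exists2 t1, 0 < t1 &
  forall t, 0 < t -> t <= t1 -> `|f (t *: v) - f 0 - t * S| <= e * t.

Lemma isdd_unique v S S' : isdd v S -> isdd v S' -> S = S'.
Proof.
move=> h1 h2; apply/eqP; rewrite -subr_eq0 -normr_eq0 eq_le normr_ge0 andbT.
apply/ler_addgt0Pr => e e0; rewrite add0r; have e2 : 0 < e / 2 by rewrite divr_gt0.
have [t1 t10 H1] := h1 _ e2; have [t2 t20 H2] := h2 _ e2.
pose t := Num.min t1 t2; have t0 : 0 < t by rewrite lt_min t10.
have := H1 t t0; rewrite ge_min lexx => /(_ isT) g1.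
have := H2 t t0; rewrite ge_min lexx orbT => /(_ isT) g2.
rewrite -(ler_pM2l t0) -{1}(gtr0_norm t0) -normrM mulrBr.
move: g1 g2; rewrite !ler_norml => /andP[g1 g2] /andP[g3 g4].
by apply/andP; split; lra.
Qed.

Lemma isdd_scale v S (c : R) : 0 < c -> isdd v S -> isdd (c *: v) (c * S).
Proof.
move=> c0 H e e0; have [t1 t10 H1] := H (e / c) (divr_gt0 e0 c0).
exists (t1 / c) => [|t tp tt]; first by rewrite divr_gt0.
have := H1 (t * c); rewrite mulr_gt0// -ler_pdivlMr// => /(_ isT tt).
have -> : e / c * (t * c) = e * t by field; rewrite gt_eqF.
by rewrite scalerA mulrA.
Qed.

Lemma isdd_upper v S : isdd v S -> enorm v <= 1 -> f v <= f 0 + S + k * enorm v ^+ 2.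
Proof.
move=> H v1; apply/ler_addgt0Pr => e e0; have [t1 t10 H1] := H e e0.
pose t := Num.min 1 t1; have t0 : 0 < t by rewrite lt_min ltr01.
have tle1 : t <= 1 by rewrite ge_min lexx.
have := H1 t t0; rewrite ge_min lexx orbT => /(_ isT); rewrite ler_norml => /andP[_ g1].
have := @f_conc 0 v t; rewrite enorm0 ler01 v1 (ltW t0) tle1 subr0 add0r => /(_ isT isT isT) g2.
rewrite -(ler_pM2l t0).
have g3 : k * (t * (1 - t)) * enorm v ^+ 2 <= t * (k * enorm v ^+ 2).
  rewrite (_ : _ * _ * _ = (1 - t) * (t * (k * enorm v ^+ 2))); last by ring.
  apply: ler_piMl; last by rewrite gerBl ltW.
  exact: (mulr_ge0 (ltW t0) (mulr_ge0 k0 (sqr_ge0 _))).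
by move: g1 g2 g3; lra.
Qed.

(** Semiconcavity at the midpoint of t v and t w; its error is of order t^2 and vanishes after
    division by t. *)
Lemma isdd_add v w S S' S'' : isdd v S -> isdd w S' -> isdd (v + w) S'' -> S + S' <= S''.
Proof.
move=> h1 h2 h3; apply/ler_addgt0Pr => e e0; have e4 : 0 < e / 4 by rewrite divr_gt0.
have [t1 t10 H1] := h1 _ e4; have [t2 t20 H2] := h2 _ e4; have [t3 t30 H3] := h3 _ e4.
pose n := enorm v + enorm w + enorm (v - w) + 1.
have n0 : 0 < n by rewrite ltr_wpDl// !addr_ge0 ?enorm_ge0.
pose C := k * enorm (w - v) ^+ 2 + 1; have C0' : 0 < C by rewrite ltr_wpDl// mulr_ge0 ?sqr_ge0.
pose t := Num.min (Num.min t1 t2) (Num.min t3 (Num.min n^-1 (e / 4 / C))).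
have t0 : 0 < t by rewrite !lt_min t10 t20 t30 invr_gt0 n0 divr_gt0.
have tt1 : t <= t1 by rewrite !ge_min lexx.
have tt2 : t <= t2 by rewrite !ge_min lexx !orbT.
have tt3 : t <= t3 by rewrite !ge_min lexx !orbT.
have ttn : t * n <= 1 by rewrite -ler_pdivlMr// mul1r !ge_min lexx !orbT.
have ttC : t * C <= e / 4 by rewrite -ler_pdivlMr// !ge_min lexx !orbT.
have v1 : enorm (t *: v) <= 1.
  rewrite enormZ gtr0_norm//; apply: le_trans ttn; rewrite ler_wpM2l ?(ltW t0)// /n -!addrA lerDl.
  by rewrite !addr_ge0 ?enorm_ge0.
have w1 : enorm (t *: w) <= 1.
  rewrite enormZ gtr0_norm//; apply: le_trans ttn; rewrite ler_wpM2l ?(ltW t0)// /n -!addrA addrCA lerDl.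
  by rewrite !addr_ge0 ?enorm_ge0.
have := H1 t t0 tt1; have := H2 t t0 tt2.
rewrite !ler_norml => /andP[g1 _] /andP[g2 _].
have th : 0 < t / 2 by rewrite divr_gt0.
have := H3 (t / 2) th; have -> : t / 2 <= t3 by rewrite (le_trans _ tt3)// ler_pdivrMr// ler_peMr ?ler1n// ltW.
move=> /(_ isT); rewrite ler_norml => /andP[_ g3].
have := f_conc v1 w1 (th := 2^-1); rewrite invr_ge0 ler0n invf_le1// ler1n => /(_ isT).
have -> : t *: v + 2^-1 *: (t *: w - t *: v) = (t / 2) *: (v + w).
  by apply/rowP => i; rewrite !mxE; field.
rewrite -scalerBr enormZ gtr0_norm// => g4.
have g5 : k * (2^-1 * (1 - 2^-1)) * (t * enorm (w - v)) ^+ 2 <= t * (e / 4) / 4.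
  have -> : k * (2^-1 * (1 - 2^-1)) * (t * enorm (w - v)) ^+ 2 = t * (t * (k * enorm (w - v) ^+ 2)) / 4.
    by field.
  apply: ler_wpM2r; first by rewrite invr_ge0.
  apply: ler_wpM2l; first exact: ltW.
  by apply: le_trans ttC; apply: ler_wpM2l; [exact: ltW|rewrite lerDl].
have et := mulr_gt0 e0 t0.
rewrite -(ler_pM2l t0); move: g4 g5; set X := k * _ * _; move: g1 g2 g3.
by move: X (f _) (f _) (f _) (f _) => X A1 A2 A3 A4; lra.
Qed.

Lemma isdd_bound v S : isdd v S -> `|S| <= cgrow lam * expR 1 * enorm v * f 0.
Proof.
move=> H; apply/ler_addgt0Pr => e e0; have [t1 t10 H1] := H e e0.
have Z1 : 0 < Num.sqrt lam * enorm v + 1 by rewrite ltr_wpDl// mulr_ge0 ?sqrtr_ge0 ?enorm_ge0.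
pose t := Num.min t1 (Num.sqrt lam * enorm v + 1)^-1.
have t0 : 0 < t by rewrite lt_min t10 invr_gt0.
have := H1 t t0; rewrite ge_min lexx => /(_ isT).
have tn : Num.sqrt lam * enorm (t *: v) <= 1.
  rewrite enormZ gtr0_norm// mulrCA.
  have : t * (Num.sqrt lam * enorm v + 1) <= 1 by rewrite -ler_pdivlMr// mul1r ge_min lexx orbT.
  by rewrite mulrDr mulr1; move: t0; lra.
have [n1 n2] := ell_near lam0 C00 Hh fin tn.
rewrite -!f0E -/(f (t *: v)) enormZ gtr0_norm// in n1 n2.
have cg := cgrow_ge0 lam.
have e1 : 1 <= expR 1 :> R by apply: le_trans (expR_ge1Dx 1); rewrite lerDl.
have n3 : cgrow lam * (t * enorm v) * f 0 <= t * (cgrow lam * expR 1 * enorm v * f 0).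
  rewrite (_ : cgrow lam * _ * _ = t * (1 * (cgrow lam * enorm v * f 0))); last by ring.
  rewrite (_ : cgrow lam * expR 1 * _ * _ = expR 1 * (cgrow lam * enorm v * f 0)); last by ring.
  by rewrite ler_wpM2l ?(ltW t0)// ler_wpM2r// !mulr_ge0 ?enorm_ge0// ltW.
rewrite (_ : cgrow lam * expR 1 * (t * enorm v) * f 0 = t * (cgrow lam * expR 1 * enorm v * f 0)) in n2; last by ring.
rewrite ler_norml => /andP[g1 g2].
rewrite -(ler_pM2l t0) -{1}(gtr0_norm t0) -normrM ler_norml.
by move: (cgrow lam * _ * _ * _) n1 n2 n3 g1 g2 => A *; apply/andP; split; lra.
Qed.

(** The corrected difference quotients decrease in t and are bounded above by the growth estimate,
    so the derivative is their supremum. *)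
Lemma ex_isdd v : exists S, isdd v S.
Proof.
pose n := enorm v; have n0 : 0 <= n := enorm_ge0 v.
pose t0 := (n + Num.sqrt lam * n + 1)^-1.
have D0 : 0 < n + Num.sqrt lam * n + 1 by rewrite ltr_wpDl// addr_ge0// mulr_ge0 ?sqrtr_ge0.
have t00 : 0 < t0 by rewrite invr_gt0.
have sl0 := sqrtr_ge0 lam.
have tn t : 0 < t -> t <= t0 -> t * n <= 1 /\ Num.sqrt lam * (t * n) <= 1.
  move=> tp tt; have h1 : t * (n + Num.sqrt lam * n + 1) <= 1 by rewrite -ler_pdivlMr// mul1r.
  have h2 : 0 <= t * n by rewrite mulr_ge0// ltW.
  have h3 : 0 <= Num.sqrt lam * (t * n) by rewrite mulr_ge0.
  by move: h1; rewrite !mulrDr mulr1 (mulrCA t); split; lra.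
(* The correction k t |v|^2 is exactly the semiconcavity defect between 0 and t v, and makes the
   quotient monotone. *)
pose E t := (f (t *: v) - f 0) / t - k * t * n ^+ 2.
have Emono s t : 0 < s -> s <= t -> t <= t0 -> E t <= E s.
  move=> s0 st tt; have tp := lt_le_trans s0 st.
  have [tn1 _] := tn t tp tt.
  have := @f_conc 0 (t *: v) (s / t); rewrite enorm0 ler01 enormZ gtr0_norm// tn1.
  rewrite divr_ge0 ?(ltW s0) ?(ltW tp)// ler_pdivrMr// mul1r st => /(_ isT isT isT).
  rewrite subr0 add0r scalerA divfK ?gt_eqF// enormZ gtr0_norm// => g.
  rewrite -(ler_pM2l s0) /E.
  have g1 : s * ((f (t *: v) - f 0) / t) = s / t * f (t *: v) + (1 - s / t) * f 0 - f 0 by ring.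
  have g2 : s * ((f (s *: v) - f 0) / s) = f (s *: v) - f 0 by rewrite mulrC divfK// gt_eqF.
  have g3 : k * (s / t * (1 - s / t)) * (t * n) ^+ 2 = k * s * (t - s) * n ^+ 2.
    by field; rewrite gt_eqF.
  rewrite g3 in g; rewrite !mulrBr g1 g2; move: g; lra.
pose A := [set E t | t in [set t | 0 < t <= t0]].
have Ane : A !=set0 by exists (E t0), t0 => //=; rewrite t00 lexx.
have Aub : ubound A (cgrow lam * n * f 0).
  move=> _ [t /= /andP[tp tt] <-]; have [_ t2] := tn t tp tt.
  have := ell_near lam0 C00 Hh fin (v := t *: v); rewrite enormZ gtr0_norm// => /(_ t2)[n1 _].
  rewrite -!f0E -/(f (t *: v)) -/n in n1; rewrite /E lerBlDr.
  have kk : 0 <= k * t * n ^+ 2 by rewrite !mulr_ge0 ?sqr_ge0// ltW.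
  have : (f (t *: v) - f 0) / t <= cgrow lam * n * f 0.
    by rewrite ler_pdivrMr//; move: n1; lra.
  by move: kk; lra.
have hA : has_sup A by split=> //; exists (cgrow lam * n * f 0).
exists (sup A) => e e0.
have [_ [s /= /andP[s0 st] <-] Es] := sup_adherent e0 hA.
have K1 : 0 < k * n ^+ 2 + 1 by rewrite ltr_wpDl// mulr_ge0 ?sqr_ge0.
exists (Num.min s (e / (k * n ^+ 2 + 1))); first by rewrite lt_min s0 divr_gt0.
move=> t tp; rewrite le_min => /andP[ts te].
have tt0 : t <= t0 := le_trans ts st.
have h1 : E t <= sup A by apply: ub_le_sup; [exact: hA.2|exists t => //=; rewrite tp].
have h2 := Emono t s tp ts st.
have h3 : k * t * n ^+ 2 <= e.
  by move: te; rewrite ler_pdivlMr// mulrDr mulr1; move: tp; lra.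
have h4 : f (t *: v) - f 0 = t * (E t + k * t * n ^+ 2).
  by rewrite /E subrK mulrC divfK// gt_eqF.
have h5 : 0 <= k * t * n ^+ 2 by rewrite !mulr_ge0 ?sqr_ge0// ltW.
rewrite h4 -mulrBr normrM gtr0_norm// mulrC ler_wpM2r ?(ltW tp)// ler_norml.
by apply/andP; split; move: h1 h2 h3 h5 Es; lra.
Qed.

(** The limit is taken along the steps 1/(n+1) so that it is measurable in a and x. *)
Definition dirder v : R := limn (fun n : nat => n.+1%:R * (f (n.+1%:R^-1 *: v) - f 0)).

Lemma isdd_cvg v S : isdd v S -> n.+1%:R * (f (n.+1%:R^-1 *: v) - f 0) @[n --> \oo] --> S.
Proof.
move=> H; apply/cvgrPdist_le => e e0; have [t1 t10 H1] := H e e0; near=> n.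
have n0 : 0 < n.+1%:R^-1 :> R by rewrite invr_gt0.
have nt : n.+1%:R^-1 <= t1 by apply: ltW; near: n; exact: (near_infty_natSinv_lt (PosNum t10)).
have := H1 _ n0 nt; rewrite distrC -(@ler_pM2l _ n.+1%:R)//.
rewrite -{1}(gtr0_norm (_ : 0 < n.+1%:R :> R))// -normrM mulrBr mulrA mulfV// mul1r => /le_trans; apply.
by rewrite mulrCA mulfV// mulr1.
Unshelve. all: by end_near. Qed.

Lemma dirderP v : isdd v (dirder v).
Proof.
have [S H] := ex_isdd v; rewrite (_ : dirder v = S)//.
exact: (cvg_lim (@Rhausdorff R) (isdd_cvg H)).
Qed.

Lemma dirder_superlinear : superlinear dirder.
Proof.
split=> [v w|c v c0].
  exact: isdd_add (dirderP v) (dirderP w) (dirderP (v + w)).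
exact: isdd_unique (dirderP (c *: v)) (isdd_scale c0 (dirderP v)).
Qed.

Definition supergrad0 : 'rV[R]_d := \row_i select dirder (ebase R i).

Lemma supergrad0_upper v : enorm v <= 1 -> f v <= f 0 + dotp supergrad0 v + k * enorm v ^+ 2.
Proof.
move=> v1; apply: le_trans (isdd_upper (dirderP v) v1) _; rewrite lerD2r lerD2l.
apply: le_trans (select_dominates dirder_superlinear v) _.
by rewrite le_eqVlt; apply/orP; left; apply/eqP; apply: eq_bigr => i _; rewrite mxE mulrC.
Qed.

Lemma enorm_ebase (i : 'I_d) : enorm (ebase R i) = 1.
Proof.
rewrite enormE /dotp (bigD1 i)//= big1 ?addr0 => [|j ji].
  by rewrite ebaseE eqxx mulr1 sqrtr1.
by rewrite ebaseE (negPf ji) mul0r.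
Qed.

(** The selected values at e_i and - e_i are opposite and dominate the directional derivatives
    there, so lower bounds on both derivatives suffice. *)
Lemma supergrad0_bound i : `|supergrad0 0 i| <= cgrow lam * expR 1 * f 0.
Proof.
have [_ sge sl] := selectP dirder_superlinear.
have b1 := isdd_bound (dirderP (ebase R i)); have b2 := isdd_bound (dirderP (- ebase R i)).
rewrite enormN enorm_ebase mulr1 in b1 b2; rewrite mxE.
have {}b1 := lerNnormlW b1; have {}b2 := lerNnormlW b2.
have := sge (ebase R i); have := sge (- ebase R i); have := sl i.
apply: numeric_bound b1 b2.
Qed.

End DirectionalDerivative.

Section Supergradient.
Context (R : realType) (d : nat) (lam C0 : R) (Cb : R -> R).
Implicit Types (h : 'rV[R]_d -> 'rV[R]_d -> R) (a x v : 'rV[R]_d).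

(** The value 0 where L is +oo keeps the family superlinear, and the selection measurable, at every
    point. *)
Definition fdir h a x v : R := if Lag h a x \is a fin_num then dirder lam C0 Cb h a x v else 0.
Definition supg h a x : 'rV[R]_d := \row_i select (fdir h a x) (ebase R i).

Hypotheses (lam0 : 0 < lam) (C00 : 0 < C0).

Lemma fdir_superlinear h a x : ham lam C0 Cb h -> superlinear (fdir h a x).
Proof.
move=> Hh; rewrite /fdir; have [f|nf] := boolP (Lag h a x \is a fin_num).
  rewrite (_ : (fun v => _) = dirder lam C0 Cb h a x); last by [].
  exact: dirder_superlinear.
by split=> [v w|c v _]; rewrite ?addr0 ?mulr0.
Qed.

Lemma supgP h a x : ham lam C0 Cb h -> Lag h a x \is a fin_num ->
  (forall i, `|supg h a x 0 i| <= cgrow lam * expR 1 * ell lam C0 Cb h a x) /\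
  forall v, enorm v <= 1 -> ell lam C0 Cb h a (x + v) <=
    ell lam C0 Cb h a x + dotp (supg h a x) v + kappa lam (ell lam C0 Cb h a x) * enorm v ^+ 2.
Proof.
move=> Hh f.
have -> : supg h a x = supergrad0 lam C0 Cb h a x.
  apply/rowP => i; rewrite !mxE; congr (select _ _); apply/funext => v.
  by rewrite /fdir f.
split=> [i|v v1].
  by have := supergrad0_bound lam0 C00 Hh f i; rewrite addr0.
by have := supergrad0_upper lam0 C00 Hh f v1; rewrite !addr0.
Qed.

End Supergradient.

(** * Measurability of H, L and the supergradients along measurable points *)

Section MeasurableFields.
Context (R : realType) (disp : measure_display) (Z : measurableType disp) (d : nat).
Context (lam C0 : R) (Cb : R -> R) (lam0 : 0 < lam) (C00 : 0 < C0).
Context (h : Z -> 'rV[R]_d -> 'rV[R]_d -> R) (Hh : forall z, ham lam C0 Cb (h z)).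
Hypothesis mh : forall p x, measurable_fun setT (fun z => h z p x).
Implicit Types (A X Y : Z -> 'rV[R]_d).

Definition mcoord (A : Z -> 'rV[R]_d) := forall i, measurable_fun setT (fun z => A z 0 i).

Lemma mcoordD A X : mcoord A -> mcoord X -> mcoord (fun z => A z + X z).
Proof. by move=> mA mX i; under eq_fun do rewrite mxE; exact: measurable_funD. Qed.
Lemma mcoord_cst v : mcoord (fun=> v).
Proof. by move=> i; exact: measurable_cst. Qed.
Lemma mdotp A X : mcoord A -> mcoord X -> measurable_fun setT (fun z => dotp (A z) (X z)).
Proof. by move=> mA mX; apply: measurable_sum => i; exact: measurable_funM. Qed.

Lemma mfield Y X : mcoord Y -> mcoord X -> measurable_fun setT (fun z => h z (Y z) (X z)).
Proof.
move=> mY mX.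
have -> : (fun z => h z (Y z) (X z)) = (fun z => joint (h z) (row_mx (Y z) (X z))).
  by apply/funext => z; rewrite joint_row.
apply: (mcaratheodory (F := fun z y => joint (h z) y) (Y := fun z => row_mx (Y z) (X z))).
- by move=> y; exact: mh.
- by move=> z; exact: joint_continuous (Hh z).
- move=> i; rewrite -[i]splitK; case: (fintype.split i) => j /=.
    by under eq_fun do rewrite row_mxEl; exact: mY.
  by under eq_fun do rewrite row_mxEr; exact: mX.
Qed.

Lemma partial_cvg n (u : 'rV[R]_n -> R) y i : derivable u y (ebase R i) ->
  k.+1%:R * (u (y + k.+1%:R^-1 *: ebase R i) - u y) @[k --> \oo] --> partial i u y.
Proof.
move=> du; have D : is_derive y (ebase R i) u (partial i u y) by exact: DeriveDef.
have cv : (fun s : R => s^-1 *: ((u \o shift y) (s *: ebase R i) - u y)) @ 0^' --> partial i u y.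
  exact: du.
move/cvgrPdist_le in cv; apply/cvgrPdist_le => e e0.
have := cv e e0; rewrite near_withinE => /nbhs_ballP[r /= r0 H]; near=> k.
have k0 : 0 < k.+1%:R^-1 :> R by rewrite invr_gt0.
have kr : k.+1%:R^-1 < r by near: k; exact: (near_infty_natSinv_lt (PosNum r0)).
have := H k.+1%:R^-1; rewrite -ball_normE /= sub0r normrN gtr0_norm// => /(_ kr).
by move=> /(_ (lt0r_neq0 k0)); rewrite invrK (addrC _ y).
Unshelve. all: by end_near. Qed.

Lemma mDp Y X : mcoord Y -> mcoord X -> mcoord (fun z => Dp (h z) (Y z) (X z)).
Proof.
move=> mY mX i.
apply: (@measurable_realfun.measurable_fun_cvg _ _ _ _ (fun k z => k.+1%:R *
  (h z (Y z + k.+1%:R^-1 *: ebase R i) (X z) - h z (Y z) (X z)))).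
  move=> k; apply: measurable_funM; first exact: measurable_cst.
  by apply: measurable_funB; apply: mfield => //; apply: mcoordD => //; exact: mcoord_cst.
move=> z _; rewrite mxE -partial_lshift.
have := partial_cvg ((ham_C2 (Hh z)).1.1 (row_mx (Y z) (X z)) (lshift d i)).
by under eq_fun do rewrite ebase_lshift joint_line joint_row scaler0 addr0.
Qed.

Lemma mDx Y X : mcoord Y -> mcoord X -> mcoord (fun z => Dx (h z) (Y z) (X z)).
Proof.
move=> mY mX i.
apply: (@measurable_realfun.measurable_fun_cvg _ _ _ _ (fun k z => k.+1%:R *
  (h z (Y z) (X z + k.+1%:R^-1 *: ebase R i) - h z (Y z) (X z)))).
  move=> k; apply: measurable_funM; first exact: measurable_cst.
  by apply: measurable_funB; apply: mfield => //; apply: mcoordD => //; exact: mcoord_cst.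
move=> z _; rewrite mxE -partial_rshift.
have := partial_cvg ((ham_C2 (Hh z)).1.1 (row_mx (Y z) (X z)) (rshift d i)).
by under eq_fun do rewrite ebase_rshift joint_line joint_row scaler0 addr0.
Qed.

Definition qpoint (n : nat) : 'rV[R]_d := map_mx ratr (odflt 0 (unpickle n) : 'rV[rat]_d).

Lemma qpoint_dense (p : 'rV[R]_d) e : 0 < e -> exists n, `|qpoint n - p| <= e.
Proof.
move=> e0.
have /choice[q Hq] : forall i, exists q : rat, p 0 i < ratr q /\ ratr q < p 0 i + e.
  move=> i; have [q] := @rat_in_itvoo R (p 0 i) (p 0 i + e) (ltac:(by rewrite ltrDl)).
  by rewrite in_itv/= => /andP[]; exists q.
exists (pickle (\row_i q i : 'rV[rat]_d)); apply: rV_norm_le => [|i]; first exact: ltW.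
rewrite /qpoint pickleK /= !mxE; have [h1 h2] := Hq i.
by rewrite ler_norml; apply/andP; split; lra.
Qed.

(** By continuity in p the supremum may be taken over rational p, enumerated by [qpoint]. *)
Lemma Lag_esups z a x : Lag (h z) a x = esups (fun n => (- dotp (qpoint n) a - h z (qpoint n) x)%:E) 0%N.
Proof.
apply/eqP; rewrite eq_le; apply/andP; split; last first.
  by apply: ge_ereal_sup => _ [n _ <-]; exact: Lag_ge.
apply: ge_ereal_sup => _ [p _ <-].
have cphi : continuous (fun p => - dotp p a - h z p x).
  have := @contD R 'rV[R]_d (fun p => (-1) * dotp p a) (fun p => (-1) * h z p x).
  under [X in _ -> _ -> continuous X]eq_fun do rewrite !mulN1r.
  apply; apply: contZ.
    by apply: continuous_fct_sum => i; apply: continuous_fctM;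
      [move=> y; exact: coord_continuous|exact: cst_continuous].
  have cid : continuous (id : 'rV[R]_d -> 'rV[R]_d) by move=> y; exact: cvg_id.
  have ccst : continuous (fun _ : 'rV[R]_d => x) by exact: cst_continuous.
  exact: (ham_continuous (Hh z) cid ccst).
apply/lee_addgt0Pr => e e0.
have /nbhs_ballP[r /= r0 Hr] := (continuous_rVP _).2 cphi p e e0.
have [n pn] := qpoint_dense p (divr_gt0 r0 (ltr0Sn _ 1)).
have : `|(- dotp p a - h z p x) - (- dotp (qpoint n) a - h z (qpoint n) x)| <= e.
  apply: Hr; rewrite -ball_normE /= distrC; apply: (le_lt_trans pn).
  by rewrite ltr_pdivrMr// ltr_pMr// ltr1n.
rewrite ler_norml => /andP[_ h1].
apply: (@le_trans _ _ ((- dotp (qpoint n) a - h z (qpoint n) x)%:E + e%:E)%E).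
  by rewrite -EFinD lee_fin; lra.
by rewrite leeD2r//; apply: ereal_sup_ubound; exists n.
Qed.

Lemma mLag A X : mcoord A -> mcoord X -> measurable_fun setT (fun z => Lag (h z) (A z) (X z)).
Proof.
move=> mA mX; under eq_fun do rewrite Lag_esups.
apply: (measurable_fun_esups (f := fun n z => (- dotp (qpoint n) (A z) - h z (qpoint n) (X z))%:E)) => n.
apply/measurable_EFinP; apply: measurable_funB.
  by apply: measurableT_comp => //; apply: mdotp => //; exact: mcoord_cst.
by apply: mfield => //; exact: mcoord_cst.
Qed.

Lemma mell A X : mcoord A -> mcoord X -> measurable_fun setT (fun z => ell lam C0 Cb (h z) (A z) (X z)).
Proof.
move=> mA mX; apply: measurable_funD; last exact: measurable_cst.
by apply: measurableT_comp => //; exact: mLag.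
Qed.

Lemma mfdir A X v : mcoord A -> mcoord X ->
  measurable_fun setT (fun z => fdir lam C0 Cb (h z) (A z) (X z) v).
Proof.
move=> mA mX.
pose F := [set z | Lag (h z) (A z) (X z) \is a fin_num].
have mF : measurable F.
  by have := emeasurable_fin_num measurableT (mLag mA mX); rewrite setTI.
apply: (@measurable_realfun.measurable_fun_cvg _ _ _ _ (fun n z => \1_F z * (n.+1%:R *
  (ell lam C0 Cb (h z) (A z) (X z + n.+1%:R^-1 *: v) - ell lam C0 Cb (h z) (A z) (X z))))).
  move=> n; apply: measurable_funM; first exact: measurable_indic.
  apply: measurable_funM; first exact: measurable_cst.
  by apply: measurable_funB; apply: mell => //; apply: mcoordD => //; exact: mcoord_cst.
move=> z _; rewrite /fdir; case: ifPn => f.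
  rewrite indicE mem_set//; under eq_fun do rewrite mul1r.
  have := isdd_cvg (dirderP lam0 C00 (Hh z) f v).
  by rewrite addr0.
rewrite indicE memNset; last by rewrite /F /=; exact/negP.
by under eq_fun do rewrite mul0r; exact: cvg_cst.
Qed.

(** Induction along the list of basis vectors: every refinement is a pointwise limit of measurable
    functions. *)
Lemma msupg A X : mcoord A -> mcoord X -> mcoord (fun z => supg lam C0 Cb (h z) (A z) (X z)).
Proof.
move=> mA mX i; under eq_fun do rewrite mxE.
have sup z := fdir_superlinear lam0 C00 (A z) (X z) (Hh z).
rewrite /select; set s := fun z => _.
suff H l : let sg z := foldr (fun i s => refine_at (ebase R i) s) (fdir lam C0 Cb (h z) (A z) (X z)) l in
    (forall z, superlinear (sg z)) /\ (forall v, measurable_fun setT (fun z => sg z v)).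
  exact: (H (enum 'I_d)).2.
elim: l => [|j l [IH1 IH2]] /=; first by split=> // v; exact: mfdir.
split=> [z|v]; first exact: refine_superlinear.
apply: (@measurable_realfun.measurable_fun_cvg _ _ _ _ (fun n z =>
  foldr (fun i s => refine_at (ebase R i) s) (fdir lam C0 Cb (h z) (A z) (X z)) l (n%:R *: ebase R j + v)
  - n%:R * foldr (fun i s => refine_at (ebase R i) s) (fdir lam C0 Cb (h z) (A z) (X z)) l (ebase R j))).
  move=> n; apply: measurable_funB => //.
  by apply: measurable_funM => //; exact: measurable_cst.
by move=> z _; exact: refine_is_cvg (IH1 z) _ v.
Qed.

End MeasurableFields.

(** * Primitives, null sets and curves with integrable velocity *)

Section Primitive.
Context (R : realType).
Notation leb := (@lebesgue_measure R).

Lemma mpath_integral disp (Z : measurableType disp) (D : set R) (g : R * Z -> R) :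
  measurable D -> measurable_fun setT g ->
  measurable_fun setT (fun z => \int[leb]_(s in D) g (s, z)).
Proof.
move=> mD mg.
have H (f : R * Z -> \bar R) : measurable_fun setT f -> (forall z, (0 <= f z)%E) ->
    measurable_fun setT (fun z => (\int[leb]_(s in D) f (s, z))%E).
  move=> mf f0.
  have mDT : measurable (D `*` [set: Z]) by exact: measurableX.
  pose fD := f \_ (D `*` [set: Z]).
  have mfD : measurable_fun setT fD by apply/measurable_restrict => //; exact: measurable_funTS.
  have fD0 z : (0 <= fD z)%E by rewrite /fD /patch; case: ifP.
  have := @measurable_fun_fubini_tonelli_G _ _ _ _ R leb fD mfD fD0.
  congr (measurable_fun _ _); apply/funext => z; rewrite /fubini_G [RHS]integral_mkcond.
  apply: eq_integral => s _; rewrite /fD /patch; congr (if _ then _ else _).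
  by apply/idP/idP; rewrite !inE => //= -[].
have me : measurable_fun setT (EFin \o g) by exact/measurable_EFinP.
rewrite /Rintegral; apply: measurableT_comp => //.
under eq_fun do rewrite integralE.
apply: emeasurable_funB.
  have := H _ (measurable_funepos me) (fun z => funepos_ge0 _ z).
  congr (measurable_fun _ _); apply/funext => z; apply: eq_integral => s _.
  by rewrite !funeposE.
have := H _ (measurable_funeneg me) (fun z => funeneg_ge0 _ z).
congr (measurable_fun _ _); apply/funext => z; apply: eq_integral => s _.
by rewrite !funenegE.
Qed.

Lemma eq_Rint (D : set R) (f g : R -> R) : (forall s, D s -> f s = g s) ->
  \int[leb]_(s in D) f s = \int[leb]_(s in D) g s.
Proof. by move=> fg; apply: eq_Rintegral => s; rewrite inE => /fg. Qed.

Lemma primitive_continuous (T : R) (f : R -> R) : 0 <= T -> leb.-integrable `[0, T] (EFin \o f) ->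
  continuous (fun t => \int[leb]_(s in `[0, clamp 0 T t]) f s).
Proof.
move=> T0 fi; apply: (continuous_clamp_within (f := fun t => \int[leb]_(s in `[0, t]) f s)) => //.
exact: parameterized_integral_continuous.
Qed.

Lemma integrable_itvS (a b a' b' : R) (f : R -> R) : a <= a' -> b' <= b ->
  leb.-integrable `[a, b] (EFin \o f) -> leb.-integrable `[a', b'] (EFin \o f).
Proof.
move=> aa bb; apply: integrableS => //.
by move=> s; rewrite /= !in_itv/= => /andP[h1 h2]; rewrite (le_trans aa)//= (le_trans h2).
Qed.

Lemma primitive_split (T s t : R) (f : R -> R) : leb.-integrable `[0, T] (EFin \o f) ->
  0 <= s -> s <= t -> t <= T ->
  \int[leb]_(r in `[0, t]) f r = \int[leb]_(r in `[0, s]) f r + \int[leb]_(r in `[s, t]) f r.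
Proof.
move=> fi s0 st tT.
have fi' : leb.-integrable `[0, t] (EFin \o f) by apply: integrable_itvS fi.
have := @Rintegral_itvB R f (BLeft 0) (BRight t) s fi'.
rewrite !bnd_simp => /(_ s0 st) E.
rewrite -[LHS](subrK (\int[leb]_(r in `[0, s]) f r)) addrC E; congr (_ + _).
rewrite [LHS]Rintegral_itv_obnd_cbnd//.
apply: integrableS (integrable_itvS s0 tT fi) => //; exact: subset_itv_oc_cc.
Qed.

End Primitive.

Section AlmostEverywhere.
Context (R : realType) (disp : measure_display) (Z : measurableType disp).
Context (mu : {measure set Z -> \bar R}).
Implicit Types A B : Z -> Prop.

Lemma ae_impl A B : (forall z, A z -> B z) -> {ae mu, forall z, A z} -> {ae mu, forall z, B z}.
Proof. by move=> AB; apply: (@filterS _ _ (ae_filter_ringOfSetsType mu)). Qed.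
Lemma ae_and A B : {ae mu, forall z, A z} -> {ae mu, forall z, B z} ->
  {ae mu, forall z, A z /\ B z}.
Proof. by move=> hA hB; apply: (@filterI _ _ (ae_filter_ringOfSetsType mu)). Qed.
Lemma ae_true A : (forall z, A z) -> {ae mu, forall z, A z}.
Proof. by move=> hA; exists set0; split => // z /=. Qed.

Lemma ae_countable (A : nat -> Z -> Prop) : (forall k, {ae mu, forall z, A k z}) ->
  {ae mu, forall z, forall k, A k z}.
Proof.
move=> h; have : mu.-negligible (\bigcup_k ~` [set z | A k z]) by apply: negligible_bigcup => k; exact: h.
apply: negligibleS => z /= /existsNP[k hk]; by exists k.
Qed.

Lemma ae_ord n (A : 'I_n -> Z -> Prop) : (forall i, {ae mu, forall z, A i z}) ->
  {ae mu, forall z, forall i, A i z}.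
Proof.
move=> h; have h' k : {ae mu, forall z, forall i : 'I_n, i = k :> nat -> A i z}.
  have [kn|nk] := ltnP k n; last by apply: ae_true => z i ik; have := ltn_ord i; rewrite ik ltnNge nk.
  by apply: ae_impl (h (Ordinal kn)) => z Az i ik; rewrite (_ : i = Ordinal kn)//; exact/val_inj.
by apply: ae_impl (ae_countable h') => z Az i; exact: Az.
Qed.

Lemma ae_null_set A : {ae mu, forall z, A z} ->
  exists N, [/\ measurable N, mu N = 0%E & forall z, ~ N z -> A z].
Proof. by move=> [N [mN N0 AN]]; exists N; split => // z Nz; apply: contrapT => /AN. Qed.

End AlmostEverywhere.

Section Curves.
Context (R : realType).
Notation leb := (@lebesgue_measure R).

Lemma ae_neq (a : R) : {ae leb, forall s, s != a}.
Proof.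
exists [set a]; split; [exact: measurable_set1|exact: lebesgue_measure_set1|].
by move=> s /= /negP; rewrite negbK => /eqP.
Qed.

Lemma menorm_sqr disp (Z : measurableType disp) (D : set Z) n (v : Z -> 'rV[R]_n) :
  measurable D -> (forall i, measurable_fun D (fun z => v z 0 i)) ->
  measurable_fun D (fun z => enorm (v z) ^+ 2).
Proof.
move=> mD mv; under eq_fun do rewrite enorm_sqr.
by apply: measurable_sum => i; apply: measurable_funM; exact: mv.
Qed.

Lemma sqr_integrable (D : set R) n (v : R -> 'rV[R]_n) : measurable D -> (leb D < +oo)%E ->
  (forall i, measurable_fun D (fun s => v s 0 i)) ->
  (\int[leb]_(s in D) ((enorm (v s)) ^+ 2)%:E < +oo)%E ->
  forall i, leb.-integrable D (fun s => (v s 0 i)%:E).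
Proof.
move=> mD fD mv fv i.
have m2 := menorm_sqr mD mv.
have i2 : leb.-integrable D (fun s => (enorm (v s) ^+ 2)%:E).
  apply/integrableP; split; first exact/measurable_EFinP.
  rewrite (_ : (fun s => `|_|%E) = (fun s => ((enorm (v s)) ^+ 2)%:E))//.
  by apply/funext => s /=; rewrite ger0_norm// sqr_ge0.
have i1 : leb.-integrable D (fun s => 1%:E).
  by apply: (@bdd_integrable _ _ _ leb D (fun=> 1) 1) => // s _; rewrite normr1.
apply: (@le_integrable _ _ _ leb D mD _ (fun s => 1%:E + (enorm (v s) ^+ 2)%:E)%E).
- apply/measurable_EFinP; exact: (mv i).
- move=> s _; rewrite /= lee_fin [leRHS]ger0_norm ?addr_ge0 ?sqr_ge0//.
  apply: (le_trans (enorm_coord _ _)); have := sqr_ge0 (enorm (v s) - 1).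
  have := enorm_ge0 (v s); move: (enorm (v s)) => e; rewrite expr2 => *; nra.
- exact: integrableD.
Qed.

(** Lebesgue differentiation of each coordinate. The left quotients are recorded as well: they only
    look at the past, which makes the velocity of an adapted process progressive. *)
Lemma primitive_deriv (T : R) n (v g : R -> 'rV[R]_n) : 0 < T ->
  (forall i, leb.-integrable `[0, T] (fun s => (v s 0 i)%:E)) ->
  (forall s, 0 <= s <= T -> g s = g 0 + vintegral 0 s v) ->
  {ae leb, forall s, 0 < s < T -> dot g s = v s /\
    forall i, k.+1%:R * (g s 0 i - g (s - k.+1%:R^-1) 0 i) @[k --> \oo] --> v s 0 i}.
Proof.
move=> T0 iv gv.
pose f i := (fun s => v s 0 i) \_ `[0, T]%classic.
have fi i : leb.-integrable setT (EFin \o f i).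
  have : leb.-integrable setT ((fun s => (v s 0 i)%:E) \_ `[0, T]%classic).
    have := iffLR (integrable_mkcond (fun s : measurableTypeR R => (v s 0 i)%:E) (measurable_itv `[0, T])) (iv i).
    exact.
  by congr (leb.-integrable _ _); apply/funext => s; rewrite /f /= /patch; case: ifP.
have lf i : locally_integrable setT (f i).
  have [m1 h] := integrableP _ _ _ (fi i).
  split; [exact/measurable_EFinP|exact: openT|move=> K _ cK].
  apply: le_lt_trans h; apply: ge0_subset_integral => //.
    by apply: closed_measurable; exact: compact_closed.
  by apply/measurable_EFinP; apply: measurableT_comp => //; exact/measurable_EFinP.
have ae : {ae leb, forall s, forall i : 'I_n, lebesgue_pt (f i) s}.
  by apply: ae_ord => i; exact: lebesgue_differentiation (lf i).
suff H (s : R) : (forall i, lebesgue_pt (f i) s) -> 0 < s < T -> dot g s = v s /\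
        forall i, k.+1%:R * (g s 0 i - g (s - k.+1%:R^-1) 0 i) @[k --> \oo] --> v s 0 i.
  by apply: ae_impl ae => s; exact: H.
move=> Ls /andP[s0 sT].
pose q (h : R) := h^-1 *: (g (h + s) - g s).
have cq i : q h 0 i @[h --> 0^'] --> v s 0 i.
  have fis : leb.-integrable [set` Interval (BLeft 0) (BRight T)] (EFin \o f i).
    by apply: integrableS (fi i).
  have s0' : (BLeft (0%R : R) < BRight s)%E by rewrite lte_fin.
  have := FTC1_lebesgue_pt sT fis s0' (Ls i); set F := (fun y : R => _) => -[dF eF].
  have -> : v s 0 i = f i s by rewrite /f patchE mem_set//= in_itv/= (ltW s0) (ltW sT).
  rewrite -eF derive1E.
  have cF : h^-1 *: (F (h *: 1 + s) - F s) @[h --> 0^'] --> 'D_1 F s by exact: dF.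
  apply: cvg_trans cF; apply: near_eq_cvg.
  have r0 : 0 < Num.min s (T - s) by rewrite lt_min s0 subr_gt0.
  have gF y : 0 <= y <= T -> g y 0 i = g 0 0 i + F y.
    move=> yT; rewrite gv// !mxE; congr (_ + _); apply: eq_Rint => r /=.
    rewrite in_itv/= => /andP[h1 h2]; rewrite /f patchE mem_set//= in_itv/= h1/=.
    by apply: le_trans h2 _; case/andP: yT.
  near=> h; have hr : `|h| < Num.min s (T - s) by near: h; apply: dnbhs0_lt.
  move: hr; rewrite lt_min !ltr_norml => /andP[/andP[h1 h2] /andP[h3 h4]].
  have e1 : g s 0 i = g 0 0 i + F s by apply: gF; rewrite (ltW s0) (ltW sT).
  have e2 : g (h + s) 0 i = g 0 0 i + F (h + s) by apply: gF; apply/andP; split; lra.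
  have -> : h *: (1 : R) + s = h + s by rewrite /GRing.scale/= mulr1.
  move: (F (h + s)) (F s) e1 e2 => a b e1 e2.
  by rewrite /q !mxE e1 e2 opprD addrACA subrr add0r.
split.
  rewrite /dot /derive1; apply: cvg_lim => //.
  by apply: (@cvg_rV _ _ _ _ (dnbhs_filter 0)) => i; exact: cq.
move=> i.
(* The steps - 1/(k+1) tend to 0 without vanishing. *)
have cs : (fun k : nat => - k.+1%:R^-1 : R) @ \oo --> 0^'.
  move=> A /=; rewrite /dnbhs /within /= => nA.
  have c0 : (fun k : nat => - k.+1%:R^-1 : R) @ \oo --> (0 : R).
    by rewrite -[X in _ --> X]oppr0; apply: cvgN; exact: cvg_harmonic.
  have := c0 _ nA; rewrite /nbhs /=; apply: filterS => k /=; apply.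
  by rewrite oppr_eq0 invr_eq0.
have := cvg_comp _ _ cs (cq i).
apply: cvg_trans; apply: near_eq_cvg; apply: nearW => k /=.
rewrite /q !mxE invrN invrK mulNr -mulrN opprB; congr (_ * (_ - _)).
by rewrite addrC.
Unshelve. all: by end_near. Qed.

End Curves.

(** * Moments of suprema over time *)

Section SupremumMoments.
Local Open Scope ereal_scope.
Import HBNNSimple.
Context (R : realType) (disp : measure_display) (Omega : measurableType disp).
Context (P : probability Omega R).

(* The integrands need not be measurable, hence the detour by simple functions. *)
Lemma integral_affine_fin (f g : Omega -> \bar R) (K K' : R) (N : set Omega) : (0 < K)%R -> (0 <= K')%R ->
  (forall w, 0 <= f w) -> (forall w, 0 <= g w) -> measurable N -> P N = 0 ->
  (forall w, ~ N w -> g w <= K%:E * f w + K'%:E) ->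
  \int[P]_w f w < +oo -> \int[P]_w g w < +oo.
Proof.
move=> K0 K'0 f0 g0 mN N0 gf fi.
apply: (@le_lt_trans _ _ (K%:E * \int[P]_w f w + K'%:E)); last first.
  rewrite lte_add_pinfty ?ltry// lte_mul_pinfty//= ?lee_fin ?ltW//.
rewrite ge0_integralTE//; apply: ub_ereal_sup => _ [h /= hg <-].
rewrite -integralT_nnsfun.
pose k w := Num.max (0%R : R) (K^-1 * (h w - K'))%R.
have mk : measurable_fun setT k.
  apply: measurable_maxr => //; apply: measurable_funM => //.
  by apply: measurable_funB => //; exact: measurable_funPT.
have k0 w : (0 <= k w)%R by rewrite /k le_max lexx.
have kf : \int[P]_w (k w)%:E <= \int[P]_w f w.
  apply: nnint_ae_le (mN) (N0) (f0) _ _ => w; last by rewrite lee_fin.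
  move=> Nw.
  rewrite /k EFin_max ge_max f0/= EFinM lee_pdivrMl// EFinB leeBlDr//.
  exact: le_trans (hg w) (gf w Nw).
apply: (@le_trans _ _ (\int[P]_w (K%:E * (k w)%:E + K'%:E))).
  apply: ge0_le_integral => //.
  - by move=> w _; rewrite lee_fin.
  - by apply/measurable_EFinP; exact: measurable_funPT.
  - by apply: emeasurable_funD => //; apply: emeasurable_funM => //; exact/measurable_EFinP.
  - move=> w _; rewrite -EFinM -EFinD lee_fin -lerBlDr -ler_pdivrMl// /k le_max lexx.
    by rewrite orbT.
rewrite ge0_integralD//; last 2 first.
- by move=> w _; rewrite -EFinM lee_fin mulr_ge0// ltW.
- by apply: emeasurable_funM => //; exact/measurable_EFinP.
have -> : \int[P]_w K'%:E = K'%:E by rewrite integral_cst// [X in _ * X](@probability_setT _ _ _ P) mule1.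
rewrite leeD2r// ge0_integralZl//.
- by rewrite lee_pmul2l.
- exact/measurable_EFinP.
- by move=> w _; rewrite lee_fin.
- by rewrite lee_fin ltW.
Qed.

Lemma poweR_shift_le (r C : R) (S : \bar R) : (1 <= r)%R -> (0 <= C)%R -> 0 <= S ->
  (S + C%:E) `^ r <= (2 `^ r)%R%:E * S `^ r + ((2 `^ r) * (C `^ r))%R%:E.
Proof.
move=> r1 C0 S0; have r0 : (0 <= r)%R by exact: le_trans r1.
have mono (x y : \bar R) : 0 <= x -> x <= y -> x `^ r <= y `^ r.
  move=> x0 xy; have y0 := le_trans x0 xy.
  by apply: gt0_ler_poweR => //; rewrite in_itv/= ?x0 ?y0 leey.
have C0' : 0 <= C%:E by rewrite lee_fin.
have S0' : 0 <= S + C%:E by exact: adde_ge0.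
have [SC|CS] := leP S C%:E.
  apply: (@le_trans _ _ ((2%:E * C%:E) `^ r)).
    by apply: mono => //; rewrite mule_natl mule2n leeD2r.
  rewrite poweRM ?lee_fin// !poweR_EFin -EFinM leeDr// mule_ge0 ?lee_fin ?powR_ge0//.
  exact: poweR_ge0.
apply: (@le_trans _ _ ((2%:E * S) `^ r)).
  by apply: mono => //; rewrite mule_natl mule2n leeD2l// ltW.
by rewrite poweRM ?lee_fin// poweR_EFin leeDl// lee_fin mulr_ge0 ?powR_ge0.
Qed.

Lemma sup_moment (r C : R) (S S' : Omega -> \bar R) (N : set Omega) : (1 <= r)%R -> (0 <= C)%R ->
  (forall w, 0 <= S w) -> (forall w, 0 <= S' w) -> measurable N -> P N = 0 ->
  (forall w, ~ N w -> S' w <= S w + C%:E) ->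
  \int[P]_w (S w `^ r) < +oo -> \int[P]_w (S' w `^ r) < +oo.
Proof.
move=> r1 C0 S0 S'0 mN N0 SS; apply: (@integral_affine_fin _ _ (2 `^ r)%R ((2 `^ r) * (C `^ r))%R N) => //.
- by rewrite mulr_ge0 ?powR_ge0.
- by move=> w; exact: poweR_ge0.
- by move=> w; exact: poweR_ge0.
- move=> w Nw; apply: le_trans (poweR_shift_le r1 C0 (S0 w)).
  have SC0 : 0 <= S w + C%:E by rewrite adde_ge0 ?lee_fin.
  apply: gt0_ler_poweR; rewrite ?in_itv/= ?S'0 ?SC0 ?leey//; last exact: SS.
  exact: le_trans r1.
Qed.

End SupremumMoments.

(** * Integration over time and omega together; Taylor bounds and sums of integrals *)

Section TimeProduct.
Context (R : realType) (disp : measure_display) (Omega : measurableType disp).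
Context (P : probability Omega R) (T : R).
Hypothesis T0 : 0 < T.
Notation leb := (@lebesgue_measure R).
Notation TO := (measurableTypeR R * Omega)%type.
Notation I := (`[0, T]%classic : set R).

Definition timeD : set TO := I `*` [set: Omega].
Definition dtP : {measure set TO -> \bar R} := (leb \x P)%E.

Lemma measurable_timeD : measurable timeD.
Proof. exact: measurableX. Qed.
Lemma measurable_section (f : TO -> \bar R) w : measurable_fun setT f ->
  measurable_fun setT (fun s : measurableTypeR R => f (s, w)).
Proof. by move=> mf; exact: measurableT_comp mf (pair2_measurable w). Qed.

Let mfD (f : TO -> \bar R) : measurable_fun timeD f -> measurable_fun setT (f \_ timeD).
Proof. by move=> mf; apply/(measurable_restrict _ measurable_timeD measurableT); rewrite setTI. Qed.

Let section_patch (f : TO -> \bar R) s w : (f \_ timeD) (s, w) = ((fun s => f (s, w)) \_ I) s.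
Proof.
rewrite /patch; congr (if _ then _ else _).
by apply/idP/idP; rewrite !inE => //= -[].
Qed.

Lemma tonelli_dtP (f : TO -> \bar R) : measurable_fun timeD f -> (forall z, (0 <= f z)%E) ->
  (\int[dtP]_(z in timeD) f z = \int[P]_w \int[leb]_(s in `[0%R, T]) f (s, w))%E /\
  measurable_fun setT (fun w => \int[leb]_(s in `[0%R, T]) f (s, w))%E.
Proof.
move=> mf f0; have m := mfD mf.
have p0 z : (0 <= (f \_ timeD) z)%E by rewrite /patch; case: ifP.
have E w : fubini_G leb (f \_ timeD) w = (\int[leb]_(s in `[0%R, T]) f (s, w))%E.
  by rewrite /fubini_G [RHS]integral_mkcond; apply: eq_integral => s _; exact: section_patch.
split.
  rewrite integral_mkcond (fubini_tonelli2 (m1 := leb) (m2 := P) _ m p0).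
  by apply: eq_integral => w _; exact: E.
have := measurable_fun_fubini_tonelli_G (m1 := leb) _ m p0.
by congr (measurable_fun _ _); apply/funext => w; exact: E.
Qed.

(** Tonelli's theorem on the indicator of the exceptional set: almost every section of it is
    null. *)
Lemma ae_dtP (A : R -> Omega -> Prop) : {ae dtP, forall z, timeD z -> A z.1 z.2} ->
  {ae P, forall w, {ae leb, forall s, 0 <= s <= T -> A s w}}.
Proof.
move=> /ae_null_set[N [mN N0 hN]].
have mi : measurable_fun timeD (fun z => (\1_N z)%:E : \bar R).
  apply/measurable_EFinP; apply: measurable_funTS; exact: measurable_indic.
have i0 z : (0 <= (\1_N z)%:E :> \bar R)%E by rewrite lee_fin.
have [E mE] := tonelli_dtP mi i0.
have : (\int[dtP]_(z in timeD) (\1_N z)%:E = 0)%E.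
  rewrite (integral_indic dtP measurable_timeD mN).
  exact: (subset_measure0 (measurableI _ _ mN measurable_timeD) mN (@subIsetl _ _ _) N0).
rewrite E => E0.
have := (ae_eq_integral_abs P measurableT mE).1.
rewrite (eq_integral (fun w => (\int[leb]_(s in `[0%R, T]) (\1_N (s, w))%:E)%E)); last first.
  by move=> w _; rewrite gee0_abs//; apply: integral_ge0.
move=> /(_ E0); apply: ae_impl => w hw; have {}hw := hw Logic.I.
have mw : measurable [set s : measurableTypeR R | N (s, w)] by have := @pair2_measurable _ _ _ _ w measurableT _ mN; rewrite setTI.
exists (`[0, T]%classic `&` [set s | N (s, w)]); split.
- by apply: measurableI => //; exact: measurable_itv.
- move: hw; rewrite (_ : (fun s => _) = (fun s => (\1_[set s | N (s, w)] s)%:E)) ?integral_indic// 1?setIC//.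
- move=> s /= /not_implyP[sT nA]; split; first by rewrite /= ?in_itv.
  by apply: contrapT => /hN h; apply: nA; apply: h; split => //=; rewrite ?in_itv.
Qed.

Lemma fubini_dtP (f : R * Omega -> R) : measurable_fun setT f -> dtP.-integrable timeD (EFin \o f) ->
  [/\ \int[dtP]_(z in timeD) f z = \int[P]_w \int[leb]_(s in `[0, T]) f (s, w),
      {ae P, forall w, leb.-integrable `[0, T] (fun s => (f (s, w))%:E)} &
      Pint P (fun w => \int[leb]_(s in `[0, T]) f (s, w))].
Proof.
move=> mf fi.
have mI : measurable (`[0, T]%classic : set (measurableTypeR R)) by exact: measurable_itv.
have mfw w : measurable_fun (`[0, T]%classic : set (measurableTypeR R)) (fun s => f (s, w)).
  by apply: measurable_funTS; exact: measurableT_comp mf (pair2_measurable w).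
have mabs : measurable_fun timeD (fun z => `|f z|%:E : \bar R).
  by apply/measurable_EFinP; apply: measurable_funTS; exact: measurableT_comp.
have [EA mA] := tonelli_dtP mabs (fun z => normr_ge0 (f z)).
set A := fun w => (\int[leb]_(s in `[0%R, T]) `|f (s, w)|%:E)%E in EA mA.
have A0 w : (0 <= A w)%E by apply: integral_ge0 => s _; rewrite lee_fin.
have Ai : P.-integrable setT A.
  apply/integrableP; split => //.
  rewrite (eq_integral A); last by move=> w _; rewrite gee0_abs.
  by rewrite -EA; have /integrableP[] := fi.
have aefin := integrable_ae measurableT Ai.
have path : {ae P, forall w, leb.-integrable `[0, T] (fun s => (f (s, w))%:E)}.
  apply: ae_impl aefin => w h; have {}h := h Logic.I; apply/integrableP; split; first exact/measurable_EFinP.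
  by rewrite ltey_eq h.
have fD : dtP.-integrable setT ((EFin \o f) \_ timeD) := iffLR (integrable_mkcond _ measurable_timeD) fi.
have E w : fubini_G leb ((EFin \o f) \_ timeD) w = (\int[leb]_(s in `[0%R, T]) (f (s, w))%:E)%E.
  by rewrite /fubini_G [RHS]integral_mkcond; apply: eq_integral => s _; exact: section_patch.
have ae1 : {ae P, forall w, fubini_G leb ((EFin \o f) \_ timeD) w = (\int[leb]_(s in `[0, T]) f (s, w))%:E}.
  apply: ae_impl path => w h; rewrite /Rintegral E fineK//; exact: integrable_fin_num.
split => //.
  rewrite /Rintegral; congr fine; rewrite integral_mkcond -(fubini2 (m1 := leb) (m2 := P) fD).
  by apply: integral_ae; apply: ae_impl ae1 => w h _.
apply/integrableP; split.
  apply/measurable_EFinP; exact: (mpath_integral (g := f)).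
have /integrableP[_] := Ai; apply: le_lt_trans.
have [N [mN N0 hN]] := ae_null_set path.
apply: (nnint_ae_le mN N0) => // w Nw; rewrite (gee0_abs (A0 w)) /Rintegral /=.
rewrite -abse_EFin fineK ?integrable_fin_num//; last exact: hN.
exact: (le_abse_integral leb (measurable_itv _) (measurable_int leb (hN w Nw))).
Qed.

Lemma dtP_le (f g : TO -> R) : measurable_fun timeD f -> dtP.-integrable timeD (EFin \o g) ->
  (forall z, timeD z -> `|f z| <= g z) -> dtP.-integrable timeD (EFin \o f).
Proof.
move=> mf gi fg; apply: (le_integrable measurable_timeD _ _ gi); first exact/measurable_EFinP.
by move=> z Dz; rewrite /= lee_fin (le_trans (fg z Dz))// ler_norm.
Qed.

End TimeProduct.

Section Regularity.
Context (R : realType) (n : nat).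
Implicit Types (u v : 'rV[R]_n -> R).

Lemma enorm_entry m k (A : 'M[R]_(m, k)) i j : `|A i j| <= enorm A.
Proof.
rewrite /enorm -sqrtr_sqr ler_sqrt; last by do 2 (apply: sumr_ge0 => ? _); rewrite sqr_ge0.
rewrite (bigD1 i)//= (bigD1 j)//= -addrA lerDl addr_ge0//.
  by apply: sumr_ge0 => ? _; rewrite sqr_ge0.
by do 2 (apply: sumr_ge0 => ? _); rewrite sqr_ge0.
Qed.

Let esup_ge0 (I : Type) (O : set I) (f : I -> R) : (exists x, O x) -> (forall x, 0 <= f x) ->
  (0 <= ereal_sup [set (f x)%:E | x in O])%E.
Proof.
move=> [x Ox] f0; apply: (@le_trans _ _ (f x)%:E); first by rewrite lee_fin.
by apply: ereal_sup_ubound; exists x.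
Qed.

Lemma C2norm_bounds (O : set 'rV[R]_n) u x : O x ->
  [/\ (`|u x|%:E <= C2norm O u)%E, ((enorm (grad u x))%:E <= C2norm O u)%E &
      ((enorm (hess u x))%:E <= C2norm O u)%E].
Proof.
move=> Ox.
have e1 : exists x, O x by exists x.
have h1 := esup_ge0 e1 (fun x => normr_ge0 (u x)).
have s0 m k (A : 'M[R]_(m, k)) : 0 <= enorm A by exact: sqrtr_ge0.
have h2 := esup_ge0 e1 (fun x => s0 _ _ (grad u x)).
have h3 := esup_ge0 e1 (fun x => s0 _ _ (hess u x)).
have k1 : (`|u x|%:E <= ereal_sup [set `|u x|%:E | x in O])%E by apply: ereal_sup_ubound; exists x.
have k2 : ((enorm (grad u x))%:E <= ereal_sup [set (enorm (grad u x))%:E | x in O])%E by apply: ereal_sup_ubound; exists x.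
have k3 : ((enorm (hess u x))%:E <= ereal_sup [set (enorm (hess u x))%:E | x in O])%E by apply: ereal_sup_ubound; exists x.
rewrite /C2norm; split.
- by apply: (le_trans k1); rewrite -addeA leeDl// adde_ge0.
- by apply: (le_trans k2); rewrite addeAC leeDr// adde_ge0.
- by apply: (le_trans k3); rewrite leeDr// adde_ge0.
Qed.

Lemma grad_sub u v x : C1 u -> C1 v -> grad (fun y => u y - v y) x = grad u x - grad v x.
Proof.
move=> [du _] [dv _]; apply/rowP => i; rewrite !mxE /partial.
exact: (deriveB (du x i) (dv x i)).
Qed.

(** The constant is crude: each of the n^2 entries of the Hessian is bounded by its norm. *)
Lemma taylor2 u (x v : 'rV[R]_n) (K : R) : C2 u -> (forall y, enorm (hess u y) <= K) ->
  u (x + v) <= u x + dotp (grad u x) v + n%:R ^+ 2 * K * enorm v ^+ 2.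
Proof.
move=> c2 hK.
have [c c1] := mvt0 1 (line_derive x v c2.1).
have [c' _] := mvt0 c (line_derive2 x v c2).
rewrite !scale0r !addr0 scale1r mulr1 => E2 E1.
have hb y : `|hessq u y v| <= n%:R ^+ 2 * K * enorm v ^+ 2.
  have -> : n%:R ^+ 2 * K * enorm v ^+ 2 = \sum_(i < n) \sum_(j < n) (enorm v * enorm v * K).
    rewrite sumr_const sumr_const !card_ord -mulrnA -[RHS]mulr_natl natrM.
    by move: (n%:R) (enorm v) => a b; ring.
  apply: le_trans (ler_norm_sum _ _ _) _; apply: ler_sum => i _.
  apply: le_trans (ler_norm_sum _ _ _) _; apply: ler_sum => j _.
  rewrite !normrM; apply: ler_pM => //.
    by apply: ler_pM => //; exact: enorm_coord.
  apply: le_trans (hK y); apply: le_trans (enorm_entry _ i j).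
  by rewrite mxE.
have := le_trans (ler_norm (hessq u (x + c' *: v) v * c)) _.
move=> /(_ (n%:R ^+ 2 * K * enorm v ^+ 2)); rewrite normrM.
have c1' : `|c| <= 1 by rewrite (le_trans c1)// normr1.
have := ler_pM (normr_ge0 _) (normr_ge0 _) (hb (x + c' *: v)) c1'; rewrite mulr1.
move=> h /(_ h); rewrite -E2 lerBlDr => {}h.
by rewrite -(subrK (u x) (u (x + v))) E1 addrC -addrA lerD2l addrC (dotpC (grad u x)) -dirDE.
Qed.

End Regularity.

(** The first integral may be +oo and k may be negative: the cost of an arbitrary competitor is not
    known to be finite. *)
Lemma integral_add (R : realType) disp (Z : measurableType disp)
    (mu : {measure set Z -> \bar R}) (D : set Z) (f : Z -> \bar R) (k : Z -> R) :
  measurable D -> measurable_fun D f -> (forall z, 0 <= f z)%E -> mu.-integrable D (EFin \o k) ->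
  (\int[mu]_(z in D) (f z + (k z)%:E) = \int[mu]_(z in D) f z + (\int[mu]_(z in D) k z)%:E)%E.
Proof.
move=> mD mf f0 ki.
have kE : (\int[mu]_(z in D) k z)%:E = (\int[mu]_(z in D) (k z)%:E)%E.
  by rewrite /Rintegral fineK//; exact: integrable_fin_num.
have mk : measurable_fun D (EFin \o k) := measurable_int _ ki.
have [finf|] := ltP (\int[mu]_(z in D) f z)%E +oo%E.
  rewrite kE integralD//; apply/integrableP; split => //.
  rewrite (eq_integral f)// => z _; by rewrite gee0_abs.
rewrite leye_eq => /eqP finf; rewrite finf addye// integralE.
have mfk : measurable_fun D (fun z => f z + (k z)%:E)%E by exact: emeasurable_funD.
have mak : measurable_fun D (fun z => `|k z|%:E : \bar R).
  by apply/measurable_EFinP; apply: measurableT_comp => //; exact/measurable_EFinP.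
have ka : (\int[mu]_(z in D) `|k z|%:E < +oo)%E by have /integrableP[] := ki.
have nfin : (\int[mu]_(z in D) (fun z => f z + (k z)%:E)^\- z < +oo)%E.
  apply: le_lt_trans ka; apply: ge0_le_integral => //; first exact: measurable_funeneg.
  move=> z _; rewrite funenegE ge_max lee_fin normr_ge0 andbT.
  case: (f z) (f0 z) => [r|_|//]; last by rewrite leNye.
  rewrite lee_fin => r0; rewrite -EFinD -EFinN lee_fin.
  by have := ler_norm (- k z); rewrite normrN; move: (k z) => c; lra.
have pinf : (\int[mu]_(z in D) (fun z => f z + (k z)%:E)^\+ z = +oo)%E.
  apply/eqP; rewrite -leye_eq -finf leNgt; apply/negP => h.
  have : (\int[mu]_(z in D) f z < +oo)%E.
    apply: (@le_lt_trans _ _ (\int[mu]_(z in D) ((fun z => f z + (k z)%:E)^\+ z + `|k z|%:E))%E).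
      apply: ge0_le_integral => //.
        by apply: emeasurable_funD => //; exact: measurable_funepos.
      move=> z _; rewrite funeposE.
      apply: (@le_trans _ _ (f z + (k z)%:E + `|k z|%:E)%E); last by rewrite leeD2r// le_max lexx.
      by rewrite -addeA leeDl// -EFinD lee_fin -lerBlDl sub0r -normrN ler_norm.
    rewrite ge0_integralD//; last exact: measurable_funepos.
    by rewrite lte_add_pinfty// -finf.
  by rewrite finf ltxx.
by rewrite pinf addye// eqe_oppLR /= lt_eqF.
Qed.

Lemma Rint_cst_itv (R : realType) (a b c : R) : a <= b ->
  \int[@lebesgue_measure R]_(s in `[a, b]) c = c * (b - a).
Proof.
move=> ab; rewrite Rintegral_cst//.
have e : (@lebesgue_measure R) `[a, b]%classic = (b - a)%:E.
  rewrite lebesgue_measure_itv/= lte_fin; move: ab; rewrite le_eqVlt => /predU1P[->|ab].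
    by rewrite ltxx subrr.
  by rewrite ab EFinB.
exact: (congr1 (fun z => c * fine z) e).
Qed.

Lemma Rint_cst_prob (R : realType) disp (Omega : measurableType disp) (P : probability Omega R)
  (c : R) : \int[P]_w c = c.
Proof.
rewrite Rintegral_cst//.
exact: (etrans (congr1 (fun z => c * fine z) (@probability_setT _ _ _ P)) (mulr1 c)).
Qed.

Lemma integrable_ae_eq (R : realType) disp (Z : measurableType disp)
    (mu : {measure set Z -> \bar R}) (D : set Z) (f g : Z -> \bar R) :
  measurable_fun D f -> {ae mu, forall z, D z -> f z = g z} ->
  mu.-integrable D g -> mu.-integrable D f.
Proof.
move=> mf fg /integrableP[_ ig]; apply/integrableP; split => //.
rewrite (integral_ae (g := fun z => `|g z|%E))//.
by apply: ae_impl fg => z h Dz; rewrite h.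
Qed.

(** Rationals are enumerated by decoding integers, with 0 where decoding fails; a countable family
    of almost sure bounds thus becomes a bound at all times. *)
Lemma le_dense (R : realType) (f : R -> R) (c : R) : continuous f ->
  (forall n : nat, f (ratr (odflt 0 (unpickle n : option rat))) <= c) -> forall x, f x <= c.
Proof.
move=> cf fc x; rewrite leNgt; apply/negP => cx.
have e0 : 0 < f x - c by rewrite subr_gt0.
have /cvgrPdist_lt/(_ _ e0)[del /= d0 hd] := cf x.
have [q] : exists q : rat, x < ratr q < x + del by apply: rat_in_itvoo; rewrite ltrDl.
move=> /andP[q1 q2]; have := fc (pickle q); rewrite pickleK /= => fq.
have := hd (ratr q); rewrite /= ltr_distlC => /(_ _)/wrap[].
  by rewrite q2 andbT; lra.
rewrite ltr_norml => /andP[_ h]; lra.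
Qed.

(** * Almost sure bounds and orthogonality from averages over events *)

Section AverageBound.
Context (R : realType) (disp : measure_display) (Omega : measurableType disp).
Context (P : probability Omega R) (F : set (set Omega)).
Hypothesis sF : is_sub_sigma F.

(** The event where f > c lies in F, and the average of f - c over it is both nonnegative and
    nonpositive. *)
Lemma average_le (f : Omega -> R) (c : R) : fmeas F f -> Pint P f ->
  (forall A, F A -> \int[P]_(w in A) f w <= c * fine (P A)) -> {ae P, forall w, f w <= c}.
Proof.
move=> mf fi fA; pose A := [set w | c < f w].
have FA : F A.
  have := fmeas_set sF mf (measurable_itv `]c, +oo[).
  by congr (F _); apply/seteqP; split => w /=; rewrite in_itv/= andbT.
have mA : measurable A by exact: sF.2.
have ci : Pint P (fun=> c) by exact: (@Pint_bdd _ _ _ _ _ `|c|).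
have iA : P.-integrable A (EFin \o (fun w => f w - c)) by apply: PintS => //; exact: PintB.
have E0 : \int[P]_(w in A) (f w - c) <= 0.
  rewrite RintegralB//; [|exact: PintS|exact: PintS].
  by rewrite Rintegral_cst// subr_le0; exact: fA.
have E1 : (\int[P]_(w in A) `|(f w - c)%:E| = 0)%E.
  rewrite (eq_integral (fun w => (f w - c)%:E)); last first.
    by move=> w; rewrite inE => Aw; rewrite gee0_abs// lee_fin subr_ge0 ltW.
  rewrite -(fineK (integrable_fin_num mA iA)); congr EFin; apply/eqP; rewrite eq_le E0/=.
  by apply: Rintegral_ge0 => w Aw; rewrite subr_ge0 ltW.
have := (ae_eq_integral_abs P mA (measurable_int _ iA)).1 E1.
apply: ae_impl => w h; rewrite leNgt; apply/negP => cw.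
have [] := h cw; move=> /eqP; rewrite subr_eq0 => /eqP fc.
by move: cw; rewrite fc ltxx.
Qed.

Lemma average_eq (f g : Omega -> R) : fmeas F f -> fmeas F g -> Pint P f -> Pint P g ->
  (forall A, F A -> \int[P]_(w in A) f w = \int[P]_(w in A) g w) -> {ae P, forall w, f w = g w}.
Proof.
suff h (f' g' : Omega -> R) : fmeas F f' -> fmeas F g' -> Pint P f' -> Pint P g' ->
    (forall A, F A -> \int[P]_(w in A) f' w = \int[P]_(w in A) g' w) -> {ae P, forall w, f' w - g' w <= 0}.
  move=> mf mg fi gi fg; apply: ae_impl (ae_and (h _ _ mf mg fi gi fg) (h _ _ mg mf gi fi _)) => [w []|A /fg//].
  by rewrite !subr_le0 => k1 k2; apply/eqP; rewrite eq_le k1.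
move=> mf mg fi gi fg; apply: average_le; [exact: measurable_funB|exact: PintB|move=> A FA].
have mA := sF.2 _ FA; rewrite RintegralB//; [|exact: PintS|exact: PintS].
by rewrite fg// subrr mul0r.
Qed.
Lemma Pint_bounded_mul (b q : Omega -> R) (B : R) : measurable_fun setT b ->
  (forall w, `|b w| <= B) -> Pint P q -> Pint P (fun w => b w * q w).
Proof.
move=> mb bB iq; have mq := Pint_measurable iq.
have B0 : 0 <= B by apply: le_trans (bB point).
apply: (@le_integrable _ _ _ P setT measurableT _ (EFin \o (fun w => B * q w))); last exact: PintZ.
- by apply/measurable_EFinP; exact: measurable_funM.
- by move=> w _; rewrite lee_fin !normrM ler_wpM2r// (ger0_norm B0).
Qed.

(** b is rounded down to a multiple of 1/(n+1). The rounded function is a finite combination of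
    indicators of events of F, and the error is at most E|q| / (n+1). *)
Let multiplier_ge0 (q b : Omega -> R) (B : R) : Pint P q ->
  (forall A, F A -> \int[P]_(w in A) q w = 0) -> fmeas F b -> (forall w, 0 <= b w <= B) ->
  \int[P]_w (b w * q w) = 0.
Proof.
move=> iq q0 mb bB; have mbO := fmeasW sF.2 mb.
have B0 : 0 <= B by have /andP[h1 h2] := bB point; exact: le_trans h2.
have bq : Pint P (fun w => b w * q w).
  by apply: (Pint_bounded_mul (B := B)) => // w; have /andP[h1 h2] := bB w; rewrite ger0_norm.
suff H n : `|\int[P]_w (b w * q w)| <= n.+1%:R^-1 * \int[P]_w `|q w|.
  apply/eqP; rewrite -normr_eq0 eq_le normr_ge0 andbT.
  have c : n.+1%:R^-1 * \int[P]_w `|q w| @[n --> \oo] --> 0 * \int[P]_w `|q w|.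
    by apply: cvgMl; exact: cvg_harmonic.
  rewrite mul0r in c; rewrite -(cvg_lim _ c)//.
  by apply: limr_ge; [apply/cvg_ex; exists 0|exact: nearW].
pose k w := Num.truncn (n.+1%:R * b w).
pose m := (Num.truncn (n.+1%:R * B)).+1.
have kb w : (k w)%:R <= n.+1%:R * b w < (k w).+1%:R.
  by apply: truncn_itv; rewrite mulr_ge0//; case/andP: (bB w).
have km w : (k w < m)%N.
  rewrite /m ltnS; apply: le_truncn; rewrite ler_wpM2l//; by case/andP: (bB w).
pose A j := [set w | j%:R <= n.+1%:R * b w < j.+1%:R].
have FA j : F (A j).
  have mnb : fmeas F (fun w => n.+1%:R * b w) by apply: measurable_funM => //; exact: measurable_cst.
  have := fmeas_set sF mnb (measurable_itv `[j%:R, j.+1%:R[).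
  by congr (F _); apply/seteqP; split => w /=; rewrite in_itv.
have Ak j w : A j w <-> k w = j.
  split=> [/andP[h1 h2]|<-]; last exact: kb.
  have /andP[h3 h4] := kb w; apply/eqP; rewrite eqn_leq.
  by apply/andP; split; rewrite -ltnS -(ltr_nat R); [exact: le_lt_trans h3 h2|exact: le_lt_trans h1 h4].
pose bn w : R := \sum_(j < m) n.+1%:R^-1 * j%:R * \1_(A j) w.
have bnE w : bn w = n.+1%:R^-1 * (k w)%:R.
  rewrite /bn (bigD1 (Ordinal (km w)))//= indicE mem_set ?mulr1; last exact/Ak.
  rewrite big1 ?addr0// => j jk; rewrite indicE memNset ?mulr0// => /Ak kj.
  by move/negP: jk; apply; apply/eqP/val_inj; rewrite /= kj.
have E0 : \int[P]_w (bn w * q w) = 0.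
  have -> : (fun w => bn w * q w) = fun w => \sum_(j < m) (n.+1%:R^-1 * j%:R * (\1_(A j) w * q w)).
    by apply/funext => w; rewrite /bn mulr_suml; apply: eq_bigr => j _; rewrite mulrA.
  have i1 j : Pint P (fun w => \1_(A j) w * q w).
    apply: (Pint_bounded_mul (B := 1)) => //; first by apply: measurable_indic; exact: sF.2.
    by move=> w; rewrite indicE; case: (_ \in _); rewrite ?normr0 ?normr1.
  suff : forall M : nat, Pint P (fun w => \sum_(j < M) (n.+1%:R^-1 * j%:R * (\1_(A j) w * q w))) /\
      \int[P]_w (\sum_(j < M) (n.+1%:R^-1 * j%:R * (\1_(A j) w * q w))) = 0 by move=> /(_ m)[].
  elim=> [|M [ihi ih]].
    rewrite (_ : (fun w => _) = fun=> 0); last by apply/funext => w; rewrite big_ord0.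
    split; first by apply: (@Pint_bdd _ _ _ _ _ 0) => // w; rewrite normr0.
    by rewrite Rint_cst_prob.
  have ij : Pint P (fun w => n.+1%:R^-1 * M%:R * (\1_(A M) w * q w)) by apply: PintZ.
  split.
    by under eq_fun do rewrite big_ord_recr/=; exact: PintD.
  under eq_Rintegral do rewrite big_ord_recr/=.
  rewrite RintegralD// ih add0r RintegralZl//; last exact: i1.
  have -> : \int[P]_w (\1_(A M) w * q w) = \int[P]_(w in A M) q w.
    rewrite [RHS]Rintegral_mkcond; apply: eq_Rintegral => w _.
    by rewrite patchE indicE; case: ifP => _; rewrite ?mul1r ?mul0r.
  by rewrite q0// mulr0.
have mbn : measurable_fun setT bn.
  apply: measurable_sum => j; apply: measurable_funM => //.
  by apply: measurable_indic; exact: sF.2.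
have bbn w : `|b w - bn w| <= n.+1%:R^-1.
  have /andP[h1 h2] := kb w; rewrite bnE; have n0 : 0 < n.+1%:R :> R by [].
  have -> : b w - n.+1%:R^-1 * (k w)%:R = n.+1%:R^-1 * (n.+1%:R * b w - (k w)%:R).
    by rewrite mulrBr mulKf// gt_eqF.
  rewrite normrM ger0_norm ?invr_ge0// ler_piMr ?invr_ge0// ger0_norm ?subr_ge0//.
  by rewrite lerBlDr addrC natr1 ltW.
have ibn : Pint P (fun w => bn w * q w).
  apply: (Pint_bounded_mul (B := B + 1)) => // w.
  have -> : bn w = b w - (b w - bn w) by rewrite subKr.
  apply: le_trans (ler_normB _ _) _; apply: lerD.
    by have /andP[h1 h2] := bB w; rewrite ger0_norm.
  by apply: le_trans (bbn w) _; rewrite invf_le1// ler1n.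
rewrite -[X in `|X|]subr0 -{1}E0 -RintegralB//.
have ibb : Pint P (fun w => b w * q w - bn w * q w) by exact: PintB.
apply: le_trans (le_normr_Rintegral measurableT ibb) _.
rewrite -RintegralZl//; last exact: Pint_abs.
apply: le_Rintegral => //; [exact: Pint_abs|by apply: PintZ; exact: Pint_abs|].
by move=> w _; rewrite -mulrBl normrM ler_wpM2r.
Qed.

Lemma multiplier (q b : Omega -> R) (B : R) : Pint P q ->
  (forall A, F A -> \int[P]_(w in A) q w = 0) -> fmeas F b -> (forall w, `|b w| <= B) ->
  \int[P]_w (b w * q w) = 0.
Proof.
move=> iq q0 mb bB; have B0 : 0 <= B by apply: le_trans (bB point).
have h : \int[P]_w ((b w + B) * q w) = 0.
  apply: (@multiplier_ge0 _ _ (2 * B)) => //.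
    by apply: measurable_funD => //; exact: measurable_cst.
  by move=> w; have := bB w; rewrite ler_norml => /andP[h1 h2]; apply/andP; split; lra.
have mbO := fmeasW sF.2 mb.
rewrite -h; have -> : (fun w => (b w + B) * q w) = fun w => b w * q w + B * q w.
  by apply/funext => w; rewrite mulrDl.
rewrite RintegralD//; [|exact: (Pint_bounded_mul mbO bB)|exact: PintZ].
rewrite RintegralZl// (_ : \int[P]_w q w = 0) ?mulr0 ?addr0//.
exact: (q0 setT (sigT sF.1)).
Qed.

End AverageBound.

(** * Exchange of time integrals and differentiation of primitives *)

Section TimeSwap.
Context (R : realType).
Notation leb := (@lebesgue_measure R).

Lemma integrable_product d1 d2 (T1 : measurableType d1) (T2 : measurableType d2)
    (m1 : {sigma_finite_measure set T1 -> \bar R}) (m2 : {sigma_finite_measure set T2 -> \bar R})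
    (f : T1 -> R) (g : T2 -> R) :
  m1.-integrable setT (EFin \o f) -> m2.-integrable setT (EFin \o g) ->
  (m1 \x m2)%E.-integrable setT (EFin \o (fun z => f z.1 * g z.2)).
Proof.
move=> fi gi.
have mf : measurable_fun setT f by apply/measurable_EFinP; exact: measurable_int fi.
have mg : measurable_fun setT g by apply/measurable_EFinP; exact: measurable_int gi.
have m : measurable_fun setT (EFin \o (fun z : T1 * T2 => f z.1 * g z.2)).
  apply/measurable_EFinP; apply: measurable_funM.
    exact: measurableT_comp mf measurable_fst.
  exact: measurableT_comp mg measurable_snd.
apply/(integrable12ltyP _ _ m).
have /integrableP[_ gfin] := gi; have /integrableP[_ ffin] := fi.
rewrite (eq_integral (fun x => `|f x|%:E * \int[m2]_y `|(g y)%:E|)%E); last first.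
  move=> x _ /=; rewrite -ge0_integralZl//; last by apply/measurable_EFinP; exact: measurableT_comp.
  by apply: eq_integral => y _; rewrite /= normrM EFinM.
have g0 : (0 <= \int[m2]_y `|(g y)%:E|)%E by apply: integral_ge0.
rewrite -(fineK (_ : (\int[m2]_y `|(g y)%:E|)%E \is a fin_num)); last by rewrite ge0_fin_numE.
rewrite ge0_integralZr//; last 2 first.
- by apply/measurable_EFinP; exact: measurableT_comp.
- by rewrite lee_fin fine_ge0.
by rewrite muleC lte_mul_pinfty// ?lee_fin ?fine_ge0.
Qed.

Lemma primitive_swap (T : R) (f g : R -> R) :
  leb.-integrable `[0, T] (EFin \o f) -> leb.-integrable `[0, T] (EFin \o g) ->
  \int[leb]_(s in `[0, T]) (f s * \int[leb]_(r in `[0, s]) g r) =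
  \int[leb]_(r in `[0, T]) (g r * \int[leb]_(s in `[r, T]) f s).
Proof.
move=> fi gi.
pose f' := f \_ `[0, T]%classic; pose g' := g \_ `[0, T]%classic.
have ext (h : R -> R) : leb.-integrable `[0, T] (EFin \o h) -> leb.-integrable setT (EFin \o (h \_ `[0, T]%classic)).
  move=> hi; have := iffLR (integrable_mkcond (fun s : measurableTypeR R => (h s)%:E) (measurable_itv `[0, T])) hi.
  by congr (leb.-integrable _ _); apply/funext => s; rewrite /= /patch; case: ifP.
have fi' := ext f fi; have gi' := ext g gi.
pose lower := [set z : measurableTypeR R * measurableTypeR R | z.2 <= z.1].
have ml : measurable lower.
  have m : measurable_fun setT (fun z : measurableTypeR R * measurableTypeR R => z.1 - z.2).
    exact: measurable_funB measurable_fst measurable_snd.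
  have := m measurableT _ (measurable_itv `[0, +oo[); rewrite setTI.
  by congr measurable; apply/seteqP; split => z /=; rewrite in_itv/= andbT subr_ge0.
have lowerE (s r : R) : (((s, r) : measurableTypeR R * measurableTypeR R) \in lower) = (r <= s).
  by apply/idP/idP; rewrite inE.
(* Kernel carried by the triangle r <= s of the square; its two iterated integrals are the two
   sides. *)
pose K (z : measurableTypeR R * measurableTypeR R) := f' z.1 * g' z.2 * \1_lower z.
have prodi := integrable_product fi' gi'.
have Ki : (leb \x leb)%E.-integrable setT (EFin \o K).
  apply: (@le_integrable _ _ _ (leb \x leb)%E setT measurableT _ _ _ _ prodi).
    apply/measurable_EFinP; apply: measurable_funM; last exact: measurable_indic.
    by apply/measurable_EFinP; exact: measurable_int prodi.
  move=> z _; rewrite lee_fin /K normrM indicE; case: (_ \in _); rewrite ?normr1 ?normr0 ?mulr1 ?mulr0//.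
have E1 (s : R) : fubini_F leb (EFin \o K) s = ((fun s => (f s * \int[leb]_(r in `[0, s]) g r)%:E) \_ `[0, T]%classic) s.
  rewrite /fubini_F /= patchE; case: ifPn => [|nT]; last first.
    by under eq_integral do rewrite /K /f' patchE (negbTE nT) mul0r mul0r; rewrite integral0.
  rewrite inE/= in_itv/= => /andP[s0 sT].
  have gs : leb.-integrable `[0, s] (EFin \o g) by exact: integrable_itvS gi.
  have -> : (fun r => (K (s, r))%:E) = (fun r => (f s)%:E * ((fun r => (g r)%:E) \_ `[0%R, s]%classic) r)%E.
    apply/funext => r; rewrite /K /f' /g' !patchE indicE lowerE !mem_setE !in_itv/= s0 sT.
    have [r0|] := boolP (0 <= r); last by rewrite /= mulr0 mul0r mule0.
    have [rs|] := boolP (r <= s).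
      by rewrite (le_trans rs sT) /= mulr1 -EFinM.
    by rewrite /= mulr0 mule0.
  rewrite integralZl//; last by exact: (iffLR (integrable_mkcond (fun s : measurableTypeR R => (g s)%:E) (measurable_itv `[0, s])) gs).
  by rewrite -integral_mkcond EFinM /Rintegral fineK//; exact: integrable_fin_num.
have E2 (r : R) : fubini_G leb (EFin \o K) r = ((fun r => (g r * \int[leb]_(s in `[r, T]) f s)%:E) \_ `[0, T]%classic) r.
  rewrite /fubini_G /= patchE; case: ifPn => [|nT]; last first.
    rewrite (eq_integral (fun=> 0%E)) ?integral0// => s _.
    by rewrite /K /g' /= patchE (negbTE nT) mulr0 mul0r.
  rewrite inE/= in_itv/= => /andP[r0 rT].
  have fr : leb.-integrable `[r, T] (EFin \o f) by exact: integrable_itvS fi.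
  have -> : (fun s => (K (s, r))%:E) = (fun s => (g r)%:E * ((fun s => (f s)%:E) \_ `[r, T]%classic) s)%E.
    apply/funext => s; rewrite /K /f' /g' !patchE indicE lowerE !mem_setE !in_itv/= r0 rT.
    have [rs|] := boolP (r <= s); last by rewrite /= mulr0 mule0.
    rewrite (le_trans r0 rs)/=; case: ifP => _; last by rewrite mul0r mul0r mule0.
    by rewrite mulr1 mulrC -EFinM.
  rewrite integralZl//; last by exact: (iffLR (integrable_mkcond (fun s : measurableTypeR R => (f s)%:E) (measurable_itv `[r, T])) fr).
  by rewrite -integral_mkcond EFinM /Rintegral fineK//; exact: integrable_fin_num.
have : (\int[leb]_s fubini_F leb (EFin \o K) s = \int[leb]_r fubini_G leb (EFin \o K) r)%E := Fubini Ki.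
rewrite (funext E1) (funext E2) -!integral_mkcond => E.
by rewrite /Rintegral E.
Qed.

End TimeSwap.

Section TimeSections.
Context (R : realType) (disp : measure_display) (Omega : measurableType disp).
Context (P : probability Omega R) (T : R).
Notation D := (@timeD R disp Omega T).

Lemma dtP_section_eq (f g : R * Omega -> R) :
  (dtP P).-integrable D (EFin \o f) -> (dtP P).-integrable D (EFin \o g) ->
  (forall s, 0 <= s <= T -> (\int[P]_w (f (s, w))%:E = \int[P]_w (g (s, w))%:E)%E) ->
  \int[dtP P]_(z in D) f z = \int[dtP P]_(z in D) g z.
Proof.
move=> fi gi fg; rewrite /Rintegral; congr fine.
have ext (h : R * Omega -> R) : (dtP P).-integrable D (EFin \o h) ->
    (\int[dtP P]_(z in D) (h z)%:E = \int[@lebesgue_measure R]_s ((fun s => \int[P]_w (h (s, w))%:E) \_ `[0%R, T]%classic) s)%E.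
  move=> hi; have hD := iffLR (integrable_mkcond _ (measurable_timeD (Omega := Omega) T)) hi.
  rewrite integral_mkcond -(fubini1 (m1 := @lebesgue_measure R) (m2 := P) hD).
  apply: eq_integral => s _; rewrite /fubini_F patchE; case: ifPn => sT.
    apply: eq_integral => w _; rewrite patchE (_ : (s, w) \in D)//.
    by rewrite inE; split => //; move: sT; rewrite inE.
  rewrite (eq_integral (fun=> 0%E)) ?integral0// => w _; rewrite patchE memNset//.
  by move=> [/= hT _]; move/negP: sT; rewrite inE.
rewrite (ext f fi) (ext g gi); apply: eq_integral => s _; rewrite !patchE; case: ifPn => // sT.
by apply: fg; move: sT; rewrite inE/= in_itv.
Qed.

End TimeSections.

Section PathDuality.
Context (R : realType).
Notation leb := (@lebesgue_measure R).

(** Pathwise integration by parts: the displacement produced by the velocity b, tested against a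
    running slope f and a terminal slope c, equals b tested against what remains of both after time
    r. *)
Lemma primitive_duality (T B c : R) (f b : R -> R) : 0 <= T ->
  leb.-integrable `[0, T] (EFin \o f) -> leb.-integrable `[0, T] (EFin \o b) ->
  (forall s, `|b s| <= B) ->
  \int[leb]_(s in `[0, T]) (f s * \int[leb]_(r in `[0, s]) b r) + c * \int[leb]_(r in `[0, T]) b r =
  \int[leb]_(r in `[0, T]) (b r * (\int[leb]_(s in `[r, T]) f s + c)).
Proof.
move=> T0 fi bi bB; have B0 : 0 <= B := le_trans (normr_ge0 _) (bB 0).
rewrite primitive_swap// mulrC -RintegralZr//.
have nf := integrable_norm fi.
pose K := \int[leb]_(s in `[0, T]) `|f s|.
have tE r : 0 <= r <= T -> \int[leb]_(s in `[r, T]) f s =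
    \int[leb]_(s in `[0, T]) f s - \int[leb]_(s in `[0, r]) f s.
  by move=> /andP[r0 rT]; rewrite (primitive_split fi r0 rT (lexx _)) addrAC subrr add0r.
have tK r : 0 <= r <= T -> `|\int[leb]_(s in `[r, T]) f s| <= K.
  move=> /andP[r0 rT]; apply: (@le_trans _ _ (\int[leb]_(s in `[r, T]) `|f s|)).
    by apply: le_normr_Rintegral => //; apply: (integrable_itvS r0 (lexx T) fi).
  by rewrite /K (primitive_split nf r0 rT (lexx T)) lerDr; apply: Rintegral_ge0 => s _; exact: normr_ge0.
have mb : measurable_fun `[0, T] b by apply/measurable_EFinP; exact: measurable_int bi.
have mt : measurable_fun (`[0, T]%classic : set (measurableTypeR R)) (fun r => \int[leb]_(s in `[r, T]) f s).
  apply: (@eq_measurable_fun _ _ (measurableTypeR R) (measurableTypeR R) _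
     (fun r => \int[leb]_(s in `[0, T]) f s - \int[leb]_(s in `[0, clamp 0 T r]) f s)).
    by move=> r /set_mem /=; rewrite in_itv/= => rT; rewrite clamp_id// (tE r rT).
  apply: measurable_funB => //; apply: measurable_funTS; apply: continuous_measurable_fun.
  exact: primitive_continuous T0 fi.
have i1 : leb.-integrable `[0, T] (EFin \o (fun r => b r * \int[leb]_(s in `[r, T]) f s)).
  apply: (@le_integrable _ _ _ leb `[0, T]%classic (measurable_itv _) _ (fun=> (B * K)%:E)).
  - by apply/measurable_EFinP; exact: measurable_funM.
  - move=> r; rewrite /= in_itv/= => rT; rewrite lee_fin normrM.
    by apply: le_trans (ler_norm _); apply: ler_pM => //; exact: tK.
  - by apply: (@bdd_integrable _ _ _ leb _ (fun=> B * K) `|B * K|) => //; exact: mu_itv_fin.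
have i2 : leb.-integrable `[0, T] (EFin \o (fun r => b r * c)).
  by have := @integrableZr _ _ _ leb _ (measurable_itv `[0, T]) c (EFin \o b) bi.
rewrite -RintegralD//.
by apply: eq_Rint => r _; rewrite mulrDr.
Qed.

Lemma Rint_sum disp (Z : measurableType disp) (mu : {measure set Z -> \bar R}) (D : set Z)
    n (f : 'I_n -> Z -> R) : measurable D -> (forall i, mu.-integrable D (EFin \o f i)) ->
  mu.-integrable D (EFin \o (fun z => \sum_i f i z)) /\
  \int[mu]_(z in D) (\sum_i f i z) = \sum_i \int[mu]_(z in D) f i z.
Proof.
move=> mD; elim: n f => [|n IH] f fi.
  rewrite (_ : (fun z => _) = fun=> 0); last by apply/funext => z; rewrite big_ord0.
  by rewrite big_ord0; split; [exact: integrable0|rewrite Rintegral_cst ?mul0r].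
rewrite (_ : (fun z => _) = fun z => \sum_(i < n) f (widen_ord (leqnSn n) i) z + f ord_max z); last first.
  by apply/funext => z; rewrite big_ord_recr.
have [i1 e1] := IH (fun i => f (widen_ord (leqnSn n) i)) (fun i => fi _).
split; last by rewrite RintegralD// big_ord_recr/= e1.
by have := integrableD mD i1 (fi ord_max).
Qed.

Lemma first_order_ge0 (S K e0 : R) : 0 < e0 -> 0 <= K ->
  (forall e, 0 < e -> e <= e0 -> 0 <= e * S + e ^+ 2 * K) -> 0 <= S.
Proof.
move=> e00 K0 h; rewrite leNgt; apply/negP => S0.
pose e := Num.min e0 (- S / (2 * (K + 1))).
have K1 : 0 < 2 * (K + 1) by lra.
have e1 : 0 < e by rewrite lt_min e00 divr_gt0// oppr_gt0.
have := h e e1; rewrite ge_min lexx => /(_ isT).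
have : e * (2 * (K + 1)) <= - S.
  by rewrite -ler_pdivlMr// ge_min lexx orbT.
move: (e) e1 => y y0 h1 h2; have : 0 <= S + y * K.
  by rewrite -(pmulr_rge0 _ y0); move: h2; congr (_ <= _); ring.
nra.
Qed.
End PathDuality.

Section CompleteMeasure.
Context (R : realType) (disp : measure_display) (Z : measurableType disp).
Context (P : {measure set Z -> \bar R}).

(** Needed for the terminal variable in the definition of the adjoint process, built from classical
    derivatives and known only up to a null set. *)
Lemma complete_measurable_fun (f g : Z -> R) : measure_is_complete P ->
  measurable_fun setT f -> {ae P, forall z, g z = f z} -> measurable_fun setT g.
Proof.
move=> cP mf [N [mN N0 hN]] _ B mB; rewrite setTI.
have -> : g @^-1` B = (f @^-1` B `&` ~` N) `|` (g @^-1` B `&` N).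
  apply/seteqP; split=> z /=.
    move=> Bz; have [Nz|Nz] := pselect (N z); [by right|left; split => //].
    by have <- : g z = f z by apply: contrapT => h; apply: Nz; apply: hN.
  case=> [[Bz Nz]|[]//]; have -> // : g z = f z.
  by apply: contrapT => h; apply: Nz; apply: hN.
apply: measurableU.
  by apply: measurableI; [rewrite -[X in measurable X]setTI; exact: mf|exact: measurableC].
by apply: cP; exists N; split => // z [].
Qed.
End CompleteMeasure.

Section PrimitiveSlope.
Context (R : realType).
Notation leb := (@lebesgue_measure R).

Lemma primitive_slope_bound (T e l : R) (c : R -> R) (a b : R) : continuous c -> 0 <= a -> a <= b -> b <= T ->
  (forall r, a <= r <= b -> `|c r - l| <= e) ->
  `|\int[leb]_(r in `[0, b]) c r - \int[leb]_(r in `[0, a]) c r - (b - a) * l| <= e * (b - a).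
Proof.
move=> cc a0 ab bT ce.
have ci x y : leb.-integrable `[x, y] (EFin \o c).
  by apply: continuous_compact_integrable; [exact: segment_compact|exact: continuous_subspaceT].
have ki x y k : leb.-integrable `[x, y] (EFin \o (fun=> k)).
  by apply: (@bdd_integrable _ _ _ leb _ (fun=> k) `|k|) => //; exact: mu_itv_fin.
rewrite (primitive_split (ci 0 T) a0 ab bT).
have -> (x y z : R) : x + y - x - z = y - z by ring.
have -> : (b - a) * l = \int[leb]_(r in `[a, b]) l by rewrite Rint_cst_itv// mulrC.
have -> : e * (b - a) = \int[leb]_(r in `[a, b]) e by rewrite Rint_cst_itv.
rewrite -RintegralB//.
have di : leb.-integrable `[a, b] (EFin \o (fun r => c r - l)).
  apply: continuous_compact_integrable; first exact: segment_compact.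
  by apply: continuous_subspaceT => r; apply: cvgB; [exact: cc|exact: cvg_cst].
have nd : leb.-integrable `[a, b] (EFin \o (fun r => `|c r - l|)) := integrable_norm di.
apply: (@le_trans _ _ (\int[leb]_(r in `[a, b]) `|c r - l|)); first exact: le_normr_Rintegral.
apply: le_Rintegral; [exact: measurable_itv|exact: nd|exact: ki|].
by move=> r; rewrite /= in_itv/=; exact: ce.
Qed.

(** A continuous velocity gives a derivative at every time, one-sided at 0 and T because s stays in
    [0, T]. *)
Lemma primitive_slope (T : R) (c g : R -> R) : continuous c ->
  (forall t, 0 <= t <= T -> g t = g 0 + \int[leb]_(s in `[0, t]) c s) ->
  forall t, 0 <= t <= T -> (s - t)^-1 * (g s - g t)
     @[s --> within [set s | 0 <= s <= T /\ s != t] (nbhs t)] --> c t.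
Proof.
move=> cc gE t tT; apply/cvgrPdist_le => e e0.
have /cvgrPdist_le/(_ e e0) ct := cc t.
have {ct}[del /= del0 ct] := ct.
rewrite /= nearE; exists del => //= s st [sT snt].
have near r : `|t - r| <= `|t - s| -> `|c r - c t| <= e.
  by move=> h; rewrite distrC; apply: ct; exact: le_lt_trans h st.
have sn0 : s - t != 0 by rewrite subr_eq0.
suff h : `|g s - g t - (s - t) * c t| <= e * `|s - t|.
  have -> : c t - (s - t)^-1 * (g s - g t) = - ((s - t)^-1 * (g s - g t - (s - t) * c t)).
    by field.
  rewrite normrN normrM normfV mulrC ler_pdivrMr ?normr_gt0//.
rewrite (gE s sT) (gE t tT); have /andP[s0 sT'] := sT; have /andP[t0 tT'] := tT.
have -> (x y z : R) : z + x - (z + y) = x - y by ring.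
have [ts|/ltW st'] := leP t s.
  rewrite [X in e * X]ger0_norm ?subr_ge0//; apply: (primitive_slope_bound cc t0 ts sT') => r /andP[h1 h2].
  by apply: near; rewrite distrC [leRHS]distrC !ger0_norm ?subr_ge0// lerD2r.
rewrite -normrN distrC [X in e * X]ger0_norm ?subr_ge0//.
have -> (x y : R) : - (x - y - (s - t) * c t) = y - x - (t - s) * c t by ring.
apply: (primitive_slope_bound cc s0 st' tT') => r /andP[h1 h2].
by apply: near; rewrite !ger0_norm ?subr_ge0// lerD2l lerN2.
Qed.
End PrimitiveSlope.

(** * Second order expansion of ell under a change of position and velocity *)

Section VariationPointwise.
Context (R : realType) (d : nat) (lam C0 : R) (Cb : R -> R).
Hypotheses (lam0 : 0 < lam) (C00 : 0 < C0).
Context (h : 'rV[R]_d -> 'rV[R]_d -> R) (Hh : ham lam C0 Cb h).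
Local Notation ell := (ell lam C0 Cb h).

Definition variation_cst (Bh La : R) : R :=
  cgrow lam * Bh * La + d%:R * (cgrow lam * expR 1) * Bh + lam * expR (Num.sqrt lam) / 2 * Bh ^+ 2.

Lemma dotp_bound (x y : 'rV[R]_d) (a b : R) : 0 <= a -> (forall i, `|x 0 i| <= a) -> enorm y <= b ->
  `|dotp x y| <= d%:R * a * b.
Proof.
move=> a0 xa yb; rewrite /dotp; apply: le_trans (ler_norm_sum _ _ _) _.
have -> : d%:R * a * b = \sum_(i < d) a * b by rewrite sumr_const card_ord -mulrA mulr_natl.
apply: ler_sum => i _; rewrite normrM; apply: ler_pM => //.
exact: le_trans (enorm_coord _ _) yb.
Qed.

(** Two cases of a perturbation: the velocity v is kept, or replaced by e a + (1 - e) v, while the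
    position moves by e k. The supergradient controls the move at velocity v, the growth estimate at
    velocity a, and convexity in the velocity combines them; the error is proportional to ell + 1,
    hence integrable. *)
Lemma variation_pointwise (v a p y k : 'rV[R]_d) (e Bh La : R) :
  Lag h v y \is a fin_num -> a = - Dp h p y -> enorm k <= Bh -> 0 < e -> e <= 1 -> e * Bh <= 1 ->
  Num.sqrt lam * (e * Bh) <= 1 -> ell a y <= La ->
  (Lag h v (y + e *: k) \is a fin_num /\
   ell v (y + e *: k) <= ell v y + e * dotp (supg lam C0 Cb h v y) k
     + e ^+ 2 * (variation_cst Bh La * (ell v y + 1))) /\
  (Lag h (e *: a + (1 - e) *: v) (y + e *: k) \is a fin_num /\
   ell (e *: a + (1 - e) *: v) (y + e *: k) <=
     ell v y + e * (dotp (supg lam C0 Cb h v y) k + (ell a y - ell v y))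
     + e ^+ 2 * (variation_cst Bh La * (ell v y + 1))).
Proof.
move=> fv aE kB e0 e1 eB1 eB2 aL.
have Bh0 : 0 <= Bh := le_trans (enorm_ge0 k) kB.
have ek : enorm (e *: k) = e * enorm k by rewrite enormZ ger0_norm ?ltW.
have ekB : enorm (e *: k) <= e * Bh by rewrite ek ler_wpM2l// ltW.
have [sb up] := supgP lam0 C00 Hh fv.
have l0 := ell_gt0 lam0 C00 Hh fv.
have fa : Lag h a y \is a fin_num by rewrite aE; have [] := Lag_gradient Hh p y.
have la0 := ell_gt0 lam0 C00 Hh fa.
have [fv' _] := ell_growth lam0 C00 Hh (y + e *: k) fv.
have [fa' _] := ell_growth lam0 C00 Hh (y + e *: k) fa.
have sq1 : Num.sqrt lam * enorm (e *: k) <= 1.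
  by apply: le_trans eB2; rewrite ler_wpM2l ?sqrtr_ge0.
have [na _] := ell_near lam0 C00 Hh fa sq1.
have u1 := up _ (le_trans ekB eB1).
have Kx0 : 0 <= cgrow lam * expR 1 * ell v y.
  by rewrite !mulr_ge0 ?cgrow_ge0 ?expR_ge0// ltW.
have db := dotp_bound Kx0 sb kB.
have cg : 0 <= cgrow lam := cgrow_ge0 lam.
have u2 : ell v (y + e *: k) <= ell v y + e * dotp (supg lam C0 Cb h v y) k
    + e ^+ 2 * (lam * expR (Num.sqrt lam) / 2 * Bh ^+ 2) * ell v y.
  apply: (le_trans u1); rewrite dotpZr lerD2l /kappa.
  have -> : e ^+ 2 * (lam * expR (Num.sqrt lam) / 2 * Bh ^+ 2) * ell v y =
     lam * (expR (Num.sqrt lam) * ell v y) / 2 * (e * Bh) ^+ 2 by ring.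
  apply: ler_wpM2l; last by rewrite ler_sqr ?nnegrE ?enorm_ge0// mulr_ge0// ltW.
  by rewrite divr_ge0// mulr_ge0 ?(ltW lam0)// mulr_ge0 ?expR_ge0// ltW.
have a2 : ell a (y + e *: k) <= ell a y + e * (cgrow lam * Bh * La).
  apply: (le_trans na); rewrite lerD2l -mulrA mulrCA.
  have -> : e * (cgrow lam * Bh * La) = (e * Bh) * (cgrow lam * La) by ring.
  by apply: ler_pM; rewrite ?enorm_ge0 ?mulr_ge0 ?(ltW la0)//; apply: ler_wpM2l.
have eI : 0 <= e <= 1 by rewrite (ltW e0).
have [fm gm] := Lag_convex Hh eI fa' fv'.
have c1 : 0 <= cgrow lam * Bh * La by rewrite !mulr_ge0// (le_trans (ltW la0)).
have c2 : 0 <= d%:R * (cgrow lam * expR 1) * Bh by rewrite !mulr_ge0 ?expR_ge0.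
have c3 : 0 <= lam * expR (Num.sqrt lam) / 2 * Bh ^+ 2.
  by rewrite mulr_ge0 ?sqr_ge0// divr_ge0// mulr_ge0 ?expR_ge0// ltW.
have {}db : - (d%:R * (cgrow lam * expR 1) * Bh * ell v y) <= dotp (supg lam C0 Cb h v y) k.
  by move: db; rewrite ler_norml => /andP[+ _]; congr (_ <= _); ring.
split; split => //; [apply: (le_trans u2)|apply: (le_trans gm)]; rewrite /variation_cst.
  have m1 := mulr_ge0 (sqr_ge0 e) (mulr_ge0 c1 (addr_ge0 (ltW l0) ler01)).
  have m2 := mulr_ge0 (sqr_ge0 e) (mulr_ge0 c2 (addr_ge0 (ltW l0) ler01)).
  have m3 := mulr_ge0 (sqr_ge0 e) c3.
  move: m1 m2 m3; move: (cgrow lam * Bh * La) (d%:R * (cgrow lam * expR 1) * Bh) => K1 K2.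
  move: (lam * expR _ / 2 * _) (ell v y) (dotp _ _) => K3 l D; nra.
have e1' : 0 <= 1 - e by rewrite subr_ge0.
have := ler_wpM2l (ltW e0) a2; have := ler_wpM2l e1' u2; move: l0 db c1 c2 c3 a2.
move: (cgrow lam * Bh * La) (d%:R * (cgrow lam * expR 1) * Bh) => K1 K2.
move: (lam * expR _ / 2 * _) (ell v y) (dotp _ _) (ell a y) => K3 l D A.
move: (ell v _) (ell a _) => V' A' l0 db c1 c2 c3 _ q1 q2.
apply: (le_trans (lerD q2 q1)).
have s2 : 0 <= e ^+ 2 := sqr_ge0 e.
have m1 := mulr_ge0 s2 (mulr_ge0 c1 (ltW l0)).
have m2 := mulr_ge0 s2 c2; have m3 := mulr_ge0 s2 c3.
have m4 := mulr_ge0 (mulr_ge0 s2 (ltW e0)) (mulr_ge0 c3 (ltW l0)).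
have m5 : 0 <= e ^+ 2 * (D + K2 * l) by rewrite mulr_ge0//; lra.
move: m1 m2 m3 m4 m5; clear; nra.
Qed.
End VariationPointwise.

Lemma small_step (R : realType) (s B e : R) : 0 <= s -> 0 <= B -> 0 < e -> e <= ((1 + s) * (1 + B))^-1 ->
  [/\ e <= 1, e * B <= 1 & s * (e * B) <= 1].
Proof.
move=> s0 B0 e0 h.
have : e * ((1 + s) * (1 + B)) <= 1.
  by rewrite -ler_pdivlMr ?mul1r// mulr_gt0// ltr_pwDl.
have m1 := mulr_ge0 (ltW e0) s0; have m2 := mulr_ge0 (ltW e0) B0.
have m3 := mulr_ge0 m1 B0.
have -> : e * ((1 + s) * (1 + B)) = e + e * s + e * B + e * s * B by ring.
have -> : s * (e * B) = e * s * B by ring.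
by move: m1 m2 m3 => /=; move: (e * s) (e * B) => p q m1 m2; move: (p * B) => t m3 h1; split; lra.
Qed.

(** * Progressive and predictable processes *)

Section Filtered.
Context (R : realType) (disp : measure_display) (Omega : measurableType disp).
Context (P : probability Omega R) (T : R) (F : R -> set (set Omega)).
Hypothesis T0 : 0 < T.
Hypothesis sF : forall t, 0 <= t <= T -> is_sub_sigma (F t).
Hypothesis monoF : forall s t, 0 <= s -> s <= t -> t <= T -> F s `<=` F t.
Hypothesis nullF : forall t N, 0 <= t <= T -> measurable N -> P N = 0%E -> F t N.
Notation leb := (@lebesgue_measure R).
Notation FT t := (g_sigma_algebraType (F t)).
Notation clT := (clamp 0 T).


Lemma clamp_itvT s : 0 <= clT s <= T.
Proof. exact: clamp_itv (ltW T0). Qed.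

Lemma clamp_clamp t s : 0 <= t <= T -> clT (clamp 0 t s) = clamp 0 t s.
Proof.
move=> /andP[t0 tT]; apply: clamp_id; have /andP[h1 h2] := clamp_itv s t0.
by rewrite h1 (le_trans h2).
Qed.

Lemma measurable_FT t : 0 <= t <= T ->
  measurable_fun (T := Omega) (U := FT t) setT (fun w => w).
Proof.
move=> tT _ B mB; rewrite setTI; have [sFt Fm] := sF tT.
by apply: Fm; move: mB; rewrite -[X in X -> _]/(<<s F t >> _) sigma_algebra_id.
Qed.

(** Progressive measurability: clamping time to [0, t] encodes the restriction of the process to
    [0, t], measurable with respect to F t. *)
Definition prog (b : R -> Omega -> R) := forall t, 0 <= t <= T ->
  measurable_fun setT (fun z : R * FT t => b (clamp 0 t z.1) z.2).

Definition vprog n (b : R -> Omega -> 'rV[R]_n) := forall i, prog (fun s w => b s w 0 i).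

Lemma prog_eq b b' : (forall s w, 0 <= s <= T -> b s w = b' s w) -> prog b -> prog b'.
Proof.
move=> bb pb t tT; rewrite (_ : (fun z => _) = (fun z => b (clamp 0 t z.1) z.2)); first exact: pb.
apply/funext => z; rewrite bb// -(clamp_clamp _ tT); exact: clamp_itvT.
Qed.

Lemma prog_continuous (X : R -> Omega -> R) : (forall w, continuous (fun t => X (clT t) w)) ->
  (forall t, 0 <= t <= T -> fmeas (F t) (X t)) -> prog X.
Proof.
move=> cX mX t tT; have /andP[t0 _] := tT.
pose X' (s : R) (w : FT t) := X (clamp 0 t s) w.
apply: (mprocess (X := X')).
  move=> w s; rewrite /X'.
  have -> : (fun s => X (clamp 0 t s) w) = (fun t => X (clT t) w) \o clamp 0 t.
    by apply/funext => r /=; rewrite clamp_clamp.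
  by apply: continuous_comp; [exact: clamp_continuous|exact: cX].
move=> s; have /andP[c0 ct] := clamp_itv s t0.
have cT : 0 <= clamp 0 t s <= T by rewrite c0 (le_trans ct)//; case/andP: tT.
by apply: (fmeasS _ (mX _ cT)); apply: monoF => //; case/andP: tT.
Qed.

Lemma prog_fmeas b t : prog b -> 0 <= t <= T -> fmeas (F t) (b t).
Proof.
move=> pb tT; have /andP[t0 _] := tT.
have mp : measurable_fun setT (fun w : FT t => (t, w) : R * FT t).
  exact: measurable_fun_pair (measurable_cst t) (@measurable_id _ _ _).
have := measurableT_comp (pb t tT) mp.
rewrite /comp /=; congr (measurable_fun _ _).
by apply/funext => w /=; rewrite clamp_id// t0 lexx.
Qed.

Lemma prog_joint b : prog b -> measurable_fun setT (fun z : R * Omega => b (clT z.1) z.2).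
Proof.
move=> pb; have TT : 0 <= T <= T by rewrite ltW//=.
have mid : measurable_fun setT (fun z : R * Omega => (z.1, z.2 : FT T)).
  by apply: measurable_fun_pair => //; exact: measurableT_comp (measurable_FT TT) measurable_snd.
exact: (measurableT_comp (pb T TT) mid).
Qed.

Lemma prog_path b w : prog b -> measurable_fun setT (fun s => b (clT s) w).
Proof.
move=> pb.
have mp : measurable_fun setT (fun s : R => (s, w) : R * Omega).
  exact: measurable_fun_pair (@measurable_id _ _ _) (measurable_cst w).
exact: (measurableT_comp (prog_joint pb) mp).
Qed.

Lemma prog_path_itv b w : prog b -> measurable_fun (`[0, T] : set R) (fun s => b s w).
Proof.
move=> pb; apply: (eq_measurable_fun (fun s => b (clT s) w)).
  by move=> s; rewrite inE /= in_itv/= => sT; rewrite clamp_id.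
exact: measurable_funTS (prog_path w pb).
Qed.

Lemma progM b b' : prog b -> prog b' -> prog (fun s w => b s w * b' s w).
Proof. by move=> pb pb' t tT; apply: measurable_funM; [exact: pb|exact: pb']. Qed.
Lemma progD b b' : prog b -> prog b' -> prog (fun s w => b s w + b' s w).
Proof. by move=> pb pb' t tT; apply: measurable_funD; [exact: pb|exact: pb']. Qed.
Lemma prog_comp (f : R -> R) b : measurable_fun setT f -> prog b -> prog (fun s w => f (b s w)).
Proof. by move=> mf pb t tT; apply: measurableT_comp; [exact: mf|exact: pb]. Qed.

Lemma prog_indic0 (A : set Omega) : F 0 A -> prog (fun _ w => \1_A w).
Proof.
move=> FA t tT; have /andP[t0 tT'] := tT.
have mA : measurable (A : set (FT t)).
  by apply: sub_sigma_algebra; exact: (monoF (lexx _) t0 tT').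
by apply: measurableT_comp; [exact: measurable_indic|exact: measurable_snd].
Qed.

(** A process switched on at time t may depend on anything known at t; only horizons r >= t have to
    be examined. *)
Lemma prog_after t (b : R -> Omega -> R) : 0 <= t <= T ->
  (forall r, t <= r <= T -> measurable_fun setT (fun z : R * FT r => b (clamp 0 r z.1) z.2)) ->
  prog (fun s w => \1_(`[t, +oo[%classic) s * b s w).
Proof.
move=> tT H r rT; have [rt|tr] := ltP r t.
  rewrite (_ : (fun z => _) = fun=> 0); first exact: measurable_cst.
  apply/funext => z; rewrite indicE memNset ?mul0r//= in_itv/= andbT.
  apply/negP; rewrite -ltNge; have /andP[r0 _] := rT; have /andP[_ h] := clamp_itv z.1 r0.
  exact: le_lt_trans h rt.
apply: measurable_funM; last by apply: H; rewrite tr; case/andP: rT.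
apply: measurableT_comp.
  by apply: measurable_indic; exact: measurable_itv.
apply: measurableT_comp; last exact: measurable_fst.
exact: continuous_measurable_fun (@clamp_continuous _ _ _).
Qed.



Lemma predictable_section Y t : predictable_sigma T F Y -> 0 <= t <= T ->
  F t [set w | Y (t, w)].
Proof.
move=> pY; move: t; pose C := [set Y : set (R * Omega) | forall t, 0 <= t <= T -> F t [set w | Y (t, w)]].
suff : predictable_sigma T F `<=` C by exact.
apply: smallest_sub; [split|].
- by move=> t tT; have [sFt _] := sF tT; exact: sig0 sFt.
- move=> A CA t tT; have [sFt _] := sF tT; have -> : [set w | (`[0, T] `*` setT `\` A) (t, w)] = ~` [set w | A (t, w)].
    by apply/seteqP; split => w /=; [case|move=> nA; split => //; rewrite in_itv].
  exact/(sigC sFt)/CA.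
- move=> A CA t tT; have [sFt _] := sF tT; rewrite [X in F t X](_ : _ = \bigcup_k [set w | A k (t, w)])//.
  by apply: sig_bigcup => // k; exact: CA.
- move=> _ [[A F0A ->]|[s [r [A [s0 sr rT FA ->]]]]] t tT; have [sFt _] := sF tT; have /andP[t0 tT'] := tT.
    have [->|tn0] := eqVneq t 0.
      by rewrite [X in F _ X](_ : _ = A)//; apply/seteqP; split => w /=; [case|].
    rewrite [X in F _ X](_ : _ = set0); first exact: sig0 sFt.
    by apply/seteqP; split => w //= [] /eqP; rewrite (negbTE tn0).
  have [/andP[st tr]|h] := boolP (s < t <= r).
    rewrite [X in F _ X](_ : _ = A); first exact: (monoF s0 (ltW st) tT').
    by apply/seteqP; split => w /=; [case|move=> Aw; rewrite in_itv/= st tr].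
  rewrite [X in F _ X](_ : _ = set0); first exact: sig0 sFt.
  by apply/seteqP; split => w //= []; rewrite in_itv/= (negbTE h).
Qed.

(** The process is approximated by its values at the left ends of a grid, which are constant on
    predictable rectangles. By continuity the set where Y > 0 is a countable union of lower limits
    of such approximations. *)
Lemma predictable_pos (Y : R -> Omega -> R) : (forall w, continuous (fun t => Y (clT t) w)) ->
  (forall t, 0 <= t <= T -> fmeas (F t) (Y t)) ->
  predictable_sigma T F [set z | 0 <= z.1 <= T /\ 0 < Y z.1 z.2].
Proof.
move=> cY mY; pose pS := predictable_sigma T F.
have sp : sigma_algebra (`[0, T]%classic `*` [set: Omega]) (pS) by exact: smallest_sigma_algebra.
have gT n k : (k <= n.+1)%N -> 0 <= T * k%:R / n.+1%:R <= T.
  move=> kn; apply/andP; split; first by rewrite divr_ge0 ?mulr_ge0 ?ler0n ?ltW.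
  by rewrite ler_pdivrMr ?ltr0n// ler_pM2l// ler_nat.
(* The initial time has its own rectangle because the grid intervals are open on the left. *)
pose E (m n : nat) := ([set 0] `*` [set w | m.+1%:R^-1 <= Y 0 w]) `|`
  \bigcup_(k in `I_n.+1) (`]T * k%:R / n.+1%:R, T * k.+1%:R / n.+1%:R]%classic `*`
      [set w | m.+1%:R^-1 <= Y (T * k%:R / n.+1%:R) w]).
have pE m n : pS (E m n).
  have ms t : 0 <= t <= T -> F t [set w | m.+1%:R^-1 <= Y t w].
    move=> tT; have := fmeas_set (sF tT) (mY t tT) (measurable_itv `[m.+1%:R^-1, +oo[).
    by congr (F t _); apply/seteqP; split => w /=; rewrite in_itv/= andbT.
  have T0' : 0 <= (0 : R) <= T by rewrite lexx ltW.
  have [s0 _ sU] := sp.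
  have U2 A B : pS A -> pS B -> pS (A `|` B).
    move=> pA pB; rewrite (_ : A `|` B = \bigcup_k (if k is 0%N then A else B)).
      by apply: sU => -[|k].
    apply/seteqP; split => z; first by case=> h; [exists 0%N|exists 1%N].
    by case=> -[|k] _ h; [left|right].
  apply: U2; first by apply: sub_sigma_algebra; left; exists [set w | m.+1%:R^-1 <= Y 0 w] => //; exact: ms.
  rewrite bigcup_mkcond; apply: sU => k; case: ifPn => // kn; rewrite inE/= in kn.
  apply: sub_sigma_algebra; right; exists (T * k%:R / n.+1%:R), (T * k.+1%:R / n.+1%:R).
  exists [set w | m.+1%:R^-1 <= Y (T * k%:R / n.+1%:R) w].
  have /andP[h1 h2] := gT n k (ltnW kn); have /andP[h3 h4] := gT n k.+1 kn.
  split => //; last by apply: ms; rewrite h1.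
  by rewrite ltr_pM2r ?invr_gt0 ?ltr0n// ltr_pM2l// ltr_nat.
have [s0 sC sU] := sp.
have sI (A : nat -> set (R * Omega)) : (forall n, pS (A n)) ->
    pS ((`[0, T]%classic `*` setT) `&` \bigcap_n A n).
  move=> pA; rewrite -[X in pS X]setDD.
  apply: (sC); rewrite setDE setC_bigcap setI_bigcupr; apply: sU => n.
  by rewrite -setDE; exact: sC.
rewrite (_ : [set z | _] = \bigcup_m \bigcup_N ((`[0, T]%classic `*` setT) `&` \bigcap_n E m (n + N)%N)).
  by apply: (sU) => m; apply: (sU) => N; apply: sI => n; exact: pE.
have idx n t : 0 < t -> t <= T -> exists2 k, (k < n.+1)%N & T * k%:R / n.+1%:R < t <= T * k.+1%:R / n.+1%:R.
  move=> t0 tT; have ex : exists k, t <= T * k%:R / n.+1%:R.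
    by exists n.+1; rewrite -mulrA divff ?pnatr_eq0// mulr1.
  pose k := ex_minn ex; have [] : t <= T * k%:R / n.+1%:R /\ forall j, t <= T * j%:R / n.+1%:R -> (k <= j)%N.
    by rewrite /k; case: ex_minnP.
  case: k => [|k] tk mk; first by move: tk; rewrite mulr0 mul0r leNgt t0.
  exists k.
    by apply: mk; rewrite -mulrA divff ?pnatr_eq0// mulr1.
  rewrite tk andbT ltNge; apply/negP => /mk; by rewrite ltnn.
have near_grid w t e : 0 <= t <= T -> 0 < e -> exists N, forall n, (N <= n)%N -> forall s, 0 <= s <= T ->
    s <= t -> t <= s + T / n.+1%:R -> `|Y s w - Y t w| < e.
  move=> tT e0; have := cY w t => /cvgrPdist_lt/(_ e e0)[del /= d0 hd].
  have [N hN] : exists N, forall n, (N <= n)%N -> T / n.+1%:R < del.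
    have c0 : T / n.+1%:R @[n --> \oo] --> (0 : R).
      by rewrite -[X in _ --> X](mulr0 T); apply: cvgMr; exact: cvg_harmonic.
    have /cvgrPdist_lt/(_ _ d0)[N _ hN] := c0; exists N => n /hN.
    by rewrite /= sub0r normrN ger0_norm// divr_ge0// ltW.
  exists N => n Nn s sT st ts; have := hd s; rewrite /= !clamp_id// => h; rewrite distrC; apply: h.
  rewrite ger0_norm ?subr_ge0//; apply: le_lt_trans (hN _ Nn); by rewrite lerBlDl.
apply/seteqP; split => -[t w] /=.
  (* The factor 2 leaves room for the oscillation of Y between t and the left end of its grid
     interval. *)
  move=> [tT Yt]; have [m hm] : exists m : nat, 2 * m.+1%:R^-1 < Y t w.
    have y0 : 0 < 2^-1 * Y t w by rewrite mulr_gt0.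
    have /cvgrPdist_lt/(_ _ y0)[m _ hm] := @cvg_harmonic R; exists m.
    have := hm m (leqnn m); rewrite /= sub0r normrN ger0_norm ?invr_ge0// => h.
    by rewrite -ltr_pdivlMl.
  have im0 : 0 < m.+1%:R^-1 :> R by rewrite invr_gt0.
  have [N hN] := near_grid w t _ tT im0.
  exists m => //; exists N => //; split; first by rewrite /= in_itv.
  move=> n _; have /andP[t0 tT'] := tT; move: t0; rewrite le_eqVlt => /predU1P[t0|t0].
    left; split => //=; rewrite t0; apply: le_trans (ltW hm).
    by rewrite -[leLHS]mul1r ler_pM2r// ler1n.
  have [k kn /andP[h1 h2]] := idx (n + N)%N t t0 tT'.
  right; exists k => //; split => /=; first by rewrite in_itv/= h1.
  have := hN (n + N)%N (leq_addl _ _) _ (gT _ _ (ltnW kn)) (ltW h1).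
  have -> : T * k%:R / (n + N).+1%:R + T / (n + N).+1%:R = T * k.+1%:R / (n + N).+1%:R.
    by rewrite -[k.+1%:R]natr1 mulrDr mulr1 mulrDl.
  move=> /(_ h2); rewrite ltr_distl => /andP[h _]; apply: ltW; apply: le_lt_trans h.
  by rewrite lerBrDr; apply: ltW; move: hm; rewrite mulr_natl mulr2n.
move=> [m _ [N _ [tT hE]]]; move: tT => [/=]; rewrite in_itv/= => tT _; split => //.
have im0 : 0 < m.+1%:R^-1 :> R by rewrite invr_gt0.
have /andP[t0 tT'] := tT; move: t0; rewrite le_eqVlt => /predU1P[t0|t0].
  have [[_ /=]|[k _ [/=]]] := hE 0%N I; first by rewrite -t0; exact: lt_le_trans.
  rewrite in_itv/= -t0 => /andP[h _]; exfalso; move: h; apply/negP; rewrite -leNgt.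
  by rewrite divr_ge0 ?mulr_ge0 ?ler0n ?ltW.
have [M hM] := near_grid w t _ tT im0.
have [[/= t00]|[k kn [/=]]] := hE M I; first by rewrite t00 ltxx in t0.
rewrite in_itv/= => /andP[h1 h2] Yk.
have := hM (M + N)%N (leq_addr _ _) _ (gT _ _ (ltnW kn)) (ltW h1).
have -> : T * k%:R / (M + N).+1%:R + T / (M + N).+1%:R = T * k.+1%:R / (M + N).+1%:R.
  by rewrite -[k.+1%:R]natr1 mulrDr mulr1 mulrDl.
move=> /(_ h2); rewrite ltr_distl => /andP[_ h]; rewrite -(ltrD2r m.+1%:R^-1) add0r.
exact: le_lt_trans h.
Qed.

Lemma continuous_processP n (X : R -> Omega -> 'rV[R]_n) :
  @continuous_process R _ Omega T (euclid R n) X <->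
  (forall w, continuous (fun t => X (clT t) w)).
Proof.
split=> [cX w t|cX w t tT e e0].
  apply/cvgrPdist_lt => e e0; have [del d0 h] := cX w (clT t) (clamp_itvT t) e e0.
  near=> s; apply: le_lt_trans (norm_enorm _) _; rewrite -enormN opprB.
  have := h (clT s) (clamp_itvT s); rewrite /= lte_fin; apply.
  rewrite distrC; apply: le_lt_trans (clamp_lip _ _ _ _) _; near: s; exact: cvgr_dist_lt.
have e1 : 0 < e / n.+1%:R by rewrite divr_gt0.
have := cX w t => /cvgrPdist_lt/(_ _ e1)[del /= d0 h]; exists del => // s sT st.
have := h s; rewrite /ball/= clamp_id// clamp_id// distrC => /(_ st).
rewrite lte_fin distrC => h1; apply: le_lt_trans (enorm_norm _) _.
apply: (@le_lt_trans _ _ (n.+1%:R * `|X s w - X t w|)); first by rewrite ler_wpM2r// ler_nat.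
by rewrite -ltr_pdivlMl// mulrC.
Unshelve. all: by end_near. Qed.

(** Distance to the complement: an open set is where it is positive, which reduces predictability of
    a vector process to a real one. As the infimum of the empty set is 0, the whole space is treated
    apart. *)
Definition dist_out n (U : set 'rV[R]_n) (u : 'rV[R]_n) : R := inf [set enorm (u - v) | v in ~` U].

Lemma dist_out_continuous n (U : set 'rV[R]_n) : continuous (dist_out U).
Proof.
have [[v0 Uv0]|noU] := pselect (exists v, (~` U) v); last first.
  have -> : dist_out U = fun=> 0; last exact: cst_continuous.
  apply/funext => u; rewrite /dist_out (_ : [set _ | _ in _] = set0) ?inf0//.
  by rewrite -subset0 => z [v Uv _]; apply: noU; exists v.
have hi u : has_inf [set enorm (u - v) | v in ~` U].
  split; first by exists (enorm (u - v0)), v0.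
  by exists 0 => _ [v _ <-]; exact: enorm_ge0.
have lip u u' : dist_out U u <= dist_out U u' + enorm (u - u').
  rewrite -lerBlDr; apply: lb_le_inf; first by case: (hi u').
  move=> _ [v Uv <-]; rewrite lerBlDr.
  apply: (@le_trans _ _ (enorm (u - v))); first by apply: ge_inf; [case: (hi u)|exists v].
  have -> : u - v = (u' - v) + (u - u') by rewrite [RHS]addrC subrKA.
  exact: enormD.
apply/continuous_rVP => u e e0.
have e1 : 0 < e / n.+1%:R by rewrite divr_gt0.
near=> u'; have : enorm (u - u') <= e.
  apply: le_trans (enorm_norm _) _; apply: (@le_trans _ _ (n.+1%:R * `|u - u'|)).
    by rewrite ler_wpM2r// ler_nat.
  rewrite -ler_pdivlMl// mulrC; near: u'; exact: cvgr_dist_le.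
move=> h; rewrite ler_norml; have := lip u u'; have := lip u' u.
rewrite -(enormN (u' - u)) opprB; move: (dist_out U u) (dist_out U u') h => a b h h1 h2.
by apply/andP; split; lra.
Unshelve. all: by end_near. Qed.

Lemma dist_out_gt0 n (U : set 'rV[R]_n) u : @mopen R (euclid R n) U -> (exists v, ~ U v) ->
  U u <-> 0 < dist_out U u.
Proof.
move=> [_ oU] [v0 Uv0]; split => [Uu|].
  have [e e0 he] := oU u Uu; apply: (lt_le_trans e0); apply: lb_le_inf.
    by exists (enorm (u - v0)), v0.
  move=> _ [v Uv <-]; rewrite leNgt; apply/negP => h; apply: Uv; apply: he => //.
apply: contraPP => Uu; apply/negP; rewrite -leNgt; apply: ge_inf.
  by exists 0 => _ [v _ <-]; exact: enorm_ge0.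
by exists u => //; rewrite subrr enorm0.
Qed.

Lemma predictable_continuous n (X : R -> Omega -> 'rV[R]_n) :
  (forall w, continuous (fun t => X (clT t) w)) ->
  (forall i t, 0 <= t <= T -> fmeas (F t) (fun w => X t w 0 i)) ->
  @predictable R disp Omega T F (euclid R n) X.
Proof.
move=> cX mX U oU; have [[v0 Uv0]|noU] := pselect (exists v, ~ U v); last first.
  rewrite (_ : [set z | _] = `[0, T]%classic `*` [set: Omega]).
    have [s0 sC _] : sigma_algebra (`[0, T]%classic `*` [set: Omega]) (predictable_sigma T F) by exact: smallest_sigma_algebra.
    by rewrite -[X in predictable_sigma T F X]setD0; exact: sC.
  apply/seteqP; split => z /=; rewrite in_itv/=; first by case.
  by move=> [zT _]; split => //; apply: contrapT => h; apply: noU; eexists; exact: h.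
rewrite (_ : [set z | _] = [set z | 0 <= z.1 <= T /\ 0 < dist_out U (X z.1 z.2)]); last first.
  by apply/seteqP; split => z /= [zT h]; split => //; apply/(dist_out_gt0 _ oU) => //; exists v0.
apply: (predictable_pos (Y := fun t w => dist_out U (X t w))).
  by move=> w t; apply: (@continuous_comp _ _ _ (fun t => X (clT t) w) (dist_out U)); [exact: cX|exact: dist_out_continuous].
move=> t tT; apply: (mcaratheodory (Om := FT t) (F := fun _ => dist_out U) (Y := X t)).
- by move=> y; exact: measurable_cst.
- by move=> w; exact: dist_out_continuous.
- by move=> i; exact: mX.
Qed.

Lemma predictable_adapted n (X : R -> Omega -> 'rV[R]_n) i t :
  @predictable R disp Omega T F (euclid R n) X -> 0 <= t <= T -> fmeas (F t) (fun w => X t w 0 i).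
Proof.
move=> pX tT; rewrite /fmeas; apply: (measurability _ (RGenOInfty.measurableE R)) => _ [_ [a ->] <-]; rewrite setTI.
have oU : @mopen R (euclid R n) [set u | a < u 0 i].
  split=> // u /= au; exists (u 0 i - a); first by rewrite subr_gt0.
  move=> v _; rewrite lte_fin => h; have := le_lt_trans (enorm_coord (u - v) i) h.
  rewrite !mxE ltr_norml => /andP[_ h']; lra.
have := predictable_section (pX _ oU) tT.
move=> h; apply: sub_sigma_algebra; move: h; congr (F t _).
by apply/seteqP; split => w /=; rewrite in_itv/= andbT; [case|split].
Qed.

(** Y only has to stay within C of the path of X, possibly at another time: its supremum exceeds
    that of X by at most C. *)
Lemma Sspace_shift n (r C : R) (X Y : R -> Omega -> 'rV[R]_n) (N : set Omega) : 1 <= r -> 0 <= C ->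
  @Sspace R disp Omega P T F r (euclid R n) X ->
  (forall w, continuous (fun t => Y (clT t) w)) ->
  (forall i t, 0 <= t <= T -> fmeas (F t) (fun w => Y t w 0 i)) ->
  measurable N -> P N = 0%E ->
  (forall w t, ~ N w -> 0 <= t <= T -> exists2 s, 0 <= s <= T & enorm (Y t w - X s w) <= C) ->
  @Sspace R disp Omega P T F r (euclid R n) Y.
Proof.
move=> r1 C0 [_ _ _ [x0 _ fX]] cY mY mN N0 YX; split => //.
- exact/continuous_processP.
- exact: predictable_continuous.
exists x0; first by [].
pose sup_dist (Z : R -> Omega -> 'rV[R]_n) w : \bar R :=
  ereal_sup [set (enorm (Z t w - x0))%:E | t in `[0%R, T]%classic].
change (\int[P]_w (sup_dist Y w `^ r) < +oo)%E.
have sd0 Z w : (0 <= sup_dist Z w)%E.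
  apply: (@le_trans _ _ (enorm (Z 0 w - x0))%:E); first by rewrite lee_fin enorm_ge0.
  by apply: ereal_sup_ubound; exists 0 => //=; rewrite in_itv/= lexx ltW.
apply: (sup_moment (S := sup_dist X) r1 C0 (sd0 X) (sd0 Y) mN N0 _ fX).
move=> w Nw; apply: ub_ereal_sup => z [t /=]; rewrite in_itv/= => tT <-.
have [s sT h] := YX w t Nw tT.
apply: (@le_trans _ _ ((enorm (X s w - x0))%:E + C%:E)%E).
  rewrite -EFinD lee_fin -(subrKA (X s w)) addrC; apply: le_trans (enormD _ _) _.
  by rewrite lerD2l.
by rewrite leeD2r//; apply: ereal_sup_ubound; exists s => //=; rewrite in_itv.
Qed.

Lemma Sspace_bounded n (r C : R) (Y : R -> Omega -> 'rV[R]_n) : 1 <= r -> 0 <= C ->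
  (forall w, continuous (fun t => Y (clT t) w)) ->
  (forall i t, 0 <= t <= T -> fmeas (F t) (fun w => Y t w 0 i)) ->
  (forall w t, 0 <= t <= T -> enorm (Y t w) <= C) ->
  @Sspace R disp Omega P T F r (euclid R n) Y.
Proof.
move=> r1 C0 cY mY YC; apply: (@Sspace_shift n r C (fun _ _ => 0) _ set0) => //; last first.
  by move=> w t _ tT; exists t => //; rewrite subr0; exact: YC.
have c0 : continuous (fun t : R => 0 : 'rV[R]_n) by exact: cst_continuous.
split => //.
- by apply/(@continuous_processP n (fun _ _ => 0)) => w; exact: c0.
- apply: (@predictable_continuous n (fun _ _ => 0)); first by move=> w; exact: c0.
  by move=> i t tT; exact: (measurable_cst ((0 : 'rV[R]_n) 0 i)).
exists 0 => //; rewrite (eq_integral (fun=> 0%E)) ?integral0 ?ltry// => w _.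
rewrite (_ : [set _ | _ in _] = [set 0%E]) ?ereal_sup1 ?poweR0r//.
  by rewrite gt_eqF// (lt_le_trans _ r1).
apply/seteqP; split => [_ [t _ <-]|_ ->] /=; first by rewrite subrr enorm0.
by exists 0; rewrite /= ?in_itv/= ?lexx ?ltW// subrr enorm0.
Qed.



Lemma prog_primitive b : prog b ->
  (forall w, leb.-integrable `[0, T] (fun s => (b s w)%:E)) ->
  (forall w, continuous (fun t => \int[leb]_(s in `[0, clT t]) b s w)) /\
  prog (fun t w => \int[leb]_(s in `[0, t]) b s w).
Proof.
move=> pb ib.
have cb w : continuous (fun t => \int[leb]_(s in `[0, clT t]) b s w).
  exact: primitive_continuous (ltW T0) (ib w).
split => //; apply: prog_continuous => // t tT.
have m := @mpath_integral R _ (FT t) `[0, t] _ (measurable_itv _) (pb t tT).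
rewrite /fmeas; move: m; congr (measurable_fun _ _); apply/funext => w /=.
by apply: eq_Rint => s /=; rewrite in_itv/= => st; rewrite clamp_id.
Qed.

(** Left quotients use only the past, and an upper limit always exists; [fine] gives 0 where it is
    infinite, which happens at negligible times for the curves considered. *)
Definition left_velocity (X : R -> Omega -> R) (s : R) (w : Omega) : R :=
  fine (limn_esup (fun k => (k.+1%:R * (X s w - X (clT (s - k.+1%:R^-1)) w))%:E)).

Lemma prog_left_velocity X : prog X -> prog (left_velocity X).
Proof.
move=> pX t tT; apply: measurableT_comp; first exact: measurable_realfun.fine_measurable.
apply: measurable_fun_limn_esup => k; apply/measurable_EFinP.
apply: measurable_funM; first exact: measurable_cst.
apply: measurable_funB; first exact: pX.
have /andP[t0 tT'] := tT.
(* Going back in time from a point of [0, t] stays below t, so clamping to [0, T] or to [0, t] is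
   the same. *)
have E s : clT (clamp 0 t s - k.+1%:R^-1) = clamp 0 t (clamp 0 t s - k.+1%:R^-1).
  have : clamp 0 t s - k.+1%:R^-1 <= t.
    by have /andP[_ h] := clamp_itv s t0; rewrite lerBlDr (le_trans h)// lerDl invr_ge0.
  by move=> h; rewrite /clamp [in LHS]min_l ?(le_trans h)// [in RHS]min_l.
have mp : measurable_fun setT (fun z : R * FT t => (clamp 0 t z.1 - k.+1%:R^-1, z.2) : R * FT t).
  apply: measurable_fun_pair; last exact: measurable_snd.
  apply: measurable_funB; last exact: measurable_cst.
  apply: measurableT_comp; last exact: measurable_fst.
  exact: continuous_measurable_fun (@clamp_continuous _ _ _).
have := measurableT_comp (pX t tT) mp.
by congr (measurable_fun _ _); apply/funext => z /=; rewrite E.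
Qed.

Lemma left_velocityE X s w l : 0 < s <= T ->
  k.+1%:R * (X s w - X (s - k.+1%:R^-1) w) @[k --> \oo] --> l -> left_velocity X s w = l.
Proof.
move=> /andP[s0 sT] cl.
have cl' : (fun k => (k.+1%:R * (X s w - X (clT (s - k.+1%:R^-1)) w))%:E) @ \oo --> l%:E.
  apply: cvg_EFin; first exact: nearW.
  apply: cvg_trans cl; apply: near_eq_cvg; near=> k => /=.
  rewrite clamp_id//; apply/andP; split; last by rewrite lerBlDr (le_trans sT)// lerDl invr_ge0.
  rewrite subr_ge0; near: k.
  have := @cvg_harmonic R; move/cvgrPdist_lt/(_ _ s0); apply: filterS => k.
  by rewrite sub0r normrN ger0_norm ?invr_ge0// => /ltW.
rewrite /left_velocity is_cvg_limn_esupE; last by apply/cvg_ex; exists l%:E.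
by rewrite (cvg_lim _ cl').
Unshelve. all: by end_near. Qed.

(** * Random fields along progressive processes; regularity of H and G *)

Section Fields.
Context (d : nat) (lam C0 : R) (Cb : R -> R) (lam0 : 0 < lam) (C00 : 0 < C0).
Context (H : R -> Omega -> 'rV[R]_d -> 'rV[R]_d -> R).
Hypothesis Hh : forall t w, 0 <= t <= T -> ham lam C0 Cb (H t w).
Hypothesis pH : forall p x, prog (fun t w => H t w p x).
Implicit Types X Y : R -> Omega -> 'rV[R]_d.

Let hz t (z : R * FT t) := H (clamp 0 t z.1) z.2.
Let Hz t : 0 <= t <= T -> forall z, ham lam C0 Cb (@hz t z).
Proof.
move=> tT z; apply: Hh; have /andP[t0 tT'] := tT; have /andP[h1 h2] := clamp_itv z.1 t0.
by rewrite h1 (le_trans h2).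
Qed.
Let mz t : 0 <= t <= T -> forall p x, measurable_fun setT (fun z => @hz t z p x).
Proof. by move=> tT p x; exact: pH. Qed.
Let mc t (Y : R -> Omega -> 'rV[R]_d) : 0 <= t <= T -> vprog Y ->
  mcoord (fun z : R * FT t => Y (clamp 0 t z.1) z.2).
Proof. by move=> tT pY i; exact: pY. Qed.

Lemma vprog_Dp Y X : vprog Y -> vprog X -> vprog (fun s w => Dp (H s w) (Y s w) (X s w)).
Proof. by move=> pY pX i t tT; exact: (mDp (Hz tT) (mz tT) (mc tT pY) (mc tT pX) i). Qed.
Lemma vprog_Dx Y X : vprog Y -> vprog X -> vprog (fun s w => Dx (H s w) (Y s w) (X s w)).
Proof. by move=> pY pX i t tT; exact: (mDx (Hz tT) (mz tT) (mc tT pY) (mc tT pX) i). Qed.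
Lemma prog_dotp Y X : vprog Y -> vprog X -> prog (fun s w => dotp (Y s w) (X s w)).
Proof. by move=> pY pX t tT; exact: (mdotp (mc tT pY) (mc tT pX)). Qed.
Lemma vprogD Y X : vprog Y -> vprog X -> vprog (fun s w => Y s w + X s w).
Proof. by move=> pY pX i t tT; exact: (mcoordD (mc tT pY) (mc tT pX) i). Qed.

Lemma vprog_scale (c : R -> Omega -> R) X : prog c -> vprog X -> vprog (fun s w => c s w *: X s w).
Proof.
move=> pc pX i; apply: (@prog_eq (fun s w => c s w * X s w 0 i)); last exact: progM.
by move=> s w _; rewrite mxE.
Qed.

Lemma vprogN X : vprog X -> vprog (fun s w => - X s w).
Proof.
move=> pX i; apply: (@prog_eq (fun s w => (-1) * X s w 0 i)).
  by move=> s w _; rewrite mxE mulN1r.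
by apply: prog_comp; [exact: (measurable_funM (measurable_cst (-1 : R)) (@measurable_id _ _ _))|exact: pX].
Qed.

Lemma prog_ell Y X : vprog Y -> vprog X -> prog (fun s w => ell lam C0 Cb (H s w) (Y s w) (X s w)).
Proof. by move=> pY pX t tT; exact: (mell (Hz tT) (mz tT) (mc tT pY) (mc tT pX)). Qed.
Lemma vprog_supg Y X : vprog Y -> vprog X -> vprog (fun s w => supg lam C0 Cb (H s w) (Y s w) (X s w)).
Proof. by move=> pY pX i t tT; exact: (msupg lam0 C00 (Hz tT) (mz tT) (mc tT pY) (mc tT pX) i). Qed.

Lemma joint_Lag Y X : vprog Y -> vprog X -> measurable_fun setT
  (fun z : R * Omega => Lag (H (clT z.1) z.2) (Y (clT z.1) z.2) (X (clT z.1) z.2)).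
Proof.
move=> pY pX; have TT : 0 <= T <= T by rewrite ltW//=.
have mid : measurable_fun setT (fun z : R * Omega => (z.1, z.2 : FT T)).
  by apply: measurable_fun_pair => //; exact: measurableT_comp (measurable_FT TT) measurable_snd.
exact: (measurableT_comp (mLag (Hz TT) (mz TT) (mc TT pY) (mc TT pX)) mid).
Qed.

End Fields.


Context (d : nat) (H : R -> Omega -> 'rV[R]_d -> 'rV[R]_d -> R) (G : Omega -> 'rV[R]_d -> R).
Hypothesis H1 : hypH1 P T F H G.


(** Continuity in time with values in C^2 of a ball, read for H and its first derivatives uniformly
    on that ball. *)
Lemma hyp_close k t w e : (0 < k)%N -> 0 <= t <= T -> 0 < e -> exists2 del, 0 < del &
  forall s, 0 <= s <= T -> `|s - t| < del -> forall y, @eball R (d + d) k%:R y ->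
    `|joint (H s w) y - joint (H t w) y| < e /\
    forall i, `|partial i (joint (H s w)) y - partial i (joint (H t w)) y| < e.
Proof.
move=> k0 tT e0; have [_ cH _ _] := H1.2 1 (lexx _) k k0.
have [del d0 hd] := cH w t tT e e0; exists del => // s sT st y ky.
have [h1 h2 _] := C2norm_bounds (fun y => joint (H s w) y - joint (H t w) y) ky.
have := hd s sT st; rewrite /Defs.mdist /= => h3; split.
  by have := le_lt_trans h1 h3; rewrite lte_fin.
move=> i; have := le_lt_trans h2 h3; rewrite lte_fin; apply: le_lt_trans.
rewrite grad_sub; [|exact: (hyp_C2 H1 w sT).1|exact: (hyp_C2 H1 w tT).1].
by apply: le_trans (enorm_coord _ i); rewrite !mxE.
Qed.

(** [q] stands for a value or a first derivative. The time dependence is uniform on a ball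
    containing the path near t, so joint continuity follows from the two separate ones. *)
Lemma hyp_H_path (Y X : R -> 'rV[R]_d) w (q : ('rV[R]_(d + d) -> R) -> 'rV[R]_(d + d) -> R) :
  (forall t, 0 <= t <= T -> continuous (q (joint (H t w)))) ->
  (forall k t e, (0 < k)%N -> 0 <= t <= T -> 0 < e -> exists2 del, 0 < del &
    forall s, 0 <= s <= T -> `|s - t| < del -> forall y, @eball R (d + d) k%:R y ->
    `|q (joint (H s w)) y - q (joint (H t w)) y| < e) ->
  continuous Y -> continuous X ->
  continuous (fun t => q (joint (H (clT t) w)) (row_mx (Y t) (X t))).
Proof.
move=> cq close cY cX t.
have cYX := continuous_row_mx cY cX.
apply/cvgrPdist_lt => e e0; have e2 : 0 < e / 2 by rewrite divr_gt0.
have tT := clamp_itvT t.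
pose k := (Num.truncn (enorm (row_mx (Y t) (X t)) + 1)).+1.
have kb : enorm (row_mx (Y t) (X t)) + 1 < k%:R by exact: truncnS_gt.
have [del d0 hd] := close k _ _ (ltn0Sn _) tT e2.
have c1 : continuous (fun s => q (joint (H (clT t) w)) (row_mx (Y s) (X s))).
  by move=> s; apply: (continuous_comp (cYX s)); exact: cq.
near=> s.
have h1 : `|q (joint (H (clT t) w)) (row_mx (Y t) (X t)) -
    q (joint (H (clT t) w)) (row_mx (Y s) (X s))| < e / 2.
  by near: s; have := c1 t => /cvgrPdist_lt/(_ _ e2).
have h2 : `|clT s - clT t| < del.
  by rewrite distrC; apply: le_lt_trans (clamp_lip _ _ _ _) _; near: s; exact: cvgr_dist_lt.
have h3 : @eball R (d + d) k%:R (row_mx (Y s) (X s)).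
  rewrite /eball /=; apply: le_lt_trans kb.
  have h : `|row_mx (Y t) (X t) - row_mx (Y s) (X s)| <= (d + d).+1%:R^-1.
    near: s; have i0 : 0 < (d + d).+1%:R^-1 :> R by rewrite invr_gt0.
    by have := cYX t => /cvgrPdist_le/(_ _ i0).
  rewrite -[X in enorm X](subrK (row_mx (Y t) (X t))); apply: le_trans (enormD _ _) _.
  rewrite addrC lerD2l -enormN opprB; apply: le_trans (enorm_norm _) _.
  apply: (@le_trans _ _ ((d + d).+1%:R * `|row_mx (Y t) (X t) - row_mx (Y s) (X s)|)).
    by rewrite ler_wpM2r// ler_nat.
  by rewrite -ler_pdivlMl// mulr1.
have h4 := hd _ (clamp_itvT s) h2 _ h3.
rewrite -(subrKA (q (joint (H (clT t) w)) (row_mx (Y s) (X s)))).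
apply: le_lt_trans (ler_normD _ _) _; rewrite [e]splitr; apply: ltrD => //.
by rewrite distrC.
Unshelve. all: by end_near. Qed.

Lemma hyp_H_continuous (Y X : R -> 'rV[R]_d) w : continuous Y -> continuous X ->
  continuous (fun t => H (clT t) w (Y t) (X t)).
Proof.
move=> cY cX.
rewrite (_ : (fun t => _) = (fun t => joint (H (clT t) w) (row_mx (Y t) (X t)))); last first.
  by apply/funext => t; rewrite joint_row.
apply: (@hyp_H_path Y X w (fun u => u)) => //.
  by move=> t tT; exact: C1_continuous (hyp_C2 H1 w tT).1.
move=> k t e k0 tT e0; have [del d0 hd] := hyp_close w k0 tT e0.
by exists del => // s sT st y /(hd s sT st y)[].
Qed.

Lemma hyp_Dp_continuous (Y X : R -> 'rV[R]_d) w i : continuous Y -> continuous X ->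
  continuous (fun t => Dp (H (clT t) w) (Y t) (X t) 0 i).
Proof.
move=> cY cX.
rewrite (_ : (fun t => _) = (fun t => partial (lshift d i) (joint (H (clT t) w)) (row_mx (Y t) (X t)))); last first.
  by apply/funext => t; rewrite partial_lshift mxE.
apply: (@hyp_H_path Y X w (partial (lshift d i))) => //.
  by move=> t tT; exact: (hyp_C2 H1 w tT).1.2.
move=> k t e k0 tT e0; have [del d0 hd] := hyp_close w k0 tT e0.
by exists del => // s sT st y /(hd s sT st y)[].
Qed.

Lemma mopen_below n (O : set 'rV[R]_n) y c : O y ->
  @mopen R (C2space O) [set u | mcar (C2space O) u /\ u y < c].
Proof.
move=> Oy; split; first by move=> u [].
move=> u [cu uc]; exists (c - u y); first by rewrite subr_gt0.
move=> v cv h; split => //.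
have [h1 _ _] := C2norm_bounds (fun x => u x - v x) Oy.
have := le_lt_trans h1 h; rewrite lte_fin ltr_norml => /andP[h2 _]; lra.
Qed.

Lemma hyp_prog p x : prog (fun t w => H t w p x).
Proof.
apply: prog_continuous => //.
  by move=> w; apply: hyp_H_continuous; exact: cst_continuous.
move=> t tT; rewrite /fmeas; apply: (measurability _ (RGenInftyO.measurableE R)) => _ [_ [c ->] <-].
rewrite setTI; apply: sub_sigma_algebra.
pose k := (Num.truncn (enorm (row_mx p x))).+1.
have ky : @eball R (d + d) k%:R (row_mx p x) by exact: truncnS_gt.
have [hc _ pr _] := H1.2 1 (lexx _) k (ltn0Sn _).
have := predictable_section (pr _ (mopen_below c ky)) tT.
congr (F t _); apply/seteqP; split => w /=; rewrite in_itv/= joint_row.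
  by move=> [_ []].
by move=> h; split=> //; split => //; exact: hc.
Qed.

Lemma hyp_G_C2 w : C2 (G w).
Proof.
by apply: is_C2_C2 => k k0 x _; have [h _ _] := H1.1; exact: h.
Qed.

Lemma hyp_G_bound : exists2 C : R, 0 <= C & forall w x,
  [/\ `|G w x| <= C, enorm (grad (G w) x) <= C & enorm (hess (G w) x) <= C].
Proof.
have [_ [C hC] _] := H1.1; exists `|C| => // w x.
have [h1 h2 h3] := @C2norm_bounds R d setT (G w) x Logic.I.
have CC : C <= `|C| by exact: ler_norm.
by split; apply: le_trans CC; rewrite -lee_fin; apply: le_trans (hC w).
Qed.

Lemma hyp_G_fmeas x : fmeas (F T) (G ^~ x).
Proof.
have TT : 0 <= T <= T by rewrite ltW//=.
rewrite /fmeas; apply: (measurability _ (RGenInftyO.measurableE R)) => _ [_ [c ->] <-].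
rewrite setTI; apply: sub_sigma_algebra.
have [hc [C hC] hm] := H1.1.
have := hm _ (@mopen_below _ setT x c Logic.I); congr (F T _).
apply/seteqP; split => w /=; rewrite in_itv/=; first by case.
by move=> h; split => //; split; [exact: hc|exact: le_lt_trans (hC w) (ltry _)].
Qed.

Lemma hyp_G_comp (Y : Omega -> 'rV[R]_d) : (forall i, fmeas (F T) (fun w => Y w 0 i)) ->
  fmeas (F T) (fun w => G w (Y w)).
Proof.
move=> mY; apply: (mcaratheodory (Om := FT T) (F := G) (Y := Y)) => //.
- by move=> y; exact: hyp_G_fmeas.
- by move=> w; exact: C1_continuous (hyp_G_C2 w).1.
Qed.

Lemma hyp_gradG_comp (Y : Omega -> 'rV[R]_d) i : (forall i, fmeas (F T) (fun w => Y w 0 i)) ->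
  fmeas (F T) (fun w => grad (G w) (Y w) 0 i).
Proof.
move=> mY.
apply: (@measurable_realfun.measurable_fun_cvg _ _ _ _ (fun k (w : FT T) => k.+1%:R *
  (G w (Y w + k.+1%:R^-1 *: ebase R i) - G w (Y w)))).
  move=> k; apply: measurable_funM; first exact: measurable_cst.
  apply: measurable_funB; last exact: hyp_G_comp.
  apply: hyp_G_comp => j; exact: (@mcoordD _ _ (FT T) _ Y (fun=> _) mY (mcoord_cst _)).
by move=> w _; rewrite mxE; exact: partial_cvg ((hyp_G_C2 w).1.1 _ i).
Qed.


(** * The control problem in terms of velocities *)

Context (x0 : 'rV[R]_d).
Implicit Types v b : R -> Omega -> 'rV[R]_d.


Definition state v t w : 'rV[R]_d := x0 + vintegral 0 t (fun s => v s w).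

Definition controlled v := vprog v /\
  forall w i, leb.-integrable `[0, T] (fun s => (v s w 0 i)%:E).

Lemma stateE v t w i : state v t w 0 i = x0 0 i + \int[leb]_(s in `[0, t]) v s w 0 i.
Proof. by rewrite !mxE. Qed.

Lemma state0 v w : state v 0 w = x0.
Proof.
apply/rowP => i; rewrite stateE (_ : \int[leb]_(s in _) _ = 0) ?addr0//.
by rewrite set_itv1 Rintegral_set1.
Qed.

Lemma state_start v t w : state v t w = state v 0 w + vintegral 0 t (fun s => v s w).
Proof. by rewrite state0. Qed.

Lemma state_continuous v w : controlled v -> continuous (fun t => state v (clT t) w).
Proof.
move=> [pv iv] t; apply: (@cvg_rV _ _ _ _ (nbhs_filter t)) => i.
have -> : (fun s => state v (clT s) w 0 i) =
    (fun s => x0 0 i + \int[leb]_(r in `[0, clT s]) v r w 0 i).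
  by apply/funext => s; rewrite stateE.
rewrite stateE; apply: cvgD; first exact: cvg_cst.
by have [c _] := prog_primitive (pv i) (fun w => iv w i); exact: c.
Qed.

Lemma vprog_state v : controlled v -> vprog (state v).
Proof.
move=> [pv iv] i; apply: (@prog_eq (fun t w => x0 0 i + \int[leb]_(r in `[0, t]) v r w 0 i)).
  by move=> s w _; rewrite stateE.
apply: progD; first by move=> t tT; exact: measurable_cst.
by have [_] := prog_primitive (pv i) (fun w => iv w i).
Qed.

Lemma state_fmeas v t i : controlled v -> 0 <= t <= T -> fmeas (F t) (fun w => state v t w 0 i).
Proof. by move=> cv tT; exact: (prog_fmeas (vprog_state cv i) tT). Qed.

Lemma state_dot v w : controlled v -> {ae leb, forall s, 0 <= s <= T -> dot (traj (state v) w) s = v s w}.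
Proof.
move=> [_ iv]; have h := primitive_deriv T0 (iv w) (fun s _ => state_start v s w).
apply: ae_impl (ae_and h (ae_and (ae_neq 0) (ae_neq T))) => s [hs [s0 sT]] /andP[h0 hT].
by have [] := hs _; first by rewrite !lt_neqAle h0 hT eq_sym s0 sT.
Qed.

Lemma state_split v s t w i : controlled v -> 0 <= s -> s <= t -> t <= T ->
  state v t w 0 i = state v s w 0 i + \int[leb]_(r in `[s, t]) v r w 0 i.
Proof.
by move=> [_ iv] s0 st tT; rewrite !stateE (primitive_split (iv w i) s0 st tT) addrA.
Qed.

Lemma state_eq v v' t w : {ae leb, forall s, 0 <= s <= t -> v s w = v' s w} -> state v t w = state v' t w.
Proof.
move=> h; apply/rowP => i; rewrite !stateE /Rintegral; congr (_ + fine _); apply: integral_ae.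
by apply: ae_impl h => s hs /=; rewrite in_itv/= => /hs ->.
Qed.


Context (lam C0 : R) (Cb : R -> R) (lam0 : 0 < lam) (C00 : 0 < C0).
Hypothesis Hh : forall t w, 0 <= t <= T -> ham lam C0 Cb (H t w).
Notation TO := (measurableTypeR R * Omega)%type.
Notation D := (@timeD R disp Omega T).
Notation mu := (dtP P).
Notation C1 := (C1ell lam C0 Cb).


Let pH : forall p x, prog (fun t w => H t w p x) := hyp_prog.

Let TT : 0 <= T <= T. Proof. by rewrite ltW//=. Qed.

(** An extended real version of ell, to allow velocities of infinite cost. It is nonnegative, hence
    can be integrated over the product without further assumptions. *)
Definition running v (z : TO) : \bar R :=
  (Lag (H (clT z.1) z.2) (v (clT z.1) z.2) (state v (clT z.1) z.2) + C1%:E)%E.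

Definition payoff v w : R := G w (state v T w).

Definition value v : \bar R := (\int[mu]_(z in D) running v z + (\int[P]_w payoff v w)%:E)%E.

Lemma running_ge0 v z : (0 <= running v z)%E.
Proof.
have := Lag_lower (Hh z.2 (clamp_itvT z.1)) (v (clT z.1) z.2) (state v (clT z.1) z.2).
rewrite /running; move: (Lag _ _ _) => [r| |]//.
  rewrite !lee_fin /C1ell => h; rewrite addrCA addr_ge0//; first exact: divr_ge0 (ltW _) (ltW _).
  by move: (Cb 1) h => c h; lra.
by move=> _; rewrite addye.
Qed.

Lemma running_measurable v : controlled v -> measurable_fun setT (running v).
Proof.
move=> cv; have pv := vprog_state cv.
apply: emeasurable_funD; last exact: measurable_cst.
exact: (joint_Lag Hh pH cv.1 pv).
Qed.

Lemma payoff_fmeas v : controlled v -> fmeas (F T) (payoff v).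
Proof.
by move=> cv; apply: (hyp_G_comp (Y := state v T)) => i; exact: (state_fmeas i cv TT).
Qed.

Lemma payoff_Pint v : controlled v -> Pint P (payoff v).
Proof.
move=> cv; have [C _ hC] := hyp_G_bound.
apply: (@Pint_bdd _ _ _ _ _ C); first exact: fmeasW (sF TT).2 (payoff_fmeas cv).
by move=> w; have [] := hC w (state v T w).
Qed.

(** [cost] involves the classical derivative of the path, and its integrand need not be measurable;
    it agrees almost everywhere with [running], whose shift C1 integrates to C1 T. *)
Lemma cost_value v (X : R -> Omega -> 'rV[R]_d) : controlled v ->
  {ae P, forall w, (forall t, 0 <= t <= T -> X t w = state v t w) /\
    {ae leb, forall s, 0 <= s <= T -> dot (traj X w) s = v s w}} ->
  (cost P T H G X + (C1 * T)%:E)%E = value v.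
Proof.
move=> cv aeX; have mr := running_measurable cv.
have [E mA] := tonelli_dtP P (measurable_funTS mr : measurable_fun D _) (running_ge0 v).
set A := fun w => (\int[leb]_(s in `[0%R, T]) running v (s, w))%E in E mA.
have -> : cost P T H G X = (\int[P]_w (A w + (payoff v w - C1 * T)%:E))%E.
  apply: integral_ae; apply: ae_impl aeX => w [Xw dX] _.
  rewrite Xw// EFinB addeA addeAC; congr (_ + _)%E.
  transitivity (\int[leb]_(s in `[0%R, T]) (running v (s, w) + (- C1)%:E))%E.
    apply: integral_ae; apply: ae_impl dX => s hs /=; rewrite in_itv/= => sT.
    rewrite /running /= clamp_id// hs// Xw// -addeA -EFinD subrr adde0//.
  rewrite (@integral_add _ _ _ leb _ _ (fun=> - C1)) //.
  - by rewrite /A; congr (_ + _)%E; rewrite Rint_cst_itv ?ltW// subr0 mulNr EFinN.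
  - apply: measurable_funTS; exact: measurable_section.
  - by move=> s; exact: running_ge0.
  - by apply: (@bdd_integrable _ _ _ leb _ _ `|C1|) => //; [exact: mu_itv_fin|move=> s _; rewrite normrN].
have ki : P.-integrable setT (EFin \o (fun w => payoff v w - C1 * T)).
  apply: PintB; first exact: payoff_Pint.
  by apply: (@Pint_bdd _ _ _ _ _ `|C1 * T|).
rewrite (integral_add measurableT mA _ ki); last first.
  by move=> w; apply: integral_ge0 => s _; exact: running_ge0.
rewrite /value E -addeA -EFinD; congr (_ + _%:E)%E.
rewrite RintegralB//; last 2 first.
- exact: payoff_Pint.
- by apply: (@Pint_bdd _ _ _ _ _ `|C1 * T|).
by rewrite Rint_cst_prob subrK.
Qed.

Section OptimalTrajectory.
Context (gam : R -> Omega -> 'rV[R]_d) (gam_opt : optimal P T F H G x0 gam).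

(** The velocity of gam is replaced by a progressive one with good properties for every omega, so
    that exceptional sets do not follow every later construction. *)
Lemma optimal_velocity : exists u, [/\ controlled u,
  forall w, (\int[leb]_(s in `[0%R, T]) (enorm (u s w) ^+ 2)%:E < +oo)%E &
  {ae P, forall w, (forall t, 0 <= t <= T -> gam t w = state u t w) /\
    {ae leb, forall s, 0 <= s <= T -> dot (traj gam w) s = u s w}}].
Proof.
have [[[_ cg pg _] aeg] _] := gam_opt.
have [N [mN N0 hN]] := ae_null_set aeg.
have FN : F 0 (~` N).
  have t0 : 0 <= (0 : R) <= T by rewrite lexx ltW.
  by apply: sigC (sF t0).1 _ _; exact: nullF.
have pgam i : prog (fun s w => gam s w 0 i).
  apply: prog_continuous => //.
    have /continuous_processP := cg.
    move=> h w t; apply: (@continuous_comp _ _ _ (fun t => gam (clT t) w) (fun y : 'rV[R]_d => y 0 i) t (h w t)).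
    exact: coord_continuous.
  by move=> t tT; exact: (predictable_adapted i pg tT).
(* Zero on the null set where gam may fail to be an H^1 curve from x0; this set lies in F 0. *)
pose u s w : 'rV[R]_d := \1_(~` N) w *: \row_i left_velocity (fun s w => gam s w 0 i) s w.
have uN s w : N w -> u s w = 0.
  by move=> Nw; rewrite /u indicE memNset ?scale0r//= => /(_ Nw).
have pu : vprog u.
  move=> i; apply: (@prog_eq (fun s w => \1_(~` N) w * left_velocity (fun s w => gam s w 0 i) s w)).
    by move=> s w _; rewrite !mxE.
  apply: progM; first exact: (prog_indic0 FN).
  by apply: prog_left_velocity => //; exact: pgam.
have good w : ~ N w -> exists v : R -> 'rV[R]_d, [/\
    forall i, leb.-integrable `[0, T] (fun s => (v s 0 i)%:E),
    (\int[leb]_(s in `[0%R, T]) ((enorm (v s)) ^+ 2)%:E < +oo)%E,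
    forall s, 0 <= s <= T -> gam s w = x0 + vintegral 0 s v &
    {ae leb, forall s, 0 <= s <= T -> dot (traj gam w) s = v s /\ u s w = v s}].
  move=> Nw; have [gx [v [mv fv gv]]] := hN w Nw; exists v.
  have iv := sqr_integrable (measurable_itv `[0, T]) (mu_itv_fin 0 T) mv fv.
  split => //; first by move=> s sT; rewrite -gx; exact: gv.
  have h := primitive_deriv T0 iv gv.
  apply: ae_impl (ae_and h (ae_and (ae_neq 0) (ae_neq T))) => s [hs [s0 sT]] /andP[h0 hT].
  have s0T : 0 < s < T by rewrite !lt_neqAle h0 hT eq_sym s0 sT.
  have [h1 h2] := hs s0T; split => //; apply/rowP => i.
  rewrite !mxE indicE mem_set// mul1r; apply: left_velocityE (h2 i).
  by case/andP: s0T => -> /ltW ->.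
have iu w i : leb.-integrable `[0, T] (fun s => (u s w 0 i)%:E).
  have mu' : measurable_fun (`[0, T] : set R) (fun s => u s w 0 i) by exact: prog_path_itv _ _ (pu i).
  have [Nw|Nw] := pselect (N w).
    rewrite (_ : (fun s => _) = fun=> 0%E); first exact: integrable0.
    by apply/funext => s; rewrite uN// mxE.
  have [v [iv _ _ ae]] := good w Nw.
  apply: integrable_ae_eq (iv i); first exact/measurable_EFinP.
  by apply: ae_impl ae => s hs; rewrite /= in_itv/= => sT; have [_ ->] := hs sT.
exists u; split; first by split.
- move=> w; have [Nw|Nw] := pselect (N w).
    rewrite (eq_integral (fun=> 0%E)) ?integral0 ?ltry// => s _.
    by rewrite uN// enorm0 expr0n.
  have [v [_ fv _ ae]] := good w Nw; rewrite (@integral_ae _ _ _ leb _ _ (fun s => (enorm (v s) ^+ 2)%:E))//.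
  by apply: ae_impl ae => s hs; rewrite /= in_itv/= => sT; have [_ ->] := hs sT.
- exists N; split => // w; apply: contra_notP => Nw.
  have [v [_ _ gv ae]] := good w Nw; split.
    move=> t tT; rewrite gv//; congr (_ + _); apply/rowP => i; rewrite !mxE /Rintegral; congr fine.
    apply: integral_ae; apply: ae_impl ae => s hs; rewrite /= in_itv/= => /andP[s0 st].
    by have [|_ ->] := hs; rewrite ?s0 ?(le_trans st)//; case/andP: tT.
  by apply: ae_impl ae => s hs sT; have [-> ->] := hs sT.
Qed.

(** Where v differs from u it is bounded, so its paths have square integrable velocity, and its
    state remains near the path of gam: it is admissible and optimality applies. *)
Lemma competitor u v (B C : R) : controlled u ->
  (forall w, (\int[leb]_(s in `[0%R, T]) (enorm (u s w) ^+ 2)%:E < +oo)%E) ->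
  {ae P, forall w, (forall t, 0 <= t <= T -> gam t w = state u t w) /\
    {ae leb, forall s, 0 <= s <= T -> dot (traj gam w) s = u s w}} ->
  vprog v -> 0 <= B -> 0 <= C ->
  (forall s w, 0 <= s <= T -> v s w = u s w \/ enorm (v s w) <= B) ->
  (forall w t, 0 <= t <= T -> exists2 s, 0 <= s <= T & enorm (state v t w - state u s w) <= C) ->
  controlled v /\ (value u <= value v)%E.
Proof.
move=> cu fu aeu pv B0 C0' uv near_u.
have mv w i : measurable_fun (`[0, T] : set R) (fun s => v s w 0 i) by exact: prog_path_itv _ _ (pv i).
have fv w : (\int[leb]_(s in `[0%R, T]) (enorm (v s w) ^+ 2)%:E < +oo)%E.
  have mu' i : measurable_fun (`[0, T] : set R) (fun s => u s w 0 i) by exact: prog_path_itv _ _ (cu.1 i).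
  have m2 := menorm_sqr (measurable_itv `[0, T]) mu'.
  apply: (@le_lt_trans _ _ (\int[leb]_(s in `[0%R, T]) ((enorm (u s w) ^+ 2)%:E + (B ^+ 2)%:E))%E).
    apply: ge0_le_integral => //.
    - by move=> s _; rewrite lee_fin sqr_ge0.
    - by apply/measurable_EFinP; exact: menorm_sqr (measurable_itv _) (mv w).
    - by apply/measurable_EFinP; apply: measurable_funD => //; exact: measurable_cst.
    - move=> s; rewrite /= in_itv/= => sT; rewrite -EFinD lee_fin.
      have [->|h] := uv s w sT; first by rewrite lerDl sqr_ge0.
      rewrite -[leLHS]add0r; apply: lerD; first exact: sqr_ge0.
      by rewrite ler_sqr ?nnegrE// sqrtr_ge0.
  rewrite ge0_integralD//; last 3 first.
  - by move=> s _; rewrite lee_fin sqr_ge0.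
  - exact/measurable_EFinP.
  - by move=> s _; rewrite lee_fin sqr_ge0.
  rewrite lte_add_pinfty// integral_cst//.
  by rewrite lte_mul_pinfty// ?lee_fin ?sqr_ge0//; exact: mu_itv_fin.
have cv : controlled v.
  split => // w i; exact: (sqr_integrable (measurable_itv _) (mu_itv_fin 0 T) (mv w) (fv w)).
split; first exact: cv.
rewrite -(cost_value cu aeu) -(@cost_value v (state v) cv); last first.
  by apply: ae_true => w; split; [by []|exact: (state_dot w cv)].
apply: leeD2r; have [[Sg _] ->] := gam_opt; apply: ereal_inf_lbound; exists (state v); last by [].
have [N [mN N0 hN]] := ae_null_set aeu.
split.
  have h12 : 1 <= 2 :> R by rewrite ler1n.
  apply: (Sspace_shift h12 C0' Sg _ _ mN N0).
  - by move=> w; exact: (@state_continuous v w cv).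
  - by move=> i t tT; exact: (state_fmeas i cv tT).
  - move=> w t Nw tT; have [s sT h] := near_u w t tT; exists s => //.
    by have [gu _] := hN w Nw; rewrite gu.
apply: ae_true => w; split; first exact: state0.
exists (fun s => v s w); split => //.
by move=> s _; exact: state_start.
Qed.

End OptimalTrajectory.

Context (u : R -> Omega -> 'rV[R]_d) (cu : controlled u).
(** The only form in which optimality is used from here on. *)
Hypothesis u_opt : forall v (B C : R), vprog v -> 0 <= B -> 0 <= C ->
  (forall s w, 0 <= s <= T -> v s w = u s w \/ enorm (v s w) <= B) ->
  (forall w t, 0 <= t <= T -> exists2 s, 0 <= s <= T & enorm (state v t w - state u s w) <= C) ->
  controlled v /\ (value u <= value v)%E.


Let CbT := Cb 1.
Let Cb1 : 0 <= CbT. Proof. exact: (Cb1_ge0 (Hh point TT)). Qed.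

Lemma int_coord_bound (f : R -> R) (s t B : R) : 0 <= s -> s <= t -> t <= T -> 0 <= B ->
  leb.-integrable `[0, T] (EFin \o f) -> (forall r, s <= r <= t -> `|f r| <= B) ->
  `|\int[leb]_(r in `[s, t]) f r| <= B * T.
Proof.
move=> s0 st tT B0 fi fB; have fi' := integrable_itvS s0 tT fi.
apply: (@le_trans _ _ (\int[leb]_(r in `[s, t]) `|f r|)).
  exact: le_normr_Rintegral.
have -> : B * T = \int[leb]_(r in `[0, T]) B by rewrite Rint_cst_itv ?ltW// subr0.
apply: (@le_trans _ _ (\int[leb]_(r in `[s, t]) B)).
  apply: le_Rintegral => //.
  - exact: integrable_norm.
  - by apply: (@bdd_integrable _ _ _ leb _ _ `|B|) => //; exact: mu_itv_fin.
by rewrite (Rint_cst_itv _ st) (Rint_cst_itv _ (ltW T0)) ler_wpM2l// lerB.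
Qed.

(** ell at velocity -D_pH(0, y) and position y is at most the last factor; the exponential carries
    it to any point within distance d Cb(1) T, the largest displacement at that speed. *)
Definition spike_bound : R :=
  expR (Num.sqrt lam * (d%:R * (CbT * T))) * (1 * CbT + CbT + C1).

Let sb0 : 0 <= spike_bound.
Proof.
have C10 : 0 <= C1 by rewrite /C1ell; apply: addr_ge0 => //; apply: divr_ge0; exact: ltW.
by rewrite /spike_bound mul1r; apply: mulr_ge0; [exact: expR_ge0|apply: addr_ge0 => //; exact: addr_ge0].
Qed.

(** From time t on, on the event A, the velocity u is replaced by a bounded one of bounded cost;
    nothing changes elsewhere. *)
Lemma spike (CG : R) t A : (forall w x, `|G w x| <= CG) -> 0 <= t <= T -> F t A ->
  exists v, [/\ controlled v, (value u <= value v)%E,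
    forall s w, 0 <= s <= T -> (running v (s, w) <=
      (1 - \1_(`[t, +oo[%classic) s * \1_A w)%:E * running u (s, w) + (spike_bound * \1_A w)%:E)%E &
    forall w, payoff v w <= payoff u w + 2 * CG * \1_A w].
Proof.
move=> hG tT FA; have /andP[t0 tT'] := tT.
(* The position is frozen at time t, so that v is given by a formula and not by a differential
   equation; the growth estimate transports the bound to the actual state. *)
pose a s w : 'rV[R]_d := - Dp (H s w) 0 (state u t w).
pose v s w : 'rV[R]_d := u s w + (\1_(`[t, +oo[%classic) s * \1_A w) *: (a s w - u s w).
have vu s w : s < t \/ ~ A w -> v s w = u s w.
  move=> h; rewrite /v !indicE; case: h => [st|nA].
    by rewrite memNset ?mul0r ?scale0r ?addr0//= in_itv/= andbT; apply/negP; rewrite -ltNge.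
  by rewrite [_ \in A]memNset// mulr0 scale0r addr0.
have va s w : t <= s -> A w -> v s w = a s w.
  by move=> ts Aw; rewrite /v !indicE !mem_set//= ?in_itv/= ?ts// mulr1 scale1r addrC subrK.
have aB s w : 0 <= s <= T -> enorm (a s w) <= CbT.
  move=> sT; rewrite enormN.
  have e01 : enorm (0 : 'rV[R]_d) <= 1 by rewrite enorm0.
  by have [_] := ham_bound1 (Hh w sT) (state u t w) ltr01 e01.
have pv : vprog v.
  move=> i; apply: (@prog_eq (fun s w => u s w 0 i +
      \1_(`[t, +oo[%classic) s * (\1_A w * (a s w 0 i - u s w 0 i)))).
    by move=> s w _; rewrite !mxE mulrA.
  apply: progD; first exact: cu.1.
  apply: prog_after => // r rT; have /andP[tr rT'] := rT.
  have rT0 : 0 <= r <= T by rewrite (le_trans t0 tr).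
  apply: measurable_funM.
    have mA : measurable (A : set (FT r)) by apply: sub_sigma_algebra; exact: (monoF t0 tr rT').
    by apply: measurableT_comp; [exact: measurable_indic|exact: measurable_snd].
  apply: measurable_funB; last exact: cu.1.
  have mX : mcoord (fun z : R * FT r => state u t z.2).
    move=> j; have m : measurable_fun setT (fun w : FT r => state u t w 0 j).
      exact: (fmeasS (monoF t0 tr rT') (state_fmeas j cu tT)).
    exact: (measurableT_comp m measurable_snd).
  have Hz (z : R * FT r) : ham lam C0 Cb (H (clamp 0 r z.1) z.2).
    apply: Hh; have /andP[h1 h2] := clamp_itv z.1 (le_trans t0 tr).
    by rewrite h1 (le_trans h2).
  have m := mDp Hz (fun p x => pH p x rT0) (mcoord_cst 0) mX i.
  rewrite /a (_ : (fun z => _) = fun z => 0 - Dp (H (clamp 0 r z.1) z.2) 0 (state u t z.2) 0 i).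
    exact: measurable_funB (measurable_cst _) m.
  by apply/funext => z; rewrite mxE sub0r.
have uvB s w : 0 <= s <= T -> v s w = u s w \/ enorm (v s w) <= CbT.
  move=> sT; have [Aw|nA] := pselect (A w); last by left; apply: vu; right.
  have [ts|st] := leP t s; first by right; rewrite va//; exact: aB.
  by left; apply: vu; left.
pose K := d%:R * (CbT * T).
have cv : controlled v.
  split=> // w i.
  have gi : leb.-integrable `[0, T] (fun r => `|(u r w 0 i)%:E| + CbT%:E)%E.
    apply: integrableD => //; first exact: integrable_abse (cu.2 w i).
    by apply: (@bdd_integrable _ _ _ leb _ (fun=> CbT) `|CbT|) => //; exact: mu_itv_fin.
  apply: (@le_integrable _ _ _ leb `[0, T]%classic (measurable_itv _) _ (fun r => `|(u r w 0 i)%:E| + CbT%:E)%E) => //.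
    by apply/measurable_EFinP; exact: prog_path_itv _ _ (pv i).
  move=> s; rewrite /= in_itv/= => sT; rewrite lee_fin [leRHS]ger0_norm ?addr_ge0 ?Cb1//.
  have [->|h] := uvB s w sT; first by rewrite lerDl Cb1.
  by rewrite -[leLHS]add0r lerD// (le_trans (enorm_coord _ i)).
have K0 : 0 <= K by rewrite /K mulr_ge0 ?ler0n// mulr_ge0 ?Cb1// ltW.
have far s w : A w -> t <= s -> s <= T -> enorm (state v s w - state u t w) <= K.
  move=> Aw ts sT; have CT0 : 0 <= CbT * T by rewrite mulr_ge0 ?Cb1// ltW.
  apply: le_trans (enorm_norm _) _; rewrite ler_wpM2l//; apply: rV_norm_le => // i.
  have -> : state u t w = state v t w.
    apply: state_eq; apply: ae_impl (ae_neq t) => r rt /andP[_ r2].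
    by rewrite vu//; left; rewrite lt_neqAle rt.
  have E := state_split w i cv t0 ts sT.
  rewrite !mxE -!stateE E addrAC subrr add0r.
  apply: int_coord_bound => //; first exact: cv.2.
  move=> r /andP[tr rs]; rewrite va//; apply: le_trans (enorm_coord _ _) (aB _ _ _).
  by rewrite (le_trans t0 tr) (le_trans rs).
have same s w : s < t \/ ~ A w -> state v s w = state u s w.
  move=> h; apply: state_eq; apply: ae_true => r /andP[_ rs]; apply: vu.
  by case: h => h; [left; exact: le_lt_trans rs h|right].
have near_u w s : 0 <= s <= T -> exists2 r, 0 <= r <= T & enorm (state v s w - state u r w) <= K.
  move=> sT; have [Aw|nA] := pselect (A w); last first.
    by exists s => //; rewrite (same s w (or_intror nA)) subrr enorm0 K0.
  have [ts|st] := leP t s; first by exists t => //; apply: far => //; case/andP: sT.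
  by exists s => //; rewrite (same s w (or_introl st)) subrr enorm0 K0.
have [_ le_uv] := u_opt pv Cb1 K0 uvB near_u.
exists v; split => //.
- move=> s w sT; have [[ts Aw]|h] := pselect (t <= s /\ A w); last first.
    have h' : s < t \/ ~ A w.
      have [ts|st] := leP t s; [right => Aw; exact: h|by left].
    have -> : \1_(`[t, +oo[%classic) s * \1_A w = 0 :> R.
      rewrite !indicE; case: h' => [st|nA]; last by rewrite [_ \in A]memNset// mulr0.
      by rewrite memNset ?mul0r//= in_itv/= andbT; apply/negP; rewrite -ltNge.
    rewrite subr0 mul1e /running /= clamp_id// vu// same//.
    rewrite leeDl// lee_fin mulr_ge0// indicE; exact: ler0n.
  rewrite !indicE !mem_set//= ?in_itv/= ?ts// !mulr1 subrr mul0e add0e.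
  rewrite /running /= clamp_id// va//.
  have [fin0 _] := Lag_gradient (Hh w sT) 0 (state u t w).
  have [fin1 gr] := ell_growth lam0 C00 (Hh w sT) (state v s w) fin0.
  rewrite -(fineK fin1) -EFinD lee_fin; apply: (le_trans gr); rewrite /spike_bound.
  have e01 : enorm (0 : 'rV[R]_d) <= 1 by rewrite enorm0.
  have eb := ell_bound (Hh w sT) (state u t w) ltr01 e01.
  apply: ler_pM => //.
    by apply/ltW/(ell_gt0 lam0 C00 (Hh w sT)).
  rewrite ler_expR ler_wpM2l ?sqrtr_ge0//; apply: far => //; by case/andP: sT.
- move=> w; rewrite /payoff; have [Aw|nA] := pselect (A w); last first.
    by rewrite same ?indicE ?memNset ?mulr0 ?addr0//; right.
  rewrite indicE mem_set// mulr1; have := hG w (state v T w); have := hG w (state u T w).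
  rewrite !ler_norml => /andP[h1 _] /andP[_ h2]; lra.
Qed.

Let after t (A : set Omega) (z : TO) : R := \1_(`[t, +oo[%classic) z.1 * \1_A z.2.

Let after_measurable t A : 0 <= t <= T -> F t A -> measurable_fun setT (after t A).
Proof.
move=> tT FA; apply: measurable_funM.
  by apply: measurableT_comp; [apply: measurable_indic; exact: measurable_itv|exact: measurable_fst].
apply: measurableT_comp; last exact: measurable_snd.
by apply: measurable_indic; exact: (sF tT).2.
Qed.

Let after01 t A z : 0 <= after t A z <= 1.
Proof. by rewrite /after !indicE; case: (_ \in _); case: (_ \in _); rewrite ?mulr1 ?mulr0 ?lexx ?ler01. Qed.

Let running_m := running_measurable cu.
Let running_0 z : (0 <= running u z)%E := running_ge0 u z.

Let mD : measurable D. Proof. exact: measurable_timeD. Qed.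

Let int_snd (c : R) A : 0 <= c -> measurable A ->
  (\int[mu]_(z in D) (c * \1_A z.2)%:E = (c * T * fine (P A))%:E)%E.
Proof.
move=> c0 mA.
have m : measurable_fun D (fun z : TO => (c * \1_A z.2)%:E : \bar R).
  apply: measurable_funTS; apply/measurable_EFinP; apply: measurable_funM => //.
  by apply: measurableT_comp; [exact: measurable_indic|exact: measurable_snd].
have p (z : TO) : (0 <= (c * \1_A z.2)%:E :> \bar R)%E by rewrite lee_fin mulr_ge0// indicE.
have [-> _] := tonelli_dtP P m p.
transitivity (\int[P]_w ((c * T) * \1_A w)%:E)%E.
  apply: eq_integral => w _ /=.
  rewrite (_ : (\int[leb]_(_ in _) _)%E = (\int[leb]_(s in `[0%R, T]) (c * \1_A w))%:E).
    by rewrite Rint_cst_itv ?ltW// subr0 mulrAC.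
  rewrite /Rintegral fineK//; apply: integrable_fin_num => //.
  by apply: (@bdd_integrable _ _ _ leb _ (fun=> c * \1_A w) `|c * \1_A w|) => //; exact: mu_itv_fin.
under eq_integral do rewrite EFinM.
rewrite ge0_integralZl//; last 2 first.
- by apply/measurable_EFinP; exact: measurable_indic.
- by rewrite lee_fin mulr_ge0// ltW.
rewrite integral_indic// setIT [RHS]EFinM fineK//; exact: fin_num_measure.
Qed.

(** The costs of u and of the spike agree off the switched region. Finiteness of that common part
    allows it to be cancelled from value u <= value v, and leaves a bound proportional to P A. *)
Let energy_aux (CG : R) t A : 0 <= CG -> (forall w x, `|G w x| <= CG) -> 0 <= t <= T -> F t A ->
  (\int[mu]_(z in D) ((1 - after t A z)%:E * running u z) < +oo)%E ->
  (\int[mu]_(z in D) ((after t A z)%:E * running u z)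
    <= ((spike_bound * T + 2 * CG) * fine (P A))%:E)%E.
Proof.
move=> CG0 hG tT FA fin.
have mA := (sF tT).2 _ FA.
have [v [cv le_uv rv gv]] := spike hG tT FA.
have ma := after_measurable tT FA.
have m1 : measurable_fun D (fun z => (1 - after t A z)%:E * running u z)%E.
  apply: measurable_funTS; apply: emeasurable_funM => //; apply/measurable_EFinP.
  exact: measurable_funB.
have m2 : measurable_fun D (fun z => (after t A z)%:E * running u z)%E.
  by apply: measurable_funTS; apply: emeasurable_funM => //; apply/measurable_EFinP.
have p1 z : (0 <= (1 - after t A z)%:E * running u z)%E.
  by rewrite mule_ge0// lee_fin subr_ge0; case/andP: (after01 t A z).
have p2 z : (0 <= (after t A z)%:E * running u z)%E.
  by rewrite mule_ge0// lee_fin; case/andP: (after01 t A z).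
have Eu : (\int[mu]_(z in D) running u z = \int[mu]_(z in D) ((1 - after t A z)%:E * running u z)
    + \int[mu]_(z in D) ((after t A z)%:E * running u z))%E.
  rewrite -[RHS]ge0_integralD//; apply: eq_integral => z _.
  rewrite -ge0_muleDl ?lee_fin ?subr_ge0//; last 2 first.
  - by case/andP: (after01 t A z).
  - by case/andP: (after01 t A z).
  by rewrite -EFinD subrK mul1e.
have Ev : (\int[mu]_(z in D) running v z <= \int[mu]_(z in D) ((1 - after t A z)%:E * running u z)
    + (spike_bound * T * fine (P A))%:E)%E.
  rewrite -(int_snd sb0 mA) -ge0_integralD//; last 2 first.
  - by move=> z _; rewrite lee_fin mulr_ge0// indicE.
  - apply: measurable_funTS; apply/measurable_EFinP; apply: measurable_funM => //.
    by apply: measurableT_comp; [exact: measurable_indic|exact: measurable_snd].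
  apply: ge0_le_integral => //.
  - by move=> z _; exact: (running_ge0 v z).
  - exact: measurable_funTS (running_measurable cv).
  - apply: emeasurable_funD => //.
    apply: measurable_funTS; apply/measurable_EFinP; apply: measurable_funM => //.
    by apply: measurableT_comp; [exact: measurable_indic|exact: measurable_snd].
  - by move=> [s w] [/= sT _]; move: sT; rewrite in_itv/= => sT; exact: rv.
have Ig : \int[P]_w payoff v w <= \int[P]_w payoff u w + 2 * CG * fine (P A).
  have i1 : Pint P (fun w => 2 * CG * \1_A w).
    apply: (@Pint_bdd _ _ _ _ _ (2 * CG)).
      by apply: measurable_funM => //; exact: measurable_indic.
    move=> w; rewrite indicE; case: (_ \in _); rewrite ?mulr1 ?mulr0 ?normr0 ?mulr_ge0//.
    by rewrite ger0_norm// mulr_ge0.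
  have gu := payoff_Pint cu.
  have -> : 2 * CG * fine (P A) = \int[P]_w (2 * CG * \1_A w).
    rewrite RintegralZl//; last first.
      apply: (@Pint_bdd _ _ _ _ _ 1); first exact: measurable_indic.
      by move=> w; rewrite indicE; case: (_ \in _); rewrite ?normr0 ?normr1.
    by congr (_ * _); rewrite /Rintegral integral_indic// setIT.
  rewrite -RintegralD//; apply: le_Rintegral => //.
  - exact: (payoff_Pint cv).
  - exact: PintD.
have := le_trans le_uv (leeD Ev (lexx (\int[P]_w payoff v w)%:E)).
rewrite /value Eu; move: fin p1; set I1 := (\int[mu]_(z in D) (_ * _))%E => fin p1.
have I10 : (0 <= I1)%E by apply: integral_ge0.
have : (0 <= \int[mu]_(z in D) ((after t A z)%:E * running u z))%E by apply: integral_ge0.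
move: I1 (\int[mu]_(z in D) ((after t A z)%:E * running u z))%E fin I10 {Eu Ev} => [i1| |] [i2| |]//= _ _ _.
rewrite -!EFinD !lee_fin; move: (\int[P]_w payoff v w) (\int[P]_w payoff u w) Ig => a b Ig h; lra.
Qed.

(** The case t = 0 and A = Omega, for which the common part is 0. *)
Lemma energy_finite : (\int[mu]_(z in D) running u z < +oo)%E.
Proof.
have [C C0' hC] := hyp_G_bound.
have hG w x : `|G w x| <= C by have [] := hC w x.
have t0 : 0 <= (0 : R) <= T by rewrite lexx ltW.
have a1 z : D z -> after 0 setT z = 1.
  move=> [/= zT _]; move: zT; rewrite in_itv/= => /andP[z0 _].
  by rewrite /after !indicE !mem_set//= ?mulr1// in_itv/= z0.
have := energy_aux C0' hG t0 (sigT (sF t0).1).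
rewrite (eq_integral (fun=> 0%E)); last by move=> z; rewrite inE => Dz; rewrite a1// subrr mul0e.
rewrite integral0 => /(_ (ltry _)) h; apply: (@le_lt_trans _ _ _ _ _ _ (ltry _)); last first.
  apply: le_trans h; rewrite (eq_integral (fun z => (after 0 setT z)%:E * running u z)%E)//.
  by move=> z; rewrite inE => Dz; rewrite a1// mul1e.
Qed.

(** With finiteness known, the comparison applies to all t and A: the conditional expectation of the
    remaining energy is bounded. *)
Lemma energy_bound : exists2 K : R, 0 <= K & forall t A, 0 <= t <= T -> F t A ->
  (\int[mu]_(z in D) ((\1_(`[t, +oo[%classic) z.1 * \1_A z.2)%:E * running u z)
    <= (K * fine (P A))%:E)%E.
Proof.
have [C C0' hC] := hyp_G_bound.
have hG w x : `|G w x| <= C by have [] := hC w x.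
exists (spike_bound * T + 2 * C).
  by apply: addr_ge0; apply: mulr_ge0 => //; exact: ltW.
move=> t A tT FA; apply: energy_aux => //.
apply: le_lt_trans energy_finite; apply: ge0_le_integral => //.
- by move=> z _; rewrite mule_ge0// lee_fin subr_ge0; case/andP: (after01 t A z).
- apply: measurable_funTS; apply: emeasurable_funM => //; apply/measurable_EFinP.
  by apply: measurable_funB => //; exact: after_measurable.
- exact: measurable_funTS.
- move=> z _; rewrite -[leRHS]mul1e lee_wpmul2r// lee_fin gerBl.
  by case/andP: (after01 t A z).
Qed.


Hypothesis martF : forall xi, fmeas (F T) xi -> Pint P xi -> hasM P T F xi.

Let Kx := cgrow lam * expR 1.

Let Kx_gt0 : 0 < Kx.
Proof. by rewrite /Kx /cgrow !mulr_gt0 ?expR_gt0// sqrtr_gt0. Qed.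

Let mrD : measurable_fun D (running u). Proof. exact: measurable_funTS. Qed.

(** Where L is +oo the right-hand side is +oo, so the bound needs no finiteness. *)
Lemma supg_running s w i : 0 <= s <= T ->
  (`|supg lam C0 Cb (H s w) (u s w) (state u s w) 0 i|%:E <= Kx%:E * running u (s, w))%E.
Proof.
move=> sT; have := running_0 (s, w); rewrite /running /= clamp_id//.
have [fin _|nfin _] := boolP (Lag (H s w) (u s w) (state u s w) \is a fin_num).
  have [h _] := supgP lam0 C00 (Hh w sT) fin.
  by rewrite -(fineK fin) -EFinD -EFinM lee_fin; exact: h.
have := Lag_lower (Hh w sT) (u s w) (state u s w); move: nfin.
by case: (Lag _ _ _) => //= _ _; rewrite addye// gt0_muley ?lte_fin// leey.
Qed.

(** xi is set to 0 on the null set of paths of infinite energy, so that every path of xi is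
    integrable in time. *)
Lemma supergradients : exists xi, [/\ vprog xi,
  forall w i, leb.-integrable `[0, T] (fun s => (xi s w 0 i)%:E),
  forall s w i, 0 <= s <= T -> (`|xi s w 0 i|%:E <= Kx%:E * running u (s, w))%E &
  {ae P, forall w, forall s, xi s w = supg lam C0 Cb (H s w) (u s w) (state u s w)}].
Proof.
have [EA mA] := tonelli_dtP P mrD running_0.
set A := fun w => (\int[leb]_(s in `[0%R, T]) running u (s, w))%E in EA mA.
have A0 w : (0 <= A w)%E by apply: integral_ge0.
have iA : P.-integrable setT A.
  apply/integrableP; split => //.
  rewrite (eq_integral A); last by move=> w _; rewrite gee0_abs.
  by rewrite -EA; exact: energy_finite.
have [N [mN N0 hN]] := ae_null_set (integrable_ae measurableT iA).
have t0 : 0 <= (0 : R) <= T by rewrite lexx ltW.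
have FN : F 0 (~` N) by apply: sigC (sF t0).1 _ _; exact: nullF.
pose xi s w : 'rV[R]_d := \1_(~` N) w *: supg lam C0 Cb (H s w) (u s w) (state u s w).
have xN s w : N w -> xi s w = 0.
  by move=> Nw; rewrite /xi indicE memNset ?scale0r//= => /(_ Nw).
have xC s w : ~ N w -> xi s w = supg lam C0 Cb (H s w) (u s w) (state u s w).
  by move=> Nw; rewrite /xi indicE mem_set// scale1r.
have pxi : vprog xi.
  apply: (vprog_scale); first exact: (prog_indic0 FN).
  exact: (vprog_supg lam0 C00 Hh pH cu.1 (vprog_state cu)).
have bxi s w i : 0 <= s <= T -> (`|xi s w 0 i|%:E <= Kx%:E * running u (s, w))%E.
  move=> sT; have [Nw|Nw] := pselect (N w); last by rewrite xC//; exact: supg_running.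
  by rewrite xN// mxE normr0 mule_ge0// lee_fin ltW.
exists xi; split => //; last by exists N; split => // w /= h; apply: contrapT => Nw; apply: h => s; exact: xC.
move=> w i; have [Nw|Nw] := pselect (N w).
  by rewrite (_ : (fun s => _) = fun=> 0%E); [exact: integrable0|apply/funext => s; rewrite xN// mxE].
apply/integrableP; split; first by apply/measurable_EFinP; exact: prog_path_itv _ _ (pxi i).
apply: (@le_lt_trans _ _ (Kx%:E * A w)%E); last first.
  by rewrite lte_mul_pinfty ?lee_fin ?(ltW Kx_gt0)// ltey_eq; have -> : A w \is a fin_num by exact: hN.
rewrite -ge0_integralZl//; last 2 first.
- by apply: measurable_funTS; exact: measurable_section.
- by rewrite lee_fin ltW.
apply: ge0_le_integral => //.
- apply: measurableT_comp => //; apply/measurable_EFinP; exact: prog_path_itv _ _ (pxi i).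
- apply: emeasurable_funM => //; apply: measurable_funTS; exact: measurable_section.
- by move=> s; rewrite /= in_itv/=; exact: bxi.
Qed.

Context (xi : R -> Omega -> 'rV[R]_d) (pxi : vprog xi).
Hypothesis ixi : forall w i, leb.-integrable `[0, T] (fun s => (xi s w 0 i)%:E).
Hypothesis bxi : forall s w i, 0 <= s <= T -> (`|xi s w 0 i|%:E <= Kx%:E * running u (s, w))%E.

Let slope i w : R := grad (G w) (state u T w) 0 i.

Let slope_fmeas i : fmeas (F T) (slope i).
Proof. by apply: (hyp_gradG_comp) => j; exact: (state_fmeas j cu TT). Qed.

Let slope_measurable i : measurable_fun setT (slope i) := fmeasW (sF TT).2 (slope_fmeas i).

Let slope_Pint i : Pint P (slope i).
Proof.
have [C _ hC] := hyp_G_bound; apply: (@Pint_bdd _ _ _ _ _ C) => // w.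
by apply: le_trans (enorm_coord _ _) _; have [] := hC w (state u T w).
Qed.

Lemma dom_integrable (f : R * Omega -> R) (K : R) : 0 <= K -> measurable_fun setT f ->
  (forall s w, 0 <= s <= T -> (`|f (s, w)|%:E <= K%:E * running u (s, w))%E) ->
  mu.-integrable D (EFin \o f).
Proof.
move=> K0 mf fK; apply/integrableP; split.
  by apply/measurable_EFinP; exact: measurable_funTS.
apply: (@le_lt_trans _ _ (\int[mu]_(z in D) (K%:E * running u z))%E).
  apply: ge0_le_integral => //.
  - by apply: measurableT_comp => //; apply/measurable_EFinP; exact: measurable_funTS.
  - by apply: emeasurable_funM => //.
  - by move=> [s w] [/= sT _]; move: sT; rewrite in_itv/=; exact: fK.
rewrite ge0_integralZl//.
by rewrite lte_mul_pinfty// ?lee_fin//; exact: energy_finite.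
Qed.

Let xij i (z : R * Omega) : R := xi (clT z.1) z.2 0 i.

Let xij_measurable i : measurable_fun setT (xij i) := prog_joint (pxi i).

Lemma xi_integrable i : mu.-integrable D (EFin \o xij i).
Proof.
apply: (dom_integrable (ltW Kx_gt0) (xij_measurable i)) => s w sT.
by rewrite /xij /= clamp_id//; exact: bxi.
Qed.

Let tail i t w : R := \int[leb]_(s in `[t, T]) xi s w 0 i + slope i w.

Let xi_head i := prog_primitive (pxi i) (fun w => ixi w i).

Let total_fmeas i : fmeas (F T) (tail i 0).
Proof.
apply: measurable_funD; last exact: slope_fmeas.
exact: (prog_fmeas (xi_head i).2 TT).
Qed.

Let path_xi i w : \int[leb]_(s in `[0, T]) xij i (s, w) = \int[leb]_(s in `[0, T]) xi s w 0 i.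
Proof. by apply: eq_Rint => s /=; rewrite in_itv/= /xij => sT; rewrite /= clamp_id. Qed.

Let total_Pint i : Pint P (tail i 0).
Proof.
apply: PintD => //; have [_ _] := fubini_dtP (xij_measurable i) (xi_integrable i).
by congr (Pint P _); apply/funext => w; rewrite path_xi.
Qed.

Let tailE i t w : 0 <= t <= T -> tail i t w = tail i 0 w - \int[leb]_(s in `[0, t]) xi s w 0 i.
Proof.
move=> /andP[t0 tT]; rewrite /tail (primitive_split (ixi w i) t0 tT (lexx _)).
by rewrite [RHS]addrAC [X in _ = X + _]addrAC subrr add0r.
Qed.

Let tail_abs i t w : 0 <= t <= T -> (`|\int[leb]_(s in `[t, T]) xi s w 0 i|%:E <=
  Kx%:E * \int[leb]_(s in `[0%R, T]) ((\1_(`[t, +oo[%classic) s)%:E * running u (s, w)))%E.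
Proof.
move=> /andP[t0 tT]; have iT := integrable_itvS t0 (lexx T) (ixi w i).
have mr : measurable_fun (`[0, T]%classic : set (measurableTypeR R)) (fun s => running u (s, w)).
  by apply: measurable_funTS; exact: measurable_section.
have m1 : measurable_fun (`[0, T]%classic : set (measurableTypeR R)) (fun s => (\1_(`[t, +oo[%classic) s)%:E * running u (s, w))%E.
  apply: emeasurable_funM => //; apply/measurable_EFinP; apply: measurable_funTS.
  by apply: measurable_indic; exact: measurable_itv.
have p1 s : (0 <= (\1_(`[t, +oo[%classic) s)%:E * running u (s, w))%E.
  by rewrite mule_ge0// lee_fin indicE.
apply: (@le_trans _ _ (\int[leb]_(s in `[t, T]) `|(xi s w 0 i)%:E|)%E).
  have := le_abse_integral leb (measurable_itv `[t, T]) (measurable_int leb iT).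
  by rewrite /Rintegral -abse_EFin fineK ?integrable_fin_num.
rewrite -ge0_integralZl//; last by rewrite lee_fin ltW.
apply: (@le_trans _ _ (\int[leb]_(s in `[t, T]) (Kx%:E * ((\1_(`[t, +oo[%classic) s)%:E * running u (s, w))))%E).
  have tTsub : `[t, T] `<=` `[0, T].
    by move=> s; rewrite /= !in_itv/= => /andP[h1 h2]; rewrite (le_trans t0 h1).
  apply: ge0_le_integral => //.
  - by apply: measurableT_comp => //; exact: measurable_int iT.
  - by apply: emeasurable_funM => //; apply: measurable_funS m1.
  - move=> s; rewrite /= in_itv/= => /andP[h1 h2].
    rewrite indicE mem_set ?mul1e//=; last by rewrite in_itv/= h1.
    by apply: bxi; rewrite (le_trans t0 h1).
apply: ge0_subset_integral => //.
- by apply: emeasurable_funM.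
- by move=> s _; rewrite mule_ge0// lee_fin ltW.
- by move=> s; rewrite /= !in_itv/= => /andP[h1 h2]; rewrite (le_trans t0 h1).
Qed.

(** An integrable bound for [tail], uniform in t. *)
Let mass i w : R := `|tail i 0 w| + \int[leb]_(s in `[0, T]) `|xij i (s, w)|.

Let mass_Pint i : Pint P (mass i).
Proof.
apply: PintD; first exact: Pint_abs.
have m : measurable_fun setT (fun z => `|xij i z|) by exact: measurableT_comp.
have j : mu.-integrable D (EFin \o (fun z => `|xij i z|)).
  exact: (integrable_norm (xi_integrable i)).
by have [_ _] := fubini_dtP m j.
Qed.

Let tail_mass i s w : 0 <= s <= T -> `|tail i s w| <= mass i w.
Proof.
move=> sT; rewrite tailE//; apply: le_trans (ler_normB _ _) _; rewrite lerD2l.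
have /andP[s0 sT'] := sT.
have j := integrable_itvS (lexx 0) sT' (ixi w i).
apply: (@le_trans _ _ (\int[leb]_(r in `[0, s]) `|xi r w 0 i|)).
  exact: le_normr_Rintegral.
have -> : \int[leb]_(s0 in `[0, T]) `|xij i (s0, w)| = \int[leb]_(s0 in `[0, T]) `|xi s0 w 0 i|.
  by apply: eq_Rint => r /=; rewrite in_itv/= /xij => rT; rewrite /= clamp_id.
have k := integrable_norm (ixi w i).
rewrite (primitive_split k s0 sT' (lexx T)) lerDl.
by apply: Rintegral_ge0 => r _; exact: normr_ge0.
Qed.

Let tail_fmeas i t : 0 <= t <= T -> fmeas (F T) (tail i t).
Proof.
move=> tT; rewrite (_ : tail i t = fun w => tail i 0 w - \int[leb]_(s in `[0, t]) xi s w 0 i).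
  apply: measurable_funB; first exact: total_fmeas.
  have /andP[t0 tT'] := tT; apply: (fmeasS (monoF t0 tT' (lexx T))).
  exact: (prog_fmeas (xi_head i).2 tT).
by apply/funext => w; exact: tailE.
Qed.

Let tail_Pint i t : 0 <= t <= T -> Pint P (tail i t).
Proof.
move=> tT; apply: (@le_integrable _ _ _ P setT measurableT _ (EFin \o mass i)); last exact: mass_Pint.
  by apply/measurable_EFinP; exact: fmeasW (sF TT).2 (tail_fmeas i tT).
by move=> w _; rewrite lee_fin; apply: le_trans (ler_norm _); exact: tail_mass.
Qed.

Let head_Pint i t : 0 <= t <= T -> Pint P (fun w => \int[leb]_(s in `[0, t]) xi s w 0 i).
Proof.
move=> tT; rewrite (_ : (fun w => _) = fun w => tail i 0 w - tail i t w).
  by apply: PintB => //; exact: tail_Pint.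
by apply/funext => w; rewrite (tailE i w tT) subKr.
Qed.

(** |xi| is bounded by ell up to a factor, so averages of the tail over events of F t are controlled
    by the energy after t, and DG is bounded. *)
Lemma tail_average : exists2 R1 : R, 0 <= R1 & forall i t A, 0 <= t <= T -> F t A ->
  `|\int[P]_(w in A) tail i t w| <= R1 * fine (P A).
Proof.
have [K K0 hK] := energy_bound; have [C C0' hC] := hyp_G_bound.
exists (Kx * K + C); first by rewrite addr_ge0// mulr_ge0// ltW.
move=> i t A tT FA; have mA := (sF tT).2 _ FA.
have ti := tail_Pint i tT.
have iA := PintS mA ti.
apply: le_trans (le_normr_Rintegral mA iA) _.
have j1 : Pint P (fun w => \int[leb]_(s in `[t, T]) xi s w 0 i).
  have -> : (fun w => \int[leb]_(s in `[t, T]) xi s w 0 i) = fun w => tail i t w - slope i w.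
    by apply/funext => w; rewrite /tail addrK.
  exact: PintB.
have h1 : \int[P]_(w in A) `|tail i t w| <= \int[P]_(w in A) (`|\int[leb]_(s in `[t, T]) xi s w 0 i| + C).
  apply: le_Rintegral => //.
  - by apply: PintS => //; exact: Pint_abs.
  - apply: PintS => //; apply: PintD; first exact: Pint_abs.
    by apply: (@Pint_bdd _ _ _ _ _ `|C|).
  - move=> w Aw; apply: le_trans (ler_normD _ _) _; rewrite lerD2l.
    by apply: le_trans (enorm_coord _ _) _; have [] := hC w (state u T w).
apply: le_trans h1 _; rewrite RintegralD//; last 2 first.
- by apply: PintS => //; exact: Pint_abs.
- by apply: PintS => //; apply: (@Pint_bdd _ _ _ _ _ `|C|).
rewrite Rintegral_cst// mulrDl lerD2r -lee_fin.
have jA : P.-integrable A (EFin \o (fun w => `|\int[leb]_(s in `[t, T]) xi s w 0 i|)) by apply: PintS => //; exact: Pint_abs.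
rewrite /Rintegral fineK ?integrable_fin_num// integral_mkcond.
have ma := after_measurable tT FA.
have p2 z : (0 <= (after t A z)%:E * running u z)%E.
  by rewrite mule_ge0// lee_fin; case/andP: (after01 t A z).
have m2 : measurable_fun D (fun z => (after t A z)%:E * running u z)%E.
  by apply: measurable_funTS; apply: emeasurable_funM => //; apply/measurable_EFinP.
have [E2 mE2] := tonelli_dtP P m2 p2.
have e1 : (\int[mu]_(z in D) ((after t A z)%:E * running u z) <= (K * fine (P A))%:E)%E := hK t A tT FA.
apply: (@le_trans _ _ (\int[P]_w (Kx%:E * \int[leb]_(s in `[0%R, T]) ((after t A (s, w))%:E * running u (s, w))))%E).
  apply: (nnint_ae_le measurable0 (measure0 P)) => w.
  - by apply: mule_ge0; [rewrite lee_fin ltW|apply: integral_ge0].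
  - move=> _; rewrite patchE; case: ifPn => [Aw|nA]; last first.
      by apply: mule_ge0; [rewrite lee_fin ltW|apply: integral_ge0].
    apply: le_trans (tail_abs i w tT) _; rewrite lee_pmul2l//.
    by rewrite (eq_integral (fun s => (after t A (s, w))%:E * running u (s, w))%E)// => s _;
      rewrite /after /= [\1_A w]indicE Aw mulr1.
  - by rewrite patchE; case: ifPn => // _; rewrite lee_fin.
rewrite ge0_integralZl//; last 2 first.
- by move=> w _; apply: integral_ge0.
- by rewrite lee_fin ltW.
by rewrite -E2 -mulrA [X in (_ <= X)%E]EFinM lee_pmul2l.
Qed.

(** p is the continuous martingale of the total minus the past integral of xi. Its averages over F t
    are those of the tail, hence at each time it is almost surely bounded by R1. *)
Lemma bounded_adjoint : exists (R1 : R) (M p : R -> Omega -> 'rV[R]_d), [/\ 0 <= R1,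
  forall i, cmart P T F (tail i 0) (fun t w => M t w 0 i),
  vprog p /\ (forall w, continuous (fun t => p (clT t) w)),
  forall s w i, `|p s w 0 i| <= R1 &
  {ae P, forall w, forall t, 0 <= t <= T -> forall i,
    p t w 0 i = M t w 0 i - \int[leb]_(s in `[0, t]) xi s w 0 i}].
Proof.
have [R1 R10 hR] := tail_average.
have /choice[Mi hM] i : exists M, cmart P T F (tail i 0) M by exact: martF.
pose p0 i t w := Mi i t w - \int[leb]_(s in `[0, t]) xi s w 0 i.
have cp0 i w : continuous (fun t => p0 i (clT t) w).
  move=> t; apply: cvgB; first by have [_ c _ _ _] := hM i; exact: c.
  exact: (xi_head i).1.
have mp0 i t : 0 <= t <= T -> fmeas (F t) (p0 i t).
  move=> tT; apply: measurable_funB; first by have [_ _ m _ _] := hM i; exact: m.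
  exact: (prog_fmeas (xi_head i).2 tT).
have ip0 i t : 0 <= t <= T -> Pint P (p0 i t).
  by move=> tT; apply: PintB; [have [_ _ _ m _] := hM i; exact: m|exact: head_Pint].
have ap0 i t A : 0 <= t <= T -> F t A -> \int[P]_(w in A) p0 i t w = \int[P]_(w in A) tail i t w.
  move=> tT FA; have mA := (sF tT).2 _ FA.
  have [_ _ _ iM aM] := hM i.
  rewrite /p0 RintegralB//; [|by apply: PintS => //; exact: iM|by apply: PintS => //; exact: head_Pint].
  rewrite aM// -RintegralB//; [|by apply: PintS|by apply: PintS => //; exact: head_Pint].
  by apply: eq_Rintegral => w _; rewrite (tailE i w tT).
have bp0 i t : 0 <= t <= T -> {ae P, forall w, `|p0 i t w| <= R1}.
  move=> tT.
  have h1 : {ae P, forall w, p0 i t w <= R1}.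
    apply: (average_le (sF tT) (mp0 i t tT) (ip0 i t tT)) => A FA; rewrite ap0//.
    exact: le_trans (ler_norm _) (hR i t A tT FA).
  have h2 : {ae P, forall w, - p0 i t w <= R1}.
    apply: (average_le (sF tT)).
    - by rewrite /fmeas; under eq_fun do rewrite -sub0r; apply: measurable_funB; [exact: measurable_cst|exact: mp0].
    - by have := PintZ (-1) (ip0 i t tT); congr (Pint P _); apply/funext => w; rewrite mulN1r.
    move=> A FA; have mA := (sF tT).2 _ FA.
    rewrite (_ : \int[P]_(w in A) - p0 i t w = - \int[P]_(w in A) p0 i t w); last first.
      rewrite -mulN1r -RintegralZl//; last by apply: PintS => //; exact: ip0.
      by apply: eq_Rintegral => w _; rewrite mulN1r.
    by rewrite ap0//; apply: le_trans (hR i t A tT FA); rewrite -normrN ler_norm.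
  by apply: ae_impl (ae_and h1 h2) => w []; rewrite ler_norml lerNl => k1 ->.
have bd : {ae P, forall w, forall i t, `|p0 i (clT t) w| <= R1}.
  apply: ae_ord => i.
  (* One exceptional set for all times, by rational times and continuity. *)
  have h := ae_countable (fun n => bp0 i _ (clamp_itvT (ratr (odflt 0 (unpickle n : option rat))))).
  apply: ae_impl h => w h; apply: le_dense => [t|n]; last exact: h.
  by apply: (continuous_comp (cp0 i w t)); exact: norm_continuous.
(* Each coordinate is clamped to [- R1, R1]: p becomes bounded for all times and omega and changes
   only on a null set. *)
exists R1, (fun t w => \row_i Mi i t w), (fun t w => \row_i clamp (- R1) R1 (p0 i t w)).
split => //.
- by move=> i; have := hM i; congr (cmart P T F _ _); apply/funext => t; apply/funext => w; rewrite mxE.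
- split.
    move=> i; apply: (@prog_eq (fun t w => clamp (- R1) R1 (p0 i t w))).
      by move=> s w _; rewrite mxE.
    apply: prog_comp; first exact: continuous_measurable_fun (@clamp_continuous _ _ _).
    by apply: prog_continuous => //; exact: mp0.
  move=> w t; apply: (@cvg_rV _ _ _ _ (nbhs_filter t)) => i; rewrite mxE.
  under eq_fun do rewrite mxE.
  by apply: (continuous_comp (cp0 i w t)); exact: clamp_continuous.
- move=> s w i; rewrite mxE ler_norml; apply: clamp_itv.
  by rewrite (le_trans _ R10)// oppr_le0.
- apply: ae_impl bd => w h t tT i; rewrite !mxE clamp_id//.
  by have := h i t; rewrite clamp_id// ler_norml.
Qed.

Lemma integrable_section (Z : Omega -> R) : Pint P Z -> mu.-integrable D (EFin \o (fun z => Z z.2)).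
Proof.
move=> iZ.
have i1 : leb.-integrable setT (EFin \o (\1_(`[0, T]%classic : set R) : R -> R)).
  exact: integrable_indic_itv.
have h := integrable_product i1 iZ.
have h2 : mu.-integrable D (EFin \o (fun z : TO => (\1_(`[0, T]%classic : set R) : R -> R) z.1 * Z z.2)).
  by apply: (@integrableS _ _ _ mu setT).
apply: (eq_integrable mD _ _ _ h2) => -[s w]; rewrite inE => -[/= sT _].
by rewrite indicE mem_set// mul1r.
Qed.

Context (R1 : R) (M p : R -> Omega -> 'rV[R]_d).
Hypothesis cM : forall i, cmart P T F (tail i 0) (fun t w => M t w 0 i).
Hypothesis pp : vprog p.
Hypothesis bp : forall s w i, `|p s w 0 i| <= R1.
Hypothesis pM : {ae P, forall w, forall t, 0 <= t <= T -> forall i,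
    p t w 0 i = M t w 0 i - \int[leb]_(s in `[0, t]) xi s w 0 i}.

Let p_Pint i t : 0 <= t <= T -> Pint P (fun w => p t w 0 i).
Proof.
move=> tT; apply: (@Pint_bdd _ _ _ _ _ R1) => //.
exact: (fmeasW (sF tT).2 (prog_fmeas (pp i) tT)).
Qed.

Lemma adjoint_average i t A : 0 <= t <= T -> F t A ->
  \int[P]_(w in A) p t w 0 i = \int[P]_(w in A) tail i t w.
Proof.
move=> tT FA; have mA := (sF tT).2 _ FA.
have [_ _ _ iM aM] := cM i.
have ih := head_Pint i tT.
transitivity (\int[P]_(w in A) (M t w 0 i - \int[leb]_(s in `[0, t]) xi s w 0 i)).
  by congr fine; apply: integral_ae; apply: ae_impl pM => w h _; rewrite h.
rewrite RintegralB//; [|by apply: PintS => //; exact: iM|by apply: PintS].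
rewrite aM// -RintegralB//; [|by apply: PintS|by apply: PintS].
by apply: eq_Rintegral => w _; rewrite (tailE i w tT).
Qed.

Let tail_joint i : measurable_fun setT (fun z : R * Omega => tail i (clT z.1) z.2).
Proof.
rewrite (_ : (fun z => _) = fun z : R * Omega =>
    tail i 0 z.2 - \int[leb]_(s in `[0, clT z.1]) xi s z.2 0 i).
  apply: measurable_funB; last exact: (prog_joint (xi_head i).2).
  apply: measurableT_comp; last exact: measurable_snd.
  exact: (fmeasW (sF TT).2 (total_fmeas i)).
by apply/funext => z; rewrite tailE// clamp_itvT.
Qed.

(** Expected first-order effect of a bounded progressive velocity b: its displacement tested against
    xi and DG equals b tested against p. *)
Lemma duality i (b : R -> Omega -> R) (B : R) : prog b -> (forall s w, `|b s w| <= B) ->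
  [/\ mu.-integrable D (EFin \o (fun z : R * Omega =>
        xij i z * \int[leb]_(r in `[0, clT z.1]) b r z.2)),
    Pint P (fun w => slope i w * \int[leb]_(r in `[0, T]) b r w),
    mu.-integrable D (EFin \o (fun z : R * Omega => b (clT z.1) z.2 * p (clT z.1) z.2 0 i)) &
    \int[mu]_(z in D) (xij i z * \int[leb]_(r in `[0, clT z.1]) b r z.2)
    + \int[P]_w (slope i w * \int[leb]_(r in `[0, T]) b r w)
    = \int[mu]_(z in D) (b (clT z.1) z.2 * p (clT z.1) z.2 0 i)].
Proof.
move=> pb bB; have B0 : 0 <= B := le_trans (normr_ge0 _) (bB 0 point).
have ib w : leb.-integrable `[0, T] (fun s => (b s w)%:E).
  apply: (@bdd_integrable _ _ _ leb _ _ B (measurable_itv _) (mu_itv_fin 0 T)) => //.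
  exact: prog_path_itv _ _ pb.
have [hc hp] := prog_primitive pb ib.
have hB s w : 0 <= s <= T -> `|\int[leb]_(r in `[0, s]) b r w| <= B * T.
  by move=> /andP[s0 sT]; apply: (int_coord_bound (lexx 0) s0 sT B0 (ib w)).
have BT : 0 <= B * T by rewrite mulr_ge0// ltW.
have mh := prog_joint hp.
have m1 : measurable_fun setT (fun z : R * Omega => xij i z * \int[leb]_(r in `[0, clT z.1]) b r z.2).
  exact: measurable_funM.
have i1 : mu.-integrable D (EFin \o (fun z : R * Omega =>
        xij i z * \int[leb]_(r in `[0, clT z.1]) b r z.2)).
  apply: (dom_integrable (mulr_ge0 (ltW Kx_gt0) BT) m1) => s w sT.
  have -> : ((Kx * (B * T))%:E * running u (s, w) = (B * T)%:E * (Kx%:E * running u (s, w)))%E.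
    by rewrite muleA -EFinM; congr (_%:E * _)%E; rewrite mulrC.
  rewrite /xij /= !clamp_id// normrM EFinM muleC.
  by apply: lee_pmul; rewrite ?lee_fin ?hB//; exact: bxi.
have i2 : Pint P (fun w => slope i w * \int[leb]_(r in `[0, T]) b r w).
  rewrite (_ : (fun w => _) = fun w => (\int[leb]_(r in `[0, T]) b r w) * slope i w).
    apply: (@Pint_bounded_mul _ _ _ _ _ _ (B * T)) => //.
      exact: (fmeasW (sF TT).2 (prog_fmeas hp TT)).
    by move=> w; exact: hB.
  by apply/funext => w; rewrite mulrC.
have mb := prog_joint pb.
have mp := prog_joint (pp i).
have m3 : measurable_fun setT (fun z : R * Omega => b (clT z.1) z.2 * p (clT z.1) z.2 0 i).
  exact: measurable_funM.
have R10 : 0 <= R1 := le_trans (normr_ge0 _) (bp 0 point i).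
have i3 : mu.-integrable D (EFin \o (fun z : R * Omega => b (clT z.1) z.2 * p (clT z.1) z.2 0 i)).
  apply: (@dtP_le _ _ _ P T _ (fun=> B * R1)).
  - exact: measurable_funTS.
  - by apply: (integrable_section (Z := fun=> B * R1)); apply: (@Pint_bdd _ _ _ _ _ `|B * R1|).
  - by move=> z _; rewrite normrM ler_pM.
have m4 : measurable_fun setT (fun z : R * Omega => b (clT z.1) z.2 * tail i (clT z.1) z.2).
  exact: measurable_funM.
have i4 : mu.-integrable D (EFin \o (fun z : R * Omega => b (clT z.1) z.2 * tail i (clT z.1) z.2)).
  apply: (@dtP_le _ _ _ P T _ (fun z => B * mass i z.2)).
  - exact: measurable_funTS.
  - by apply: (integrable_section (Z := fun w => B * mass i w)); exact: PintZ.
  - by move=> z _; rewrite normrM ler_pM//; apply: tail_mass; exact: clamp_itvT.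
split => //.
have [e1 _ j1] := fubini_dtP m1 i1; have [e4 _ j4] := fubini_dtP m4 i4.
transitivity (\int[mu]_(z in D) (b (clT z.1) z.2 * tail i (clT z.1) z.2)).
  rewrite e1 e4 -RintegralD//; apply: eq_Rintegral => w _.
  have -> : \int[leb]_(s in `[0, T]) (xij i (s, w) * \int[leb]_(r in `[0, clT s]) b r w) =
      \int[leb]_(s in `[0, T]) (xi s w 0 i * \int[leb]_(r in `[0, s]) b r w).
    by apply: eq_Rint => r /=; rewrite in_itv/= /xij => rT; rewrite /= clamp_id.
  rewrite /= (primitive_duality (slope i w) (ltW T0) (ixi w i) (ib w) (bB^~ w)).
  by apply: eq_Rint => r /=; rewrite in_itv/= => rT; rewrite /= clamp_id.
(* At each time s, b is F s-measurable and bounded, so the tail may be replaced by p, which has the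
   same averages over F s. *)
apply: (dtP_section_eq i4 i3) => s sT; rewrite /= clamp_id//.
have iq : Pint P (fun w => tail i s w - p s w 0 i) by apply: PintB; [exact: tail_Pint|exact: p_Pint].
have bs : fmeas (F s) (b s) := prog_fmeas pb sT.
have bm := fmeasW (sF sT).2 bs.
have q1 := Pint_bounded_mul bm (bB s) (tail_Pint i sT).
have q2 := Pint_bounded_mul bm (bB s) (p_Pint i sT).
have q0 : \int[P]_w (b s w * (tail i s w - p s w 0 i)) = 0.
  apply: (multiplier (sF sT) iq _ bs (bB s)) => A FA.
  have mA : measurable A by exact: (sF sT).2.
  rewrite RintegralB//; [|by apply: PintS => //; exact: tail_Pint|by apply: PintS => //; exact: p_Pint].
  by rewrite adjoint_average// subrr.
have q3 : \int[P]_w (b s w * tail i s w) = \int[P]_w (b s w * p s w 0 i).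
  apply/eqP; rewrite -subr_eq0 -RintegralB//; apply/eqP; rewrite -[RHS]q0.
  by apply: eq_Rintegral => w _; rewrite mulrBr.
have f1 := integrable_fin_num measurableT q1.
have f2 := integrable_fin_num measurableT q2.
by rewrite -(fineK f1) -(fineK f2); congr EFin.
Qed.

Hypothesis R10 : 0 <= R1.
Hypothesis sxi : {ae P, forall w, forall s, xi s w = supg lam C0 Cb (H s w) (u s w) (state u s w)}.

Let Hc (z : R * Omega) : ham lam C0 Cb (H (clT z.1) z.2) := Hh z.2 (clamp_itvT z.1).
Let e (z : R * Omega) : R := fine (running u z).
Let a s w : 'rV[R]_d := - Dp (H (clT s) w) (p s w) (state u s w).
(** A radius for p in Euclidean norm; the added 1 makes it positive even if R1 = 0, as the bound on
    H requires. *)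
Let Rp := d%:R * R1 + 1.
Let ea (z : R * Omega) : R := ell lam C0 Cb (H (clT z.1) z.2)
  (a (clT z.1) z.2) (state u (clT z.1) z.2).

Let Rp0 : 0 < Rp.
Proof. by rewrite /Rp ltr_wpDl ?mulr_ge0 ?ler0n. Qed.

Let pRp s w : enorm (p s w) <= Rp.
Proof.
apply: le_trans (enorm_norm _) _; apply: (@le_trans _ _ (d%:R * R1)); last by rewrite lerDl.
by rewrite ler_wpM2l ?ler0n//; apply: rV_norm_le.
Qed.

Let aB s w : enorm (a s w) <= Cb Rp.
Proof.
by rewrite enormN; have [_] := ham_bound1 (Hh w (clamp_itvT s)) (state u s w) Rp0 (pRp s w).
Qed.

Let vprog_a : vprog a.
Proof.
move=> i; apply: (@prog_eq (fun s w => (- Dp (H s w) (p s w) (state u s w)) 0 i)).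
  by move=> s w sT; rewrite /a clamp_id.
by apply: (vprogN (vprog_Dp Hh pH pp (vprog_state cu))).
Qed.

Let ea_bound z : 0 <= ea z <= Rp * Cb Rp + Cb Rp + C1.
Proof.
have zT := clamp_itvT z.1.
rewrite /ea /a (clamp_id zT); apply/andP; split; last first.
  exact: (ell_bound (Hc z) _ Rp0 (pRp _ _)).
have [f _] := Lag_gradient (Hc z) (p (clT z.1) z.2) (state u (clT z.1) z.2).
exact: ltW (ell_gt0 lam0 C00 (Hc z) f).
Qed.

Let ea_measurable : measurable_fun setT ea.
Proof. exact: (prog_joint (prog_ell Hh pH vprog_a (vprog_state cu))). Qed.
Let e_measurable : measurable_fun setT e.
Proof. exact: measurableT_comp. Qed.

Let e_integrable : mu.-integrable D (EFin \o e).
Proof.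
apply: (dom_integrable ler01 e_measurable) => s w _; rewrite mul1e /e.
have := running_0 (s, w); case: (running u (s, w)) => [r| |]//=.
  by rewrite lee_fin => r0; rewrite ger0_norm.
by rewrite normr0 leey.
Qed.

Let run_fin : {ae mu, forall z, D z -> running u z = (e z)%:E /\
  Lag (H (clT z.1) z.2) (u (clT z.1) z.2) (state u (clT z.1) z.2) \is a fin_num}.
Proof.
have i : mu.-integrable D (running u).
  apply/integrableP; split; first exact: measurable_funTS.
  rewrite (eq_integral (running u)); last by move=> z _; rewrite gee0_abs.
  exact: energy_finite.
apply: ae_impl (integrable_ae mD i) => z h Dz; have f := h Dz; rewrite /e fineK//; split => //.
by move: f; rewrite /running; case: (Lag _ _ _).
Qed.

Lemma ae_snd (A : Omega -> Prop) : {ae P, forall w, A w} -> {ae mu, forall z : TO, A z.2}.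
Proof.
move=> [N [mN N0 hN]]; exists (setT `*` N); split.
- exact: measurableX.
- have -> : mu (setT `*` N) = (leb setT * P N)%E by apply: product_measure1E => //; exact: measurableT.
  by rewrite N0 mule0.
- by move=> z h; split => //; apply: hN => /= h'; exact: h.
Qed.

(** * First variation in the direction -D_pH(p, gam) - u, where |u|^2 <= N *)

Section Truncated.
Context (N : nat).
Let chi s w : R := \1_(`]-oo, N%:R]%classic) (dotp (u s w) (u s w)).
Let b s w : 'rV[R]_d := chi s w *: (a s w - u s w).
Let Bb := Cb Rp + (N%:R + 1).
Let k s w : 'rV[R]_d := vintegral 0 s (b^~ w).
Let Bh := d%:R * (Bb * T).
(** The first-order change of the cost at a given time, once the effect of the displacement has been
    written with p. *)
Let J (z : R * Omega) : R := chi (clT z.1) z.2 *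
  (dotp (a (clT z.1) z.2 - u (clT z.1) z.2) (p (clT z.1) z.2) + (ea z - e z)).

Let chi01 s w : chi s w = 0 \/ chi s w = 1 /\ enorm (u s w) <= N%:R + 1.
Proof.
rewrite /chi indicE; have [h|h] := boolP (_ \in _); [right|by left]; split => //.
move: h => /set_mem /=; rewrite in_itv/= -enorm_sqr => h.
rewrite -ler_sqr ?nnegrE ?enorm_ge0 ?addr_ge0 ?ler0n//.
apply: (le_trans h); have := ler0n R N; move: (N%:R : R) => n n0; nra.
Qed.

Let Cb0 : 0 <= Cb Rp := le_trans (enorm_ge0 _) (aB 0 point).
Let Bb0 : 0 <= Bb. Proof. by rewrite addr_ge0// addr_ge0. Qed.
Let Bh0 : 0 <= Bh. Proof. by rewrite mulr_ge0// mulr_ge0// ltW. Qed.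

Let bB s w : enorm (b s w) <= Bb.
Proof.
rewrite /b; case: (chi01 s w) => [->|[-> h]]; first by rewrite scale0r enorm0.
rewrite scale1r; apply: le_trans (enormD _ _) _; rewrite enormN.
exact: lerD.
Qed.

Let pchi : prog chi.
Proof.
apply: prog_comp; first by apply: measurable_indic; exact: measurable_itv.
exact: (prog_dotp cu.1 cu.1).
Qed.

Let pb : vprog b.
Proof.
apply: (vprog_scale pchi); apply: (vprogD vprog_a); exact: (vprogN cu.1).
Qed.

Let bi s w i : `|b s w 0 i| <= Bb. Proof. exact: le_trans (enorm_coord _ _) (bB s w). Qed.

Let ib w i : leb.-integrable `[0, T] (fun s => (b s w 0 i)%:E).
Proof.
apply: (@bdd_integrable _ _ _ leb _ _ Bb (measurable_itv _) (mu_itv_fin 0 T)) => //.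
exact: prog_path_itv _ _ (pb i).
Qed.

Let kB s w : 0 <= s <= T -> enorm (k s w) <= Bh.
Proof.
move=> /andP[s0 sT]; apply: le_trans (enorm_norm _) _; rewrite ler_wpM2l ?ler0n//.
apply: rV_norm_le => [|i]; first by rewrite mulr_ge0// ltW.
by rewrite mxE; apply: (int_coord_bound (lexx 0) s0 sT Bb0 (ib w i)).
Qed.

(** Because the velocity a is dual to p, J equals chi times - p . u - H(p) - L(u), which Fenchel's
    inequality makes nonpositive, with equality only if u is dual to p. *)
Let J_le0 : {ae mu, forall z, D z -> J z <= 0 /\
  (J z = 0 -> enorm (u z.1 z.2) ^+ 2 <= N%:R -> u z.1 z.2 = - Dp (H z.1 z.2) (p z.1 z.2) (state u z.1 z.2))}.
Proof.
apply: ae_impl run_fin => -[s w] h Dz; have [er f] := h Dz.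
have sT : 0 <= s <= T by case: Dz => /= + _; rewrite in_itv.
have eE : e (s, w) = ell lam C0 Cb (H s w) (u s w) (state u s w).
  move: f er; rewrite /running /= !clamp_id// => f er.
  by apply/EFin_inj; rewrite -er -{1}(fineK f) -EFinD.
move: f; rewrite /= !clamp_id// => f.
have [fa ga] := Lag_gradient (Hh w sT) (p s w) (state u s w).
have eaE : ea (s, w) = - dotp (p s w) (a s w) - H s w (p s w) (state u s w) + C1.
  rewrite /ea /ell /= !clamp_id// {1}/a clamp_id// ga /a clamp_id// dotpNr opprK; lra.
have q := Lag_fine_ge (p s w) f.
have JE : J (s, w) = chi s w * (- dotp (p s w) (u s w) - H s w (p s w) (state u s w)
    - fine (Lag (H s w) (u s w) (state u s w))).
  rewrite /J /= !clamp_id// eE eaE dotpBl !(dotpC _ (p s w)) /ell; ring.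
rewrite JE; split.
  by rewrite mulr_ge0_le0// ?subr_le0// indicE ler0n.
move=> + un; rewrite /chi indicE mem_set/= ?in_itv/= -?enorm_sqr// mul1r => /eqP.
by rewrite subr_eq0 => /eqP hq; apply: (Fenchel_eq (Hh w sT) f).
Qed.

Let sl := Num.sqrt lam.
Let e0 : R := ((1 + sl) * (1 + Bh))^-1.

Let sl0 : 0 <= sl. Proof. exact: sqrtr_ge0. Qed.

Let e00 : 0 < e0.
Proof. by rewrite invr_gt0 mulr_gt0// ltr_pwDl. Qed.

Let perturbed eps s w := u s w + eps *: b s w.

Let vprog_perturbed eps : vprog (perturbed eps).
Proof.
apply: (vprogD cu.1).
by apply: (@vprog_scale _ (fun _ _ => eps)).
Qed.

Let state_perturbed eps s w : 0 <= s <= T -> state (perturbed eps) s w = state u s w + eps *: k s w.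
Proof.
move=> /andP[s0 sT]; apply/rowP => i; rewrite !mxE -addrA; congr (_ + _).
have iu := integrable_itvS (lexx 0) sT (cu.2 w i).
have ibs := integrable_itvS (lexx 0) sT (ib w i).
rewrite -RintegralZl// -RintegralD//; first by apply: eq_Rint => r _; rewrite !mxE.
by have := @integrableZl _ _ _ leb _ (measurable_itv `[0, s]) eps _ ibs.
Qed.

Let La := Rp * Cb Rp + Cb Rp + C1.
Let Kv := variation_cst d lam Bh La.

(** Contribution of the displacement to the running cost; [gain] is that of the velocity, and [tilt]
    that of the terminal cost. *)
Let head i (z : R * Omega) : R := xij i z * \int[leb]_(r in `[0, clT z.1]) b r z.2 0 i.
Let gain (z : R * Omega) : R := chi (clT z.1) z.2 * (ea z - e z).

Let expansion eps z := e z + eps * (\sum_i head i z + gain z) + eps ^+ 2 * (Kv * (e z + 1)).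

Let running_at v s w : 0 <= s <= T -> running v (s, w) = (Lag (H s w) (v s w) (state v s w) + C1%:E)%E.
Proof. by move=> sT; rewrite /running [(s, w).1]/= [(s, w).2]/= (clamp_id sT). Qed.
Let head_at s w i : 0 <= s <= T -> head i (s, w) = xi s w 0 i * k s w 0 i.
Proof. by move=> sT; rewrite /head /xij [(s, w).1]/= [(s, w).2]/= (clamp_id sT) [k s w 0 i]mxE. Qed.
Let gain_at s w : 0 <= s <= T -> gain (s, w) = chi s w * (ea (s, w) - e (s, w)).
Proof. by move=> sT; rewrite /gain [(s, w).1]/= [(s, w).2]/= (clamp_id sT). Qed.
Let ea_at s w : 0 <= s <= T -> ea (s, w) = ell lam C0 Cb (H s w) (a s w) (state u s w).
Proof. by move=> sT; rewrite /ea [(s, w).1]/= [(s, w).2]/= (clamp_id sT). Qed.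

Let running_perturbed eps : 0 < eps -> eps <= e0 ->
  {ae mu, forall z, D z -> (running (perturbed eps) z <= (expansion eps z)%:E)%E}.
Proof.
move=> eps0 epse; have [eps1 epsB epsS] := small_step sl0 Bh0 eps0 epse.
apply: ae_impl (ae_and run_fin (ae_snd sxi)) => -[s w] [h /= sx] Dz.
have [er] := h Dz; have sT : 0 <= s <= T by case: Dz => /= + _; rewrite in_itv.
rewrite [(s, w).1]/= [(s, w).2]/= (clamp_id sT) => f.
have eE : e (s, w) = ell lam C0 Cb (H s w) (u s w) (state u s w).
  by apply/EFin_inj; rewrite -er (running_at _ _ sT) -{1}(fineK f) -EFinD.
have aE : a s w = - Dp (H s w) (p s w) (state u s w) by rewrite /a (clamp_id sT).
have aL : ell lam C0 Cb (H s w) (a s w) (state u s w) <= La.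
  by rewrite -(ea_at _ sT); case/andP: (ea_bound (s, w)).
have [[f1 g1] [f2 g2]] := variation_pointwise lam0 C00 (Hh w sT) f aE (kB w sT) eps0 eps1 epsB epsS aL.
have hE : \sum_i head i (s, w) = dotp (supg lam C0 Cb (H s w) (u s w) (state u s w)) (k s w).
  by apply: eq_bigr => i _; rewrite (head_at _ _ sT) sx.
rewrite (running_at _ _ sT) (state_perturbed _ _ sT) /expansion hE (gain_at _ sT) (ea_at _ sT) eE.
rewrite {1}/perturbed {1}/b.
case: (chi01 s w) => [->|[-> _]].
  rewrite scale0r scaler0 addr0 mul0r addr0 -(fineK f1) -EFinD lee_fin; exact: g1.
have -> : u s w + eps *: (1 *: (a s w - u s w)) = eps *: a s w + (1 - eps) *: u s w.
  by apply/rowP => i; rewrite !mxE; ring.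
by rewrite mul1r -(fineK f2) -EFinD lee_fin; exact: g2.
Qed.

Let tilt w : R := \sum_i slope i w * \int[leb]_(r in `[0, T]) b r w 0 i.

Let payoff_perturbed : exists2 Kg, 0 <= Kg & forall eps w,
  payoff (perturbed eps) w <= payoff u w + eps * tilt w + eps ^+ 2 * Kg.
Proof.
have [C C0' hC] := hyp_G_bound.
exists (d%:R ^+ 2 * C * Bh ^+ 2); first by rewrite mulr_ge0 ?sqr_ge0// mulr_ge0 ?sqr_ge0.
move=> eps w; rewrite /payoff (state_perturbed _ _ TT).
have hK y : enorm (hess (G w) y) <= C by have [] := hC w y.
apply: le_trans (taylor2 _ _ (hyp_G_C2 w) hK) _.
rewrite dotpZr enormZ exprMn real_normK ?num_real// -!addrA lerD2l; apply: lerD.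
  rewrite (_ : dotp _ _ = tilt w)//; apply: eq_bigr => i _.
  by rewrite [k T w 0 i]mxE.
rewrite mulrCA; apply: ler_wpM2l; first exact: sqr_ge0.
rewrite ler_wpM2l ?mulr_ge0 ?sqr_ge0//.
by rewrite ler_sqr ?nnegrE ?enorm_ge0//; exact: kB.
Qed.

Let gain_integrable : mu.-integrable D (EFin \o gain).
Proof.
have [/andP[La0 _] _] : 0 <= La <= La /\ True.
  by split => //; have /andP[h1 h2] := ea_bound (0, point); rewrite lexx andbT (le_trans h1 h2).
have iL : mu.-integrable D (EFin \o (fun=> La)).
  by apply: (integrable_section (Z := fun=> La)); apply: (@Pint_bdd _ _ _ _ _ `|La|).
apply: (@dtP_le _ _ _ P T _ (fun z => La + `|e z|)).
- apply: measurable_funTS; apply: measurable_funM; first exact: (prog_joint pchi).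
  by apply: measurable_funB; [exact: ea_measurable|exact: e_measurable].
- by have := integrableD mD iL (integrable_norm e_integrable).
- move=> z _; rewrite /gain; case: (chi01 (clT z.1) z.2) => [->|[-> _]].
    by rewrite mul0r normr0 addr_ge0.
  rewrite mul1r; apply: le_trans (ler_normB _ _) _; rewrite lerD2r.
  by have /andP[h1 h2] := ea_bound z; rewrite ger0_norm.
Qed.

(** For small eps, optimality compared with the second order expansion gives 0 <= eps S + eps^2 K,
    where S sums [head], [gain] and [tilt]; by duality S is the integral of J. *)
Lemma first_variation : 0 <= \int[mu]_(z in D) J z.
Proof.
have dual i := duality i (pb i) (fun s w => bi s w i).
have dh i : mu.-integrable D (EFin \o head i) by have [h _ _ _] := dual i.
have dt i : Pint P (fun w => slope i w * \int[leb]_(r in `[0, T]) b r w 0 i) by have [_ h _ _] := dual i.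
have dq i : mu.-integrable D (EFin \o (fun z => b (clT z.1) z.2 0 i * p (clT z.1) z.2 0 i)).
  by have [_ _ h _] := dual i.
have [ih eh] := Rint_sum mD dh.
have [it et] := Rint_sum measurableT dt.
have [iq eq] := Rint_sum mD dq.
have JE : \int[mu]_(z in D) J z =
    \int[mu]_(z in D) (\sum_i head i z) + \int[mu]_(z in D) gain z + \int[P]_w tilt w.
  transitivity (\int[mu]_(z in D) (\sum_i b (clT z.1) z.2 0 i * p (clT z.1) z.2 0 i + gain z)).
    apply: eq_Rintegral => z _; rewrite /J /gain mulrDr; congr (_ + _).
    by rewrite -dotpZl.
  rewrite RintegralD// eq [RHS]addrAC; congr (_ + _).
  rewrite eh et -big_split; apply: eq_bigr => i _.
  by have [_ _ _ E] := dual i; rewrite -E.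
have [Kg Kg0 hKg] := payoff_perturbed.
have ipu := payoff_Pint cu.
have i1 : mu.-integrable D (EFin \o (fun=> 1)).
  by apply: (integrable_section (Z := fun=> 1)); apply: (@Pint_bdd _ _ _ _ _ `|1|).
pose E1 := \int[mu]_(z in D) e z.
pose K := Kv * (E1 + \int[mu]_(z in D) 1).
have ie1 : mu.-integrable D (EFin \o (fun z => e z + 1)) := integrableD mD e_integrable i1.
have ihg : mu.-integrable D (EFin \o (fun z => \sum_i head i z + gain z)) := integrableD mD ih gain_integrable.
apply: (@first_order_ge0 _ _ (`|K + Kg|) e0 e00) => //.
move=> eps eps0 epse; have [eps1 epsB epsS] := small_step sl0 Bh0 eps0 epse.
rewrite JE.
have [cv le_uv] : controlled (perturbed eps) /\ (value u <= value (perturbed eps))%E.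
  apply: (u_opt (vprog_perturbed eps) (addr_ge0 (addr_ge0 (ler0n R N) ler01) Bb0) Bh0).
  - move=> s w _; move: (bB s w); rewrite /perturbed /b; case: (chi01 s w) => [->|[-> h]] hb.
      by left; rewrite scale0r scaler0 addr0.
    right; apply: le_trans (enormD _ _) _; apply: lerD => //.
    rewrite enormZ ger0_norm ?(ltW eps0)//.
    exact: le_trans (ler_piMl (enorm_ge0 _) eps1) hb.
  - move=> w t tT; exists t => //; rewrite (state_perturbed _ _ tT) addrAC subrr add0r.
    rewrite enormZ ger0_norm ?(ltW eps0)//; apply: le_trans (ler_piMl (enorm_ge0 _) eps1) _.
    exact: kB.
have Eu : (\int[mu]_(z in D) running u z = E1%:E)%E.
  rewrite /E1 /Rintegral fineK; last exact: integrable_fin_num e_integrable.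
  by apply: integral_ae; apply: ae_impl run_fin => z h Dz; have [] := h Dz.
have j1 : mu.-integrable D (EFin \o (fun z => eps * (\sum_i head i z + gain z))).
  by have := @integrableZl _ _ _ mu D mD eps _ ihg.
have j3 : mu.-integrable D (EFin \o (fun z => Kv * (e z + 1))).
  by have := @integrableZl _ _ _ mu D mD Kv _ ie1.
have j2 : mu.-integrable D (EFin \o (fun z => eps ^+ 2 * (Kv * (e z + 1)))).
  by have := @integrableZl _ _ _ mu D mD (eps ^+ 2) _ j3.
have iexp : mu.-integrable D (EFin \o expansion eps).
  exact: (integrableD mD (integrableD mD e_integrable j1) j2).
have Ev : (\int[mu]_(z in D) running (perturbed eps) z <= (\int[mu]_(z in D) expansion eps z)%:E)%E.
  rewrite /Rintegral fineK; last exact: integrable_fin_num iexp.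
  have rv0 z : (0 <= running (perturbed eps) z)%E := running_ge0 _ z.
  have aer := running_perturbed eps0 epse.
  rewrite (_ : (\int[mu]_(z in D) (expansion eps z)%:E)%E = (\int[mu]_(z in D) `|expansion eps z|%:E)%E); last first.
    apply: integral_ae; apply: ae_impl aer => z h Dz; rewrite ger0_norm//.
    by rewrite -lee_fin; exact: le_trans (rv0 z) (h Dz).
  have m1 : measurable_fun D (running (perturbed eps)).
    by apply: measurable_funTS; exact: (running_measurable cv).
  have m2 : measurable_fun D (fun z => `|expansion eps z|%:E).
    have /measurable_EFinP m := measurable_int mu iexp.
    by apply/measurable_EFinP; exact: measurableT_comp.
  have p2 z : D z -> (0 <= `|expansion eps z|%:E)%E by rewrite lee_fin.
  apply: (ae_ge0_le_integral mD (fun z _ => rv0 z) m1 p2 m2).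
  by apply: ae_impl aer => z h Dz; apply: le_trans (h Dz) _; rewrite lee_fin ler_norm.
have Eexp : \int[mu]_(z in D) expansion eps z =
    E1 + eps * (\int[mu]_(z in D) (\sum_i head i z) + \int[mu]_(z in D) gain z) + eps ^+ 2 * K.
  rewrite (RintegralD mD (integrableD mD e_integrable j1) j2) (RintegralD mD e_integrable j1).
  rewrite (RintegralZl _ mD ihg) (RintegralZl _ mD j3) (RintegralZl _ mD ie1).
  by rewrite (RintegralD mD ih gain_integrable) (RintegralD mD e_integrable i1).
have Ep : \int[P]_w payoff (perturbed eps) w <= \int[P]_w payoff u w + eps * \int[P]_w tilt w + eps ^+ 2 * Kg.
  have k1 : Pint P (fun w => eps * tilt w) by exact: PintZ.
  have k2 : Pint P (fun=> eps ^+ 2 * Kg) by apply: (@Pint_bdd _ _ _ _ _ `|eps ^+ 2 * Kg|).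
  rewrite -(Rint_cst_prob P (eps ^+ 2 * Kg)) -(RintegralZl _ measurableT it).
  rewrite -(RintegralD measurableT ipu k1) -(RintegralD measurableT (PintD ipu k1) k2).
  apply: le_Rintegral => //.
  - exact: (payoff_Pint cv).
  - exact: (PintD (PintD ipu k1) k2).
have := le_trans le_uv (leeD Ev (lexx _)); rewrite /value Eu -!EFinD lee_fin Eexp => h.
have := ler_norm (K + Kg); move: (ler_wpM2l (sqr_ge0 eps) (ler_norm (K + Kg))) h Ep.
move: (\int[P]_w payoff u w) (\int[P]_w payoff (perturbed eps) w) => q1 q2.
move: (\int[P]_w tilt w) (\int[mu]_(z in D) _) (\int[mu]_(z in D) _) (`|K + Kg|) => q3 q4 q5 q6.
rewrite !mulrDr; lra.
Qed.

Let J_integrable : mu.-integrable D (EFin \o J).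
Proof.
have dq i : mu.-integrable D (EFin \o (fun z => b (clT z.1) z.2 0 i * p (clT z.1) z.2 0 i)).
  by have [_ _ h _] := duality i (pb i) (fun s w => bi s w i).
have [iq _] := Rint_sum mD dq.
have h : mu.-integrable D (EFin \o (fun z => \sum_i b (clT z.1) z.2 0 i * p (clT z.1) z.2 0 i + gain z)).
  by have := integrableD mD iq gain_integrable.
apply: (eq_integrable mD _ _ _ h) => z _; congr EFin.
by rewrite /J [RHS]mulrDr -dotpZl.
Qed.

(** J is nonpositive with nonnegative integral, so it vanishes almost everywhere. *)
Lemma truncated_feedback : {ae mu, forall z, D z -> enorm (u z.1 z.2) ^+ 2 <= N%:R ->
  u z.1 z.2 = - Dp (H z.1 z.2) (p z.1 z.2) (state u z.1 z.2)}.
Proof.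
have h0 : (\int[mu]_(z in D) `|(EFin \o J) z| = 0)%E.
  apply/eqP; rewrite eq_le; apply/andP; split; last by apply: integral_ge0.
  have -> : (\int[mu]_(z in D) `|(EFin \o J) z| = \int[mu]_(z in D) (- (EFin \o J) z))%E.
    by apply: integral_ae; apply: ae_impl J_le0 => z h Dz; have [h1 _] := h Dz; rewrite /= ler0_norm.
  rewrite integralN; last exact: integrable_add_def J_integrable.
  have := first_variation; rewrite oppe_le0 -lee_fin /Rintegral fineK//.
  exact: integrable_fin_num J_integrable.
have mJ : measurable_fun D (EFin \o J) := measurable_int mu J_integrable.
have := (ae_eq_integral_abs mu mD mJ).1 h0.
move=> hz; apply: ae_impl (ae_and J_le0 hz) => z [h1 h2] Dz hN.
have [_ h3] := h1 Dz; apply: h3 => //.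
by apply/EFin_inj; exact: h2.
Qed.
End Truncated.

(** * The feedback formula, existence of D_xL and the adjoint equation *)

Lemma optimal_feedback : {ae mu, forall z, D z ->
  u z.1 z.2 = - Dp (H z.1 z.2) (p z.1 z.2) (state u z.1 z.2)}.
Proof.
apply: ae_impl (ae_countable truncated_feedback) => z h Dz.
apply: (h (Num.truncn (enorm (u z.1 z.2) ^+ 2)).+1 Dz).
by apply: ltW; apply: truncnS_gt.
Qed.

Let at_time (A : R -> Omega -> Prop) : {ae mu, forall z, D z -> A z.1 z.2} ->
  {ae P, forall w, {ae leb, forall s, 0 <= s <= T -> A s w}} := @ae_dtP _ _ _ P T A.

(** Knowing that u is dual to p, the supergradient inequality at (u, state) and the lower bound by H
    force differentiability of L(u, .) with gradient xi. *)
Lemma optimality : {ae P, forall w, {ae leb, forall s, 0 <= s <= T ->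
  [/\ u s w = - Dp (H s w) (p s w) (state u s w),
      DxL H s w (u s w) (state u s w) = xi s w &
      xi s w = - Dx (H s w) (p s w) (state u s w)]}}.
Proof.
apply: at_time; apply: ae_impl (ae_and optimal_feedback (ae_snd sxi)) => -[s w] [/= h sx] Dz.
have sT : 0 <= s <= T by case: Dz => /= + _; rewrite in_itv.
have uE := h Dz; have Hs := Hh w sT.
have [f _] := Lag_gradient Hs (p s w) (state u s w); rewrite -uE in f.
have [_ up] := supgP lam0 C00 Hs f; rewrite -sx in up.
have l0 := ell_gt0 lam0 C00 Hs f.
have K0 : 0 <= kappa lam (ell lam C0 Cb (H s w) (u s w) (state u s w)).
  by rewrite /kappa divr_ge0// mulr_ge0 ?(ltW lam0)// mulr_ge0 ?expR_ge0// ltW.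
rewrite uE in up K0.
have [e1 e2] := Lag_differentiable lam0 C00 Hs K0 up.
by split => //; rewrite uE.
Qed.

Hypothesis cp : forall w, continuous (fun t => p (clT t) w).
Context (gam : R -> Omega -> 'rV[R]_d).
Hypothesis P_complete : measure_is_complete P.
Hypothesis gam_u : {ae P, forall w, (forall t, 0 <= t <= T -> gam t w = state u t w) /\
  {ae leb, forall s, 0 <= s <= T -> dot (traj gam w) s = u s w}}.

Let terminal t w : 'rV[R]_d :=
  vintegral t T (fun s => DxL H s w (dot (traj gam w) s) (gam s w)) + grad (G w) (gam T w).

(** Identifies, after the fact, the variable of the statement with the tail built from
    supergradients. *)
Let terminal_tail : {ae P, forall w, forall t, 0 <= t <= T -> forall i, terminal t w 0 i = tail i t w}.
Proof.
apply: ae_impl (ae_and gam_u optimality) => w [[gE dE] oc] t tT i.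
rewrite /terminal mxE [vintegral _ _ _ _ _]mxE (gE T TT) /tail; congr (_ + _).
congr fine; apply: integral_ae; apply: ae_impl (ae_and dE oc) => s [h1 h2] /=.
rewrite in_itv/= => /andP[ts sT]; have sT0 : 0 <= s <= T by case/andP: tT => t0 _; rewrite (le_trans t0 ts).
by have [_ h3 _] := h2 sT0; rewrite (h1 sT0) (gE s sT0) h3.
Qed.

Let p_fmeas t i : 0 <= t <= T -> fmeas (F t) (fun w => p t w 0 i) := prog_fmeas (pp i).

Let coord_path (X : R -> 'rV[R]_d) i : continuous X -> continuous (fun t => X t 0 i).
Proof.
by move=> cX t; apply: (cvg_comp X (fun y : 'rV[R]_d => y 0 i) (cX t)); exact: coord_continuous.
Qed.

Let average_ereal (f g : Omega -> R) A : measurable A -> Pint P f -> Pint P g ->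
  \int[P]_(w in A) f w = \int[P]_(w in A) g w ->
  (\int[P]_(w in A) (f w)%:E = \int[P]_(w in A) (g w)%:E)%E.
Proof.
move=> mA fi gi E; have f1 := integrable_fin_num mA (PintS mA fi).
have f2 := integrable_fin_num mA (PintS mA gi).
by rewrite -(fineK f1) -(fineK f2); congr EFin.
Qed.

Lemma adjoint_exists : adjoint_process P T F H G gam p.
Proof.
split; first exact/continuous_processP.
  by move=> t i tT B mB; exact: (fmeas_set (sF tT) (p_fmeas i tT) mB).
move=> t tT i.
have E : {ae P, forall w, terminal t w 0 i = tail i t w}.
  by apply: ae_impl terminal_tail => w h; exact: h.
have mx : measurable_fun setT (fun w => terminal t w 0 i).
  exact: (complete_measurable_fun P_complete (Pint_measurable (tail_Pint i tT)) E).
split.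
- apply: (@integrable_ae_eq _ _ _ P setT _ (EFin \o tail i t)).
  + exact/measurable_EFinP.
  + by apply: ae_impl E => w h _ /=; rewrite h.
  + exact: tail_Pint.
- exact: p_Pint.
- by move=> B mB; exact: (fmeas_set (sF tT) (p_fmeas i tT) mB).
- move=> A FA; have mA := (sF tT).2 _ FA.
  rewrite (average_ereal mA (p_Pint i tT) (tail_Pint i tT) (adjoint_average i tT FA)).
  by apply: integral_ae; apply: ae_impl E => w h _; rewrite h.
Qed.

Section AnyAdjoint.
Context (pbar : R -> Omega -> 'rV[R]_d) (adj : adjoint_process P T F H G gam pbar).

(** Both are versions of the same conditional expectation at each time; continuity makes the
    exceptional set independent of time. *)
Lemma adjoint_unique : {ae P, forall w, forall t, 0 <= t <= T -> pbar t w = p t w}.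
Proof.
have [/(continuous_processP) cb _ ab] := adj.
have at_t t i : 0 <= t <= T -> {ae P, forall w, pbar t w 0 i = p t w 0 i}.
  move=> tT; have [_ ib mb eb] := ab t tT i.
  have mb' : fmeas (F t) (fun w => pbar t w 0 i) by apply/(fmeasP _ (sF tT).1).
  apply: (average_eq (sF tT) mb' (p_fmeas i tT) ib (p_Pint i tT)) => A FA.
  rewrite adjoint_average//; congr fine; rewrite eb//; apply: integral_ae.
  by apply: ae_impl terminal_tail => w h _; congr EFin; exact: h.
have dense : {ae P, forall w, forall i n, let t := clT (ratr (odflt 0 (unpickle n : option rat))) in
    pbar t w 0 i = p t w 0 i}.
  by apply: ae_ord => i; apply: ae_countable => n; apply: at_t; exact: clamp_itvT.
apply: ae_impl dense => w h t tT; apply/rowP => i; apply/eqP.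
rewrite -subr_eq0 -normr_le0 -{1 2}(clamp_id tT).
apply: (@le_dense _ (fun t => `|pbar (clT t) w 0 i - p (clT t) w 0 i|)) => [s|n].
  have c1 : {for s, continuous (fun t => pbar (clT t) w 0 i - p (clT t) w 0 i)}.
    by apply: cvgB; [exact: (@coord_path _ i (cb w) s)|exact: (@coord_path _ i (@cp w) s)].
  by apply: (continuous_comp c1); exact: norm_continuous.
by rewrite h subrr normr0.
Qed.

(** The velocity equals almost everywhere a function continuous in time, by continuity of p, gam and
    D_pH; its primitive gam is therefore differentiable at every time. *)
Lemma optimal_dynamics : {ae P, forall w, forall t, 0 <= t <= T ->
  (s - t)^-1 *: (gam s w - gam t w)
    @[s --> within [set s | 0 <= s <= T /\ s != t] (nbhs t)]
    --> - Dp (H t w) (pbar t w) (gam t w)}.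
Proof.
apply: ae_impl (ae_and (ae_and gam_u adjoint_unique) optimality) => w [[[gE _] pE] oc] t tT.
rewrite (pE t tT) (gE t tT).
have cX := @state_continuous u w cu.
have PF : Filter (within [set s | 0 <= s <= T /\ s != t] (nbhs t)) by exact: within_filter.
apply: cvg_rV => i.
pose c s := - Dp (H (clT s) w) (p (clT s) w) (state u (clT s) w) 0 i.
have cc : continuous c.
  by move=> s; apply: cvgN; exact: (hyp_Dp_continuous (@cp w) cX).
have stE s : 0 <= s <= T -> state u s w 0 i = state u 0 w 0 i + \int[leb]_(r in `[0, s]) c r.
  move=> sT; rewrite stateE state0; congr (_ + _); congr fine; apply: integral_ae.
  apply: ae_impl oc => r h /=; rewrite in_itv/= => /andP[r0 rs].
  have rT : 0 <= r <= T by rewrite r0; case/andP: sT => _; exact: le_trans.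
  by have [-> _ _] := h rT; rewrite /c (clamp_id rT) mxE.
have h := primitive_slope cc stE tT; rewrite /c (clamp_id tT) in h.
rewrite [(- Dp _ _ _) 0 i]mxE.
apply: cvg_trans h; apply: near_eq_cvg.
by rewrite near_withinE; apply: nearW => s [sT _]; rewrite [RHS]mxE [(gam s w - _) 0 i]mxE [(- state u t w) 0 i]mxE (gE s sT).
Qed.

Let drift s w : 'rV[R]_d := Dx (H s w) (p s w) (state u s w).
(** Almost surely this is the martingale M, since xi = - D_xH along the path; defined this way it is
    bounded for every omega, which puts it in all the spaces S^r. *)
Let mbar s w : 'rV[R]_d := p s w - vintegral 0 s (drift^~ w).
Let Bd := cgrow lam * (Rp * Cb Rp + Cb Rp + C1).

Let drift_bound s w : 0 <= s <= T -> enorm (drift s w) <= Bd.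
Proof.
move=> sT; apply: le_trans (Dx_bound lam0 C00 (Hh w sT) _ _) _.
apply: ler_wpM2l; first exact: cgrow_ge0.
exact: (ell_bound (Hh w sT) _ Rp0 (pRp s w)).
Qed.

Let Bd0 : 0 <= Bd.
Proof. by apply: le_trans (drift_bound point TT); exact: enorm_ge0. Qed.

Let vprog_drift : vprog drift := vprog_Dx Hh pH pp (vprog_state cu).

Let drift_integrable w i : leb.-integrable `[0, T] (fun s => (drift s w 0 i)%:E).
Proof.
apply: (@bdd_integrable _ _ _ leb _ _ Bd (measurable_itv _) (mu_itv_fin 0 T)).
  exact: prog_path_itv _ _ (vprog_drift i).
by move=> s; rewrite /= in_itv/= => sT; exact: le_trans (enorm_coord _ _) (drift_bound w sT).
Qed.

Let drift_head i := prog_primitive (vprog_drift i) (fun w => drift_integrable w i).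

Let mbarE t w i : mbar t w 0 i = p t w 0 i - \int[leb]_(s in `[0, t]) drift s w 0 i.
Proof. by rewrite /mbar !mxE. Qed.

Let mbar_continuous w : continuous (fun t => mbar (clT t) w).
Proof.
move=> t; apply: (@cvg_rV _ _ _ _ (nbhs_filter t)) => i; rewrite mbarE.
under eq_fun do rewrite mbarE.
apply: cvgB; last exact: (drift_head i).1.
exact: (@coord_path _ i (@cp w) t).
Qed.

Let mbar_fmeas i t : 0 <= t <= T -> fmeas (F t) (fun w => mbar t w 0 i).
Proof.
move=> tT; rewrite (_ : (fun w => _) = fun w => p t w 0 i - \int[leb]_(s in `[0, t]) drift s w 0 i).
  by apply: measurable_funB; [exact: p_fmeas|exact: (prog_fmeas (drift_head i).2 tT)].
by apply/funext => w; exact: mbarE.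
Qed.

Let mbar_bound t w : 0 <= t <= T -> enorm (mbar t w) <= Rp + d%:R * (Bd * T).
Proof.
move=> /andP[t0 tT]; apply: le_trans (enormD _ _) _; apply: lerD; first exact: pRp.
rewrite enormN; apply: le_trans (enorm_norm _) _; rewrite ler_wpM2l ?ler0n//.
apply: rV_norm_le => [|i]; first by rewrite mulr_ge0// ltW.
rewrite mxE; apply: (int_coord_bound (lexx 0) t0 tT Bd0 (drift_integrable w i)) => r /andP[r0 rt].
by apply: le_trans (enorm_coord _ _) (drift_bound w _); rewrite r0 (le_trans rt).
Qed.

Let mbar_M : {ae P, forall w, forall t, 0 <= t <= T -> forall i, mbar t w 0 i = M t w 0 i}.
Proof.
apply: ae_impl (ae_and pM optimality) => w [h oc] t tT i.
rewrite mbarE (h t tT).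
have -> : \int[leb]_(s in `[0, t]) xi s w 0 i = - \int[leb]_(s in `[0, t]) drift s w 0 i.
  have /andP[t0 tT'] := tT.
  rewrite -mulN1r -RintegralZl//; last exact: (integrable_itvS (lexx 0) tT' (drift_integrable w i)).
  congr fine; apply: integral_ae; apply: ae_impl oc => s h1 /=; rewrite in_itv/= => /andP[s0 st].
  have sT : 0 <= s <= T by rewrite s0 (le_trans st).
  by have [_ _ ->] := h1 sT; rewrite mxE mulN1r.
by rewrite opprK addrK.
Qed.

Let mbar_Pint t i : 0 <= t <= T -> Pint P (fun w => mbar t w 0 i).
Proof.
move=> tT; apply: (@Pint_bdd _ _ _ _ _ (Rp + d%:R * (Bd * T))).
  exact: (fmeasW (sF tT).2 (mbar_fmeas i tT)).
by move=> w; apply: le_trans (enorm_coord _ _) (mbar_bound w tT).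
Qed.

Lemma adjoint_equation : exists mbar : R -> Omega -> 'rV[R]_d,
  [/\ forall r : R, 1 <= r -> Sspace P T F r (E := euclid R d) mbar,
    martingale P T F mbar,
    {ae P, forall w, forall s t, 0 <= s -> s <= t -> t <= T ->
       pbar t w - pbar s w =
       vintegral s t (fun r => Dx (H r w) (pbar r w) (gam r w)) + (mbar t w - mbar s w)} &
    {ae P, forall w, pbar T w = grad (G w) (gam T w)}].
Proof.
exists mbar; split.
- move=> r r1; apply: (@Sspace_bounded _ r (Rp + d%:R * (Bd * T)) mbar r1 _ mbar_continuous mbar_fmeas) => [|w t tT]; last exact: mbar_bound.
  by rewrite addr_ge0 ?(ltW Rp0)// mulr_ge0// mulr_ge0// ltW.
- move=> s t s0 st tT i.
  have sT : 0 <= s <= T by rewrite s0 (le_trans st).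
  have tT0 : 0 <= t <= T by rewrite (le_trans s0 st).
  split; [exact: mbar_Pint|exact: mbar_Pint| |].
    by move=> B mB; exact: (fmeas_set (sF sT) (mbar_fmeas i sT) mB).
  move=> A FA; have mA : measurable A by exact: (sF sT).2.
  have FA' : F t A by exact: (monoF s0 st tT).
  apply: (average_ereal mA (mbar_Pint i sT) (mbar_Pint i tT0)).
  have [_ _ _ _ aM] := cM i.
  have mE r : 0 <= r <= T -> \int[P]_(w in A) mbar r w 0 i = \int[P]_(w in A) M r w 0 i.
    by move=> rT; congr fine; apply: integral_ae; apply: ae_impl mbar_M => w h _; rewrite h.
  by rewrite !mE// !aM.
- apply: ae_impl (ae_and gam_u adjoint_unique) => w [[gE _] pE] s t s0 st tT.
  have sT : 0 <= s <= T by rewrite s0 (le_trans st).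
  have tT0 : 0 <= t <= T by rewrite (le_trans s0 st).
  rewrite (pE t tT0) (pE s sT); apply/rowP => i.
  have E : vintegral s t (fun r => Dx (H r w) (pbar r w) (gam r w)) 0 i = \int[leb]_(r in `[s, t]) drift r w 0 i.
    rewrite mxE; apply: eq_Rint => r /=; rewrite in_itv/= => /andP[sr rt].
    have rT : 0 <= r <= T by rewrite (le_trans s0 sr) (le_trans rt tT).
    by rewrite (pE r rT) (gE r rT).
  rewrite [LHS]mxE [(- p s w) 0 i]mxE [RHS]mxE E [(mbar t w - _) 0 i]mxE [(- mbar s w) 0 i]mxE.
  rewrite !mbarE.
  rewrite (primitive_split (drift_integrable w i) s0 st tT); ring.
- have E i : {ae P, forall w, p T w 0 i = slope i w}.
    apply: (average_eq (sF TT) (p_fmeas i TT) (slope_fmeas i) (p_Pint i TT) (slope_Pint i)) => A FA.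
    rewrite adjoint_average//; apply: eq_Rintegral => w _.
    by rewrite /tail set_itv1 Rintegral_set1 add0r.
  apply: ae_impl (ae_and (ae_and gam_u adjoint_unique) (ae_ord E)) => w [[[gE _] pE] h].
  by rewrite (pE T TT) (gE T TT); apply/rowP => i; exact: h.
Qed.
End AnyAdjoint.
End Filtered.

(** * Assembly of the result for the augmented Brownian filtration *)

Theorem theorem2p8 (R : realType) (disp : measure_display)
  (Omega : measurableType disp) (P : probability Omega R)
  (P_complete : measure_is_complete P)
  (d : nat) (d_gt0 : (0 < d)%N) (T : R) (T_gt0 : 0 < T)
  (W : R -> Omega -> 'rV[R]_d) (W_wiener : wiener P T W)
  (H : R -> Omega -> 'rV[R]_d -> 'rV[R]_d -> R)
  (G : Omega -> 'rV[R]_d -> R)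
  (H1 : hypH1 P T (augmented_filtration P W) H G)
  (H2 : hypH2 T H)
  (H3 : hypH3 P T H)
  (x : 'rV[R]_d) (gam : R -> Omega -> 'rV[R]_d)
  (gam_opt : optimal P T (augmented_filtration P W) H G x gam) :
  (exists pbar, adjoint_process P T (augmented_filtration P W) H G gam pbar) /\
  forall pbar, adjoint_process P T (augmented_filtration P W) H G gam pbar ->
    {ae P, forall w, forall t, 0 <= t <= T ->
       (s - t)^-1 *: (gam s w - gam t w)
         @[s --> within [set s | 0 <= s <= T /\ s != t] (nbhs t)]
         --> - Dp (H t w) (pbar t w) (gam t w)} /\
    exists mbar : R -> Omega -> 'rV[R]_d,
      [/\ forall r : R, 1 <= r ->
            Sspace P T (augmented_filtration P W) r (E := euclid R d) mbar,
          martingale P T (augmented_filtration P W) mbar,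
          {ae P, forall w, forall s t, 0 <= s -> s <= t -> t <= T ->
             pbar t w - pbar s w =
             vintegral s t (fun r => Dx (H r w) (pbar r w) (gam r w))
             + (mbar t w - mbar s w)} &
          {ae P, forall w, pbar T w = grad (G w) (gam T w)}].
Proof.
have [lam [C0 [Cb [lam0 C00 Hh]]]] := hyp_ham H1 H2.
set F := augmented_filtration P W in H1 gam_opt *.
have sF t : 0 <= t <= T -> is_sub_sigma (F t) by case/andP => _; exact: (aug_sub_sigma W_wiener).
have monoF s t : 0 <= s -> s <= t -> t <= T -> F s `<=` F t by move=> _ st _; exact: (aug_mono st).
have nullF t N : 0 <= t <= T -> measurable N -> P N = 0%E -> F t N by move=> _; exact: aug_null.
have martF xi : fmeas (F T) xi -> Pint P xi -> hasM P T F xi := @hasM_integrable _ _ _ _ _ _ W W_wiener T_gt0 xi.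
have [u [cu u2 gam_u]] := optimal_velocity T_gt0 sF monoF nullF gam_opt.
have u_opt v B C := competitor T_gt0 sF monoF H1 lam0 C00 Hh gam_opt (v := v) (B := B) (C := C) cu u2 gam_u.
have [xi [pxi ixi bxi sxi]] := supergradients T_gt0 sF monoF nullF H1 lam0 C00 Hh cu u_opt.
have [R1 [M [p [R10 cM [pp cp] bp pM]]]] :=
  bounded_adjoint T_gt0 sF monoF H1 lam0 C00 Hh cu u_opt martF pxi ixi bxi.
split.
  exists p; apply: (adjoint_exists T_gt0 sF monoF H1 lam0 C00 Hh cu u_opt pxi ixi bxi cM pp bp pM R10 sxi cp P_complete gam_u).
move=> pbar adj; split.
  exact: (optimal_dynamics T_gt0 sF monoF H1 lam0 C00 Hh cu u_opt pxi ixi bxi cM pp bp pM R10 sxi cp gam_u adj).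
exact: (adjoint_equation T_gt0 sF monoF H1 lam0 C00 Hh cu u_opt pxi ixi bxi cM pp bp pM R10 sxi cp gam_u adj).
Qed.
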